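(* Let $\Gamma$ be an infinite weighted graph (as in the context) satisfying $(D)$, $(L_2)$ and $(P_2)$. Let $L$ be a second order uniformly elliptic operator on $L^2(\Gamma)$ with ellipticity constants $C_\infty$ and $\delta$. Then: 1. $L$ generates a holomorphic semigroup $(e^{-tL})_{t>0}$ on $L^2(\Gamma)$ which has a kernel $K_t(x,y)$: for all $u\in L^2(\Gamma)$, $x\in\Gamma$ and $t>0$, $$(e^{-tL}u)(x)=\sum_{y\in\Gamma}K_t(x,y)u(y)m(y).$$ Moreover there exist $C,C',\beta>0$, depending only on the geometric constants and the ellipticity constants, such that for every $(x,y)\in\Gamma^2$ and $t>0$: (a) if $t\le C'h^*_{xy}d(x,y)$, then $|K_t(x,y)|\le\frac Ct e^{-\beta\frac{d(x,y)}{h^*_{xy}}}$; (b) if $t\ge C'h^*_{xy}d(x,y)$, then $|K_t(x,y)|\le\frac Ct e^{-\beta\frac{d^2(x,y)}{t}}$. 2. There exist $C''>0$ and $\eta>0$, depending only on the geometric constants and the ellipticity constants, such that for every $t>0$ and every $x,x',y\in\Gamma$, $$|K_t(x,y)-K_t(x',y)|\le\frac{C''}{t}\left(\frac{d(x,x')}{\sqrt t}\right)^\eta.$$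
   Context: Graph. $\Gamma$ is an infinite set with a symmetric weight $h_{xy}=h_{yx}\ge0$, $h_{xx}=0$; $x\sim y$ means $h_{xy}>0$ or $x=y$; $E=\{(x,y):x\sim y\}$ is the set of edges; $h_x=\sup_{y\sim x}h_{xy}$. Standing assumptions: there is $N$ with $\#\{y:y\sim x\}\le N$ for all $x$; there is $C_W\ge1$ with $C_W^{-1}\le h_{xy}/h_{xz}\le C_W$ whenever $x\sim y$, $x\sim z$, $y\ne x$, $z\ne x$; $\Gamma$ is connected (any $x,y$ are joined by a finite path $x=x_0\sim x_1\sim\dots\sim x_n=y$, of length $\sum_k h_{x_kx_{k+1}}$); coefficients $\mu_{xy}=\mu_{yx}>0$ are given for $x\sim y$ (including $x=y$), with $\mu_{xy}/\mu_{xz}\le C_\mu$ whenever $x\sim y$, $x\sim z$. $d(x,y)$ is the infimum of the lengths of paths joining $x$ to $y$; $B(x,r)=\{y:d(x,y)<r\}$; $m(x)=\sum_{y\sim x}\mu_{xy}$, $m(A)=\sum_{x\in A}m(x)$, $V(x,r)=m(B(x,r))$. Function spaces (complex-valued functions). $\|f\|_{L^p(\Gamma)}=(\sum_x|f(x)|^pm(x))^{1/p}$. $df(x,y)=(f(y)-f(x))/h_{xy}$ if $x\ne y$, $df(x,x)=0$. $\nabla f(x)=\frac1{h_x}\big(\sum_{y\sim x}|f(y)-f(x)|^2\big)^{1/2}$. $W^{1,p}(\Gamma)$: $\|f\|_{W^{1,p}}=\|f\|_{L^p}+\|\nabla f\|_{L^p}<\infty$. Geometric assumptions. $(D)$: there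 is $C$ with $V(x,2r)\le CV(x,r)$ for all $x$, $r>0$. $(L_2)$: there is $c>0$ with $V(x,r)\ge cr^2$ for all $x$, $r>0$. $(P_2)$: there is $C$ with $\sum_{y\in B}|f(y)-f_B|^2m(y)\le Cr^2\sum_{y\in B}|\nabla f(y)|^2m(y)$ for all balls $B=B(x,r)$, $r>0$, and all $f$, where $f_B=\frac1{m(B)}\sum_{y\in B}f(y)m(y)$. The geometric constants are $N,C_W,C_\mu$ and the constants in $(D),(L_2),(P_2)$. Operator. Coefficients $c_{xy}\in\mathbb{C}$, $x\sim y$, are given with $|c_{xy}|\le C_\infty$ and, for all $u\in W^{1,2}(\Gamma)$, $\mathrm{Re}\sum_{(x,y)\in E}c_{xy}|du(x,y)|^2\mu_{xy}\ge\delta\sum_{(x,y)\in E}|du(x,y)|^2\mu_{xy}$, where $C_\infty,\delta>0$ (no positivity of the $c_{xy}$ is assumed). $L$ is the unique maximal accretive operator on $L^2(\Gamma)$ such that for all $u\in\mathcal{D}(L)$ and $v\in W^{1,2}(\Gamma)$, $\sum_xLu(x)\overline{v(x)}m(x)=\sum_{(x,y)\in E}c_{xy}du(x,y)\overline{dv(x,y)}\mu_{xy}$; it is called a second order uniformly elliptic operator with ellipticity constants $C_\infty,\delta$. Notation. For $x,y\in\Gamma$: $h^*_{x\to y}=0$ if $x=y$; if $x\ne y$, $h^*_{x\to y}$ is the supremum of the weights $h_{zw}$ of the edges $(z,w)$ at least one of whose two vertices belongs to $B(x,d(x,y))$. Then $h^*_{xy}=\min(h^*_{x\to y},h^*_{y\to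 x})$. *)

(* Defs.v *)
From HB Require Import structures.
From mathcomp Require Export all_boot all_order all_algebra.
From mathcomp Require Export all_classical all_reals all_analysis.
From mathcomp Require Export complex.

Set Implicit Arguments.
Unset Strict Implicit.
Unset Printing Implicit Defensive.

Export Order.TTheory GRing.Theory Num.Theory.
Export numFieldNormedType.Exports.

#[global] Open Scope classical_set_scope.
#[global] Open Scope complex_scope.
#[global] Open Scope ring_scope.

Section complex_sums.
Variables (R : realType) (T : choiceType).

Definition cmod (z : R[i]) : R := ComplexField.Normc.normc z.

Definition csummable (D : set T) (f : T -> R[i]) : Prop :=
  summable D (fun x => (cmod (f x))%:E).

(* [esum] of a signed family only takes its positive part into account, hence
   the split of real families into f^\+ and f^\-. *)
Definition rsum (D : set T) (f : T -> R) : R :=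
  fine (\esum_(x in D) (f^\+ x)%:E) - fine (\esum_(x in D) (f^\- x)%:E).

(* Meaningful when [csummable D f]. *)
Definition csum (D : set T) (f : T -> R[i]) : R[i] :=
  (rsum D (fun x => complex.Re (f x)) +i* rsum D (fun x => complex.Im (f x)))%C.

End complex_sums.

Section graph.
Variables (R : realType) (Gamma : choiceType).
Variables (h mu : Gamma -> Gamma -> R).

Definition adj : rel Gamma := fun x y => (0 < h x y) || (x == y).

Definition edges : set (Gamma * Gamma) := [set e | adj e.1 e.2].

Definition hsup (x : Gamma) : R := sup [set h x y | y in [set y | adj x y]].

(* [s] lists the vertices of the path other than its origin [x] *)
Definition path_length (x : Gamma) (s : seq Gamma) : R :=
  \sum_(l <- pairmap h x s) l.

Record weighted_graph (N : nat) (CW Cmu : R) : Prop := {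
  graph_infinite : infinite_set [set: Gamma] ;
  weight_sym : forall x y, h x y = h y x ;
  weight_ge0 : forall x y, 0 <= h x y ;
  weight_diag : forall x, h x x = 0 ;
  graph_degree : forall x, ([set y | adj x y] #<= `I_N)%card ;
  weight_comparable : forall x y z, adj x y -> adj x z -> y != x -> z != x ->
    CW^-1 <= h x y / h x z <= CW ;
  graph_connected : forall x y, exists2 s, path adj x s & last x s = y ;
  mu_sym : forall x y, adj x y -> mu x y = mu y x ;
  mu_gt0 : forall x y, adj x y -> 0 < mu x y ;
  mu_comparable : forall x y z, adj x y -> adj x z -> mu x y / mu x z <= Cmu }.

Definition gdist (x y : Gamma) : R :=
  inf [set path_length x s | s in [set s | path adj x s /\ last x s = y]].

Definition gball (x : Gamma) (r : R) : set Gamma := [set y | gdist x y < r].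

Definition vmass (x : Gamma) : R := \sum_(y \in [set y | adj x y]) mu x y.

Definition mass (A : set Gamma) : \bar R := \esum_(x in A) (vmass x)%:E.

Definition vol (x : Gamma) (r : R) : \bar R := mass (gball x r).

Definition hstar_to (x y : Gamma) : R :=
  if x == y then 0 else
  sup [set h e.1 e.2 | e in [set e | edges e /\
        (gball x (gdist x y) e.1 \/ gball x (gdist x y) e.2)]].

Definition hstar (x y : Gamma) : R := Num.min (hstar_to x y) (hstar_to y x).

Implicit Types u v f : Gamma -> R[i].

Definition L2norm f : \bar R :=
  ((\esum_(x in [set: Gamma]) (cmod (f x) ^+ 2 * vmass x)%:E) `^ 2^-1)%E.

Definition inL2 f : Prop := (L2norm f < +oo)%E.

Definition L2dot u v : R[i] :=
  csum [set: Gamma] (fun x => u x * conjc (v x) * (vmass x)%:C).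

Definition gdiff f (x y : Gamma) : R[i] :=
  if x == y then 0 else (f y - f x) / (h x y)%:C.

Definition grad f (x : Gamma) : R :=
  (hsup x)^-1 *
  Num.sqrt (\sum_(y \in [set y | adj x y]) cmod (f y - f x) ^+ 2).

Definition W12norm f : \bar R :=
  (L2norm f + L2norm (fun x => (grad f x)%:C))%E.

Definition inW12 f : Prop := (W12norm f < +oo)%E.

Definition doubling (C : R) : Prop :=
  forall x r, 0 < r -> (vol x (2 * r) <= C%:E * vol x r)%E.

Definition volume_lower_bound (c : R) : Prop :=
  forall x r, 0 < r -> ((c * r ^+ 2)%:E <= vol x r)%E.

Definition mean (B : set Gamma) f : R[i] :=
  ((fine (mass B))^-1)%:C * csum B (fun y => f y * (vmass y)%:C).

(* Balls may be infinite sets: the inequality is required of those f whose mean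
   on B is an absolutely convergent sum. *)
Definition poincare2 (C : R) : Prop :=
  forall x r f, 0 < r -> let B := gball x r in
    csummable B (fun y => f y * (vmass y)%:C) ->
    ((\esum_(y in B) (cmod (f y - mean B f) ^+ 2 * vmass y)%:E) <=
     (C * r ^+ 2)%:E * (\esum_(y in B) (grad f y ^+ 2 * vmass y)%:E))%E.

(* Possibly unbounded operator on L2; [app] is irrelevant outside [dom]. *)
Record operator := Operator {
  dom : set (Gamma -> R[i]) ;
  app : (Gamma -> R[i]) -> (Gamma -> R[i]) }.

Definition linear_operator (A : operator) : Prop :=
  [/\ dom A (fun=> 0),
      forall u, dom A u -> inL2 u /\ inL2 (app A u) &
      forall (a : R[i]) u v, dom A u -> dom A v ->
        let w := fun x => a * u x + v x in
        dom A w /\ app A w = (fun x => a * app A u x + app A v x)].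

Definition accretive (A : operator) : Prop :=
  linear_operator A /\ forall u, dom A u -> 0 <= complex.Re (L2dot (app A u) u).

Definition extends (B A : operator) : Prop :=
  dom A `<=` dom B /\ forall u, dom A u -> app B u = app A u.

Definition maximal_accretive (A : operator) : Prop :=
  accretive A /\
  forall B, accretive B -> extends B A -> dom B `<=` dom A.

Definition sesqui_form (c : Gamma -> Gamma -> R[i]) u v : R[i] :=
  csum edges (fun e => c e.1 e.2 * gdiff u e.1 e.2 *
                       conjc (gdiff v e.1 e.2) * (mu e.1 e.2)%:C).

Definition elliptic_coeffs (Cinf delta : R) (c : Gamma -> Gamma -> R[i]) :=
  (forall x y, adj x y -> cmod (c x y) <= Cinf) /\
  (forall u, inW12 u ->
    (delta%:E *
       (\esum_(e in edges) (cmod (gdiff u e.1 e.2) ^+ 2 * mu e.1 e.2)%:E) <=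
     (complex.Re (csum edges (fun e => c e.1 e.2 *
            (cmod (gdiff u e.1 e.2) ^+ 2 * mu e.1 e.2)%:C)))%:E)%E).

(* The inclusion of the domain in W12 is what gives a meaning to the form. These
   conditions say that A is a restriction of the operator of the form, and
   maximality forces equality. *)
Definition operator_of_coeffs (c : Gamma -> Gamma -> R[i]) (A : operator) :=
  [/\ maximal_accretive A,
      dom A `<=` inW12 &
      forall u v, dom A u -> inW12 v -> L2dot (app A u) v = sesqui_form c u v].

Definition bounded_operator (S : (Gamma -> R[i]) -> (Gamma -> R[i])) : Prop :=
  [/\ forall u, inL2 u -> inL2 (S u),
      forall (a : R[i]) u v, inL2 u -> inL2 v ->
        S (fun x => a * u x + v x) = (fun x => a * S u x + S v x) &
      exists M : R, forall u, inL2 u -> (L2norm (S u) <= M%:E * L2norm u)%E].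

(* open sector |arg z| < theta, for 0 < theta < pi / 2 *)
Definition sector (theta : R) : set R[i] :=
  [set z | 0 < complex.Re z /\ `|complex.Im z| < tan theta * complex.Re z].

Definition holomorphic_semigroup
    (T : R[i] -> (Gamma -> R[i]) -> (Gamma -> R[i])) : Prop :=
  exists theta : R, 0 < theta < pi / 2 /\
  let S := sector theta in
  [/\ forall z, z = 0 \/ S z -> bounded_operator (T z),
      forall u, inL2 u -> T 0 u = u,
      forall z w u, S z -> S w -> inL2 u -> T (z + w) u = T z (T w u),
      forall z u, S z -> inL2 u -> exists2 v, inL2 v &
        L2norm (fun x => w^-1 * (T (z + w) u x - T z u x) - v x)
          @[w --> (0 : R[i]^o)^'] --> 0%E &
      forall u, inL2 u ->
        L2norm (fun x => T z u x - u x)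
          @[z --> within S (nbhs (0 : R[i]^o))] --> 0%E].

(* The infinitesimal generator of (T t), t >= 0, is - A, so T t = e^{-tA}. *)
Definition generated_by (A : operator)
    (T : R[i] -> (Gamma -> R[i]) -> (Gamma -> R[i])) : Prop :=
  forall u v, inL2 u -> inL2 v ->
    (dom A u /\ app A u = v) <->
    L2norm (fun x => (t^-1)%:C * (u x - T t%:C u x) - v x)
      @[t --> (0 : R)^'+] --> 0%E.

Definition has_kernel (T : R[i] -> (Gamma -> R[i]) -> (Gamma -> R[i]))
    (K : R -> Gamma -> Gamma -> R[i]) : Prop :=
  forall u x t, inL2 u -> 0 < t ->
    let F := fun y => K t x y * u y * (vmass y)%:C in
    csummable [set: Gamma] F /\ T t%:C u x = csum [set: Gamma] F.

End graph.

(* Main.v *)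
Require Import Defs.
From mathcomp Require Import finmap ring lra.

(* By maximality L is the operator of the sesquilinear form, so its resolvents are
   given by the Lax-Milgram theorem; rotating the coefficients, they are contractions
   on a sector, and e^{-zL} is the limit of the implicit Euler products
   (1 + 2^-k z L)^{-2^k}.  Conjugating the form by e^psi, with psi lambda-Lipschitz and
   of oscillation at most 1 along edges (Davies' method), changes it by a term of size
   lambda^2, which yields weighted bounds for the Euler products, hence for e^{-tL} and
   L e^{-tL}.

   Pointwise bounds come from u = e^{-tL}f solving L u = g in L2.  Testing the equation
   with u - kappa_j cut off to balls B(x, r0 K^-j), all j at once with weights
   growing like q^j, and using Poincare's inequality in the disjoint shells where the
   cutoffs vary, shows that the energy of u in B(x, r0 K^-j) is O(q^-2j) for some
   q > 1.  As balls have volume at least c r^2, Morrey's argument gives the sup and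
   Hoelder bounds of u.  Weighted by e^psi and combined with duality they bound the
   kernel of e^{-2tL} by C t^-1 exp(C lambda^2 t - lambda d(x,y)); the slope
   lambda = eps min(d/t, 1/hstar) is the largest one compatible with the restriction on
   the oscillation of psi, and gives the two regimes of the theorem. *)

Set Implicit Arguments.
Unset Strict Implicit.
Unset Printing Implicit Defensive.

(** * Unordered sums *)

Section Sums.
Variables (R : realType) (I : choiceType).
Implicit Types (f g : I -> R) (s : seq I).

(** Ellipticity is assumed only for the full sum over the edges; no single term of the form has a
    sign. Coercivity can therefore not be restricted to a ball: it is applied to globally defined
    functions, such as e^psi u or a multi-scale combination of the u - kappa_j, and the errors in
    the discrete Leibniz rule are absorbed afterwards. Volume growth r^2 is critical for Morrey's
    argument. An energy bound alone makes the means of u on successive balls differ by a bounded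
    amount, and such differences do not sum; the gain q^-j makes them geometric, and q together with
    the ratio of the radii fixes the Hoelder exponent. The bound on L e^{-tL} does not come from
    Cauchy's formula but from the quantity alpha |u_j|^2 + (j t)^2 |L u_j|^2, which is controlled
    along the Euler scheme by an argument that also goes through with the weights e^psi. All
    constants are closed expressions in the given ones, so they can be fixed before the graph is. *)

Definition summR f : Prop := summable [set: I] (EFin \o f).
Definition tsum f : R := rsum [set: I] f.

Lemma esum_le_seq f M : (forall i, 0 <= f i) ->
  (forall s, uniq s -> \sum_(i <- s) f i <= M) ->
  (\esum_(i in [set: I]) (f i)%:E <= M%:E)%E.
Proof.
move=> f0 H; apply: ge_ereal_sup => _ [X [finX _]] <-.
by rewrite fsbig_finite// sumEFin lee_fin; exact: H.
Qed.

Lemma seq_le_esum f s : (forall i, 0 <= f i) -> uniq s ->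
  ((\sum_(i <- s) f i)%:E <= \esum_(i in [set: I]) (f i)%:E)%E.
Proof.
move=> f0 us; apply: esum_ge; exists [set` s] => //.
by rewrite -(fsbig_seq _ (fun i => (f i)%:E))//= sumEFin.
Qed.

Lemma summR_abs f : summR f <-> summR (fun i => `|f i|).
Proof.
by rewrite /summR /summable; under [in X in _ <-> X]eq_esum do rewrite /= normr_id.
Qed.

Lemma summR_ge0 f : (forall i, 0 <= f i) ->
  summR f <-> (\esum_(i in [set: I]) (f i)%:E < +oo)%E.
Proof.
move=> f0; rewrite /summR /summable.
by under eq_esum do rewrite /= ger0_norm//.
Qed.

Lemma summR_seq f M : (forall s, uniq s -> \sum_(i <- s) `|f i| <= M) -> summR f.
Proof.
move=> H; apply/summR_abs/summR_ge0 => //.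
by apply: le_lt_trans (esum_le_seq _ H) _; rewrite ?ltry.
Qed.

Lemma summR_le f g : (forall i, `|f i| <= g i) -> summR g -> summR f.
Proof.
move=> fg; apply: le_lt_trans; apply: le_esum => i _ /=.
by rewrite lee_fin (le_trans (fg i)) ?ler_norm.
Qed.

Lemma summR_funrpos f : summR f -> summR f^\+.
Proof.
move=> /summR_abs; apply: summR_le => i; rewrite /funrpos /=.
by rewrite ger0_norm ?le_max ?lexx ?orbT// ge_max ler_norm normr_ge0.
Qed.

Lemma summRD f g : summR f -> summR g -> summR (fun i => f i + g i).
Proof. by move=> sf sg; apply: summableD sf sg. Qed.

Lemma summRZ a f : summR f -> summR (fun i => a * f i).
Proof.
move=> sf; have sf' := (summR_abs f).1 sf.
apply: (@summR_seq _ (`|a| * fine (\esum_(i in [set: I]) (`|f i|)%:E))) => s us.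
under eq_bigr do rewrite normrM; rewrite -mulr_sumr ler_wpM2l//.
rewrite -lee_fin fineK; first exact: seq_le_esum.
by rewrite ge0_fin_numE ?esum_ge0//; apply: (summR_ge0 _).1.
Qed.

Lemma summRN f : summR f -> summR (fun i => - f i).
Proof. by move/(summRZ (-1)); congr summR; apply/funext => i; rewrite mulN1r. Qed.

Lemma summRB f g : summR f -> summR g -> summR (fun i => f i - g i).
Proof. by move=> sf /summRN; exact: summRD. Qed.

Lemma summR0 : summR (fun=> 0).
Proof. by apply: (@summR_seq _ 0) => s _; rewrite big1// => i _; rewrite normr0. Qed.

Lemma tsum_ge0E f : (forall i, 0 <= f i) ->
  tsum f = fine (\esum_(i in [set: I]) (f i)%:E).
Proof.
move=> f0; rewrite /tsum /rsum [X in _ - fine X](_ : _ = 0%E) ?subr0.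
  congr fine; apply: eq_esum => i _; rewrite /funrpos /=.
  by congr EFin; apply/max_idPl.
by apply: esum1 => i _; rewrite /funrneg /=; congr EFin; apply/max_idPr; rewrite oppr_le0.
Qed.

Lemma tsum_ge0_EFin f : (forall i, 0 <= f i) -> summR f ->
  (tsum f)%:E = \esum_(i in [set: I]) (f i)%:E.
Proof.
move=> f0 sf; rewrite tsum_ge0E// fineK//.
by rewrite ge0_fin_numE; [exact: (summR_ge0 f0).1|apply: esum_ge0 => i _; rewrite lee_fin].
Qed.

(** The source of additivity for signed families: positive and negative parts are not additive, but
    [esumB] evaluates the difference of any two nonnegative families, whether or not these are the
    positive and negative parts of the difference. *)
Lemma tsumBE f g : (forall i, 0 <= f i) -> (forall i, 0 <= g i) ->
  summR f -> summR g -> tsum (fun i => f i - g i) = tsum f - tsum g.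
Proof.
move=> f0 g0 sf sg.
have fF : \esum_(i in [set: I]) (f i)%:E \is a fin_num.
  by rewrite -tsum_ge0_EFin.
have gF : \esum_(i in [set: I]) (g i)%:E \is a fin_num.
  by rewrite -tsum_ge0_EFin.
have := esumB sf sg (fun i _ => f0 i) (fun i _ => g0 i).
set h := fun i => f i - g i.
have sh : summR h by exact: summRB.
have shN : summR (fun i => - h i) by exact: summRN.
have Ep : (\esum_(i in [set: I]) ((EFin \o f \- (EFin \o g))^\+ i)%E =
    \esum_(i in [set: I]) (h^\+ i)%R%:E)%E.
  apply: eq_esum => i _; rewrite funeposE /funrpos /h /=.
  by rewrite -EFinB -EFin_max.
have En : (\esum_(i in [set: I]) ((EFin \o f \- (EFin \o g))^\- i)%E =
    \esum_(i in [set: I]) (h^\- i)%R%:E)%E.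
  apply: eq_esum => i _; rewrite funenegE /funrneg /h /=.
  by rewrite EFin_max.
have p0 i : 0 <= h^\+ i by rewrite /funrpos le_max lexx orbT.
have n0 i : 0 <= h^\- i by rewrite /funrneg le_max lexx orbT.
have sp := summR_funrpos sh.
have sn : summR h^\- by rewrite -funrposN; exact: summR_funrpos shN.
rewrite Ep En -!tsum_ge0_EFin// -!EFinB => -[] <-.
by rewrite /tsum [LHS]/rsum -!tsum_ge0E.
Qed.

Lemma funrposneg f i : f i = f^\+ i - f^\- i.
Proof. by have /(congr1 (@^~ i)) := funrposBneg f. Qed.

Lemma tsumD_ge0 f g : (forall i, 0 <= f i) -> (forall i, 0 <= g i) ->
  summR f -> summR g -> tsum (fun i => f i + g i) = tsum f + tsum g.
Proof.
move=> f0 g0 sf sg.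
have fg0 i : 0 <= f i + g i by rewrite addr_ge0.
have : (tsum (fun i => f i + g i))%:E = (tsum f + tsum g)%:E; last by case.
rewrite (tsum_ge0_EFin fg0 (summRD sf sg)) EFinD.
rewrite (tsum_ge0_EFin f0 sf) (tsum_ge0_EFin g0 sg).
by rewrite -esumD// => i _; rewrite lee_fin.
Qed.

Lemma tsumD f g : summR f -> summR g ->
  tsum (fun i => f i + g i) = tsum f + tsum g.
Proof.
move=> sf sg.
have p0 h i : 0 <= h^\+ i :> R by rewrite /funrpos le_max lexx orbT.
have n0 h i : 0 <= h^\- i :> R by rewrite /funrneg le_max lexx orbT.
have sp h : summR h -> summR h^\+ by exact: summR_funrpos.
have sn h : summR h -> summR h^\- by move/summRN/summR_funrpos; rewrite -funrposN.
have -> : tsum (fun i => f i + g i) =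
    tsum (fun i => (f^\+ i + g^\+ i) - (f^\- i + g^\- i)).
  congr tsum; apply/funext => i; rewrite {1}(funrposneg f) {1}(funrposneg g).
  by rewrite opprD addrACA.
have sF := sp _ sf; have sG := sp _ sg; have nF := sn _ sf; have nG := sn _ sg.
rewrite tsumBE; first last.
- exact: summRD nF nG.
- exact: summRD sF sG.
- by move=> i; rewrite addr_ge0.
- by move=> i; rewrite addr_ge0.
rewrite !tsumD_ge0// opprD addrACA -!tsumBE//.
by congr (tsum _ + tsum _); apply/funext => i; rewrite -funrposneg.
Qed.

Lemma tsum0 : tsum (fun=> 0) = 0.
Proof. by rewrite tsum_ge0E// esum1. Qed.

Lemma tsumN f : summR f -> tsum (fun i => - f i) = - tsum f.
Proof.
move=> sf; apply/eqP; rewrite -addr_eq0 -tsumD//; last exact: summRN.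
by under eq_fun do rewrite addNr; rewrite tsum0.
Qed.

Lemma tsumB f g : summR f -> summR g ->
  tsum (fun i => f i - g i) = tsum f - tsum g.
Proof. by move=> sf sg; rewrite tsumD ?tsumN//; exact: summRN. Qed.

Lemma tsum_ge0 f : (forall i, 0 <= f i) -> 0 <= tsum f.
Proof. by move=> f0; rewrite tsum_ge0E// fine_ge0// esum_ge0// => i _; rewrite lee_fin. Qed.

Lemma le_tsum f g : summR f -> summR g -> (forall i, f i <= g i) -> tsum f <= tsum g.
Proof.
move=> sf sg fg; rewrite -subr_ge0 -tsumB//.
by apply: tsum_ge0 => i; rewrite subr_ge0.
Qed.

Lemma seq_le_tsum f s : (forall i, 0 <= f i) -> summR f -> uniq s ->
  \sum_(i <- s) f i <= tsum f.
Proof. by move=> f0 sf us; rewrite -lee_fin tsum_ge0_EFin// seq_le_esum. Qed.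

Lemma tsum_le_seq f M : (forall i, 0 <= f i) ->
  (forall s, uniq s -> \sum_(i <- s) f i <= M) -> tsum f <= M.
Proof.
move=> f0 H; have sf : summR f.
  by apply: (@summR_seq _ M) => s us; under eq_bigr do rewrite ger0_norm//; exact: H.
by rewrite -lee_fin tsum_ge0_EFin// esum_le_seq.
Qed.

Lemma le1_tsum f i : (forall i, 0 <= f i) -> summR f -> f i <= tsum f.
Proof. by move=> f0 sf; have := seq_le_tsum (s := [:: i]) f0 sf; rewrite big_seq1; exact. Qed.

Lemma tsum_abs f : summR f -> `|tsum f| <= tsum (fun i => `|f i|).
Proof.
move=> sf; have sa := (summR_abs f).1 sf.
rewrite ler_norml -tsumN//; apply/andP; split; apply: le_tsum => //.
- exact: summRN.
- by move=> i; have := lexx `|f i|; rewrite {1}ler_norml => /andP[].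
- by move=> i; exact: ler_norm.
Qed.

Lemma tsumZ a f : summR f -> tsum (fun i => a * f i) = a * tsum f.
Proof.
have Z0 b g : 0 <= b -> (forall i, 0 <= g i) -> summR g ->
    tsum (fun i => b * g i) <= b * tsum g.
  move=> b0 g0 sg; apply: tsum_le_seq => [i|s us]; first by rewrite mulr_ge0.
  by rewrite -mulr_sumr ler_wpM2l// seq_le_tsum.
have Z1 b g : 0 < b -> (forall i, 0 <= g i) -> summR g ->
    tsum (fun i => b * g i) = b * tsum g.
  move=> b0 g0 sg; apply/eqP; rewrite eq_le Z0 ?(ltW b0)//= -ler_pdivlMl//.
  have -> : tsum g = tsum (fun i => b^-1 * (b * g i)).
    by congr tsum; apply/funext => i; rewrite mulKf ?gt_eqF.
  apply: Z0; rewrite ?invr_ge0 ?(ltW b0)//; last exact: summRZ.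
  by move=> i; rewrite mulr_ge0// ltW.
have Z2 b g : 0 < b -> summR g -> tsum (fun i => b * g i) = b * tsum g.
  move=> b0 sg.
  have p0 i : 0 <= g^\+ i by rewrite /funrpos le_max lexx orbT.
  have n0 i : 0 <= g^\- i by rewrite /funrneg le_max lexx orbT.
  have sp := summR_funrpos sg.
  have sn : summR g^\- by rewrite -funrposN; apply: summR_funrpos; exact: summRN.
  transitivity (tsum (fun i => b * g^\+ i - b * g^\- i)).
    by congr tsum; apply/funext => i; rewrite {1}funrposneg mulrBr.
  rewrite tsumB ?Z1// -?mulrBr -?tsumB//; try exact: summRZ.
  by congr (_ * tsum _); apply/funext => i; rewrite -funrposneg.
move=> sf; have [a0|a0|->] := ltgtP a 0; first last.
- by under eq_fun do rewrite mul0r; rewrite tsum0 mul0r.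
- exact: Z2.
rewrite -[a]opprK; under eq_fun do rewrite mulNr.
by rewrite tsumN ?Z2 ?oppr_gt0// ?mulNr//; exact: summRZ.
Qed.


Lemma summR_sum (J : Type) (r : seq J) (F : J -> I -> R) :
  (forall j, summR (F j)) -> summR (fun i => \sum_(j <- r) F j i).
Proof.
move=> sF; elim: r => [|j r IH].
  by under eq_fun do rewrite big_nil; exact: summR0.
by under eq_fun do rewrite big_cons; exact: summRD.
Qed.

Lemma tsum_sum (J : Type) (r : seq J) (F : J -> I -> R) :
  (forall j, summR (F j)) ->
  tsum (fun i => \sum_(j <- r) F j i) = \sum_(j <- r) tsum (F j).
Proof.
move=> sF; elim: r => [|j r IH].
  by under eq_fun do rewrite big_nil; rewrite tsum0 big_nil.
under eq_fun do rewrite big_cons.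
by rewrite tsumD ?IH ?big_cons//; exact: summR_sum.
Qed.

Let delta (a : I) (x : R) i := if i == a then x else 0.

Let summR_delta a x : summR (delta a x).
Proof.
apply: (@summR_seq _ `|x|) => s us; rewrite (bigID (pred1 a))/= [X in _ + X]big1 ?addr0.
  rewrite -big_filter; have [as_|/negbTE as_] := boolP (a \in s).
    by rewrite filter_pred1_uniq// big_seq1 /delta eqxx.
  by rewrite (_ : [seq i <- s | i == a] = [::]) ?big_nil//; apply/eqP; rewrite -[_ == _]negbK -has_filter has_pred1 as_.
by move=> i /negbTE ia; rewrite /delta ia normr0.
Qed.

Let tsum_delta a x : tsum (delta a x) = x.
Proof.
have E : tsum (delta a 1) = 1.
  rewrite tsum_ge0E; last by move=> i; rewrite /delta; case: ifP.
  transitivity (fine (\esum_(i in [set a]) (1%:E : \bar R)%E)); last by rewrite esum_set1.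
  rewrite [in RHS]esum_mkcond; congr fine; apply: eq_esum => i _; rewrite /delta.
  by rewrite in_set1; case: ifP.
transitivity (tsum (fun i => x * delta a 1 i)).
  by congr tsum; apply/funext => i; rewrite /delta; case: ifP; rewrite ?mulr1 ?mulr0.
by rewrite tsumZ// E mulr1.
Qed.

Let finsuppE f s : uniq s -> (forall i, i \notin s -> f i = 0) ->
  f = (fun i => \sum_(j <- s) delta j (f j) i).
Proof.
move=> us f0; apply/funext => i; have [si|/f0 fi] := boolP (i \in s).
  rewrite (bigD1_seq i)//= {1}/delta eqxx big1 ?addr0// => j ji.
  by rewrite /delta eq_sym (negbTE ji).
by rewrite fi big1// => j _; rewrite /delta; case: eqP => // <-.
Qed.

Lemma finsupp_summR f s : (forall i, i \notin s -> f i = 0) -> summR f.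
Proof.
move=> f0; have f0' i : i \notin undup s -> f i = 0 by rewrite mem_undup; exact: f0.
rewrite (finsuppE (undup_uniq s) f0'); apply: summR_sum => j; exact: summR_delta.
Qed.

Lemma finsupp_tsum f s : uniq s -> (forall i, i \notin s -> f i = 0) ->
  tsum f = \sum_(i <- s) f i.
Proof.
move=> us f0; rewrite {1}(finsuppE us f0) tsum_sum => [|j]; last exact: summR_delta.
by apply: eq_bigr => j _; rewrite tsum_delta.
Qed.

Lemma tsum_approx f e : summR f -> 0 < e ->
  exists s, uniq s /\ forall t, uniq t -> {subset s <= t} ->
    `|tsum f - \sum_(i <- t) f i| <= e.
Proof.
move=> sf e0; have sa := (summR_abs f).1 sf.
have [s us Hs] : exists2 s, uniq s & tsum (fun i => `|f i|) - e <= \sum_(i <- s) `|f i|.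
  apply: contrapT => /forall2NP H.
  have : tsum (fun i => `|f i|) <= tsum (fun i => `|f i|) - e.
    apply: tsum_le_seq => // s us.
    by case: (H s) => // /negP; rewrite -ltNge => /ltW.
  by rewrite lerBrDl gerDr leNgt e0.
exists s; split=> // t ut st.
(* [f] cut down to [t]: |f - g| is |f| off [t], so the error is a tail of the sum of |f|. *)
pose g i := if i \in t then f i else 0.
have gE : \sum_(i <- t) f i = tsum g.
  rewrite (@finsupp_tsum g t)//; last by move=> i /negbTE it; rewrite /g it.
  by apply: eq_big_seq => i it; rewrite /g it.
have sg : summR g by apply: (@finsupp_summR _ t) => i /negbTE it; rewrite /g it.
have gaE : tsum (fun i => `|g i|) = \sum_(i <- t) `|f i|.
  rewrite (@finsupp_tsum _ t)//; last by move=> i /negbTE it; rewrite /g it normr0.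
  by apply: eq_big_seq => i it; rewrite /g it.
have sga := (summR_abs g).1 sg.
rewrite gE -tsumB//; apply: le_trans (tsum_abs (summRB sf sg)) _.
have -> : tsum (fun i => `|f i - g i|) = tsum (fun i => `|f i|) - tsum (fun i => `|g i|).
  rewrite -tsumB//; congr tsum; apply/funext => i; rewrite /g; case: ifP => _.
    by rewrite !subrr normr0.
  by rewrite normr0 !subr0.
rewrite gaE lerBlDl -lerBlDr (le_trans Hs)//.
rewrite [leRHS](bigID (mem s))/=.
have -> : \sum_(i <- t | i \in s) `|f i| = \sum_(i <- s) `|f i|.
  rewrite -big_filter; apply: perm_big; apply: uniq_perm => //.
    exact: filter_uniq.
  by move=> i; rewrite mem_filter; case: (boolP (i \in s)) => //= /st.
by rewrite lerDl sumr_ge0.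
Qed.

End Sums.

(** * Sums over pairs and reindexing *)

Section Pairs.
Variables (R : realType) (I J : choiceType).
Implicit Types (f : I * J -> R).

Let esum_pair f : (forall p, 0 <= f p) ->
  (\esum_(p in [set: I * J]) (f p)%:E =
   \esum_(i in [set: I]) \esum_(j in [set: J]) (f (i, j))%:E)%E.
Proof.
move=> f0; rewrite (@esum_esum _ _ _ _ (fun=> setT) (fun i j => (f (i, j))%:E)); last first.
  by move=> i j _ _; rewrite lee_fin.
rewrite (_ : setT `*`` _ = setT); first by apply: eq_esum => -[].
by apply/seteqP; split=> // -[].
Qed.

Lemma tsum_pair f : (forall p, 0 <= f p) ->
  (forall i, summR (fun j => f (i, j))) ->
  summR (fun i => tsum (fun j => f (i, j))) ->
  summR f /\ tsum f = tsum (fun i => tsum (fun j => f (i, j))).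
Proof.
move=> f0 s1 s2.
have g0 i : 0 <= tsum (fun j => f (i, j)) by exact: tsum_ge0.
have E : \esum_(p in [set: I * J]) (f p)%:E =
    \esum_(i in [set: I]) (tsum (fun j => f (i, j)))%:E.
  by rewrite esum_pair//; apply: eq_esum => i _; rewrite tsum_ge0_EFin.
split; last by rewrite tsum_ge0E// E -tsum_ge0E.
by apply: (summR_ge0 f0).2; rewrite E; exact: (summR_ge0 g0).1.
Qed.

Lemma summR_pair f : (forall p, 0 <= f p) -> summR f ->
  (forall i, summR (fun j => f (i, j))) /\
  summR (fun i => tsum (fun j => f (i, j))).
Proof.
move=> f0 sf.
have s1 i : summR (fun j => f (i, j)).
  apply: (@summR_seq _ _ _ (tsum f)) => s us.
  have := @seq_le_tsum _ _ f [seq (i, j) | j <- s] f0 sf.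
  rewrite map_inj_uniq => [|j j' [] //] /(_ us); apply: le_trans.
  by rewrite big_map; apply: ler_sum => j _; rewrite ger0_norm.
have g0 i : 0 <= tsum (fun j => f (i, j)) by exact: tsum_ge0.
split=> //; apply: (summR_ge0 g0).2.
under eq_esum do rewrite tsum_ge0_EFin//.
by rewrite -esum_pair//; exact: (summR_ge0 f0).1.
Qed.

(** Serves the reversal of edges, which preserves norms with a symmetric edge weight. *)
Lemma tsum_swap (K : choiceType) (e : I -> K) (e' : K -> I) (f : K -> R) :
  cancel e e' -> cancel e' e -> (forall i, 0 <= f i) -> summR f ->
  summR (f \o e) /\ tsum (f \o e) = tsum f.
Proof.
move=> ee' e'e f0 sf.
have E : \esum_(j in [set: K]) (f j)%:E = \esum_(i in [set: I]) (f (e i))%:E.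
  apply: reindex_esum; split=> //; first by move=> i i' _ _ /(can_inj ee').
  by move=> k _; exists (e' k).
have g0 i : 0 <= (f \o e) i by exact: f0.
split; first by apply: (summR_ge0 g0).2; rewrite -E; exact: (summR_ge0 f0).1.
by rewrite (tsum_ge0E g0) (tsum_ge0E f0) E.
Qed.

End Pairs.

(** * Weighted L2 spaces *)

Section ComplexFacts.
Variable R : realType.
Implicit Types z w : R[i].

(* The real inner product Re (z * conj w). Complex identities are recovered by testing
   against both v and i v. *)
Definition rd z w : R := complex.Re z * complex.Re w + complex.Im z * complex.Im w.

Lemma cmod_ge0 z : 0 <= cmod z.
Proof. by case: z => a b; exact: sqrtr_ge0. Qed.

Lemma cmod2 z : cmod z ^+ 2 = rd z z.
Proof.
case: z => a b; rewrite /cmod /ComplexField.Normc.normc /rd /= sqr_sqrtr ?expr2//.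
by rewrite addr_ge0 ?sqr_ge0.
Qed.

Lemma rd_ge0 z : 0 <= rd z z.
Proof. by rewrite -cmod2 sqr_ge0. Qed.

Lemma cmodM z w : cmod (z * w) = cmod z * cmod w.
Proof. exact: ComplexField.Normc.normcM. Qed.

Lemma cmodD z w : cmod (z + w) <= cmod z + cmod w.
Proof. exact: le_normcD. Qed.

Lemma cmod0 : cmod (0 : R[i]) = 0.
Proof. exact: ComplexField.Normc.normc0. Qed.

Lemma cmod1 : cmod (1 : R[i]) = 1.
Proof. exact: ComplexField.Normc.normc1. Qed.

Lemma cmodN z : cmod (- z) = cmod z.
Proof. by case: z => a b; rewrite /cmod /= !sqrrN. Qed.

Lemma cmodC z w : cmod (z - w) = cmod (w - z).
Proof. by rewrite -cmodN opprB. Qed.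

Lemma cmodB z w : cmod (z - w) <= cmod z + cmod w.
Proof. by rewrite (le_trans (cmodD _ _))// cmodN. Qed.

Lemma cmod_eq0 z : cmod z = 0 -> z = 0.
Proof. exact: ComplexField.Normc.eq0_normc. Qed.

Lemma cmodR (a : R) : cmod (a%:C)%C = `|a|.
Proof. by rewrite /cmod /= expr0n addr0 sqrtr_sqr. Qed.

Lemma cmod_conj z : cmod (conjc z) = cmod z.
Proof. by case: z => a b; rewrite /cmod /= sqrrN. Qed.

Lemma cmodV z : cmod z^-1 = (cmod z)^-1.
Proof. exact: ComplexField.Normc.normcV. Qed.

Lemma cmod_gt0 z : z != 0 -> 0 < cmod z.
Proof.
by move=> z0; rewrite lt_def cmod_ge0 andbT; apply: contraNneq z0 => /cmod_eq0 ->.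
Qed.

Lemma Re_le_cmod z : `|complex.Re z| <= cmod z.
Proof.
rewrite -[leLHS]sqrtr_sqr; case: z => a b /=; apply: ler_wsqrtr.
by rewrite lerDl sqr_ge0.
Qed.

Lemma Im_le_cmod z : `|complex.Im z| <= cmod z.
Proof.
rewrite -[leLHS]sqrtr_sqr; case: z => a b /=; apply: ler_wsqrtr.
by rewrite lerDr sqr_ge0.
Qed.

Lemma cmod_le_ReIm z : cmod z <= `|complex.Re z| + `|complex.Im z|.
Proof.
case: z => a b; rewrite -(@ler_pXn2r _ 2)// ?nnegrE ?cmod_ge0 ?addr_ge0//.
rewrite cmod2 /rd /= -!expr2 -(real_normK (num_real a)) -(real_normK (num_real b)).
have := mulr_ge0 (normr_ge0 a) (normr_ge0 b); nra.
Qed.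

Lemma rdC z w : rd z w = rd w z.
Proof. by rewrite /rd mulrC [X in _ + X]mulrC. Qed.

Lemma rdDl z w v : rd (z + w) v = rd z v + rd w v.
Proof. by case: z => a b; case: w => c d; rewrite /rd /=; ring. Qed.

Lemma rdDr z w v : rd v (z + w) = rd v z + rd v w.
Proof. by rewrite rdC rdDl !(rdC v). Qed.

Lemma rdNl z w : rd (- z) w = - rd z w.
Proof. by case: z => a b; rewrite /rd /=; ring. Qed.

Lemma rdZl (a : R) z w : rd ((a%:C)%C * z) w = a * rd z w.
Proof. by case: z => c d; rewrite /rd /=; ring. Qed.

Lemma rd_mull a z w : rd (a * z) w = rd z (conjc a * w).
Proof. by case: a => a b; case: z => c d; case: w => e f; rewrite /rd /=; ring. Qed.

Lemma rdE z w : rd z w = complex.Re (z * conjc w).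
Proof. by case: z => c d; case: w => e f; rewrite /rd /=; ring. Qed.

Lemma rd_amgm z w : `|rd z w| <= (rd z z + rd w w) / 2.
Proof.
case: z => a b; case: w => c d; rewrite /rd /= ler_norml.
have := sqr_ge0 (a - c); have := sqr_ge0 (b - d).
have := sqr_ge0 (a + c); have := sqr_ge0 (b + d).
by move=> *; apply/andP; split; lra.
Qed.

Lemma rd_mul2 a z : rd (a * z) (a * z) = cmod a ^+ 2 * rd z z.
Proof. by rewrite -!cmod2 cmodM exprMn. Qed.

Lemma rd0l z : rd 0 z = 0.
Proof. by rewrite /rd /= !mul0r addr0. Qed.

Lemma rd_sqrD z w : rd (z + w) (z + w) <= 2 * rd z z + 2 * rd w w.
Proof.
case: z => a b; case: w => c d; rewrite /rd /=.
have := sqr_ge0 (a - c); have := sqr_ge0 (b - d); lra.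
Qed.

End ComplexFacts.

(** * Null sequences and Cauchy sequences *)

Section Cv0.
Variable R : realType.
Implicit Types a b : nat -> R.

(** Only the upper bound is asked for: this is convergence to 0 for nonnegative sequences such as
    norms, and no absolute value has to be carried along. *)
Definition cv0 a := forall e : R, 0 < e -> exists N, forall n, (N <= n)%N -> a n <= e.

Lemma cv0_le a b : (forall n, a n <= b n) -> cv0 b -> cv0 a.
Proof.
by move=> ab H e /H[N HN]; exists N => n /HN; apply: le_trans.
Qed.

Lemma cv0_0 : cv0 (fun=> 0).
Proof. by move=> e e0; exists 0%N => n _; exact: ltW. Qed.

Lemma cv0D a b : cv0 a -> cv0 b -> cv0 (fun n => a n + b n).
Proof.
move=> ha hb e e0; have e2 : 0 < e / 2 by rewrite divr_gt0.
have [N1 H1] := ha _ e2; have [N2 H2] := hb _ e2.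
exists (maxn N1 N2) => n; rewrite geq_max => /andP[/H1 h1 /H2 h2]; lra.
Qed.

Lemma cv0Z (c : R) a : 0 <= c -> cv0 a -> cv0 (fun n => c * a n).
Proof.
move=> c0 ha e e0; have [N H] := ha (e / (c + 1)) ltac:(by rewrite divr_gt0// ltr_wpDl).
exists N => n /H h; apply: le_trans (ler_wpM2l c0 h) _.
by rewrite mulrCA ler_piMr ?(ltW e0)// ler_pdivrMr ?mul1r ?lerDl ?ltr_wpDl.
Qed.

Lemma cv0_sum (J : Type) (r : seq J) (F : J -> nat -> R) :
  (forall j, cv0 (F j)) -> cv0 (fun n => \sum_(j <- r) F j n).
Proof.
move=> H; elim: r => [|j r IH].
  by under eq_fun do rewrite big_nil; exact: cv0_0.
by under eq_fun do rewrite big_cons; exact: cv0D.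
Qed.

Lemma cv0_sqr a : (forall n, 0 <= a n) -> cv0 a -> cv0 (fun n => a n ^+ 2).
Proof.
move=> a0 ha e e0; have [N H] := ha (Num.min e 1) ltac:(by rewrite lt_min e0 ltr01).
exists N => n /H; rewrite le_min => /andP[h1 h2].
by apply: le_trans h1; rewrite expr2 ler_piMl.
Qed.

Lemma cv0_shift a k : cv0 a -> cv0 (fun n => a (n + k)%N).
Proof.
by move=> H e /H[N HN]; exists N => n Nn; apply: HN; rewrite (leq_trans Nn)// leq_addr.
Qed.

Lemma cv0_const c : cv0 (fun=> c) -> c <= 0.
Proof.
move=> H; rewrite leNgt; apply/negP => c0.
have [|N /(_ N (leqnn N))] := H (c / 2); first by rewrite divr_gt0.
by rewrite leNgt => /negP; apply; lra.
Qed.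

Lemma cv0_ge (c d : R) a : (forall n, c <= d + a n) -> cv0 a -> c <= d.
Proof.
move=> H h; rewrite -subr_le0; apply: cv0_const; apply: cv0_le h => n.
by rewrite lerBlDl.
Qed.

Lemma cv0_half (c : R) : 0 <= c -> cv0 (fun n => c * 2^-1 ^+ n).
Proof.
move=> c0; apply: cv0Z => // e e0.
have /cvgrPdist_le /(_ e e0) [N _ HN] : (2^-1 : R) ^+ n @[n --> \oo] --> 0.
  by apply: cvg_expr; rewrite ger0_norm; lra.
exists N => n /HN /=; rewrite sub0r normrN ger0_norm// exprn_ge0; lra.
Qed.

Lemma cv0_cauchy (u : nat -> R) :
  (forall e, 0 < e -> exists N, forall n m, (N <= n)%N -> (N <= m)%N -> `|u n - u m| <= e) ->
  exists l, cv0 (fun n => `|u n - l|).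
Proof.
move=> H; have : cvg (u @ \oo).
  apply/cauchy_cvgP/cauchy_ballP => e e0.
  have [N HN] := H (e / 2) ltac:(by rewrite divr_gt0).
  exists ([set x | exists2 n, (N <= n)%N & u n = x], [set x | exists2 n, (N <= n)%N & u n = x]) => /=.
    by split; exists N => // n Nn; exists n.
  move=> [x y] /= [[n Nn <-] [m Nm <-]]; rewrite /ball /=.
  by apply: le_lt_trans (HN _ _ Nn Nm) _; lra.
move=> /cvg_ex[l /= /cvgrPdist_le Hl]; exists l => e /Hl[N _ HN].
by exists N => n /HN; rewrite distrC.
Qed.

Lemma cv0_cauchyC (u : nat -> R[i]) :
  (forall e, 0 < e -> exists N, forall n m, (N <= n)%N -> (N <= m)%N -> cmod (u n - u m) <= e) ->
  exists l, cv0 (fun n => cmod (u n - l)).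
Proof.
move=> H.
have [|a ha] := @cv0_cauchy (fun n => complex.Re (u n)).
  move=> e /H[N HN]; exists N => n m Nn Nm; apply: le_trans (HN _ _ Nn Nm).
  by apply: le_trans (Re_le_cmod _); case: (u n) (u m) => ? ? [? ?].
have [|b hb] := @cv0_cauchy (fun n => complex.Im (u n)).
  move=> e /H[N HN]; exists N => n m Nn Nm; apply: le_trans (HN _ _ Nn Nm).
  by apply: le_trans (Im_le_cmod _); case: (u n) (u m) => ? ? [? ?].
exists (a +i* b)%C; apply: cv0_le (cv0D ha hb) => n.
by apply: le_trans (cmod_le_ReIm _) _; case: (u n).
Qed.

End Cv0.

(** * Weighted l2 spaces as real inner product spaces *)

Section L2.
Variables (R : realType) (I : choiceType) (w : I -> R).
Hypothesis w0 : forall i, 0 <= w i.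
Implicit Types F G H : I -> R[i].

(** The weight may vanish. The same theory then serves the vertices, the edges, and their
    restrictions to balls, which are obtained by cutting the weight; pointwise hypotheses below are
    therefore required only where [0 < w i]. *)
Definition l2 F := summR (fun i => rd (F i) (F i) * w i).
Definition ip F G : R := tsum (fun i => rd (F i) (G i) * w i).
Definition nq F : R := ip F F.
Definition nm F : R := Num.sqrt (nq F).

Lemma rdw_ge0 F i : 0 <= rd (F i) (F i) * w i.
Proof. by rewrite mulr_ge0// rd_ge0. Qed.

Lemma nq_ge0 F : 0 <= nq F.
Proof. by apply: tsum_ge0 => i; exact: rdw_ge0. Qed.

Lemma nm_ge0 F : 0 <= nm F.
Proof. exact: sqrtr_ge0. Qed.

Lemma nm2 F : nm F ^+ 2 = nq F.
Proof. by rewrite sqr_sqrtr// nq_ge0. Qed.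

Lemma summ_ip F G : l2 F -> l2 G -> summR (fun i => rd (F i) (G i) * w i).
Proof.
move=> lF lG; apply: (@summR_le _ _ _ (fun i => 2^-1 * (rd (F i) (F i) * w i + rd (G i) (G i) * w i))).
  move=> i; rewrite normrM (ger0_norm (w0 i)) -mulrDl mulrA ler_wpM2r// mulrC.
  exact: rd_amgm.
by apply: summRZ; exact: summRD.
Qed.

Lemma ipC F G : ip F G = ip G F.
Proof. by rewrite /ip; under eq_fun do rewrite rdC. Qed.

Lemma l2D F G : l2 F -> l2 G -> l2 (fun i => F i + G i).
Proof.
move=> lF lG; apply: (@summR_le _ _ _ (fun i => 2 * (rd (F i) (F i) * w i) + 2 * (rd (G i) (G i) * w i))).
  move=> i; rewrite ger0_norm ?mulr_ge0 ?rd_ge0// !mulrA -mulrDl ler_wpM2r//.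
  exact: rd_sqrD.
by apply: summRD; apply: summRZ.
Qed.

Lemma l2_bmul (a : I -> R[i]) (B : R) F : (forall i, 0 < w i -> cmod (a i) <= B) ->
  l2 F -> l2 (fun i => a i * F i).
Proof.
move=> aB lF; apply: (@summR_le _ _ _ (fun i => B ^+ 2 * (rd (F i) (F i) * w i))); last exact: summRZ.
move=> i; rewrite ger0_norm ?(rdw_ge0 (fun i => a i * F i))// rd_mul2 -mulrA.
have := w0 i; rewrite le_eqVlt => /predU1P[<-|wi]; first by rewrite !mulr0.
rewrite ler_wpM2r ?rdw_ge0// lerXn2r// ?nnegrE ?cmod_ge0 ?aB//.
by rewrite (le_trans (cmod_ge0 (a i)))// aB.
Qed.

Lemma l2Z (a : R[i]) F : l2 F -> l2 (fun i => a * F i).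
Proof. exact: (@l2_bmul (fun=> a) (cmod a)). Qed.

Lemma l2N F : l2 F -> l2 (fun i => - F i).
Proof. by move=> /(l2Z (-1)); congr l2; apply/funext => i; rewrite mulN1r. Qed.

Lemma l2B F G : l2 F -> l2 G -> l2 (fun i => F i - G i).
Proof. by move=> lF /l2N; exact: l2D. Qed.

Lemma l2_0 : l2 (fun=> 0).
Proof. by rewrite /l2; under eq_fun do rewrite rd0l mul0r; exact: summR0. Qed.

Lemma l2_le F G : (forall i, 0 < w i -> cmod (F i) <= cmod (G i)) -> l2 G -> l2 F.
Proof.
move=> FG; apply: summR_le => i; rewrite ger0_norm ?rdw_ge0//.
have := w0 i; rewrite le_eqVlt => /predU1P[<-|wi]; first by rewrite !mulr0.
by rewrite ler_wpM2r// -!cmod2 lerXn2r ?nnegrE ?cmod_ge0 ?FG.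
Qed.

Lemma le_nq F G : (forall i, 0 < w i -> cmod (F i) <= cmod (G i)) -> l2 G -> nq F <= nq G.
Proof.
move=> FG lG; apply: le_tsum => // [|i]; first exact: l2_le lG.
have := w0 i; rewrite le_eqVlt => /predU1P[<-|wi]; first by rewrite !mulr0.
by rewrite ler_wpM2r// -!cmod2 lerXn2r ?nnegrE ?cmod_ge0 ?FG.
Qed.

Lemma le_nm F G : (forall i, 0 < w i -> cmod (F i) <= cmod (G i)) -> l2 G -> nm F <= nm G.
Proof. by move=> FG lG; apply: ler_wsqrtr; exact: le_nq. Qed.

Lemma ipDl F G H : l2 F -> l2 G -> l2 H ->
  ip (fun i => F i + G i) H = ip F H + ip G H.
Proof.
move=> lF lG lH; rewrite /ip -tsumD; try exact: summ_ip.
by under eq_fun do rewrite rdDl mulrDl.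
Qed.

Lemma ipDr F G H : l2 F -> l2 G -> l2 H ->
  ip H (fun i => F i + G i) = ip H F + ip H G.
Proof. by move=> lF lG lH; rewrite ipC ipDl// !(ipC H). Qed.

Lemma ipZl (a : R) F G : l2 F -> l2 G -> ip (fun i => (a%:C)%C * F i) G = a * ip F G.
Proof.
move=> lF lG; rewrite /ip -tsumZ; last exact: summ_ip.
by under eq_fun do rewrite rdZl -mulrA.
Qed.

Lemma ipZr (a : R) F G : l2 F -> l2 G -> ip F (fun i => (a%:C)%C * G i) = a * ip F G.
Proof. by move=> lF lG; rewrite ipC ipZl// ipC. Qed.

Lemma ipNl F G : l2 F -> l2 G -> ip (fun i => - F i) G = - ip F G.
Proof.
move=> lF lG; rewrite /ip -tsumN; last exact: summ_ip.
by under eq_fun do rewrite rdNl mulNr.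
Qed.

Lemma ipBl F G H : l2 F -> l2 G -> l2 H ->
  ip (fun i => F i - G i) H = ip F H - ip G H.
Proof. by move=> lF lG lH; rewrite ipDl ?ipNl//; exact: l2N. Qed.

Lemma ipBr F G H : l2 F -> l2 G -> l2 H ->
  ip H (fun i => F i - G i) = ip H F - ip H G.
Proof. by move=> lF lG lH; rewrite ipC ipBl// !(ipC H). Qed.

Lemma ip_mull (a : I -> R[i]) F G :
  ip (fun i => a i * F i) G = ip F (fun i => conjc (a i) * G i).
Proof. by rewrite /ip; under eq_fun do rewrite rd_mull. Qed.

Lemma ip_extl F F' G : (forall i, F i = F' i) -> ip F G = ip F' G.
Proof. by move=> E; rewrite (_ : F = F')//; exact/funext. Qed.

Lemma ip_extr F F' G : (forall i, F i = F' i) -> ip G F = ip G F'.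
Proof. by move=> E; rewrite (_ : F = F')//; exact/funext. Qed.

Lemma l2_ext F F' : (forall i, 0 < w i -> F i = F' i) -> l2 F -> l2 F'.
Proof. by move=> E; apply: l2_le => i /E ->. Qed.

Lemma l2_sum (J : Type) (r : seq J) (P : J -> I -> R[i]) :
  (forall j, l2 (P j)) -> l2 (fun i => \sum_(j <- r) P j i).
Proof.
move=> lP; elim: r => [|j r IH].
  by rewrite (_ : (fun i => _) = fun=> 0); [exact: l2_0|apply/funext => i; rewrite big_nil].
rewrite (_ : (fun i => _) = fun i => P j i + \sum_(j <- r) P j i); first exact: l2D.
by apply/funext => i; rewrite big_cons.
Qed.

Lemma ip_sumr (J : Type) (r : seq J) (P : J -> I -> R[i]) G : l2 G ->
  (forall j, l2 (P j)) -> ip G (fun i => \sum_(j <- r) P j i) = \sum_(j <- r) ip G (P j).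
Proof.
move=> lG lP; elim: r => [|j r IH].
  rewrite big_nil ipC (ip_extl (F' := fun=> 0)); last by move=> i; rewrite big_nil.
  by rewrite /ip; under eq_fun do rewrite rd0l mul0r; exact: tsum0.
rewrite big_cons -IH -ipDr//; last exact: l2_sum.
by apply: ip_extr => i; rewrite big_cons.
Qed.

Lemma ip0l G : ip (fun=> 0) G = 0.
Proof. by rewrite /ip; under eq_fun do rewrite rd0l mul0r; exact: tsum0. Qed.

Lemma nqD F G : l2 F -> l2 G -> nq (fun i => F i + G i) = nq F + 2 * ip F G + nq G.
Proof.
move=> lF lG; have lFG := l2D lF lG; rewrite /nq ipDl// !ipDr// (ipC G F); ring.
Qed.

Lemma nqB F G : l2 F -> l2 G -> nq (fun i => F i - G i) = nq F - 2 * ip F G + nq G.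
Proof.
move=> lF lG; have lFG := l2B lF lG; rewrite /nq ipBl// !ipBr// (ipC G F); ring.
Qed.

Lemma nqZ (a : R[i]) F : l2 F -> nq (fun i => a * F i) = cmod a ^+ 2 * nq F.
Proof.
move=> lF; rewrite /nq /ip -tsumZ//.
by under eq_fun do rewrite rd_mul2 -mulrA.
Qed.

Lemma nmZ (a : R[i]) F : l2 F -> nm (fun i => a * F i) = cmod a * nm F.
Proof.
by move=> lF; rewrite /nm nqZ// sqrtrM ?sqr_ge0// sqrtr_sqr ger0_norm ?cmod_ge0.
Qed.

Lemma nmN F : l2 F -> nm (fun i => - F i) = nm F.
Proof. by move=> lF; rewrite /nm /nq /ip; under eq_fun do rewrite rdNl rdC rdNl opprK. Qed.

Lemma ip_CS F G : l2 F -> l2 G -> `|ip F G| <= nm F * nm G.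
Proof.
move=> lF lG.
have quad t : 0 <= nq F - 2 * t * ip F G + t ^+ 2 * nq G.
  have := nq_ge0 (fun i => F i - (t%:C)%C * G i).
  rewrite nqB ?nqZ//; last exact: l2Z.
  by rewrite ipZr// cmodR real_normK ?num_real// mulrA.
have key : ip F G ^+ 2 <= nq F * nq G.
  have := nq_ge0 G; rewrite le_eqVlt => /predU1P[E|G0].
    have [->|ne] := eqVneq (ip F G) 0; first by rewrite expr0n mulr_ge0 ?nq_ge0.
    (* With [nq G = 0] the quadratic is affine in t; at this t it takes the value -1. *)
    have := quad ((nq F + 1) / (2 * ip F G)); rewrite -E !mulr0 addr0.
    rewrite (_ : _ * ip F G = nq F + 1); last by field.
    by rewrite opprD addrA subrr add0r oppr_ge0 ler10.
  have := quad (ip F G / nq G).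
  rewrite (_ : _ + _ = nq F - ip F G ^+ 2 / nq G); last by field; rewrite gt_eqF.
  by rewrite subr_ge0 ler_pdivrMr.
rewrite -(@ler_pXn2r _ 2) ?nnegrE ?mulr_ge0 ?nm_ge0//.
by rewrite real_normK ?num_real// exprMn !nm2.
Qed.

Lemma ip_CS_le F G : l2 F -> l2 G -> ip F G <= nm F * nm G.
Proof. by move=> lF lG; apply: le_trans (ler_norm _) (ip_CS lF lG). Qed.

Lemma nmD F G : l2 F -> l2 G -> nm (fun i => F i + G i) <= nm F + nm G.
Proof.
move=> lF lG; rewrite -(@ler_pXn2r _ 2) ?nnegrE ?addr_ge0 ?nm_ge0// sqrrD !nm2 nqD//.
have := ip_CS_le lF lG; lra.
Qed.

Lemma nmB F G : l2 F -> l2 G -> nm (fun i => F i - G i) <= nm F + nm G.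
Proof. by move=> lF lG; rewrite -(nmN lG); apply: nmD => //; exact: l2N. Qed.

Lemma nm_bmul (a : I -> R[i]) (B : R) F : 0 <= B -> (forall i, 0 < w i -> cmod (a i) <= B) ->
  l2 F -> nm (fun i => a i * F i) <= B * nm F.
Proof.
move=> B0 aB lF; rewrite -[B]ger0_norm// -cmodR -nmZ//; apply: le_nm; last exact: l2Z.
by move=> i wi; rewrite !cmodM cmodR ger0_norm// ler_wpM2r ?cmod_ge0 ?aB.
Qed.

Lemma nm0 : nm (fun=> 0) = 0.
Proof. by rewrite /nm /nq ip0l sqrtr0. Qed.

Lemma nq_pt F i : l2 F -> rd (F i) (F i) * w i <= nq F.
Proof. by move=> lF; apply: (@le1_tsum _ _ (fun i => rd (F i) (F i) * w i)) => // j; exact: rdw_ge0. Qed.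

Lemma nm_eq0 F : l2 F -> nm F = 0 -> forall i, 0 < w i -> F i = 0.
Proof.
move=> lF E i wi; apply: cmod_eq0; apply/eqP; rewrite -sqrf_eq0; apply/eqP/le_anti.
rewrite sqr_ge0 andbT cmod2 -(pmulr_rle0 _ wi) mulrC.
by rewrite (le_trans (nq_pt i lF))// -nm2 E expr0n.
Qed.

Lemma nm_le_sqr F M : 0 <= M -> (nm F <= M) = (nq F <= M ^+ 2).
Proof. by move=> M0; rewrite -nm2 ler_pXn2r ?nnegrE ?nm_ge0. Qed.

Lemma l2_seq F M : (forall s, uniq s -> \sum_(i <- s) rd (F i) (F i) * w i <= M) ->
  l2 F /\ nq F <= M.
Proof.
move=> h; split; last by apply: tsum_le_seq => // i; exact: rdw_ge0.
apply: (@summR_seq _ _ _ M) => s us.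
by under eq_bigr do rewrite ger0_norm ?rdw_ge0//; exact: h.
Qed.

(** Fatou's lemma. Each finite partial sum for [F] is compared with that for a single [Fn n], so
    pointwise convergence is used at finitely many indices only. *)
Lemma l2_fatou (Fn : nat -> I -> R[i]) F (M : R) (a : nat -> R) : 0 <= M ->
  (forall n, l2 (Fn n)) -> (forall n, nm (Fn n) <= M + a n) -> cv0 a ->
  (forall i, 0 < w i -> cv0 (fun n => cmod (Fn n i - F i))) ->
  l2 F /\ nm F <= M.
Proof.
move=> M0 lFn bd ha pt.
suff h s : uniq s -> \sum_(i <- s) rd (F i) (F i) * w i <= M ^+ 2.
  by have [lF h2] := l2_seq h; rewrite nm_le_sqr.
move=> us; apply/ler_addgt0Pr => e e0.
(* Parameter of Young's inequality |F|^2 <= (1 + d) |Fn|^2 + (1 + 1/d) |Fn - F|^2; it makes d (M +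
   1)^2 at most e / 4. *)
pose d := Num.min 1 (e / 4 / ((M + 1) ^+ 2)).
have d0 : 0 < d by rewrite lt_min ltr01 !divr_gt0// exprn_gt0// ltr_wpDl.
pose b n := \sum_(i <- s) cmod (Fn n i - F i) ^+ 2 * w i.
have cb : cv0 b.
  apply: cv0_sum => i; have := w0 i; rewrite le_eqVlt => /predU1P[<-|wi].
    by under eq_fun do rewrite mulr0; exact: cv0_0.
  under eq_fun do rewrite mulrC; apply: cv0Z => //.
  by apply: cv0_sqr => [n|]; [exact: cmod_ge0|exact: pt].
have [N1 H1] := ha (Num.min 1 (e / 8 / (M + 1))) ltac:(by rewrite lt_min ltr01 !divr_gt0// ltr_wpDl).
have [N2 H2] := cb (e / 4 / (1 + d^-1)) ltac:(by rewrite !divr_gt0// addr_gt0// invr_gt0).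
pose n := maxn N1 N2.
have {}H1 := H1 n (leq_maxl _ _); have {}H2 := H2 n (leq_maxr _ _).
have pw i : rd (F i) (F i) * w i <= (1 + d) * (rd (Fn n i) (Fn n i) * w i)
    + (1 + d^-1) * (cmod (Fn n i - F i) ^+ 2 * w i).
  rewrite cmodC cmod2 !mulrA -mulrDl ler_wpM2r//.
  set x := Fn n i; set y := F i.
  have -> : rd y y = rd x x + 2 * rd x (y - x) + rd (y - x) (y - x).
    by case: (x) (y) => x1 x2 [y1 y2]; rewrite /rd /=; ring.
  set z := y - x.
  have : 2 * rd x z <= d * rd x x + d^-1 * rd z z.
    have dd : d * d^-1 = 1 by rewrite mulfV ?gt_eqF.
    have di : 0 < d^-1 by rewrite invr_gt0.
    rewrite -subr_ge0.
    have -> : d * rd x x + d^-1 * rd z z - 2 * rd x z =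
        d * rd (x - (d^-1)%:C%C * z) (x - (d^-1)%:C%C * z).
      case: (x) (z) => x1 x2 [z1 z2]; rewrite /rd /=.
      by field; rewrite gt_eqF.
    by rewrite mulr_ge0 ?rd_ge0 ?ltW.
  by move=> ?; lra.
have : \sum_(i <- s) rd (F i) (F i) * w i <= (1 + d) * nq (Fn n) + (1 + d^-1) * b n.
  apply: le_trans (ler_sum _ (fun i _ => pw i)) _.
  rewrite big_split /= -!mulr_sumr lerD2r; apply: ler_wpM2l; first by rewrite addr_ge0// ltW.
  apply: (@seq_le_tsum _ _ (fun i => rd (Fn n i) (Fn n i) * w i)) => //; last exact: lFn.
  by move=> i; exact: rdw_ge0.
move=> /le_trans; apply.
have B : (1 + d^-1) * b n <= e / 4.
  by rewrite mulrC -ler_pdivlMr// addr_gt0// invr_gt0.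
have q1 : nq (Fn n) <= M ^+ 2 + e / 4.
  rewrite -nm2; have h := bd n; have n0 := nm_ge0 (Fn n).
  have a1 : a n <= 1 by move: H1; rewrite le_min => /andP[].
  have a2 : a n * (M + 1) <= e / 8.
    by move: H1; rewrite le_min => /andP[_]; rewrite ler_pdivlMr// ltr_wpDl.
  have [aneg|apos] := lerP (a n) 0; first by nra.
  by nra.
have q2 : nq (Fn n) <= (M + 1) ^+ 2.
  rewrite -nm2; have h := bd n; have n0 := nm_ge0 (Fn n).
  have a1 : a n <= 1 by move: H1; rewrite le_min => /andP[].
  by nra.
have q3 : d * (M + 1) ^+ 2 <= e / 4.
  by rewrite -ler_pdivlMr ?exprn_gt0 ?ltr_wpDl// ge_min lexx orbT.
have : d * nq (Fn n) <= e / 4 by apply: le_trans q3; rewrite ler_wpM2l// ltW.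
by move=> ?; lra.
Qed.

(** Positive weights let the norm control every coordinate, which gives a pointwise limit; Fatou's
    lemma for [Fn n - Fn m] as m grows turns it into a limit in norm. *)
Lemma l2_complete (Fn : nat -> I -> R[i]) : (forall i, 0 < w i) ->
  (forall n, l2 (Fn n)) ->
  (forall e, 0 < e -> exists N, forall n m, (N <= n)%N -> (N <= m)%N ->
     nm (fun i => Fn n i - Fn m i) <= e) ->
  exists F, l2 F /\ cv0 (fun n => nm (fun i => Fn n i - F i)).
Proof.
move=> wp lF H.
have pt i : exists l, cv0 (fun n => cmod (Fn n i - l)).
  apply: cv0_cauchyC => e e0.
  have [|N HN] := H (e * Num.sqrt (w i)); first by rewrite mulr_gt0// sqrtr_gt0.
  exists N => n m Nn Nm; have := HN _ _ Nn Nm; set D := fun i => _ => h.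
  have lD : l2 D by exact: l2B.
  rewrite -(@ler_pM2r _ (Num.sqrt (w i))) ?sqrtr_gt0//; apply: le_trans h.
  rewrite -(@ler_pXn2r _ 2) ?nnegrE ?mulr_ge0 ?cmod_ge0 ?sqrtr_ge0 ?nm_ge0//.
  rewrite exprMn (sqr_sqrtr (ltW (wp i))) nm2 cmod2.
  exact: (nq_pt i lD).
have [F hF] := choice pt.
have key e : 0 < e -> exists N, forall n, (N <= n)%N -> l2 (fun i => Fn n i - F i) /\ nm (fun i => Fn n i - F i) <= e.
  move=> e0; have [N HN] := H e e0; exists N => n Nn.
  apply: (@l2_fatou (fun m i => Fn n i - Fn (m + N)%N i) _ _ (fun=> 0)); rewrite ?(ltW e0)//.
  - by move=> m; exact: l2B.
  - by move=> m; rewrite addr0; apply: HN => //; rewrite leq_addl.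
  - exact: cv0_0.
  move=> i _; apply: cv0_le (cv0_shift N (hF i)) => m.
  by rewrite (_ : _ - (_ - _) = - (Fn (m + N)%N i - F i)) ?cmodN//; ring.
exists F; split; last by move=> e /key[N HN]; exists N => n /HN[].
have [N /(_ N (leqnn N))[lD _]] := key 1 ltr01.
rewrite (_ : F = fun i => Fn N i - (Fn N i - F i)); first exact: l2B.
by apply/funext => i; rewrite opprB addrC subrK.
Qed.

End L2.

(** * The Lax-Milgram theorem *)

Section LaxMilgram.
Variables (R : realType) (T : Type).
Local Notation V := (T -> R[i]).
Variables (W : set V) (g : V -> V -> R).
Hypothesis W0 : W (fun=> 0).
Hypothesis WD : forall u v, W u -> W v -> W (fun x => u x + v x).
Hypothesis WZ : forall (a : R) u, W u -> W (fun x => (a%:C)%C * u x).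
Hypothesis gC : forall u v, g u v = g v u.
Hypothesis gD : forall u v z, W u -> W v -> W z ->
  g (fun x => u x + v x) z = g u z + g v z.
Hypothesis gZ : forall (a : R) u z, W u -> W z -> g (fun x => (a%:C)%C * u x) z = a * g u z.
Hypothesis g_ge0 : forall u, W u -> 0 <= g u u.
Hypothesis g_complete : forall un : nat -> V, (forall n, W (un n)) ->
  (forall e, 0 < e -> exists N, forall n m, (N <= n)%N -> (N <= m)%N ->
     g (fun x => un n x - un m x) (fun x => un n x - un m x) <= e) ->
  exists u, W u /\ cv0 (fun n => g (fun x => un n x - u x) (fun x => un n x - u x)).

Let WB u v : W u -> W v -> W (fun x => u x - v x).
Proof.
move=> Wu Wv; rewrite (_ : (fun x => _) = (fun x => u x + ((-1)%:C)%C * v x)).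
  by apply: WD => //; exact: WZ.
by apply/funext => x; case: (u x) (v x) => a b [c d] /=; congr (_ +i* _)%C; ring.
Qed.

Let subE (u v : V) : (fun x => u x - v x) = (fun x => u x + ((-1)%:C)%C * v x).
Proof. by apply/funext => x; case: (u x) (v x) => a b [c d] /=; congr (_ +i* _)%C; ring. Qed.

Let gB u v z : W u -> W v -> W z -> g (fun x => u x - v x) z = g u z - g v z.
Proof. by move=> Wu Wv Wz; rewrite subE gD ?gZ ?mulN1r//; exact: WZ. Qed.

Let gDr u v z : W u -> W v -> W z -> g z (fun x => u x + v x) = g z u + g z v.
Proof. by move=> *; rewrite gC gD// !(gC z). Qed.

Let gZr a u z : W u -> W z -> g z (fun x => (a%:C)%C * u x) = a * g z u.
Proof. by move=> *; rewrite gC gZ// (gC z). Qed.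

Let gexp t u v : W u -> W v ->
  g (fun x => u x + (t%:C)%C * v x) (fun x => u x + (t%:C)%C * v x) =
  g u u + 2 * t * g u v + t ^+ 2 * g v v.
Proof.
move=> Wu Wv; have Wtv := WZ t Wv; have Ws := WD Wu Wtv.
rewrite gD// !gDr// !gZ// !gZr// (gC v u); ring.
Qed.

Let quad_disc (a b c : R) : 0 <= c -> (forall t, 0 <= a + 2 * t * b + t ^+ 2 * c) -> b ^+ 2 <= a * c.
Proof.
move=> c0 H; move: c0; rewrite le_eqVlt => /predU1P[E|c0].
  have [->|b0] := eqVneq b 0; first by rewrite expr0n -E mulr0.
  have := H (- (a + 1) / (2 * b)); rewrite -E !mulr0 addr0.
  rewrite (_ : a + _ = -1); last by field.
  by rewrite oppr_ge0 ler10.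
have := H (- b / c); rewrite (_ : _ + _ = (a * c - b ^+ 2) / c); last by field; rewrite gt_eqF.
by rewrite pmulr_lge0 ?invr_gt0// subr_ge0.
Qed.

Let gCS u v : W u -> W v -> g u v ^+ 2 <= g u u * g v v.
Proof.
move=> Wu Wv; apply: quad_disc => [|t]; first exact: g_ge0.
by rewrite -gexp//; apply: g_ge0; apply: WD => //; exact: WZ.
Qed.

(** The minimum of J v = g v v - 2 ell v. An almost minimal element almost satisfies the equation
    ([vari]), and testing this with the difference of two of them shows that a minimising sequence
    is Cauchy. *)
Lemma riesz (ell : V -> R) (M : R) :
  (forall u v, W u -> W v -> ell (fun x => u x + v x) = ell u + ell v) ->
  (forall (a : R) u, W u -> ell (fun x => (a%:C)%C * u x) = a * ell u) ->
  (forall u, W u -> ell u ^+ 2 <= M * g u u) ->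
  exists2 u, W u & forall v, W v -> g u v = ell v.
Proof.
move=> ellD ellZ ellM.
pose J v := g v v - 2 * ell v.
have J_ge v : W v -> - (`|M|) <= J v.
  move=> Wv; have g0 := g_ge0 Wv; rewrite /J.
  have h : ell v ^+ 2 <= `|M| * g v v.
    by apply: le_trans (ellM _ Wv) _; rewrite ler_wpM2r// ler_norm.
  have := normr_ge0 M; set m := `|M| in h *; move=> m0.
  have [|/ltW ev] := lerP (ell v) 0; first by nra.
  rewrite -subr_ge0 opprK; have [s0|] := lerP (2 * ell v) (g v v); first by lra.
  by move=> gl; have := sqr_ge0 (m - g v v); nra.
pose E := [set J v | v in W].
have hE : has_inf E.
  by split; [exists (J (fun=> 0)); exists (fun=> 0)|exists (- `|M|) => _ [v Wv <-]; exact: J_ge].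
set m := inf E.
have Jm v : W v -> m <= J v by move=> Wv; apply: ge_inf; [exact: hE.2|exists v].
have Jexp t u v : W u -> W v ->
    J (fun x => u x + (t%:C)%C * v x) = J u + 2 * t * (g u v - ell v) + t ^+ 2 * g v v.
  move=> Wu Wv; have Wtv := WZ t Wv; rewrite /J gexp// ellD// ellZ//; ring.
have /choice[un hun] (n : nat) : exists u, W u /\ J u <= m + n.+1%:R^-1.
  have [|_ [u Wu <-] /ltW Ju] := @inf_adherent _ E (n.+1%:R^-1) _ hE; last by exists u.
  by rewrite invr_gt0.
have Wun n := (hun n).1.
(* J (un n + t v) - inf J is a quadratic in t that is nonnegative for all t and at most 1/(n+1) at t
   = 0: its discriminant is bounded. *)
have vari n v : W v -> (g (un n) v - ell v) ^+ 2 <= n.+1%:R^-1 * g v v.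
  move=> Wv; apply: quad_disc => [|t]; first exact: g_ge0.
  have : m <= J (fun x => un n x + (t%:C)%C * v x) by apply: Jm; apply: WD => //; exact: WZ.
  rewrite Jexp//; have := (hun n).2; set s := _^-1; lra.
have cv_inv : cv0 (fun n => (n.+1%:R^-1 : R)).
  move=> e e0; have [k hk] : exists k : nat, e^-1 < k%:R.
    by exists (Num.bound e^-1); apply: le_lt_trans (archi_boundP _) => //; rewrite ?invr_ge0 ?ltW.
  exists k => n kn; rewrite -[e]invrK lef_pV2 ?posrE ?invr_gt0//.
  by apply: le_trans (ltW hk) _; rewrite ler_nat (leq_trans kn).
have cau n p : g (fun x => un n x - un p x) (fun x => un n x - un p x)
    <= 2 * (n.+1%:R^-1 + p.+1%:R^-1).
  set d := fun x => un n x - un p x.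
  have Wd : W d by exact: WB.
  have E1 : g d d = (g (un n) d - ell d) - (g (un p) d - ell d) by rewrite {1}/d gB//; ring.
  have h1 := vari n d Wd; have h2 := vari p d Wd.
  set a := g (un n) d - ell d in E1 h1; set b := g (un p) d - ell d in E1 h2.
  have i1 : 0 < n.+1%:R^-1 :> R by rewrite invr_gt0.
  have i2 : 0 < p.+1%:R^-1 :> R by rewrite invr_gt0.
  set s := n.+1%:R^-1 in h1 i1 *; set t := p.+1%:R^-1 in h2 i2 *.
  have [->|] := eqVneq (g d d) 0; first by lra.
  move=> gn0; have gd0 : 0 < g d d by rewrite lt_def gn0 g_ge0.
  rewrite -(ler_pM2r gd0) -expr2 {1}E1.
  by have := sqr_ge0 (a + b); nra.
have [u [Wu hu]] : exists u, W u /\ cv0 (fun n => g (fun x => un n x - u x) (fun x => un n x - u x)).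
  apply: g_complete => // e e0; have [N HN] := cv_inv (e / 4) ltac:(by rewrite divr_gt0).
  exists N => n p /HN h1 /HN h2; apply: le_trans (cau n p) _; move: h1 h2.
  set x := n.+1%:R^-1; set y := p.+1%:R^-1; lra.
exists u => // v Wv; apply/eqP; rewrite -subr_eq0 -sqrf_eq0; apply/eqP/le_anti.
rewrite sqr_ge0 andbT -[leRHS]addr0.
apply: (@cv0_ge _ _ _ (fun n => 2 * g v v * n.+1%:R^-1 + 2 * g v v * g (fun x => un n x - u x) (fun x => un n x - u x))); last first.
  by apply: cv0D; apply: cv0Z => //; rewrite mulr_ge0 ?g_ge0.
move=> n; set d := fun x => un n x - u x; have Wd : W d by exact: WB.
have E1 : g u v - ell v = (g (un n) v - ell v) - g d v by rewrite /d gB//; ring.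
have h1 := vari n v Wv; have h2 := gCS Wd Wv.
rewrite E1 addr0 add0r; set a := g (un n) v - ell v in h1 *; set b := g d v in h2 *.
move: h1; set x := n.+1%:R^-1; have := sqr_ge0 (a + b); nra.
Qed.

Variables (B : V -> V -> R) (ell : V -> R) (M delta Ml : R).
Hypothesis BDl : forall u v z, W u -> W v -> W z ->
  B (fun x => u x + v x) z = B u z + B v z.
Hypothesis BZl : forall (a : R) u z, W u -> W z -> B (fun x => (a%:C)%C * u x) z = a * B u z.
Hypothesis BDr : forall u v z, W u -> W v -> W z ->
  B z (fun x => u x + v x) = B z u + B z v.
Hypothesis BZr : forall (a : R) u z, W u -> W z -> B z (fun x => (a%:C)%C * u x) = a * B z u.
Hypothesis B_bounded : forall u v, W u -> W v -> B u v ^+ 2 <= M ^+ 2 * (g u u * g v v).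
Hypothesis B_coercive : forall u, W u -> delta * g u u <= B u u.
Hypothesis delta0 : 0 < delta.
Hypothesis deltaM : delta <= M.
Hypothesis ellD : forall u v, W u -> W v -> ell (fun x => u x + v x) = ell u + ell v.
Hypothesis ellZ : forall (a : R) u, W u -> ell (fun x => (a%:C)%C * u x) = a * ell u.
Hypothesis ell_bounded : forall u, W u -> ell u ^+ 2 <= Ml * g u u.

(* Richardson iteration u + rho r(u), where r(u) represents the residual
   ell - B u for the inner product g. *)
Lemma lax_milgram : exists2 u, W u & forall v, W v -> B u v = ell v.
Proof.
have M0 : 0 < M by exact: lt_le_trans deltaM.
have exr u : exists r, W u -> W r /\ forall v, W v -> g r v = ell v - B u v.
  have [Wu|nWu] := pselect (W u); last by exists u.
  have [| | |r Wr hr] := @riesz (fun v => ell v - B u v) (2 * `|Ml| + 2 * M ^+ 2 * g u u).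
  - by move=> a b Wa Wb; rewrite ellD// BDr//; ring.
  - by move=> a b Wb; rewrite ellZ// BZr//; ring.
  - move=> v Wv; have h1 := ell_bounded Wv; have h2 := B_bounded Wu Wv.
    have h3 : Ml * g v v <= `|Ml| * g v v by rewrite ler_wpM2r ?g_ge0// ler_norm.
    have := sqr_ge0 (ell v + B u v).
    rewrite mulrDl -!mulrA; lra.
  by exists r.
have [r hr] := choice exr.
(* The minimiser of 1 - 2 rho delta + rho^2 M^2, the contraction factor of the squared residuals;
   its minimum is [Q] below. *)
pose rho := delta / M ^+ 2.
have rho0 : 0 < rho by rewrite divr_gt0// exprn_gt0.
pose un := fix un n := if n is n'.+1 then (fun x => un n' x + (rho%:C)%C * r (un n') x) else (fun=> 0).
have unS n : un n.+1 = (fun x => un n x + (rho%:C)%C * r (un n) x) by [].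
have Wun n : W (un n).
  elim: n => [|n IH] //; rewrite unS; apply: WD => //; apply: WZ.
  exact: (hr _ IH).1.
have Wr n : W (r (un n)) by exact: (hr _ (Wun n)).1.
have rE n v : W v -> g (r (un n)) v = ell v - B (un n) v by exact: (hr _ (Wun n)).2.
pose Q := 1 - delta ^+ 2 / M ^+ 2.
have Q0 : 0 <= Q by rewrite subr_ge0 ler_pdivrMr ?exprn_gt0// mul1r lerXn2r// nnegrE ltW.
have Q1 : Q < 1 by rewrite gtrBl divr_gt0// exprn_gt0.
(* The residual changes from p to p - d, where d represents rho B p. In |p - d|^2 coercivity bounds
   the cross term from below and boundedness of B bounds |d|^2. *)
have step n : g (r (un n.+1)) (r (un n.+1)) <= Q * g (r (un n)) (r (un n)).
  set s := r (un n.+1); set p := r (un n).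
  have Ws : W s := Wr n.+1; have Wp : W p := Wr n.
  pose d := fun x => p x - s x; have Wd : W d by exact: WB.
  have dE v : W v -> g d v = rho * B p v.
    by move=> Wv; rewrite gB// !rE// unS BDl// ?BZl//; [ring|exact: WZ].
  have ss : g s s = g p p - 2 * g d p + g d d.
    have e1 : g d d = g p d - g s d := gB Wp Ws Wd.
    have e2 : g d p = g p p - g s p := gB Wp Ws Wp.
    have e3 : g d s = g p s - g s s := gB Wp Ws Ws.
    by rewrite e1 (gC p d) (gC s d) e2 e3 (gC s p); ring.
  have h1 : g d d <= rho ^+ 2 * M ^+ 2 * g p p.
    have := dE d Wd; have := B_bounded Wp Wd; have := g_ge0 Wd; have := g_ge0 Wp.
    set a := g p p; set b := g d d; set c := B p d => a0 b0 h E.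
    have [->|bn0] := eqVneq b 0; first by apply: mulr_ge0 => //; apply: mulr_ge0; exact: sqr_ge0.
    have bp : 0 < b by rewrite lt_def bn0.
    have bb : b * b = rho ^+ 2 * c ^+ 2 by rewrite E; ring.
    have h' := ler_wpM2l (sqr_ge0 rho) h.
    by rewrite -(ler_pM2r bp) bb; apply: le_trans h' _; rewrite !mulrA.
  rewrite ss dE//; have := B_coercive Wp; set a := g p p in h1 *; set b := B p p => h2.
  have E : rho ^+ 2 * M ^+ 2 = rho * delta by rewrite /rho; field; rewrite gt_eqF.
  have E2 : Q = 1 - rho * delta by rewrite /Q /rho; field; rewrite gt_eqF.
  rewrite E2; move: h1; rewrite E => h1.
  have := ler_wpM2l (ltW rho0) h2; nra.
have decay n : g (r (un n)) (r (un n)) <= Q ^+ n * g (r (un 0%N)) (r (un 0%N)).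
  elim: n => [|n IH]; first by rewrite expr0 mul1r.
  apply: le_trans (step n) _; rewrite exprS -mulrA ler_wpM2l//.
set G0 := g (r (un 0%N)) (r (un 0%N)) in decay.
have G00 : 0 <= G0 by exact: g_ge0.
pose q := Num.sqrt Q; have q0 : 0 <= q by exact: sqrtr_ge0.
have q2 : q ^+ 2 = Q by rewrite sqr_sqrtr.
have q1 : q < 1 by rewrite -(@ltr_pXn2r _ 2)// ?nnegrE// q2 expr1n.
pose N u := Num.sqrt (g u u).
have N2 u : W u -> N u ^+ 2 = g u u by move=> Wu; rewrite sqr_sqrtr ?g_ge0.
have N0 u : 0 <= N u by exact: sqrtr_ge0.
have ND u v : W u -> W v -> N (fun x => u x + v x) <= N u + N v.
  move=> Wu Wv; have Wuv := WD Wu Wv.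
  rewrite -(@ler_pXn2r _ 2) ?nnegrE ?addr_ge0// N2// gD// !gDr// (gC v u).
  have : g u v <= N u * N v.
    apply: le_trans (ler_norm _) _.
    rewrite -(@ler_pXn2r _ 2) ?nnegrE ?mulr_ge0// real_normK ?num_real// exprMn !N2//.
    exact: gCS.
  by rewrite sqrrD !N2//; lra.
(* The sum of the increments, which are at most [rho * Num.sqrt G0 * q ^+ n]. *)
pose c := rho * Num.sqrt G0 / (1 - q).
have c0 : 0 <= c by apply: divr_ge0; [apply: mulr_ge0; [exact: ltW|exact: sqrtr_ge0]|rewrite subr_ge0 ltW].
have far n k : N (fun x => un (n + k)%N x - un n x) <= c * q ^+ n * (1 - q ^+ k).
  elim: k => [|k IH].
    rewrite addn0 expr0 subrr mulr0 /N (_ : (fun x => _) = (fun x => (0%:C)%C * un n x)) ?gZ ?mul0r ?sqrtr0//.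
      exact: WZ.
    by apply/funext => x; rewrite subrr mul0r.
  have Wd : W (fun x => un (n + k)%N x - un n x) by exact: WB.
  have -> : (fun x => un (n + k.+1)%N x - un n x) =
      (fun x => (un (n + k)%N x - un n x) + (rho%:C)%C * r (un (n + k)%N) x).
    by apply/funext => x; rewrite addnS unS; ring.
  apply: le_trans (ND _ _ Wd (WZ rho (Wr _))) _.
  have h : N (fun x => (rho%:C)%C * r (un (n + k)%N) x) <= rho * Num.sqrt G0 * q ^+ n * q ^+ k.
    have rhs0 : 0 <= rho * Num.sqrt G0 * q ^+ n * q ^+ k.
      by do 3 (apply: mulr_ge0; last by rewrite ?exprn_ge0 ?sqrtr_ge0); exact: ltW.
    rewrite -(@ler_pXn2r _ 2) ?nnegrE ?N0//.
    rewrite N2; last exact: WZ.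
    rewrite gZ ?gZr//; last exact: WZ.
    have -> : (rho * Num.sqrt G0 * q ^+ n * q ^+ k) ^+ 2 = rho * (rho * (Q ^+ (n + k) * G0)).
      rewrite -{2}(sqr_sqrtr G00) -q2 -exprM mulnC exprM exprD; ring.
    by rewrite !(ler_pM2l rho0); exact: decay.
  apply: le_trans (lerD IH h) _; rewrite exprS.
  have E : rho * Num.sqrt G0 = c * (1 - q) by rewrite /c divfK// gt_eqF// subr_gt0.
  rewrite E le_eqVlt; apply/orP; left; apply/eqP; ring.
have cvq : cv0 (fun n => (c * q ^+ n) ^+ 2).
  apply: cv0_sqr => [n|]; first exact: mulr_ge0 c0 (exprn_ge0 n q0).
  apply: cv0Z => // e e0.
  have /cvgrPdist_le /(_ e e0) [k _ hk] : q ^+ n @[n --> \oo] --> 0.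
    by apply: cvg_expr; rewrite ger0_norm.
  by exists k => n /hk /=; rewrite sub0r normrN ger0_norm// exprn_ge0.
have far2 n k : g (fun x => un (n + k)%N x - un n x) (fun x => un (n + k)%N x - un n x) <= (c * q ^+ n) ^+ 2.
  rewrite -N2; last exact: WB.
  have cq0 : 0 <= c * q ^+ n := mulr_ge0 c0 (exprn_ge0 n q0).
  rewrite (@lerXn2r _ 2) ?nnegrE ?N0//; apply: le_trans (far n k) _.
  by apply: ler_piMr cq0 _; rewrite gerBl exprn_ge0.
have gneg u v : W u -> W v -> g (fun x => u x - v x) (fun x => u x - v x) = g (fun x => v x - u x) (fun x => v x - u x).
  move=> Wu Wv; have Wd := WB Wu Wv; have Wd' := WB Wv Wu.
  rewrite [in RHS](_ : (fun x => v x - u x) = fun x => ((-1)%:C)%C * (u x - v x)).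
    by rewrite gZ// ?gZr// ?mulN1r ?opprK//; exact: WZ.
  by apply/funext => x; case: (u x) (v x) => a b [a' b'] /=; congr (_ +i* _)%C; ring.
have [u [Wu hu]] : exists u, W u /\ cv0 (fun n => g (fun x => un n x - u x) (fun x => un n x - u x)).
  apply: g_complete => // e e0; have [K hK] := cvq e e0.
  have main n m : (K <= n)%N -> (n <= m)%N ->
      g (fun x => un m x - un n x) (fun x => un m x - un n x) <= e.
    by move=> Kn nm; rewrite -(subnKC nm); apply: le_trans (far2 _ _) (hK _ Kn).
  exists K => n m Kn Km; have [nm|mn] := leqP n m; last exact/main/ltnW.
  by rewrite gneg//; exact: main.
exists u => // v Wv; apply/esym/eqP; rewrite -subr_eq0 -sqrf_eq0; apply/eqP/le_anti.
rewrite sqr_ge0 andbT.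
apply: (@cv0_ge _ _ _ (fun n => 2 * (G0 * g v v) * Q ^+ n + 2 * (M ^+ 2 * g v v) * g (fun x => un n x - u x) (fun x => un n x - u x))); last first.
  have gv0 := g_ge0 Wv.
  apply: cv0D; apply: cv0Z => //; try by apply: mulr_ge0 => //; apply: mulr_ge0 => //; exact: sqr_ge0.
  move=> e e0.
  have /cvgrPdist_le /(_ e e0) [k _ hk] : Q ^+ n @[n --> \oo] --> 0.
    by apply: cvg_expr; rewrite ger0_norm.
  by exists k => n /hk /=; rewrite sub0r normrN ger0_norm// exprn_ge0.
move=> n; set d := fun x => un n x - u x; have Wd : W d by exact: WB.
have Bd : B d v = B (un n) v - B u v by rewrite /d subE BDl ?BZl ?mulN1r//; exact: WZ.
have E1 : ell v - B u v = g (r (un n)) v + B d v by rewrite rE// Bd; ring.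
have h1 := gCS (Wr n) Wv; have h2 := B_bounded Wd Wv; have h3 := decay n.
have gv := g_ge0 Wv.
have h4 := ler_wpM2r gv h3.
rewrite E1 add0r; set a := g (r (un n)) v in h1 *; set b := B d v in h2 *.
have := sqr_ge0 (a - b); nra.
Qed.

End LaxMilgram.

(** * Holomorphic semigroups from contractive resolvents *)

Section Semigroup.
Variables (R : realType) (X : Type).
Local Notation V := (X -> R[i]).
Local Notation "u [+] v" := (fun x => u x + v x) (at level 50, left associativity).
Local Notation "u [-] v" := (fun x => u x - v x) (at level 50, left associativity).
Local Notation "a [*] u" := (fun x => a * u x) (at level 40).
Variables (H : set V) (nm : V -> R).
Hypothesis H0 : H (fun=> 0).
Hypothesis HD : forall u v, H u -> H v -> H (u [+] v).
Hypothesis HZ : forall (a : R[i]) u, H u -> H (a [*] u).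
Hypothesis nm_ge0 : forall u, 0 <= nm u.
Hypothesis nmZ : forall (a : R[i]) u, H u -> nm (a [*] u) = cmod a * nm u.
Hypothesis nmD : forall u v, H u -> H v -> nm (u [+] v) <= nm u + nm v.
Hypothesis nm_eq0 : forall u, H u -> nm u = 0 -> u = fun=> 0.
Hypothesis complete : forall un : nat -> V, (forall n, H (un n)) ->
  (forall e, 0 < e -> exists N, forall n m, (N <= n)%N -> (N <= m)%N ->
     nm (un n [-] un m) <= e) ->
  exists u, H u /\ cv0 (fun n => nm (un n [-] u)).
Variables (G : V -> V -> Prop) (tau Cs : R).
Hypothesis tau0 : 0 < tau.
(** The open sector of half-angle arctan tau. In what follows [G u g] is the graph of an operator L,
    that is L u = g; [Gdense] is density of the domain of L^2, and [Gsmooth] bounds L (1 + tL)^-n by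
    Cs / (n t). *)
Definition cone : set R[i] :=
  [set z | 0 < complex.Re z /\ `|complex.Im z| < tau * complex.Re z].
Hypothesis GH : forall u g, G u g -> H u /\ H g.
Hypothesis Glin : forall (a : R[i]) u g v h, G u g -> G v h -> G (a [*] u [+] v) (a [*] g [+] h).
Hypothesis Gfun : forall u g g', G u g -> G u g' -> g = g'.
Hypothesis Gres : forall z f, cone z -> H f -> exists u g, G u g /\ f = u [+] z [*] g.
Hypothesis Gcontr : forall z u g, cone z -> G u g -> nm u <= nm (u [+] z [*] g).
Hypothesis Gdense : forall u e, H u -> 0 < e ->
  exists v g h, [/\ G v g, G g h & nm (u [-] v) <= e].
Hypothesis Gsmooth : forall (t : R) n (u g : nat -> V), 0 < t -> (2 <= n)%N -> H (u 0%N) ->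
  (forall j, (j < n)%N -> G (u j.+1) (g j.+1) /\ u j = u j.+1 [+] (t%:C)%C [*] g j.+1) ->
  nm (g n) <= Cs / (n%:R * t) * nm (u 0%N).

Let HN u : H u -> H (fun x => - u x).
Proof. by move/(HZ (-1)); congr H; apply/funext => x; rewrite mulN1r. Qed.
Let HB u v : H u -> H v -> H (u [-] v).
Proof. by move=> Hu /HN; exact: HD. Qed.
Let nmN u : H u -> nm (fun x => - u x) = nm u.
Proof.
move=> Hu; rewrite (_ : (fun x => _) = (-1) [*] u); last by apply/funext => x; rewrite mulN1r.
by rewrite nmZ// cmodN cmod1 mul1r.
Qed.
Let nmB u v : H u -> H v -> nm (u [-] v) <= nm u + nm v.
Proof. by move=> Hu Hv; rewrite -(nmN Hv); apply: nmD => //; exact: HN. Qed.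
Let nmC u v : H u -> H v -> nm (u [-] v) = nm (v [-] u).
Proof.
move=> Hu Hv; rewrite -nmN; last exact: HB.
by congr nm; apply/funext => x; rewrite opprB.
Qed.
Let nm0 : nm (fun=> 0) = 0.
Proof.
rewrite (_ : (fun=> 0) = (0 : R[i]) [*] (fun=> (0 : R[i]))); last by apply/funext => x; rewrite mul0r.
by rewrite nmZ// cmod0 mul0r.
Qed.
Let nm_tri u v w : H u -> H v -> H w -> nm (u [-] w) <= nm (u [-] v) + nm (v [-] w).
Proof.
move=> Hu Hv Hw; apply: le_trans (nmD (HB Hu Hv) (HB Hv Hw)).
by rewrite (_ : (fun x => u x - v x + (v x - w x)) = u [-] w)//; apply/funext => x; ring.
Qed.
Let nm_sub_eq u v : H u -> H v -> nm (u [-] v) = 0 -> u = v.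
Proof.
move=> Hu Hv /(nm_eq0 (HB Hu Hv)) /funeqP E; apply/funext => x.
by have /eqP := E x; rewrite subr_eq0 => /eqP.
Qed.
Let nm_le_dist u v : H u -> H v -> nm u <= nm v + nm (u [-] v).
Proof.
move=> Hu Hv; apply: le_trans (nmD Hv (HB Hu Hv)).
by rewrite (_ : (fun x => v x + (u x - v x)) = u)//; apply/funext => x; ring.
Qed.

Let cone_neq0 z : cone z -> z != 0.
Proof. by case=> z0 _; apply: contraTneq z0 => ->; rewrite /= ltxx. Qed.
Let coneD z w : cone z -> cone w -> cone (z + w).
Proof.
case: z w => a b [c d] [/= a0 b0] [/= c0 d0]; split => /=; first exact: addr_gt0.
by rewrite mulrDr (le_lt_trans (ler_normD _ _))// ltrD.
Qed.
Let coneR (t : R) : 0 < t -> cone (t%:C)%C.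
Proof. by move=> t0; split => //=; rewrite normr0 mulr_gt0. Qed.
Let coneZ (t : R) z : 0 < t -> cone z -> cone ((t%:C)%C * z).
Proof.
case: z => a b t0 [/= a0 b0]; split => /=; first by rewrite mul0r subr0 mulr_gt0.
rewrite mul0r addr0.
by rewrite mul0r subr0 normrM gtr0_norm// mulrCA ltr_pM2l.
Qed.
Let pow2C k : ((2 ^+ k)^-1 : R)%:C%C = ((2 ^+ k)^-1 : R[i]).
Proof. by rewrite fmorphV rmorphXn rmorph_nat. Qed.
Let cone_pow2 z k : cone z -> cone (z / 2 ^+ k).
Proof. by move=> cz; rewrite mulrC -pow2C; apply: coneZ => //; rewrite invr_gt0 exprn_gt0. Qed.
Let cmod_pow2 (z : R[i]) k : cmod (z / 2 ^+ k) = cmod z / 2 ^+ k.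
Proof. by rewrite cmodM -pow2C cmodR ger0_norm// invr_ge0 exprn_ge0. Qed.
Let cone1 : cone 1. Proof. exact: (@coneR 1). Qed.

Let GB u g v h : G u g -> G v h -> G (u [-] v) (g [-] h).
Proof.
move=> Gu Gv; have := Glin (-1) Gv Gu.
by congr G; apply/funext => x; ring.
Qed.
Let G_uniq z u g u' g' : cone z -> G u g -> G u' g' ->
  u [+] z [*] g = u' [+] z [*] g' -> u = u' /\ g = g'.
Proof.
move=> cz Gu Gu' E; have GG := GB Gu Gu'.
have [Hu Hg] := GH Gu; have [Hu' Hg'] := GH Gu'.
have uu' : u = u'.
  apply: nm_sub_eq => //; apply/eqP; rewrite eq_le nm_ge0 andbT.
  apply: le_trans (Gcontr cz GG) _; rewrite (_ : (fun x => _) = fun=> 0) ?nm0//.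
  by apply/funext => x; have /funeqP/(_ x) := E => e; transitivity ((u x + z * g x) - (u' x + z * g' x)); [ring|rewrite e subrr].
split=> //; apply/funext => x; have /funeqP/(_ x) := E; rewrite uu' => /addrI/mulfI; apply.
exact: cone_neq0.
Qed.

Let resE : exists P : R[i] * V -> V * V, forall z f, cone z -> H f ->
  G (P (z, f)).1 (P (z, f)).2 /\ f = (P (z, f)).1 [+] z [*] (P (z, f)).2.
Proof.
have ch (zf : R[i] * V) : exists p : V * V, cone zf.1 -> H zf.2 ->
  G p.1 p.2 /\ zf.2 = p.1 [+] zf.1 [*] p.2; last first.
  by have [P hP] := choice ch; exists P => z f; exact: (hP (z, f)).
move: zf => [z f]; have [cz|ncz] := pselect (cone z); last by exists (f, f).
have [Hf|nHf] := pselect (H f); last by exists (f, f).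
by have [u [g h]] := Gres cz Hf; exists (u, g).
Qed.

Definition resP := projT1 (cid resE).
(** (1 + zL)^-1 f, while [Lres z f] is L (1 + zL)^-1 f. Having both at hand avoids treating L as a
    function. *)
Definition res z f := (resP (z, f)).1.
Definition Lres z f := (resP (z, f)).2.

Lemma resG z f : cone z -> H f -> G (res z f) (Lres z f).
Proof. by rewrite /res /Lres /resP; case: cid => P hP /= cz Hf; exact: (hP z f cz Hf).1. Qed.

Lemma res_eq z f : cone z -> H f -> f = res z f [+] z [*] Lres z f.
Proof. by rewrite /res /Lres /resP; case: cid => P hP /= cz Hf; exact: (hP z f cz Hf).2. Qed.

Let resH z f : cone z -> H f -> H (res z f).
Proof. by move=> cz Hf; exact: (GH (resG cz Hf)).1. Qed.

Let res_uniq z f u g : cone z -> H f -> G u g -> f = u [+] z [*] g -> res z f = u /\ Lres z f = g.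
Proof.
move=> cz Hf Gu E; apply: (G_uniq cz (resG cz Hf) Gu).
by rewrite -res_eq.
Qed.

Let res_contr z f : cone z -> H f -> nm (res z f) <= nm f.
Proof. by move=> cz Hf; rewrite {2}(res_eq cz Hf); apply: Gcontr => //; exact: resG. Qed.

Let res_lin z a u v : cone z -> H u -> H v ->
  res z (a [*] u [+] v) = a [*] res z u [+] res z v /\
  Lres z (a [*] u [+] v) = a [*] Lres z u [+] Lres z v.
Proof.
move=> cz Hu Hv; apply: res_uniq => //; first by apply: HD => //; exact: HZ.
  by apply: Glin; exact: resG.
rewrite {1}(res_eq cz Hu) {1}(res_eq cz Hv); apply/funext => x; ring.
Qed.

Let res_L z u g : cone z -> G u g -> G (res z u) (res z g).
Proof.
move=> cz Gu; have [Hu Hg] := GH Gu.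
suff -> : res z g = Lres z u by exact: resG.
have [E _] := res_uniq (f := u [+] z [*] g) cz (HD Hu (HZ z Hg)) Gu erefl.
have [E2 _] := @res_lin z z g u cz Hg Hu.
have {}E2 : u = z [*] res z g [+] res z u.
  by rewrite -{1}E -E2; congr res; apply/funext => x; rewrite addrC.
have E3 := res_eq cz Hu.
apply/funext => x; have /funeqP/(_ x) := E2; have /funeqP/(_ x) := E3 => /= -> e.
have := e; rewrite addrC => /addIr/mulfI ->//; exact: cone_neq0.
Qed.

Let res_comm z w f : cone z -> cone w -> H f -> res z (res w f) = res w (res z f).
Proof.
move=> cz cw Hf; have Hz := resH cz Hf; have Hw := resH cw Hf.
have Gz := resG cz Hf; have [_ HLz] := GH Gz.
apply: (res_uniq (g := res w (Lres z f)) cz Hw _ _).1; first exact: res_L.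
have [E _] := @res_lin w z (Lres z f) (res z f) cw HLz Hz.
rewrite (_ : (fun x => res w (res z f) x + z * res w (Lres z f) x) = z [*] res w (Lres z f) [+] res w (res z f)); last first.
  by apply/funext => x; rewrite addrC.
rewrite -E; congr res; rewrite {1}(res_eq cz Hf).
by apply/funext => x; rewrite addrC.
Qed.

Definition contr (A : V -> V) := (forall u, H u -> H (A u) /\ nm (A u) <= nm u) /\
  (forall a u v, H u -> H v -> A (a [*] u [+] v) = a [*] A u [+] A v).
Definition commut (A B : V -> V) := forall u, H u -> A (B u) = B (A u).

Let res_ctr z : cone z -> contr (res z).
Proof.
move=> cz; split=> [u Hu|a u v Hu Hv]; first by split; [exact: resH|exact: res_contr].
by have [] := res_lin a cz Hu Hv.
Qed.

Let ctrD A u v : contr A -> H u -> H v -> A (u [+] v) = A u [+] A v.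
Proof.
move=> [_ hA] Hu Hv; have := hA 1 u v Hu Hv.
rewrite (_ : (fun x => 1 * u x + v x) = u [+] v); last by apply/funext => x; rewrite mul1r.
by move->; apply/funext => x; rewrite mul1r.
Qed.
Let ctrB A u v : contr A -> H u -> H v -> A (u [-] v) = A u [-] A v.
Proof.
move=> [_ hA] Hu Hv; have := hA (-1) v u Hv Hu.
rewrite (_ : (fun x => -1 * v x + u x) = u [-] v); last by apply/funext => x; ring.
by move->; apply/funext => x; ring.
Qed.
Let ctrZ A (a : R[i]) u : contr A -> H u -> A (a [*] u) = a [*] A u.
Proof.
move=> cA Hu; have E := ctrB cA Hu Hu; have [_ hA] := cA.
have := hA a u (fun=> 0) Hu H0.
have A0 : A (fun=> 0) = fun=> 0.
  rewrite (_ : (fun=> 0) = u [-] u) ?E; last by apply/funext => x; rewrite subrr.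
  by apply/funext => x; rewrite !subrr.
rewrite A0 (_ : (fun x => a * u x + 0) = a [*] u); last by apply/funext => x; rewrite addr0.
by move->; apply/funext => x; rewrite addr0.
Qed.
Let ctr_iter A n : contr A -> contr (iter n A).
Proof.
move=> cA; elim: n => [|n [IH1 IH2]]; first by split.
split=> [u Hu|a u v Hu Hv].
  have [h1 h2] := IH1 u Hu; have [h3 h4] := cA.1 _ h1.
  by split => //; exact: le_trans h2.
rewrite !iterS IH2// cA.2//; [exact: (IH1 _ Hu).1|exact: (IH1 _ Hv).1].
Qed.
Let ctr_comp A B : contr A -> contr B -> contr (fun u => A (B u)).
Proof.
move=> cA cB; split=> [u Hu|a u v Hu Hv].
  have [h1 h2] := cB.1 _ Hu; have [h3 h4] := cA.1 _ h1.
  by split => //; exact: le_trans h2.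
rewrite cB.2// cA.2//; [exact: (cB.1 _ Hu).1|exact: (cB.1 _ Hv).1].
Qed.
Let comm_iter A B n : contr A -> contr B -> commut A B -> commut (iter n A) B.
Proof.
move=> cA cB AB; elim: n => [|n IH] u Hu //.
by rewrite !iterS IH// AB//; exact: ((ctr_iter n cA).1 _ Hu).1.
Qed.

(** Telescoping of A^n - B^n for commuting contractions: a one-step error of second order becomes a
    first-order error after n steps. Convergence, the semigroup law and the comparison with the
    identity all rest on it. *)
Let chernoff A B n u : contr A -> contr B -> commut A B -> H u ->
  nm (iter n A u [-] iter n B u) <= n%:R * nm (A u [-] B u).
Proof.
move=> cA cB AB Hu; have HA := (cA.1 _ Hu).1; have HBu := (cB.1 _ Hu).1.
elim: n => [|n IH].
  by rewrite mul0r (_ : (fun x => _) = fun=> 0) ?nm0//; apply/funext => x; rewrite subrr.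
have cAn := ctr_iter n cA; have cBn := ctr_iter n cB.
have HAn := (cAn.1 _ Hu).1; have HBn := (cBn.1 _ Hu).1.
have -> : (fun x => iter n.+1 A u x - iter n.+1 B u x) =
    iter n A (A u [-] B u) [+] B (iter n A u [-] iter n B u).
  rewrite (ctrB cAn)// (ctrB cB)// -(comm_iter n cA cB AB)// -iterSr -iterS.
  by apply/funext => x; ring.
have h1 := cAn.1 _ (HB HA HBu); have h2 := cB.1 _ (HB HAn HBn).
apply: le_trans (nmD h1.1 h2.1) _.
rewrite -natr1 mulrDl mul1r addrC lerD// ?h1.2//.
exact: le_trans h2.2 IH.
Qed.

Let res_pow1 z n v g : cone z -> G v g ->
  nm (v [-] iter n (res z) v) <= n%:R * (cmod z * nm g).
Proof.
move=> cz Gv; have [Hv Hg] := GH Gv; have cR := res_ctr cz.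
have := @chernoff id (res z) n v; rewrite iter_fix//.
have cid' : contr id by split.
move=> /(_ cid' cR) /(_ _ Hv) h; apply: le_trans (h _) _; first by [].
rewrite ler_wpM2l//.
have E : v [-] res z v = z [*] res z g.
  rewrite {1}(res_eq cz Hv); apply/funext => x.
  by rewrite addrC addKr (Gfun (resG cz Hv) (res_L cz Gv)).
by rewrite E nmZ ?ler_wpM2l ?cmod_ge0 ?res_contr//; exact: resH.
Qed.


(** On the domain of L^2 the resolvent is exactly 1 - zL + z^2 (1 + zL)^-1 L^2, and the last factor
    of the remainder is a contraction applied to L^2 v. *)
Let res_taylor z v g h : cone z -> G v g -> G g h ->
  nm (res z v [-] v [+] z [*] g) <= cmod z ^+ 2 * nm h.
Proof.
move=> cz Gv Gg; have [Hv Hg] := GH Gv; have [_ Hh] := GH Gg.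
rewrite (_ : (fun x => _) = z ^+ 2 [*] res z h).
  by rewrite nmZ ?cmodM ?expr2; [rewrite ler_wpM2l ?mulr_ge0 ?cmod_ge0 ?res_contr|exact: resH].
have E1 := res_eq cz Hv; have E2 := res_eq cz Hg.
rewrite (Gfun (resG cz Hv) (res_L cz Gv)) in E1.
rewrite (Gfun (resG cz Hg) (res_L cz Gg)) in E2.
apply/funext => x; have /funeqP/(_ x) /= -> := E1.
have /funeqP/(_ x) /= -> := E2.
ring.
Qed.

Let res_pow2 z n v g h : cone z -> G v g -> G g h ->
  nm (iter n (res z) v [-] v [+] (n%:R * z) [*] g) <= n%:R ^+ 2 * (cmod z ^+ 2 * nm h).
Proof.
move=> cz Gv Gg; have [Hv Hg] := GH Gv; have [_ Hh] := GH Gg.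
have cR := res_ctr cz; set M := cmod z ^+ 2 * nm h.
have M0 : 0 <= M by rewrite mulr_ge0// exprn_ge0// cmod_ge0.
elim: n => [|n IH].
  rewrite (_ : (fun x => _) = fun=> 0) ?nm0; first by rewrite mulr_ge0// sqr_ge0.
  by apply/funext => x /=; rewrite subrr !mul0r add0r.
have Hn := ((ctr_iter n cR).1 _ Hv).1.
set e := (X in nm X <= _) in IH.
have He : H e by apply: HD; [exact: HB|exact: HZ].
have He1 : H (res z v [-] v [+] z [*] g).
  by apply: HD; [apply: HB => //; exact: resH|exact: HZ].
have Hg1 : H (g [-] res z g) by apply: HB => //; exact: resH.
have -> : iter n.+1 (res z) v [-] v [+] (n.+1%:R * z) [*] g =
    res z e [+] (res z v [-] v [+] z [*] g) [+] (n%:R * z) [*] (g [-] res z g).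
  have -> : res z e = iter n.+1 (res z) v [-] res z v [+] (n%:R * z) [*] res z g.
    rewrite /e (ctrD cR) ?(ctrB cR) ?(ctrZ (n%:R * z) cR)//; [exact: HB|exact: HZ].
  by apply/funext => x; rewrite -natr1; ring.
have HRe : H (res z e) by exact: resH.
apply: le_trans (nmD (HD HRe He1) (HZ _ Hg1)) _.
apply: le_trans (lerD (nmD HRe He1) (lexx _)) _.
have h1 : nm (res z e) <= n%:R ^+ 2 * M by exact: le_trans (res_contr cz He) IH.
have h2 := res_taylor cz Gv Gg.
have h3 : nm ((n%:R * z) [*] (g [-] res z g)) <= n%:R * M.
  rewrite nmZ// cmodM -(rmorph_nat (real_complex R)) cmodR ger0_norm// -mulrA ler_wpM2l//.
  have := @res_pow1 z 1 g h cz Gg; rewrite mul1r /= => h3.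
  by rewrite /M expr2 -mulrA ler_wpM2l ?cmod_ge0.
rewrite -/M in h2; have n0 : 0 <= n%:R :> R by [].
rewrite -natr1; move: h1 h2 h3 n0 M0; set N := n%:R.
move=> h1 h2 h3 n0 M0; have := mulr_ge0 n0 M0; nra.
Qed.

(** Only powers of two are used as numbers of steps: consecutive products then differ by splitting
    each step into two halves, and the errors are summable in k. *)
Definition euler z k f := iter (2 ^ k) (res (z / 2 ^+ k)) f.

Let euler_ctr z k : cone z -> contr (euler z k).
Proof. by move=> cz; apply: ctr_iter; apply: res_ctr; exact: cone_pow2. Qed.

Let eulerH z k f : cone z -> H f -> H (euler z k f).
Proof. by move=> cz Hf; exact: ((euler_ctr k cz).1 _ Hf).1. Qed.

(** One step of size y and two steps of size y/2 both equal v - y L v up to |y|^2 |L^2 v|; with y =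
    z / 2^k, [chernoff] multiplies the discrepancy by 2^k. *)
Let euler_step z k v g h : cone z -> G v g -> G g h ->
  nm (euler z k v [-] euler z k.+1 v) <= (2 * (cmod z ^+ 2 * nm h)) * 2^-1 ^+ k.
Proof.
move=> cz Gv Gg; have [Hv Hg] := GH Gv; have [_ Hh] := GH Gg.
set w := z / 2 ^+ k.+1; have cw : cone w by exact: cone_pow2.
set y := z / 2 ^+ k; have cy : cone y by exact: cone_pow2.
have yw : y = 2%:R * w by rewrite /y /w exprS; field; rewrite expf_neq0.
have cR := ctr_iter 2 (res_ctr cw).
have E : euler z k.+1 v = iter (2 ^ k) (iter 2 (res w)) v.
  by rewrite /euler -/w expnSr -iterM.
rewrite E /euler -/y; apply: le_trans (chernoff _ (res_ctr cy) cR _ Hv) _.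
  move=> u Hu /=; rewrite res_comm ?(res_comm cy cw)//; exact: resH.
have h1 := res_taylor cy Gv Gg; have h2 := @res_pow2 w 2 v g h cw Gv Gg.
have HR1 : H (res y v) by exact: resH.
have HR2 : H (iter 2 (res w) v) by exact: (cR.1 _ Hv).1.
set A := (X in nm X <= _) in h1; set B := (X in nm X <= _) in h2.
have HA : H A by apply: HD; [exact: HB|exact: HZ].
have HBB : H B by apply: HD; [exact: HB|exact: HZ].
have -> : res y v [-] iter 2 (res w) v = A [-] B.
  by apply/funext => x; rewrite /A /B yw; ring.
apply: le_trans (ler_wpM2l _ (nmB HA HBB)) _; first by [].
apply: le_trans (ler_wpM2l _ (lerD h1 h2)) _; first by [].
have e2 : (2 ^+ k.+1 : R) = 2 * 2 ^+ k by exact: exprS.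
rewrite !cmod_pow2 natrX e2 exprVn le_eqVlt; apply/orP; left; apply/eqP.
by field; rewrite expf_neq0.
Qed.

Let geom_cauchy (un : nat -> V) (c : R) : (forall n, H (un n)) ->
  (forall k, nm (un k [-] un k.+1) <= c * 2^-1 ^+ k) ->
  forall k j, nm (un k [-] un (k + j)%N) <= 2 * c * 2^-1 ^+ k.
Proof.
move=> Hun st; have c0 : 0 <= c by have := st 0%N; rewrite expr0 mulr1; exact: le_trans.
suff h k j : nm (un k [-] un (k + j)%N) <= 2 * c * 2^-1 ^+ k * (1 - 2^-1 ^+ j).
  move=> k j; apply: le_trans (h k j) _.
  have q0 : 0 <= 2^-1 ^+ k :> R by rewrite exprn_ge0.
  have q1 : 0 <= 2^-1 ^+ j :> R by rewrite exprn_ge0.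
  by rewrite ler_piMr// ?mulr_ge0// gerBl.
elim: j => [|j IH].
  rewrite addn0 expr0 subrr mulr0 (_ : (fun x => _) = fun=> 0) ?nm0//.
  by apply/funext => x; rewrite subrr.
apply: le_trans (nm_tri (Hun k) (Hun (k + j)%N) (Hun _)) _.
have := st (k + j)%N; rewrite addnS exprD exprS => h.
apply: le_trans (lerD IH h) _.
by rewrite le_eqVlt; apply/orP; left; apply/eqP; field.
Qed.

(** Contractivity carries convergence from the dense domain of L^2 over to all of H. *)
Let dense_cauchy (F : nat -> V -> V) : (forall k, contr (F k)) ->
  (forall v g h, G v g -> G g h -> exists c, forall k, nm (F k v [-] F k.+1 v) <= c * 2^-1 ^+ k) ->
  forall u, H u -> exists f, H f /\ cv0 (fun k => nm (F k u [-] f)).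
Proof.
move=> cF st u Hu; apply: complete => [n|e e0]; first exact: ((cF n).1 _ Hu).1.
have [v [g [h [Gv Gg uv]]]] := Gdense Hu (divr_gt0 e0 (ltr0n R 4)).
have [c hc] := st v g h Gv Gg; have Hv := (GH Gv).1.
have HFv n : H (F n v) := ((cF n).1 _ Hv).1.
have HFu n : H (F n u) := ((cF n).1 _ Hu).1.
have gc := geom_cauchy HFv hc.
have c0 : 0 <= 2 * c.
  by rewrite mulr_ge0//; have := hc 0%N; rewrite expr0 mulr1; exact: le_trans.
have [N hN] := cv0_half c0 (divr_gt0 e0 (ltr0n R 4)).
have near k : nm (F k u [-] F k v) <= e / 4.
  by rewrite -(ctrB (cF k) Hu Hv); apply: le_trans ((cF k).1 _ (HB Hu Hv)).2 uv.
have half k : (N <= k)%N -> nm (F k v [-] F N v) <= e / 4.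
  move=> Nk; rewrite nmC// -(subnKC Nk); exact: le_trans (gc _ _) (hN _ (leqnn N)).
exists N => n m Nn Nm.
have := nm_tri (HFu n) (HFv n) (HFu m); have := nm_tri (HFv n) (HFv N) (HFu m).
have := nm_tri (HFv N) (HFv m) (HFu m).
have := half n Nn; have := half m Nm; have := near n; have := near m.
rewrite (nmC (HFu m)) ?(nmC (HFv m) (HFv N))//; lra.
Qed.

Let TE : exists T : R[i] * V -> V, forall z f, cone z -> H f ->
  H (T (z, f)) /\ cv0 (fun k => nm (euler z k f [-] T (z, f))).
Proof.
have ch (zf : R[i] * V) : exists p : V, cone zf.1 -> H zf.2 ->
  H p /\ cv0 (fun k => nm (euler zf.1 k zf.2 [-] p)); last first.
  by have [T hT] := choice ch; exists T => z f; exact: (hT (z, f)).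
move: zf => [z f]; have [cz|ncz] := pselect (cone z); last by exists f.
have [Hf|nHf] := pselect (H f); last by exists f.
have [|u hu] := @dense_cauchy (euler z) (fun k => euler_ctr k cz) _ f Hf; last by exists u.
by move=> v g h Gv Gg; exists (2 * (cmod z ^+ 2 * nm h)) => k; exact: (euler_step k cz Gv Gg).
Qed.

(** The cone is open and omits 0, where the value is set by hand. *)
Definition sg (z : R[i]) (f : V) : V := if z == 0 then f else projT1 (cid TE) (z, f).

Let sgP z f : cone z -> H f -> H (sg z f) /\ cv0 (fun k => nm (euler z k f [-] sg z f)).
Proof.
by move=> cz Hf; rewrite /sg (negbTE (cone_neq0 cz)); case: cid => T hT /=; exact: hT.
Qed.

Lemma sg0 f : sg 0 f = f.
Proof. by rewrite /sg eqxx. Qed.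

Lemma sgH z f : cone z -> H f -> H (sg z f).
Proof. by move=> cz Hf; have [] := sgP cz Hf. Qed.

Lemma sg_cv z f : cone z -> H f -> cv0 (fun k => nm (euler z k f [-] sg z f)).
Proof. by move=> cz Hf; have [] := sgP cz Hf. Qed.

Let lim_uniq (un : nat -> V) u v : (forall n, H (un n)) -> H u -> H v ->
  cv0 (fun k => nm (un k [-] u)) -> cv0 (fun k => nm (un k [-] v)) -> u = v.
Proof.
move=> Hun Hu Hv cu cv; apply: nm_sub_eq => //; apply/le_anti; rewrite nm_ge0 andbT.
apply: (@cv0_ge _ _ _ (fun k => nm (un k [-] u) + nm (un k [-] v))); last exact: cv0D.
by move=> n; rewrite add0r (nmC (Hun n) Hu); exact: nm_tri.
Qed.

Let lim_le (un : nat -> V) u M : (forall n, H (un n)) -> H u ->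
  cv0 (fun k => nm (un k [-] u)) -> (forall n, nm (un n) <= M) -> nm u <= M.
Proof.
move=> Hun Hu cu bd; apply: (@cv0_ge _ _ _ (fun k => nm (un k [-] u))) => // n.
by rewrite (nmC (Hun n) Hu); apply: le_trans (nm_le_dist Hu (Hun n)) _; rewrite lerD2r.
Qed.

Let lim_lin (un vn : nat -> V) u v a : (forall n, H (un n)) -> (forall n, H (vn n)) -> H u -> H v ->
  cv0 (fun k => nm (un k [-] u)) -> cv0 (fun k => nm (vn k [-] v)) ->
  cv0 (fun k => nm ((a [*] un k [+] vn k) [-] (a [*] u [+] v))).
Proof.
move=> Hun Hvn Hu Hv cu cv.
apply: cv0_le (cv0D (cv0Z (cmod_ge0 a) cu) cv) => n.
have -> : (a [*] un n [+] vn n) [-] (a [*] u [+] v) = a [*] (un n [-] u) [+] (vn n [-] v).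
  by apply/funext => x; ring.
by apply: le_trans (nmD (HZ a (HB (Hun n) Hu)) (HB (Hvn n) Hv)) _; rewrite nmZ//; exact: HB.
Qed.

Let lim_ctr (F : nat -> V -> V) (un : nat -> V) u w :
  (forall k, contr (F k)) -> (forall n, H (un n)) -> H u -> H w ->
  cv0 (fun k => nm (un k [-] u)) -> cv0 (fun k => nm (F k u [-] w)) ->
  cv0 (fun k => nm (F k (un k) [-] w)).
Proof.
move=> cF Hun Hu Hw cu cw; apply: cv0_le (cv0D cu cw) => n.
have h1 := (cF n).1 _ (Hun n); have h2 := (cF n).1 _ Hu.
apply: le_trans (nm_tri h1.1 h2.1 Hw) _; rewrite lerD2r -(ctrB (cF n))//.
exact: ((cF n).1 _ (HB (Hun n) Hu)).2.
Qed.

Lemma sg_ctr z : cone z -> contr (sg z).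
Proof.
move=> cz; split=> [u Hu|a u v Hu Hv].
  split; first exact: sgH.
  apply: (lim_le (un := fun k => euler z k u)) (sg_cv cz Hu) _ => [n||n].
  - exact: eulerH.
  - exact: sgH.
  - exact: ((euler_ctr n cz).1 _ Hu).2.
have Huv : H (a [*] u [+] v) by apply: HD => //; exact: HZ.
apply: (lim_uniq (un := fun k => euler z k (a [*] u [+] v))); last 2 first.
- exact: sg_cv.
- under eq_fun do rewrite (euler_ctr _ cz).2//.
  apply: lim_lin; try (by move=> n; exact: eulerH); try exact: sgH; exact: sg_cv.
- by move=> n; exact: eulerH.
- exact: sgH.
- by apply: HD; [apply: HZ|]; exact: sgH.
Qed.

Let euler_comm z w k j : cone z -> cone w -> commut (euler z k) (euler w j).
Proof.
move=> cz cw; have cR1 := res_ctr (cone_pow2 k cz); have cR2 := res_ctr (cone_pow2 j cw).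
apply: comm_iter => //; first exact: ctr_iter.
move=> u Hu; apply/esym; apply: (comm_iter _ cR2 cR1) => // f Hf.
by apply: res_comm => //; exact: cone_pow2.
Qed.

Let sg_comm_ctr A z : cone z -> contr A -> (forall k, commut A (euler z k)) -> commut A (sg z).
Proof.
move=> cz cA AE u Hu; have HA := (cA.1 _ Hu).1.
have HS := sgH cz Hu; have HAS := (cA.1 _ HS).1.
apply: (lim_uniq (un := fun k => euler z k (A u))) (sg_cv cz HA) => //.
- by move=> n; exact: eulerH.
- exact: sgH.
apply: cv0_le (sg_cv cz Hu) => k; rewrite -AE// -(ctrB cA)//; last exact: eulerH.
by apply: ((cA.1) _ _).2; apply: HB => //; exact: eulerH.
Qed.

Let sg_res_comm w z : cone w -> cone z -> commut (res w) (sg z).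
Proof.
move=> cw cz; apply: sg_comm_ctr => // [|k]; first exact: res_ctr.
move=> u Hu; apply/esym; apply: (comm_iter _ (res_ctr (cone_pow2 k cz)) (res_ctr cw)) => // f Hf.
by apply: res_comm => //; exact: cone_pow2.
Qed.

Let sg_comm w z : cone w -> cone z -> commut (sg w) (sg z).
Proof.
move=> cw cz; apply: sg_comm_ctr => // [|k]; first exact: sg_ctr.
move=> u Hu; apply/esym; apply: (sg_comm_ctr cw (euler_ctr k cz)) => // j.
exact: euler_comm.
Qed.

(** The one instance of the semigroup law that is visible on the Euler products: 2^(k+1) steps for z
    are twice 2^k steps for z/2. *)
Let sg_half z u : cone z -> H u -> sg z u = sg (z / 2 ^+ 1) (sg (z / 2 ^+ 1) u).
Proof.
move=> cz Hu; set y := z / 2 ^+ 1; have cy : cone y by exact: cone_pow2.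
have Hy := sgH cy Hu.
apply: (lim_uniq (un := fun k => euler z k.+1 u)).
- by move=> n; exact: eulerH.
- exact: sgH.
- exact: sgH.
- by have := cv0_shift 1 (sg_cv cz Hu); under eq_fun do rewrite addn1.
have E k : euler z k.+1 u = euler y k (euler y k u).
  rewrite /euler expnS mul2n -addnn iterD.
  by rewrite (_ : y / 2 ^+ k = z / 2 ^+ k.+1)// /y expr1 exprS invfM mulrA.
under eq_fun do rewrite E.
apply: (lim_ctr (F := fun k => euler y k)) (sg_cv cy Hu) (sg_cv cy Hy) => //.
- by move=> k; exact: euler_ctr.
- by move=> n; exact: eulerH.
- exact: sgH.
Qed.

Let sg_pow z k u : cone z -> H u -> sg z u = iter (2 ^ k) (sg (z / 2 ^+ k)) u.
Proof.
elim: k z u => [|k IH] z u cz Hu; first by rewrite expn0 expr0 divr1.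
have cy : cone (z / 2 ^+ 1) by exact: cone_pow2.
have Hy := sgH cy Hu.
rewrite (sg_half cz Hu) IH// (IH (z / 2 ^+ 1) u)// -iterD addnn -mul2n -expnS.
by rewrite (_ : z / 2 ^+ 1 / 2 ^+ k = z / 2 ^+ k.+1)// expr1 exprS invfM mulrA.
Qed.

Let pow2_nat k : ((2 ^ k)%N)%:R * (2 ^+ k)^-1 = 1 :> R[i].
Proof. by rewrite natrX mulfV// expf_neq0// pnatr_eq0. Qed.

Let pow2_natR k : ((2 ^ k)%N)%:R * (2 ^+ k)^-1 = 1 :> R.
Proof. by rewrite natrX mulfV// expf_neq0// pnatr_eq0. Qed.

Let sg_dist1 z v g : cone z -> G v g -> nm (v [-] sg z v) <= cmod z * nm g.
Proof.
move=> cz Gv; have [Hv Hg] := GH Gv.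
apply: (lim_le (un := fun k => v [-] euler z k v)).
- by move=> n; apply: HB => //; exact: eulerH.
- by apply: HB => //; exact: sgH.
- apply: cv0_le (sg_cv cz Hv) => k.
  rewrite (_ : (v [-] euler z k v) [-] (v [-] sg z v) = sg z v [-] euler z k v); last first.
    by apply/funext => x; ring.
  by rewrite nmC//; [exact: sgH|exact: eulerH].
move=> k; apply: le_trans (res_pow1 _ (cone_pow2 k cz) Gv) _.
by rewrite cmod_pow2 mulrA [X in X * _]mulrCA pow2_natR mulr1.
Qed.

Let sg_dist2 z v g h : cone z -> G v g -> G g h ->
  nm (sg z v [-] v [+] z [*] g) <= cmod z ^+ 2 * nm h.
Proof.
move=> cz Gv Gg; have [Hv Hg] := GH Gv.
apply: (lim_le (un := fun k => euler z k v [-] v [+] z [*] g)).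
- by move=> n; apply: HD; [apply: HB => //; exact: eulerH|exact: HZ].
- by apply: HD; [apply: HB => //; exact: sgH|exact: HZ].
- apply: cv0_le (sg_cv cz Hv) => k.
  have -> // : (fun x => euler z k v x - v x + z * g x - (sg z v x - v x + z * g x)) = euler z k v [-] sg z v.
  by apply/funext => x; ring.
move=> k; have := @res_pow2 _ (2 ^ k)%N _ _ _ (cone_pow2 k cz) Gv Gg.
have e1 : (2 ^ k)%:R * (z / 2 ^+ k) = z by rewrite mulrCA pow2_nat mulr1.
have e2 : (2 ^ k)%:R ^+ 2 * (cmod (z / 2 ^+ k) ^+ 2 * nm h) = cmod z ^+ 2 * nm h.
  by rewrite mulrA -exprMn cmod_pow2 mulrCA pow2_natR mulr1.
by rewrite e1 e2.
Qed.

(** Euler products for different arguments do not combine exactly. Both sides are cut into 2^k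
    factors by [sg_pow]; for x = w / 2^k and y = z / 2^k, T(y + x) and T(y) T(x) agree to second
    order on the domain of L^2, and [chernoff] leaves an error of order 2^-k. *)
Lemma sgD z w u : cone z -> cone w -> H u -> sg (z + w) u = sg z (sg w u).
Proof.
move=> cz cw Hu; have czw := coneD cz cw.
have cA := ctr_comp (sg_ctr cz) (sg_ctr cw).
have cB := sg_ctr czw.
have main v g h : G v g -> G g h -> sg (z + w) v = sg z (sg w v).
  move=> Gv Gg; have [Hv Hg] := GH Gv; have Hh := (GH Gg).2.
  apply: nm_sub_eq; [exact: (cB.1 _ Hv).1|exact: (cA.1 _ Hv).1|].
  apply/le_anti; rewrite nm_ge0 andbT.
  set M := 2 * (cmod z + cmod w) ^+ 2 * nm h.
  have M0 : 0 <= M by rewrite mulr_ge0// mulr_ge0// sqr_ge0.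
  apply: (@cv0_ge _ _ _ _ _ (cv0_half M0)) => k; rewrite add0r.
  set y := z / 2 ^+ k; set x := w / 2 ^+ k; have cy : cone y by exact: cone_pow2.
  have cx : cone x by exact: cone_pow2.
  have Eyx : (z + w) / 2 ^+ k = y + x by rewrite mulrDl.
  rewrite (sg_pow k czw Hv) Eyx (sg_pow k cw Hv) -/x.
  have Hx := ((ctr_iter (2 ^ k)%N (sg_ctr cx)).1 _ Hv).1.
  rewrite (sg_pow k cz Hx) -/y.
  have cyx := coneD cy cx; have cC := ctr_comp (sg_ctr cy) (sg_ctr cx).
  have it n : iter n (sg y) (iter n (sg x) v) = iter n (fun f => sg y (sg x f)) v.
    elim: n => [|n IH] //; rewrite !iterS -IH.
    have Hxn := ((ctr_iter n (sg_ctr cx)).1 _ Hv).1.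
    by rewrite (comm_iter n (sg_ctr cy) (sg_ctr cx) (sg_comm cy cx) Hxn).
  rewrite it; apply: le_trans (chernoff _ (sg_ctr cyx) cC _ Hv) _.
    move=> f Hf; have Hxf := sgH cx Hf.
    by rewrite (sg_comm cyx cy Hxf) (sg_comm cyx cx Hf).
  have h1 := sg_dist2 cx Gv Gg; have h2 := sg_dist2 cy Gv Gg.
  have h3 := sg_dist1 cy Gg; have h4 := sg_dist2 cyx Gv Gg.
  set a := (X in nm X <= _) in h1; set b := (X in nm X <= _) in h2.
  set c := (X in nm X <= _) in h3; set d := (X in nm X <= _) in h4.
  have Hxv := sgH cx Hv; have Hyv := sgH cy Hv; have Hyg := sgH cy Hg.
  have Ha : H a by apply: HD; [exact: HB|exact: HZ].
  have Hb : H b by apply: HD; [exact: HB|exact: HZ].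
  have Hc : H c by exact: HB.
  have Hd : H d by apply: HD; [apply: HB => //; exact: sgH|exact: HZ].
  have -> : sg (y + x) v [-] sg y (sg x v) = d [-] (sg y a [+] b [+] x [*] c).
    have -> : sg y a = sg y (sg x v) [-] sg y v [+] x [*] sg y g.
      by rewrite /a (ctrD (sg_ctr cy)) ?(ctrB (sg_ctr cy)) ?(ctrZ _ (sg_ctr cy))//; [exact: HB|exact: HZ].
    by apply/funext => t; rewrite /b /c /d; ring.
  have HSa := sgH cy Ha; have h5 := ((sg_ctr cy).1 _ Ha).2.
  have := nmB Hd (HD (HD HSa Hb) (HZ x Hc)); have := nmD (HD HSa Hb) (HZ x Hc).
  have := nmD HSa Hb; rewrite nmZ// => e1 e2 e3.
  have h6 := ler_wpM2l (cmod_ge0 x) h3.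
  have h7 : cmod (y + x) ^+ 2 <= (cmod y + cmod x) ^+ 2.
    by rewrite lerXn2r ?nnegrE ?addr_ge0 ?cmod_ge0 ?cmodD.
  have h8 := ler_wpM2r (nm_ge0 h) h7.
  have tot : nm (d [-] (sg y a [+] b [+] x [*] c)) <= 2 * (cmod y + cmod x) ^+ 2 * nm h.
    have y0 := cmod_ge0 y; have x0 := cmod_ge0 x.
    have := mulr_ge0 (mulr_ge0 y0 x0) (nm_ge0 h); nra.
  apply: le_trans (ler_wpM2l _ tot) _; first by [].
  rewrite !cmod_pow2 natrX exprVn le_eqVlt; apply/orP; left; apply/eqP.
  by rewrite /M; field; rewrite expf_neq0.
have HA := (cA.1 _ Hu).1; have HBu := (cB.1 _ Hu).1.
apply: nm_sub_eq => //; apply/le_anti; rewrite nm_ge0 andbT.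
apply/ler_addgt0Pr => e e0; rewrite add0r.
have [v [g [h [Gv Gg uv]]]] := Gdense Hu (divr_gt0 e0 (ltr0n R 2)).
have Hv := (GH Gv).1; have E := main v g h Gv Gg.
have h1 := (cA.1 _ (HB Hu Hv)).2; have h2 := (cB.1 _ (HB Hu Hv)).2.
rewrite (ctrB cA)// in h1; rewrite (ctrB cB)// in h2.
have HAv := (cA.1 _ Hv).1; have HBv := (cB.1 _ Hv).1.
have := nm_tri HBu HBv HA; rewrite {2}E (nmC HAv HA); lra.
Qed.

(** Since v = (1 + L)^-1 (v + L v) and the semigroup commutes with this resolvent, no limit of
    unbounded operators is involved. *)
Lemma sg_G z v g : cone z -> G v g -> G (sg z v) (sg z g).
Proof.
move=> cz Gv; have [Hv Hg] := GH Gv.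
have Hf : H (v [+] g) by exact: HD.
have E1 : res 1 (v [+] g) = v.
  apply: (res_uniq cone1 Hf Gv _).1; apply/funext => x; by rewrite mul1r.
have HTf := sgH cz Hf.
have E2 : sg z v = res 1 (sg z (v [+] g)) by rewrite -{1}E1 (sg_res_comm cone1 cz).
have -> : sg z g = Lres 1 (sg z (v [+] g)).
  have := res_eq cone1 HTf; rewrite -E2 (ctrD (sg_ctr cz))// => /funeqP E.
  by apply/funext => x; have := E x; rewrite mul1r => /addrI.
by rewrite E2; exact: resG.
Qed.

(** L is closed because (1 + L)^-1 is bounded and defined everywhere. *)
Let G_closed (un gn : nat -> V) u g : (forall n, G (un n) (gn n)) -> H u -> H g ->
  cv0 (fun k => nm (un k [-] u)) -> cv0 (fun k => nm (gn k [-] g)) -> G u g.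
Proof.
move=> Gn Hu Hg cu cg; have Hf : H (u [+] g) by exact: HD.
have Hun n := (GH (Gn n)).1; have Hgn n := (GH (Gn n)).2.
have E : u = res 1 (u [+] g).
  apply: (@lim_uniq un _ _ Hun Hu (resH cone1 Hf) cu).
  apply: cv0_le (cv0D cu cg) => n.
  have Hfn : H (un n [+] gn n) by exact: HD.
  have En : un n = res 1 (un n [+] gn n).
    apply/esym; apply: (res_uniq cone1 Hfn (Gn n) _).1; apply/funext => x; by rewrite mul1r.
  rewrite {1}En -(ctrB (res_ctr cone1))//; apply: le_trans (res_contr cone1 (HB Hfn Hf)) _.
  rewrite (_ : (un n [+] gn n) [-] (u [+] g) = (un n [-] u) [+] (gn n [-] g)); last first.
    by apply/funext => x; ring.
  by apply: nmD; exact: HB.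
have -> : g = Lres 1 (u [+] g).
  have /funeqP E2 := res_eq cone1 Hf.
  by apply/funext => x; have := E2 x; rewrite -E mul1r => /addrI.
by rewrite {1}E; exact: resG.
Qed.

(** L applied to the Euler product: the outermost of the 2^k resolvents is the one that L acts on,
    hence the predecessor. *)
Definition Leuler z k f := Lres (z / 2 ^+ k) (iter (2 ^ k).-1 (res (z / 2 ^+ k)) f).

Lemma euler_G z k f : cone z -> H f -> G (euler z k f) (Leuler z k f).
Proof.
move=> cz Hf; have cy := cone_pow2 k cz.
have Hn := ((ctr_iter (2 ^ k).-1 (res_ctr cy)).1 _ Hf).1.
have := resG cy Hn; rewrite /euler /Leuler -iterS prednK// expn_gt0//.
Qed.

Lemma euler_seq z f n : cone z -> H f -> forall j, (j < n)%N ->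
  G (iter j.+1 (res z) f) (Lres z (iter j (res z) f)) /\
  iter j (res z) f = iter j.+1 (res z) f [+] z [*] Lres z (iter j (res z) f).
Proof.
move=> cz Hf j jn; have Hj := ((ctr_iter j (res_ctr cz)).1 _ Hf).1.
by rewrite iterS; split; [exact: resG|exact: res_eq].
Qed.

(** The operators [Leuler] are bounded by Cs / t uniformly in the number of steps and converge on
    the domain of L, where they are Euler products of L v. Hence they converge everywhere, and
    closedness of L identifies the limit. The convergence itself is kept in the statement because
    weighted bounds are passed to the limit later. *)
Lemma sg_smooth (t : R) f : 0 < t -> H f -> exists g,
  [/\ G (sg (t%:C)%C f) g, nm g <= Cs / t * nm f &
      cv0 (fun k => nm (Leuler (t%:C)%C k.+1 f [-] g))].
Proof.
move=> t0 Hf; have ct := coneR t0; set z := (t%:C)%C in ct *.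
have bd k u : H u -> nm (Leuler z k.+1 u) <= Cs / t * nm u.
  move=> Hu; have cy := cone_pow2 k.+1 ct; set y := z / 2 ^+ k.+1 in cy.
  have yE : y = ((t / 2 ^+ k.+1)%:C)%C by rewrite /y /z -pow2C -rmorphM.
  have tk0 : 0 < t / 2 ^+ k.+1 by rewrite divr_gt0// exprn_gt0.
  have n2 : (2 <= 2 ^ k.+1)%N by rewrite expnS leq_pmulr// expn_gt0.
  have := @Gsmooth _ _ (fun j => iter j (res y) u) (fun j => Lres y (iter j.-1 (res y) u)) tk0 n2 Hu.
  rewrite /= natrX (_ : 2 ^+ k.+1 * (t / 2 ^+ k.+1) = t); last by field; rewrite expf_neq0.
  apply => j jn; rewrite -yE; exact: (euler_seq (n := (2 ^ k.+1)%N) cy Hu).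
have HL k u : H u -> H (Leuler z k u) by move=> Hu; exact: (GH (euler_G k ct Hu)).2.
have LB k u v : H u -> H v -> Leuler z k u [-] Leuler z k v = Leuler z k (u [-] v).
  move=> Hu Hv; apply: Gfun (euler_G k ct (HB Hu Hv)).
  by rewrite (ctrB (euler_ctr k ct))//; apply: GB; exact: euler_G.
have Lv k v p : G v p -> Leuler z k v = euler z k p.
  move=> Gv; have [Hv Hp] := GH Gv; apply: Gfun (euler_G k ct Hv) _.
  rewrite /euler; elim: (2 ^ k)%N => [|n IH] //.
  by rewrite !iterS; apply: res_L => //; exact: cone_pow2.
(* No sign of Cs is assumed; a negative value is compatible with [bd] only if all norms vanish. *)
have Cs0 : 0 <= Cs / t \/ forall u, H u -> nm u = 0.
  have [|neg] := lerP 0 (Cs / t); first by left.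
  right=> u Hu; apply/le_anti; rewrite nm_ge0 andbT leNgt; apply/negP => up.
  have := le_trans (nm_ge0 _) (bd 0%N u Hu); rewrite leNgt => /negP; apply.
  by rewrite nmulr_rlt0.
have [g [Hg cg]] : exists g, H g /\ cv0 (fun n => nm (Leuler z n.+1 f [-] g)).
  apply: complete => [n|e e0]; first exact: HL.
  case: Cs0 => [C0|z0]; last first.
    by exists 0%N => n m _ _; rewrite z0 ?ltW//; apply: HB; exact: HL.
  have [|v [p [q [Gv Gp fv]]]] := Gdense (u := f) (e := e / 4 / (Cs / t + 1)) Hf.
    by rewrite divr_gt0 ?divr_gt0// ltr_wpDl.
  have [Hv Hp] := GH Gv.
  have near k : nm (Leuler z k.+1 f [-] Leuler z k.+1 v) <= e / 4.
    rewrite LB//; apply: le_trans (bd k _ (HB Hf Hv)) _.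
    apply: le_trans (ler_wpM2l C0 fv) _; rewrite mulrCA ler_piMr ?divr_ge0 ?ltW//.
    by rewrite ltr_pdivrMr ?mul1r ?ltrDl// ltr_wpDl.
  have [N hN] := sg_cv ct Hp (divr_gt0 e0 (ltr0n R 4)).
  have HT := sgH ct Hp.
  exists N => n m Nn Nm.
  have a1 := hN n.+1 (leqW Nn); have a2 := hN m.+1 (leqW Nm).
  rewrite -(Lv n.+1 _ _ Gv) in a1; rewrite -(Lv m.+1 _ _ Gv) in a2.
  have := near n; have := near m.
  have HLn := HL n.+1 _ Hf; have HLm := HL m.+1 _ Hf.
  have HLn' := HL n.+1 _ Hv; have HLm' := HL m.+1 _ Hv.
  have := nm_tri HLn HLn' HLm; have := nm_tri HLn' HT HLm; have := nm_tri HT HLm' HLm.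
  rewrite (nmC HT HLm') (nmC HLm' HLm); lra.
exists g; split=> //.
  apply: (G_closed (un := fun k => euler z k.+1 f)) cg => //.
  - by move=> n; exact: euler_G.
  - exact: sgH.
  - by have := cv0_shift 1 (sg_cv ct Hf); under eq_fun do rewrite addn1.
by apply: (lim_le (un := fun n => Leuler z n.+1 f)) cg _ => // n; [exact: HL|exact: bd].
Qed.

Lemma sg_cont0 u e : H u -> 0 < e -> exists2 d, 0 < d &
  forall z, cone z -> cmod z < d -> nm (sg z u [-] u) <= e.
Proof.
move=> Hu e0; have [v [g [h [Gv Gg uv]]]] := Gdense Hu (divr_gt0 e0 (ltr0n R 4)).
have [Hv Hg] := GH Gv.
exists (e / 2 / (nm g + 1)); first by rewrite divr_gt0 ?divr_gt0// ltr_wpDl.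
move=> z cz /ltW zd; have h1 := sg_dist1 cz Gv.
have h2 : cmod z * nm g <= e / 2.
  apply: le_trans (ler_wpM2r (nm_ge0 g) zd) _.
  rewrite mulrAC ler_pdivrMr ?ltr_wpDl//; have := nm_ge0 g; set P := nm g; nra.
have HS := sgH cz Hu; have HSv := sgH cz Hv.
have h3 := ((sg_ctr cz).1 _ (HB Hu Hv)).2; rewrite (ctrB (sg_ctr cz))// in h3.
have := nm_tri HS HSv Hu; have := nm_tri HSv Hv Hu.
rewrite (nmC HSv Hv) (nmC Hv Hu); lra.
Qed.

(** The increment w may point out of the cone. Part of z is spent in advance: a real a > 0
    regularises u into the domain of L^2, and a further real rho proportional to |w| makes rho + w
    admissible. T(rho + w) and T(rho) are then compared by their second-order expansions at y = T(z
    - a - rho) T(a) u, and the derivative is - T(z - a) L T(a) u. *)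
Lemma sg_diff z u : cone z -> H u -> exists2 v, H v & forall e, 0 < e ->
  exists2 d, 0 < d & forall w, w != 0 -> cmod w < d ->
  nm (w^-1 [*] (sg (z + w) u [-] sg z u) [-] v) <= e.
Proof.
(* K |w| + w lies in the cone for every w other than 0: its real part is at least (K - 1) |w|, and
   tau (K - 1) = tau + 1 exceeds 1. *)
move=> cz Hu; pose K := 2 + tau^-1.
have ti : 0 < tau^-1 by rewrite invr_gt0.
have K0 : 0 < K by rewrite addr_gt0.
have [a a0 ca] : exists2 a : R, 0 < a & cone (z - (2 * a)%:C%C).
  case: z cz => x y [/= x0 yx]; exists ((x - `|y| / tau) / 4).
    by rewrite divr_gt0// subr_gt0 ltr_pdivrMr// mulrC.
  have y0 : 0 <= `|y| / tau by rewrite divr_ge0// ltW.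
  have yx' : `|y| / tau < x by rewrite ltr_pdivrMr// mulrC.
  split => /=; first by lra.
  have e1 : `|y| = tau * (`|y| / tau) by field; rewrite gt_eqF.
  rewrite subr0 {1}e1 ltr_pM2l//; lra.
have up w (s : R) : 0 <= s -> cone w -> cone (w + (s%:C)%C).
  move=> s0 cw; move: s0; rewrite le_eqVlt => /predU1P[<-|s0]; first by rewrite addr0.
  by apply: coneD => //; exact: coneR.
have ca2 : cone ((a / 2)%:C%C) by apply: coneR; rewrite divr_gt0.
set u1 := sg ((a / 2)%:C%C) u; have Hu1 : H u1 by exact: sgH.
have [p [Gp _ _]] := sg_smooth (divr_gt0 a0 (ltr0n R 2)) Hu; rewrite -/u1 in Gp.
have Hp := (GH Gp).2.
(* Smoothing is used twice at time a/2, once for each power of L. *)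
have [h0 [Gh0 _ _]] := sg_smooth (divr_gt0 a0 (ltr0n R 2)) Hp.
have caa : cone (a%:C%C) by exact: coneR.
have E0 : sg (a%:C%C) u = sg ((a / 2)%:C%C) u1.
  by rewrite -sgD// -rmorphD /= -splitr.
set g0 := sg ((a / 2)%:C%C) p in Gh0.
have Gu0 : G (sg (a%:C%C) u) g0 by rewrite E0; exact: sg_G.
set u0 := sg (a%:C%C) u in Gu0.
have [Hu0 Hg0] := GH Gu0; have Hh0 := (GH Gh0).2.
have cza : cone (z - a%:C%C).
  rewrite (_ : z - a%:C%C = z - (2 * a)%:C%C + a%:C%C); first exact/up/ca/ltW.
  by rewrite rmorphM /= rmorph_nat; ring.
exists (fun x => - sg (z - a%:C%C) g0 x); first by apply: HN; exact: sgH.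
move=> e e0; pose C := K + (K + 1) ^+ 2 + K ^+ 2.
have C0 : 0 < C by rewrite addr_gt0 ?exprn_gt0// addr_gt0// exprn_gt0// addr_gt0.
exists (Num.min (a / K) (e / (C * (nm h0 + 1)))).
  by rewrite lt_min !divr_gt0// mulr_gt0// ltr_wpDl.
move=> w w0; rewrite lt_min => /andP[wa we].
have cw0 := cmod_gt0 w0.
pose rho := K * cmod w; have rho0 : 0 < rho by rewrite mulr_gt0.
have rhoa : rho < a by rewrite /rho mulrC -ltr_pdivlMr.
have crho : cone (rho%:C%C) by exact: coneR.
have crw : cone (rho%:C%C + w).
  have h1 := Im_le_cmod w; have := Re_le_cmod w; rewrite ler_norml => /andP[h2 _].
  rewrite /rho; move: h1 h2 cw0; set c := cmod w; clearbody c.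
  case: (w) => x y /= h1 h2 c0.
  have q : 1 <= tau * (K - 1).
    have -> : tau * (K - 1) = tau + 1 by rewrite /K; field; rewrite gt_eqF.
    by rewrite lerDr ltW.
  split => /=; first by rewrite /K; nra.
  rewrite add0r; apply: le_lt_trans h1 _.
  apply: (@lt_le_trans _ _ (tau * ((K - 1) * c))); last by rewrite ler_wpM2l ?(ltW tau0)//; lra.
  have -> : tau * ((K - 1) * c) = c + tau * c by rewrite /K; field; rewrite gt_eqF.
  by rewrite ltrDl mulr_gt0.
have cb : cone (z - a%:C%C - rho%:C%C).
  rewrite (_ : _ - _ - _ = z - (2 * a)%:C%C + (a - rho)%:C%C); first by apply: up ca; lra.
  by case: (z) => x y; apply/eqP; rewrite eq_complex /=; apply/andP; split; apply/eqP; ring.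
set b := z - a%:C%C - rho%:C%C in cb.
pose y := sg b u0; pose gy := sg b g0; pose hy := sg b h0.
have Gy : G y gy by exact: sg_G.
have Gg : G gy hy by exact: sg_G.
have [Hy Hgy] := GH Gy; have Hhy := (GH Gg).2.
have hyh : nm hy <= nm h0 by exact: ((sg_ctr cb).1 _ Hh0).2.
have E1 : sg z u = sg (rho%:C%C) y.
  rewrite /y /u0 -(sgD cb caa Hu) -(sgD crho (coneD cb caa) Hu).
  by congr sg; rewrite /b; ring.
have E2 : sg (z + w) u = sg (rho%:C%C + w) y.
  rewrite /y /u0 -(sgD cb caa Hu) -(sgD crw (coneD cb caa) Hu).
  by congr sg; rewrite /b; ring.
have E3 : sg (z - a%:C%C) g0 = sg (rho%:C%C) gy.
  by rewrite /gy -(sgD crho cb Hg0); congr sg; rewrite /b; ring.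
have d1 := sg_dist2 crw Gy Gg; have d2 := sg_dist2 crho Gy Gg; have d3 := sg_dist1 crho Gg.
set A := (X in nm X <= _) in d1; set B := (X in nm X <= _) in d2.
set D := (X in nm X <= _) in d3.
have HS1 := sgH crw Hy; have HS2 := sgH crho Hy; have HS3 := sgH crho Hgy.
have HA : H A by apply: HD; [exact: HB|exact: HZ].
have HBB : H B by apply: HD; [exact: HB|exact: HZ].
have HDD : H D by exact: HB.
have -> : (fun x => w^-1 * (sg (z + w) u x - sg z u x) - - sg (z - a%:C%C) g0 x) =
    w^-1 [*] (A [-] B) [-] D.
  by apply/funext => x; rewrite E1 E2 E3 /A /B /D; field.
have HAB := HB HA HBB; have := nmB (HZ w^-1 HAB) HDD; rewrite nmZ// => q1.
have q2 := nmB HA HBB.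
apply: le_trans q1 _; rewrite cmodV.
have n0 := nm_ge0 h0.
have crw2 : cmod (rho%:C%C + w) ^+ 2 <= ((K + 1) * cmod w) ^+ 2.
  have K1 : 0 <= K + 1 by apply: addr_ge0 => //; exact: ltW.
  rewrite (@lerXn2r _ 2) ?nnegrE ?cmod_ge0//; first exact: mulr_ge0 K1 (cmod_ge0 w).
  by apply: le_trans (cmodD _ _) _; rewrite cmodR gtr0_norm// mulrDl mul1r.
have rh : cmod (rho%:C%C) = K * cmod w by rewrite cmodR gtr0_norm.
rewrite rh in d2 d3.
have d1' : nm A <= ((K + 1) * cmod w) ^+ 2 * nm h0.
  apply: le_trans d1 _; apply: ler_pM => //; first exact: sqr_ge0.
have d2' : nm B <= (K * cmod w) ^+ 2 * nm h0.
  by apply: le_trans d2 _; rewrite ler_wpM2l ?sqr_ge0.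
have d3' : nm D <= K * cmod w * nm h0.
  by apply: le_trans d3 _; apply: ler_wpM2l hyh; exact: mulr_ge0 (ltW K0) (cmod_ge0 w).
have q3 : (cmod w)^-1 * nm (A [-] B) <= ((K + 1) ^+ 2 + K ^+ 2) * cmod w * nm h0.
  rewrite ler_pdivrMl//; apply: le_trans q2 _; apply: le_trans (lerD d1' d2') _.
  by rewrite le_eqVlt; apply/orP; left; apply/eqP; ring.
apply: le_trans (lerD q3 d3') _.
have -> : ((K + 1) ^+ 2 + K ^+ 2) * cmod w * nm h0 + K * cmod w * nm h0 = cmod w * (C * nm h0).
  by rewrite /C; ring.
apply: le_trans (ler_wpM2r (mulr_ge0 (ltW C0) n0) (ltW we)) _.
have D0 : 0 < C * (nm h0 + 1) := mulr_gt0 C0 (ltr_wpDl n0 ltr01).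
by rewrite mulrAC (ler_pdivrMr _ _ D0) (ler_pM2l e0) (ler_pM2l C0) lerDl.
Qed.

Let quot_le (t : R) y p : 0 < t -> G y p ->
  nm ((t^-1)%:C%C [*] (y [-] sg (t%:C)%C y)) <= nm p.
Proof.
move=> t0 Gy; have ct := coneR t0; have [Hy Hp] := GH Gy.
rewrite nmZ; last by apply: HB => //; exact: sgH.
rewrite cmodR gtr0_norm ?invr_gt0// ler_pdivrMl//.
by apply: le_trans (sg_dist1 ct Gy) _; rewrite cmodR gtr0_norm.
Qed.

(** The quotient converges at once on the domain of L^2. For general u the approximation must be
    made in the graph norm: f = u + L u is approximated by f' in the domain of L, and u' = (1 +
    L)^-1 f' lies in the domain of L^2 with L u' close to L u; [quot_le] controls the remaining
    quotient. *)
Lemma sg_gen1 u v e : G u v -> 0 < e -> exists2 d, 0 < d & forall t : R, 0 < t -> t < d ->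
  nm ((t^-1)%:C%C [*] (u [-] sg (t%:C)%C u) [-] v) <= e.
Proof.
move=> Gu e0; have [Hu Hv] := GH Gu; pose f := u [+] v; have Hf : H f by exact: HD.
have [f' [p [q [Gf' Gp ff']]]] := Gdense Hf (divr_gt0 e0 (ltr0n R 8)).
have [Hf' Hp] := GH Gf'.
pose u' := res 1 f'; pose v' := f' [-] u'.
have Eu : res 1 f = u.
  by apply: (res_uniq cone1 Hf Gu _).1; apply/funext => x; rewrite mul1r.
have Gu' : G u' v'.
  have -> : v' = Lres 1 f'.
    have /funeqP E := res_eq cone1 Hf'.
    by apply/funext => x; rewrite /v' {1}E mul1r addrC addKr.
  exact: resG.
have Gv' : G v' (p [-] res 1 p) by apply: GB => //; exact: res_L.
set h := p [-] res 1 p in Gv'; have Hh := (GH Gv').2.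
have [Hu' Hv'] := GH Gu'.
have uu' : nm (u [-] u') <= e / 8.
  rewrite -{1}Eu -(ctrB (res_ctr cone1))//; apply: le_trans (res_contr cone1 (HB Hf Hf')) ff'.
have vv' : nm (v [-] v') <= e / 4.
  have -> : v [-] v' = (f [-] f') [-] (u [-] u') by apply/funext => x; rewrite /v' /f; ring.
  by have := nmB (HB Hf Hf') (HB Hu Hu'); lra.
exists (e / 2 / (nm h + 1)); first by rewrite divr_gt0 ?divr_gt0// ltr_wpDl.
move=> t t0 /ltW td; have ct := coneR t0.
have q1 := quot_le t0 (GB Gu Gu').
have q2 : nm ((t^-1)%:C%C [*] (u' [-] sg (t%:C)%C u') [-] v') <= e / 2.
  have HS := sgH ct Hu'.
  have -> : (t^-1)%:C%C [*] (u' [-] sg (t%:C)%C u') [-] v' =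
     (- (t^-1)%:C%C) [*] (sg (t%:C)%C u' [-] u' [+] (t%:C)%C [*] v').
    have tt : (t^-1)%:C%C * (t%:C)%C = 1 by rewrite -rmorphM /= mulVf ?gt_eqF.
    by apply/funext => x; rewrite -[X in _ - X]mul1r -tt; ring.
  rewrite nmZ; last by apply: HD; [exact: HB|exact: HZ].
  rewrite cmodN cmodR gtr0_norm ?invr_gt0// ler_pdivrMl//.
  apply: le_trans (sg_dist2 ct Gu' Gv') _.
  rewrite cmodR gtr0_norm// expr2 -mulrA ler_pM2l//.
  apply: le_trans (ler_wpM2r (nm_ge0 h) td) _.
  rewrite mulrAC ler_pdivrMr ?ltr_wpDl//; have := nm_ge0 h; set P := nm h; nra.
have HS := sgH ct Hu; have HS' := sgH ct Hu'.
set A := (X in nm X <= _) in q2; have HA : H A by apply: HB => //; apply: HZ; exact: HB.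
have Hd := HB (HB Hu Hu') (sgH ct (HB Hu Hu')).
have -> : (t^-1)%:C%C [*] (u [-] sg (t%:C)%C u) [-] v =
    (t^-1)%:C%C [*] ((u [-] u') [-] sg (t%:C)%C (u [-] u')) [+] A [-] (v [-] v').
  by rewrite (ctrB (sg_ctr ct))//; apply/funext => x; rewrite /A; ring.
have := nmB (HD (HZ (t^-1)%:C%C Hd) HA) (HB Hv Hv'); have := nmD (HZ (t^-1)%:C%C Hd) HA.
lra.
Qed.

(** Applying R = (1 + L)^-1 to the assumed limit and comparing with [sg_gen1] for R u gives L R u =
    R v, so u = R (u + v) lies in the domain of L. *)
Lemma sg_gen2 u v : H u -> H v ->
  (forall e, 0 < e -> exists2 d, 0 < d & forall t : R, 0 < t -> t < d ->
    nm ((t^-1)%:C%C [*] (u [-] sg (t%:C)%C u) [-] v) <= e) -> G u v.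
Proof.
move=> Hu Hv lim; have cR := res_ctr cone1.
have GR := resG cone1 Hu; have HR := resH cone1 Hu; have HL := (GH GR).2.
have HRv := resH cone1 Hv.
have E : Lres 1 u = res 1 v.
  apply: nm_sub_eq => //; apply/le_anti; rewrite nm_ge0 andbT.
  apply/ler_addgt0Pr => e e0; rewrite add0r.
  have [d1 d10 h1] := sg_gen1 GR (divr_gt0 e0 (ltr0n R 2)).
  have [d2 d20 h2] := lim _ (divr_gt0 e0 (ltr0n R 2)).
  pose t := Num.min d1 d2 / 2.
  have m0 : 0 < Num.min d1 d2 by rewrite lt_min d10.
  have t0 : 0 < t by rewrite divr_gt0.
  have tm : t < Num.min d1 d2 by rewrite ltr_pdivrMr// ltr_pMr// ltr1n.
  have ct := coneR t0.
  move: tm; rewrite lt_min => /andP[/(h1 _ t0) {}h1 /(h2 _ t0) {}h2].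
  have HS := sgH ct Hu; have HSR := sgH ct HR.
  set A := (X in nm X <= _) in h2; have HA : H A by apply: HB => //; apply: HZ; exact: HB.
  have E1 : res 1 A = (t^-1)%:C%C [*] (res 1 u [-] sg (t%:C)%C (res 1 u)) [-] res 1 v.
    rewrite /A (ctrB cR) ?(ctrZ _ cR) ?(ctrB cR) ?(sg_res_comm cone1 ct)//; try exact: HB.
    by apply: HZ; exact: HB.
  have := le_trans (res_contr cone1 HA) h2; rewrite E1 => h3.
  set B := (X in nm X <= _) in h1; set B' := (X in nm X <= _) in h3.
  have HBB : H B by apply: HB => //; apply: HZ; exact: HB.
  have HBB' : H B' by apply: HB => //; apply: HZ; exact: HB.
  have -> : Lres 1 u [-] res 1 v = B' [-] B by apply/funext => x; rewrite /B /B'; ring.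
  by have := nmB HBB' HBB; lra.
have /funeqP Eu := res_eq cone1 Hu.
have Hf : H (u [+] v) by exact: HD.
have E2 : res 1 (u [+] v) = u.
  by rewrite (ctrD cR)// -E; apply/funext => x; rewrite [in RHS]Eu mul1r.
have -> : v = Lres 1 (u [+] v).
  have /funeqP E3 := res_eq cone1 Hf.
  by apply/funext => x; have := E3 x; rewrite E2 mul1r => /addrI.
by rewrite -{1}E2; exact: resG.
Qed.

End Semigroup.

(** * Forms on weighted graphs *)

Section Form.
Variables (R : realType) (X : choiceType) (m : X -> R) (k : X * X -> R) (nb : X -> seq X).
Hypothesis m_gt0 : forall x, 0 < m x.
Hypothesis k_ge0 : forall e, 0 <= k e.
Hypothesis k_nb : forall x y, k (x, y) != 0 -> y \in nb x /\ x \in nb y.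
Implicit Types (u v g f : X -> R[i]) (c : X * X -> R[i]).

Definition du u (e : X * X) : R[i] := u e.2 - u e.1.
Definition sob u := l2 m u /\ l2 k (du u).
Definition form c u v := ip k (fun e => c e * du u e) (du v).
Definition elliptic (M delta : R) c :=
  (forall e, 0 < k e -> cmod (c e) <= M) /\
  (forall u, sob u -> delta * nq k (du u) <= form c u u).
(** The graph of L in weak form. As a relation it needs no choice of a domain or of values off the
    domain. *)
Definition opgraph c u g :=
  [/\ sob u, l2 m g & forall v, sob v -> form c u v = ip m g v].

Let m_ge0 x : 0 <= m x. Proof. exact: ltW. Qed.

Lemma duD u v : du (fun x => u x + v x) = fun e => du u e + du v e.
Proof. by apply/funext => e; rewrite /du; ring. Qed.

Lemma duZ (a : R[i]) u : du (fun x => a * u x) = fun e => a * du u e.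
Proof. by apply/funext => e; rewrite /du mulrBr. Qed.

Lemma duB u v : du (fun x => u x - v x) = fun e => du u e - du v e.
Proof. by apply/funext => e; rewrite /du; ring. Qed.

Lemma sob0 : sob (fun=> 0).
Proof.
split; first exact: l2_0.
by rewrite (_ : du _ = fun=> 0); [exact: l2_0|apply/funext => e; rewrite /du subrr].
Qed.

Lemma sobD u v : sob u -> sob v -> sob (fun x => u x + v x).
Proof. by move=> [u1 u2] [v1 v2]; split; rewrite ?duD; exact: l2D. Qed.

Lemma sobZ (a : R[i]) u : sob u -> sob (fun x => a * u x).
Proof. by move=> [u1 u2]; split; rewrite ?duZ; exact: l2Z. Qed.

Section Bounded.
Variables (M : R) (c : X * X -> R[i]).
Hypothesis cM : forall e, 0 < k e -> cmod (c e) <= M.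

Lemma l2_cmul F : l2 k F -> l2 k (fun e => c e * F e).
Proof. by move=> lF; exact: (l2_bmul k_ge0 cM lF). Qed.

Lemma ip_cmul_le (M0 : 0 <= M) F F' : l2 k F -> l2 k F' ->
  `|ip k (fun e => c e * F e) F'| <= M * (nm k F * nm k F').
Proof.
move=> lF lF'; apply: le_trans (ip_CS k_ge0 (l2_cmul lF) lF') _.
by rewrite mulrA ler_wpM2r ?nm_ge0//; exact: nm_bmul.
Qed.

Lemma formDl u v w : sob u -> sob v -> sob w ->
  form c (fun x => u x + v x) w = form c u w + form c v w.
Proof.
move=> [_ u2] [_ v2] [_ w2]; rewrite /form duD -ipDl//; try exact: l2_cmul.
by apply: ip_extl => e; rewrite mulrDr.
Qed.

Lemma formDr u v w : sob u -> sob v -> sob w ->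
  form c w (fun x => u x + v x) = form c w u + form c w v.
Proof. by move=> [_ u2] [_ v2] [_ w2]; rewrite /form duD ipDr//; exact: l2_cmul. Qed.

Lemma formZl (a : R) u v : sob u -> sob v ->
  form c (fun x => (a%:C)%C * u x) v = a * form c u v.
Proof.
move=> [_ u2] [_ v2]; rewrite /form duZ -ipZl//; last exact: l2_cmul.
by apply: ip_extl => e; ring.
Qed.

Lemma formZr (a : R) u v : sob u -> sob v ->
  form c u (fun x => (a%:C)%C * v x) = a * form c u v.
Proof. by move=> [_ u2] [_ v2]; rewrite /form duZ ipZr//; exact: l2_cmul. Qed.

Lemma form_conj (a : R[i]) u v : form c u (fun x => conjc a * v x) = form (fun e => a * c e) u v.
Proof.
by rewrite /form duZ -(ip_mull _ (fun=> a)); apply: ip_extl => e; ring.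
Qed.

End Bounded.

Let sob_g u v := ip m u v + ip k (du u) (du v).

Lemma sob_complete (un : nat -> X -> R[i]) : (forall n, sob (un n)) ->
  (forall e, 0 < e -> exists N, forall n p, (N <= n)%N -> (N <= p)%N ->
     sob_g (fun x => un n x - un p x) (fun x => un n x - un p x) <= e) ->
  exists u, sob u /\ cv0 (fun n => sob_g (fun x => un n x - u x) (fun x => un n x - u x)).
Proof.
move=> sn H.
have H1 e : 0 < e -> exists N, forall n p, (N <= n)%N -> (N <= p)%N -> nm m (fun x => un n x - un p x) <= e.
  move=> e0; have [N hN] := H _ (exprn_gt0 2 e0); exists N => n p Nn Np.
  rewrite nm_le_sqr ?(ltW e0)//; apply: le_trans (hN _ _ Nn Np).
  by rewrite lerDl nq_ge0.
have H2 e : 0 < e -> exists N, forall n p, (N <= n)%N -> (N <= p)%N ->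
    nm k (fun i => du (un n) i - du (un p) i) <= e.
  move=> e0; have [N hN] := H _ (exprn_gt0 2 e0); exists N => n p Nn Np.
  rewrite nm_le_sqr ?(ltW e0)//; apply: le_trans (hN _ _ Nn Np).
  by rewrite -duB lerDr nq_ge0.
have [u [lu cu]] := l2_complete m_ge0 m_gt0 (fun n => (sn n).1) H1.
have pt x : cv0 (fun n => cmod (un n x - u x)).
  move=> e e0; have e1 : 0 < e * Num.sqrt (m x) by rewrite mulr_gt0// sqrtr_gt0.
  have [N hN] := cu _ e1; exists N => n /hN; rewrite nm_le_sqr ?(ltW e1)// => h.
  have := nq_pt m_ge0 x (l2B m_ge0 (sn n).1 lu); move/le_trans => /(_ _ h).
  rewrite exprMn sqr_sqrtr// ler_pM2r// -cmod2.
  by rewrite ler_pXn2r ?nnegrE ?cmod_ge0 ?(ltW e0).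
(* Convergence of the differences comes from Fatou's lemma, as the pointwise limit of [du (un p)] is
   necessarily [du u]. *)
have far e : 0 < e -> exists N, forall n, (N <= n)%N ->
    l2 k (du (fun x => un n x - u x)) /\ nm k (du (fun x => un n x - u x)) <= e.
  move=> e0; have [N hN] := H2 e e0; exists N => n Nn.
  apply: (@l2_fatou _ _ _ k_ge0 (fun p i => du (un n) i - du (un (p + N)%N) i) _ _ (fun=> 0)); rewrite ?(ltW e0)//.
  - by move=> p; apply: l2B => //; [exact: (sn n).2|exact: (sn _).2].
  - by move=> p; rewrite addr0; apply: hN => //; rewrite leq_addl.
  - exact: cv0_0.
  move=> i _; apply: cv0_le (cv0_shift N (cv0D (pt i.1) (pt i.2))) => p.
  rewrite /du addrC; set a := un n i.2; set b := un n i.1; set a' := un (p + N)%N i.2; set b' := un (p + N)%N i.1.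
  rewrite [X in cmod X](_ : _ = - (a' - u i.2) + (b' - u i.1)); last by ring.
  by apply: le_trans (cmodD _ _) _; rewrite cmodN addrC.
exists u; split.
  split=> //; have [N /(_ N (leqnn N))[lD _]] := far 1 ltr01.
  rewrite (_ : du u = fun i => du (un N) i - du (fun x => un N x - u x) i); first exact: l2B (sn N).2 lD.
  by apply/funext => i; rewrite /du; ring.
move=> e e0; have e2 : 0 < Num.min 1 (e / 2) by rewrite lt_min ltr01 divr_gt0.
have [N1 h1] := cu _ e2; have [N2 h2] := far _ e2.
exists (maxn N1 N2) => n; rewrite geq_max => /andP[/h1 a1 /h2[_ a2]].
have sq (x : R) : 0 <= x -> x <= Num.min 1 (e / 2) -> x ^+ 2 <= e / 2.
  by rewrite le_min => x0 /andP[x1 xe]; apply: le_trans xe; rewrite expr2 ler_piMr.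
rewrite /sob_g -/(nq m _) -/(nq k _) -!nm2//.
have := sq _ (nm_ge0 _ _) a1; have := sq _ (nm_ge0 _ _) a2; lra.
Qed.

Lemma resolvent_exists (M delta : R) c f : 0 < delta -> elliptic M delta c -> l2 m f ->
  exists u g, opgraph c u g /\ f = fun x => u x + g x.
Proof.
move=> d0 [cM cd] lf.
(* The sign of M is not given, since the bound is stated only on edges of positive weight. *)
pose M' := `|M|; have cM' e : 0 < k e -> cmod (c e) <= M'.
  by move/cM => h; exact: le_trans h (ler_norm M).
have M'0 : 0 <= M' by exact: normr_ge0.
pose B u v := ip m u v + form c u v.
have CSm u v : sob u -> sob v -> ip m u v ^+ 2 <= nq m u * nq m v.
  move=> [u1 _] [v1 _]; rewrite -!nm2// -exprMn -(real_normK (num_real (ip m u v))).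
  by rewrite lerXn2r ?nnegrE ?mulr_ge0 ?nm_ge0// ip_CS.
have CSk u v : sob u -> sob v -> form c u v ^+ 2 <= M' ^+ 2 * (nq k (du u) * nq k (du v)).
  move=> [_ u2] [_ v2]; rewrite -!nm2// -!exprMn -(real_normK (num_real (form c u v))).
  by rewrite lerXn2r ?nnegrE ?mulr_ge0 ?nm_ge0//; exact: ip_cmul_le.
pose de := Num.min 1 delta.
have de0 : 0 < de by rewrite lt_min ltr01.
have [| | | | | | | | | | | | | | |u su hu] := @lax_milgram R X sob sob_g sob0 sobD (fun a => @sobZ _) _ _ _ _ sob_complete
  B (fun v => ip m f v) (2 * (1 + M')) de (nq m f).
- by move=> u v; rewrite /sob_g ipC [X in _ + X]ipC.
- move=> u v z [u1 u2] [v1 v2] [z1 z2]; rewrite /sob_g duD (ipDl m_ge0)// (ipDl k_ge0)//; ring.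
- move=> a u z [u1 u2] [z1 z2]; rewrite /sob_g duZ (ipZl m_ge0)// (ipZl k_ge0)//; ring.
- by move=> u _; rewrite addr_ge0//; exact: nq_ge0.
- move=> u v z su sv sz; rewrite /B (formDl cM')// (ipDl m_ge0 su.1 sv.1 sz.1); ring.
- move=> a u z su sz; rewrite /B (formZl cM')// (ipZl m_ge0 a su.1 sz.1); ring.
- move=> u v z su sv sz; rewrite /B (formDr cM')// (ipDr m_ge0 su.1 sv.1 sz.1); ring.
- move=> a u z su sz; rewrite /B (formZr cM')// (ipZr m_ge0 a sz.1 su.1); ring.
- move=> u v su sv; have h1 := CSm u v su sv; have h2 := CSk u v su sv.
  rewrite /B /sob_g -/(nq m u) -/(nq m v) -/(nq k (du u)) -/(nq k (du v)).
  have := nq_ge0 m_ge0 u; have := nq_ge0 m_ge0 v.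
  have := nq_ge0 k_ge0 (du u); have := nq_ge0 k_ge0 (du v).
  set a := ip m u v in h1 *; set b := form c u v in h2 *.
  set p := nq m u in h1 *; set q := nq m v in h1 *.
  set r := nq k (du u) in h2 *; set s := nq k (du v) in h2 *.
  move=> s0 r0 q0 p0.
  have hp := mulr_ge0 p0 q0; have hq := mulr_ge0 p0 s0.
  have hr := mulr_ge0 r0 q0; have hs := mulr_ge0 r0 s0.
  apply: (@le_trans _ _ (2 * a ^+ 2 + 2 * b ^+ 2)); first by have := sqr_ge0 (a - b); nra.
  apply: (@le_trans _ _ (2 * (p * q) + 2 * (M' ^+ 2 * (r * s)))); first by lra.
  have hM := sqr_ge0 M'; have e1 := mulr_ge0 hM hs; have e2 := mulr_ge0 hM hp.
  have e3 := mulr_ge0 hM hq; have e4 := mulr_ge0 hM hr.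
  have e5 := mulr_ge0 M'0 hs; have e6 := mulr_ge0 M'0 hp.
  have e7 := mulr_ge0 M'0 hq; have e8 := mulr_ge0 M'0 hr.
  nra.
- move=> u su; have := cd u su; rewrite /B /sob_g -/(nq m u) -/(nq k (du u)) => h.
  have := nq_ge0 m_ge0 u; have := nq_ge0 k_ge0 (du u) => r0 p0.
  have h1 : de * nq m u <= nq m u by rewrite ler_piMl// ge_min lexx.
  have h2 : de * nq k (du u) <= delta * nq k (du u) by rewrite ler_wpM2r// ge_min lexx orbT.
  lra.
- exact: de0.
- have : de <= 1 by rewrite ge_min lexx.
  lra.
- by move=> u v [u1 _] [v1 _]; rewrite ipDr.
- by move=> a u [u1 _]; rewrite ipZr.
- move=> u su; have u1 := su.1; have h : ip m f u ^+ 2 <= nq m f * nq m u.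
    rewrite -!nm2// -exprMn -(real_normK (num_real (ip m f u))).
    by rewrite lerXn2r ?nnegrE ?mulr_ge0 ?nm_ge0// ip_CS.
  apply: le_trans h _; rewrite ler_wpM2l ?nq_ge0// /sob_g lerDl.
  exact: nq_ge0.
exists u, (fun x => f x - u x); split; last by apply/funext => x; ring.
have lfu := l2B m_ge0 lf su.1; split=> // v sv.
by rewrite (ipBl m_ge0 lf su.1 sv.1); have := hu v sv; rewrite /B => <-; ring.
Qed.

Definition dirac (y : X) (a : R[i]) : X -> R[i] := fun x => if x == y then a else 0.
Definition finsupp u := exists s : seq X, forall x, x \notin s -> u x = 0.

Lemma finsupp_dirac y a : finsupp (dirac y a).
Proof. by exists [:: y] => x; rewrite inE /dirac => /negbTE ->. Qed.

Lemma finsuppD u v : finsupp u -> finsupp v -> finsupp (fun x => u x + v x).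
Proof.
move=> [s hs] [t ht]; exists (s ++ t) => x; rewrite mem_cat negb_or => /andP[/hs -> /ht ->].
by rewrite addr0.
Qed.

Lemma finsupp_l2 u : finsupp u -> l2 m u.
Proof.
by move=> [s hs]; apply: (@finsupp_summR _ _ _ s) => x /hs ->; rewrite rd0l mul0r.
Qed.

Definition star (s : seq X) : seq (X * X) :=
  [seq (x, y) | x <- s, y <- nb x] ++ [seq (y, x) | x <- s, y <- nb x].

Lemma star_edge u s e : (forall x, x \notin s -> u x = 0) -> e \notin star s ->
  du u e = 0 \/ k e = 0.
Proof.
case: e => x y hs; rewrite mem_cat negb_or => /andP[h1 h2].
have [->|kn] := eqVneq (k (x, y)) 0; [by right|left].
have [yx xy] := k_nb kn; rewrite /du /= !hs ?subrr//.
  by apply: contra h1 => xs; apply/allpairsPdep; exists x, y.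
by apply: contra h2 => ys; apply/allpairsPdep; exists y, x.
Qed.

Lemma finsupp_sob u : finsupp u -> sob u.
Proof.
move=> fu; split; first exact: finsupp_l2.
have [s hs] := fu; apply: (@finsupp_summR _ _ _ (star s)) => e he.
by have [->|->] := star_edge hs he; rewrite ?rd0l ?mul0r ?mulr0.
Qed.

Lemma ip_dirac y a w : ip m (dirac y (a / (m y)%:C%C)) w = rd a (w y).
Proof.
rewrite /ip (@finsupp_tsum _ _ _ [:: y])//; last first.
  by move=> x; rewrite inE /dirac => /negbTE ->; rewrite rd0l mul0r.
by rewrite big_seq1 /dirac eqxx (mulrC a) -fmorphV rdZl mulrAC mulVf ?mul1r// gt_eqF.
Qed.

(** Summation by parts: every edge contributes two point masses. *)
Lemma finsupp_riesz (es : seq (X * X)) (a : X * X -> R[i]) :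
  exists2 g, finsupp g & forall w, l2 m w ->
    \sum_(e <- es) rd (a e) (w e.2 - w e.1) = ip m g w.
Proof.
elim: es => [|e es [g fg hg]].
  exists (fun=> 0); first by exists [::].
  by move=> w _; rewrite big_nil ip0l.
pose d1 := dirac e.2 (a e / (m e.2)%:C%C); pose d2 := dirac e.1 (- a e / (m e.1)%:C%C).
have f1 : finsupp d1 by exact: finsupp_dirac.
have f2 : finsupp d2 by exact: finsupp_dirac.
exists (fun x => (d1 x + d2 x) + g x).
  by do 2 apply: finsuppD => //.
move=> w lw; rewrite big_cons hg// !ipDl ?ip_dirac//; try exact: finsupp_l2.
  by rewrite rdNl rdDr [X in _ + X + _ = _]rdC rdNl (rdC (w _)).
by apply: finsupp_l2; exact: finsuppD.
Qed.

(** Local finiteness makes L preserve finite supports. Finitely supported functions thus belong to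
    the domain of L^2, which supplies the density required by the semigroup construction. *)
Lemma opgraph_finsupp (M : R) c u : (forall e, 0 < k e -> cmod (c e) <= M) ->
  finsupp u -> exists2 g, finsupp g & opgraph c u g.
Proof.
move=> cM fu; have [s hs] := fu.
have [g fg hg] := finsupp_riesz (undup (star s)) (fun e => (k e)%:C%C * (c e * du u e)).
exists g => //; split; [exact: finsupp_sob|exact: finsupp_l2|].
move=> v [v1 v2]; rewrite -hg// /form /ip (@finsupp_tsum _ _ _ (undup (star s)))//.
- by apply: eq_bigr => e _; rewrite rdZl mulrC.
- exact: undup_uniq.
move=> e; rewrite mem_undup => he.
by have [->|->] := star_edge hs he; rewrite ?mulr0// rd0l mul0r.
Qed.

Lemma finsupp_dense u e : l2 m u -> 0 < e -> exists2 v, finsupp v & nm m (fun x => u x - v x) <= e.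
Proof.
move=> lu e0; have [s [us hs]] := tsum_approx lu (exprn_gt0 2 e0).
pose v x := if x \in s then u x else 0.
have fv : finsupp v by exists s => x /negbTE; rewrite /v => ->.
exists v => //; rewrite nm_le_sqr ?(ltW e0)//.
have := hs s us (fun x h => h); rewrite ler_norml => /andP[_]; apply: le_trans.
have E : \sum_(i <- s) rd (u i) (u i) * m i = tsum (fun i => rd (v i) (v i) * m i).
  rewrite (@finsupp_tsum _ _ _ s)//; last by move=> x /negbTE xs; rewrite /v xs rd0l mul0r.
  by apply: eq_big_seq => x xs; rewrite /v xs.
rewrite E -tsumB//; last exact: finsupp_l2.
rewrite /nq /ip le_eqVlt; apply/orP; left; apply/eqP; congr tsum; apply/funext => x.
by rewrite /v; case: ifP => _; [rewrite !subrr rd0l mul0r|rewrite subr0 rd0l mul0r subr0].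
Qed.

Lemma ip_rd_inj g g' : l2 m g -> l2 m g' -> (forall v, sob v -> ip m g v = ip m g' v) -> g = g'.
Proof.
move=> lg lg' H; apply/funext => y.
have key a : rd a (g y) = rd a (g' y).
  have sa : sob (dirac y (a / (m y)%:C%C)) by apply: finsupp_sob; exact: finsupp_dirac.
  by have := H _ sa; rewrite ipC ip_dirac ipC ip_dirac.
have := key 1; have := key 'i%C; rewrite /rd /= !mul0r !mul1r !add0r !addr0.
by case: (g y) (g' y) => p q [p' q'] /= -> ->.
Qed.

Lemma opgraph_fun c u g g' : opgraph c u g -> opgraph c u g' -> g = g'.
Proof.
by move=> [_ l1 h1] [_ l2 h2]; apply: ip_rd_inj => // v sv; rewrite -h1// h2.
Qed.

Lemma opgraph_lin (M : R) c a u g v h : (forall e, 0 < k e -> cmod (c e) <= M) ->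
  opgraph c u g -> opgraph c v h ->
  opgraph c (fun x => a * u x + v x) (fun x => a * g x + h x).
Proof.
move=> cM [su lg hu] [sv lh hv]; have sau := sobZ a su; split.
- exact: sobD.
- by apply: l2D => //; exact: l2Z.
move=> w sw; rewrite (formDl cM)// (ipDl m_ge0)//; [|exact: l2Z|exact: sw.1].
rewrite hv//; congr (_ + _); rewrite (ip_mull _ (fun=> a)) -hu; last exact: sobZ.
rewrite form_conj /form duZ; apply: ip_extl => e; ring.
Qed.

(** Multiplication by z costs at most |Im z| M in coercivity; the angle tau = delta / (2 M) is
    chosen so that this is half of the gain Re z delta. *)
Lemma elliptic_rot (M delta tau : R) c z : 0 < delta -> 0 < M -> tau = delta / (2 * M) ->
  elliptic M delta c -> cone tau z ->
  elliptic (cmod z * M) (complex.Re z * delta / 2) (fun e => z * c e).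
Proof.
move=> d0 M0 tE [cM cd] [z0 zt]; split=> [e ke|u su].
  by rewrite cmodM ler_wpM2l ?cmod_ge0 ?cM.
have [_ lu] := su; set F := du u in lu *.
have lcF := l2_cmul cM lu.
have E : form (fun e => z * c e) u u = complex.Re z * form c u u +
    complex.Im z * ip k (fun e => 'i%C * (c e * F e)) F.
  have liF : l2 k (fun e => 'i%C * (c e * F e)) by exact: l2Z.
  rewrite /form -/F -(ipZl k_ge0 _ lcF lu) -(ipZl k_ge0 _ liF lu).
  rewrite -(ipDl k_ge0 (l2Z k_ge0 _ lcF) (l2Z k_ge0 _ liF) lu).
  apply: ip_extl => e; case: (z) (c e) (F e) => ? ? [? ?] [? ?] /=; congr (_ +i* _)%C; ring.
have h1 : `|ip k (fun e => 'i%C * (c e * F e)) F| <= M * nq k F.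
  have cM' e : 0 < k e -> cmod ('i%C * c e) <= M.
    by move=> ke; rewrite cmodM [X in X * _](_ : _ = 1) ?mul1r ?cM// /cmod /= expr0n expr1n add0r sqrtr1.
  have := ip_cmul_le cM' (ltW M0) lu lu; rewrite -expr2 nm2//.
  by rewrite (_ : ip k (fun e => 'i%C * c e * F e) F = ip k (fun e => 'i%C * (c e * F e)) F)//; apply: ip_extl => e; rewrite mulrA.
have h2 := cd u su; have q0 := nq_ge0 k_ge0 F.
rewrite -/F in h2; rewrite E; set J := ip k _ F in h1 *; set A := form c u u in h2 *.
have h3 : `|complex.Im z * J| <= tau * complex.Re z * (M * nq k F).
  by rewrite normrM; apply: ler_pM => //; exact: ltW.
have h4 : tau * complex.Re z * (M * nq k F) = complex.Re z * delta / 2 * nq k F.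
  by rewrite tE; field; rewrite gt_eqF.
move: h3; rewrite h4 ler_norml => /andP[h3 _].
have := ler_wpM2l (ltW z0) h2; lra.
Qed.

Lemma opgraph_unrot c z u g : z != 0 -> opgraph (fun e => z * c e) u g ->
  opgraph c u (fun x => z^-1 * g x).
Proof.
move=> z0 [su lg h]; split=> //; first exact: l2Z.
move=> v sv; rewrite (ip_mull _ (fun=> z^-1)) -h; last exact: sobZ.
by rewrite form_conj; apply: ip_extl => e; rewrite !mulrA mulVf ?mul1r.
Qed.

(** The cross term in |u + zg|^2 is twice the form with coefficients z c evaluated at u, hence
    nonnegative. *)
Lemma opgraph_contr (M delta tau : R) c z u g : 0 < delta -> 0 < M -> tau = delta / (2 * M) ->
  elliptic M delta c -> cone tau z -> opgraph c u g ->
  nm m u <= nm m (fun x => u x + z * g x).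
Proof.
move=> d0 M0 tE el cz [su lg h].
have lu := su.1; have lzg := l2Z m_ge0 z lg.
rewrite -(@ler_pXn2r _ 2) ?nnegrE ?nm_ge0// !nm2// nqD//.
have E : ip m u (fun x => z * g x) = form (fun e => z * c e) u u.
  by rewrite ipC (ip_mull _ (fun=> z)) -h ?form_conj//; exact: sobZ.
have h1 := (elliptic_rot d0 M0 tE el cz).2 u su; rewrite -E in h1.
have := nq_ge0 m_ge0 (fun x => z * g x); have := nq_ge0 k_ge0 (du u).
have [z0 _] := cz => q0 q1.
have : 0 <= complex.Re z * delta / 2 * nq k (du u) by do !apply: mulr_ge0 => //; exact: ltW.
lra.
Qed.

Lemma elliptic_conj M delta c : elliptic M delta c -> elliptic M delta (fun e => conjc (c e)).
Proof.
move=> [cM cd]; split=> [e ke|u su]; first by rewrite cmod_conj cM.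
rewrite /form ip_mull ipC; have := cd u su; rewrite /form.
by rewrite (_ : ip k (fun e => conjc (conjc (c e)) * du u e) (du u) = ip k (fun e => c e * du u e) (du u))//; apply: ip_extl => e; rewrite conjcK.
Qed.

Lemma form_adj c u v : form (fun e => conjc (c e)) v u = form c u v.
Proof. by rewrite /form ip_mull ipC; apply: ip_extl => e; rewrite conjcK. Qed.

End Form.

(** * Davies' exponential weights *)

Section PairBound.
Variables (R : realType) (X : choiceType) (m : X -> R).
Hypothesis m_gt0 : forall x, 0 < m x.

(** Tonelli's theorem, summing over the second vertex first. It bounds the Leibniz errors of both
    the exponential weights and the cutoffs, with the squared increments of psi or of the cutoff
    inside [b]. *)
Lemma pair_bound (b : X * X -> R) (ga : R) (u : X -> R[i]) : (forall e, 0 <= b e) ->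
  (forall y, summR (fun z => b (y, z)) /\ tsum (fun z => b (y, z)) <= ga * m y) -> l2 m u ->
  summR (fun e => rd (u e.1) (u e.1) * b e) /\
  tsum (fun e => rd (u e.1) (u e.1) * b e) <= ga * nq m u.
Proof.
move=> b0 hb lu; set F := fun e : X * X => _.
have F0 e : 0 <= F e by rewrite mulr_ge0 ?rd_ge0.
have s1 y : summR (fun z => F (y, z)) by exact: (summRZ (rd (u y) (u y)) (hb y).1).
have E y : tsum (fun z => F (y, z)) = rd (u y) (u y) * tsum (fun z => b (y, z)).
  exact: (tsumZ (rd (u y) (u y)) (hb y).1).
have le1 y : tsum (fun z => F (y, z)) <= ga * (rd (u y) (u y) * m y).
  by rewrite E mulrCA ler_wpM2l ?rd_ge0//; exact: (hb y).2.
have s2 : summR (fun y => tsum (fun z => F (y, z))).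
  apply: (@summR_le _ _ _ (fun y => ga * (rd (u y) (u y) * m y))); last exact: (summRZ ga lu).
  by move=> y; rewrite ger0_norm ?le1// tsum_ge0.
have [sF ->] := tsum_pair F0 s1 s2; split=> //.
apply: le_trans (le_tsum s2 (summRZ ga lu) le1) _.
by rewrite (tsumZ ga lu).
Qed.

End PairBound.

(** * Elementary bounds for the exponential *)

Section ExpBound.
Variable R : realType.

Lemma expR_sub1 (s : R) : `|s| <= 1 -> `|1 - expR s| <= 4 * `|s|.
Proof.
move=> s1; have [s0|s0] := lerP 0 s.
  (* Squaring and multiplying by e^s gives e^s (1 - s/2)^2 <= 1, and (1 + 4 s) (1 - s/2)^2 >= 1 on
     [0, 1]. *)
  have h : 1 - s / 2 <= expR (- (s / 2)) by have := expR_ge1Dx (- (s / 2)).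
  rewrite (ger0_norm s0) in s1 *.
  have E : expR s * expR (- (s / 2)) ^+ 2 = 1.
    by rewrite -expRM_natl -expRD (_ : s + _ = 0) ?expR0//; field.
  have q : (1 - s / 2) ^+ 2 <= expR (- (s / 2)) ^+ 2.
    by rewrite lerXn2r ?nnegrE ?expR_ge0//; lra.
  have e1 : 1 <= expR s by have := expR_ge1Dx s; lra.
  rewrite ler0_norm ?subr_le0// opprB; have es := expR_gt0 s.
  have q2 : expR s * (1 - s / 2) ^+ 2 <= 1 by rewrite -[leRHS]E ler_pM2l.
  have pos : 0 < (1 - s / 2) ^+ 2 by rewrite exprn_gt0//; lra.
  suff : expR s <= 1 + 4 * s by move=> ?; lra.
  rewrite -(ler_pM2r pos); apply: le_trans q2 _.
  have -> : (1 + 4 * s) * (1 - s / 2) ^+ 2 = 1 + s * (3 - 15 / 4 * s + s ^+ 2) by field.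
  rewrite lerDl mulr_ge0//; have := sqr_ge0 (1 - s); lra.
rewrite (ltr0_norm s0); have := expR_ge1Dx s.
have : expR s <= 1 by rewrite -expR0 ler_expR ltW.
move=> h1 h2; rewrite ger0_norm ?subr_ge0//; lra.
Qed.

(** From 1 - y >= e^{-2y} for 0 <= y <= 1/2, where e^{2y} >= 1 + 2y and (1 + 2y) (1 - y) >= 1. It
    converts the loss accumulated over n Euler steps into an exponential. *)
Lemma one_sub_pow_ge (x : R) n : 0 <= x -> (0 < n)%N -> 2 * x <= n%:R ->
  expR (- (2 * x)) <= (1 - x / n%:R) ^+ n.
Proof.
move=> x0 n0 xn; have np : 0 < n%:R :> R by rewrite ltr0n.
have -> : - (2 * x) = n%:R * (- (2 * (x / n%:R))) by field; rewrite gt_eqF.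
rewrite expRM_natl lerXn2r ?nnegrE ?expR_ge0//.
  by rewrite subr_ge0 ler_pdivrMr ?mul1r//; lra.
set y := x / n%:R; have y0 : 0 <= y by rewrite divr_ge0// ltW.
have y1 : y <= 2^-1 by rewrite ler_pdivrMr//; lra.
have h := expR_ge1Dx (2 * y); have e := expR_gt0 (- (2 * y)).
have E : expR (2 * y) * expR (- (2 * y)) = 1 by rewrite -expRD subrr expR0.
have h2 : (1 + 2 * y) * expR (- (2 * y)) <= 1 by rewrite -[leRHS]E ler_pM2r.
set w := expR (- (2 * y)) in e h2 *; rewrite -(@ler_pM2l _ (1 + 2 * y)); last by lra.
apply: le_trans h2 _; nra.
Qed.

End ExpBound.

(** * Absorption inequalities for the weighted form *)

Section Arith.
Variable R : realType.

(** Here g stands for the norm of d(e^psi u), p and q for the norms of the two Leibniz errors, both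
    at most T, and X0, a, b, d for the four terms of the expanded form. Young's inequality absorbs
    the mixed terms into half of the coercivity. *)
Lemma coercivity_arith (M delta g T p q X0 a b d : R) : 0 <= M -> 0 < delta ->
  0 <= g -> 0 <= T -> 0 <= p <= T -> 0 <= q <= T -> delta * g ^+ 2 <= X0 ->
  `|a| <= M * (g * q) -> `|b| <= M * (p * g) -> `|d| <= M * (p * q) ->
  delta / 2 * (g ^+ 2 + T ^+ 2) - (2 * M ^+ 2 / delta + M + delta / 2) * T ^+ 2 <= X0 + a + (b + d).
Proof.
move=> M0 d0 g0 T0 /andP[p0 pT] /andP[q0 qT] hX.
have r1 : M * (g * q) <= M * (g * T) by apply: ler_wpM2l => //; exact: ler_wpM2l.
have r2 : M * (p * g) <= M * (g * T) by apply: ler_wpM2l => //; rewrite mulrC; exact: ler_wpM2l.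
have r3 : M * (p * q) <= M * T ^+ 2 by apply: ler_wpM2l => //; exact: ler_pM.
rewrite !ler_norml => /andP[h1 _] /andP[h2 _] /andP[h3 _].
have key : 2 * M * (g * T) <= delta / 2 * g ^+ 2 + 2 * M ^+ 2 / delta * T ^+ 2.
  rewrite -subr_ge0.
  have -> : delta / 2 * g ^+ 2 + 2 * M ^+ 2 / delta * T ^+ 2 - 2 * M * (g * T) =
      delta / 2 * (g - 2 * M / delta * T) ^+ 2 by field; rewrite gt_eqF.
  by rewrite mulr_ge0 ?sqr_ge0// divr_ge0// ltW.
lra.
Qed.

(* AM-GM on the cross term 2 J t^2 q, with q^2 <= 4 M^2 a b *)
Lemma smoothing_arith (M delta t J Om al a b p q u w : R) : 0 < delta -> 0 < t -> 0 <= J ->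
  0 <= Om -> 0 <= 1 - 2 * t * Om -> 1 <= al -> 4 * M ^+ 2 <= al * delta ^+ 2 ->
  0 <= a -> 0 <= b -> 0 <= q -> q ^+ 2 <= (2 * M) ^+ 2 * (a * b) ->
  (1 - 2 * t * Om) * p + t * delta * a + t ^+ 2 * q <= u ->
  (1 - 2 * t * Om) * q + t * delta * b <= w ->
  (1 - 2 * t * Om) * (al * p + ((J + 1) * t) ^+ 2 * q) <= al * u + (J * t) ^+ 2 * w.
Proof.
move=> d0 t0 J0 Om0 r0 a1 alE a0 b0 q0 qb base base1.
have al0 : 0 <= al by exact: le_trans a1.
have r1 : 1 - 2 * t * Om <= 1 by rewrite gerBl !mulr_ge0// ltW.
have tq : 0 <= t ^+ 2 * q by rewrite mulr_ge0 ?sqr_ge0.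
have key : 2 * J * t ^+ 2 * q <= al * (t * delta * a) + (J * t) ^+ 2 * (t * delta * b).
  pose x := al * (t * delta * a); pose y := (J * t) ^+ 2 * (t * delta * b).
  have x0 : 0 <= x by rewrite !mulr_ge0// ltW.
  have y0 : 0 <= y by rewrite !mulr_ge0 ?sqr_ge0// ltW.
  rewrite -/x -/y; apply: (@le_trans _ _ (`|2 * J * t ^+ 2 * q|)); first exact: ler_norm.
  rewrite -(@ler_pXn2r _ 2) ?nnegrE ?(addr_ge0 x0 y0)// real_normK ?num_real//.
  apply: (@le_trans _ _ (4 * (x * y))); last by have := sqr_ge0 (x - y); lra.
  have -> : (2 * J * t ^+ 2 * q) ^+ 2 = 4 * (J * t ^+ 2) ^+ 2 * q ^+ 2 by ring.
  have -> : 4 * (x * y) = 4 * (J * t ^+ 2) ^+ 2 * (al * delta ^+ 2 * (a * b)) by rewrite /x /y; ring.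
  have jt : 0 <= 4 * (J * t ^+ 2) ^+ 2 by rewrite mulr_ge0 ?sqr_ge0.
  apply: (ler_wpM2l jt); apply: le_trans qb _.
  have -> : (2 * M) ^+ 2 = 4 * M ^+ 2 by ring.
  exact: (ler_wpM2r (mulr_ge0 a0 b0) alE).
have A1 := ler_wpM2l al0 base.
have A2 := ler_wpM2l (sqr_ge0 (J * t)) base1.
apply: le_trans (lerD A1 A2).
have B1 : (1 - 2 * t * Om) * (t ^+ 2 * q) <= al * (t ^+ 2 * q).
  by apply: (ler_wpM2r tq); exact: le_trans r1 a1.
have cross : 0 <= 2 * J * t ^+ 2 * q by rewrite !mulr_ge0 ?sqr_ge0// ltW.
have B2 : (1 - 2 * t * Om) * (2 * J * t ^+ 2 * q) <= 2 * J * t ^+ 2 * q by rewrite ler_piMl.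
have -> : (1 - 2 * t * Om) * (al * p + ((J + 1) * t) ^+ 2 * q) =
  al * ((1 - 2 * t * Om) * p) + (J * t) ^+ 2 * ((1 - 2 * t * Om) * q) +
  (1 - 2 * t * Om) * (t ^+ 2 * q) + (1 - 2 * t * Om) * (2 * J * t ^+ 2 * q) by ring.
rewrite !mulrDr; lra.
Qed.

End Arith.

(** * The Euler scheme in exponentially weighted norms *)

Section Weighted.
Variables (R : realType) (X : choiceType) (m : X -> R) (k : X * X -> R).
Hypothesis m_gt0 : forall x, 0 < m x.
Hypothesis k_ge0 : forall e, 0 <= k e.
Variables (psi : X -> R) (ga Bd : R).
Hypothesis ga0 : 0 <= ga.
Hypothesis psi_bd : forall x, `|psi x| <= Bd.
Hypothesis psi_jump : forall e, 0 < k e -> `|psi e.2 - psi e.1| <= 1.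
Hypothesis psi_grad : forall y, summR (fun z => k (y, z) * (psi z - psi y) ^+ 2) /\
  tsum (fun z => k (y, z) * (psi z - psi y) ^+ 2) <= ga * m y.
Implicit Types (u v g f : X -> R[i]).

Let m_ge0 x : 0 <= m x. Proof. exact: ltW. Qed.

Definition wexp u : X -> R[i] := fun x => (expR (psi x))%:C%C * u x.

Let Bd0 : 0 <= expR Bd. Proof. exact: expR_ge0. Qed.

Let cmod_exp x : cmod (expR (psi x))%:C%C <= expR Bd.
Proof.
by rewrite cmodR ger0_norm ?expR_ge0// ler_expR (le_trans (ler_norm _) (psi_bd x)).
Qed.

Lemma wexp_l2 u : l2 m u -> l2 m (wexp u).
Proof. by move=> lu; apply: (@l2_bmul _ _ _ m_ge0 _ (expR Bd)). Qed.

(** The Leibniz error of the weight. Since psi varies by at most 1 along edges, 1 - e^s is at most 4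
    |s|, and the squared norm of the error is controlled by the gradient bound [ga] on psi, with the
    factor 16 = 4^2. *)
Let A (s : X * X -> R) u : X * X -> R[i] := fun e => (1 - expR (s e))%:C%C * u e.1.

Let A_bound (s : X * X -> R) u : (forall e, `|s e| = `|psi e.2 - psi e.1|) -> l2 m u ->
  l2 k (A s u) /\ nq k (A s u) <= 16 * ga * nq m u.
Proof.
move=> hs lu; have b0 e : 0 <= k e * (psi e.2 - psi e.1) ^+ 2 by rewrite mulr_ge0 ?sqr_ge0.
have [s1 s2] := @pair_bound _ _ m (fun e : X * X => k e * (psi e.2 - psi e.1) ^+ 2) ga u b0 psi_grad lu.
have pt e : rd (A s u e) (A s u e) * k e <= 16 * (rd (u e.1) (u e.1) * (k e * (psi e.2 - psi e.1) ^+ 2)).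
  have := k_ge0 e; rewrite le_eqVlt => /predU1P[<-|ke]; first by rewrite mul0r !mulr0.
  rewrite /A rd_mul2 cmodR [leRHS](_ : _ = 16 * (psi e.2 - psi e.1) ^+ 2 * rd (u e.1) (u e.1) * k e); last by ring.
  rewrite ler_wpM2r// ler_wpM2r ?rd_ge0//.
  have h := @expR_sub1 R (s e) _; rewrite -(real_normK (num_real (psi e.2 - psi e.1))) -hs.
  rewrite (_ : 16 * `|s e| ^+ 2 = (4 * `|s e|) ^+ 2); last by ring.
  rewrite lerXn2r ?nnegrE ?mulr_ge0// h// hs; exact: psi_jump.
have sF : l2 k (A s u).
  apply: summR_le (summRZ 16 s1) => e; rewrite ger0_norm//.
  by rewrite mulr_ge0 ?rd_ge0.
split=> //; apply: le_trans (le_tsum sF (summRZ 16 s1) pt) _.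
by rewrite tsumZ// -mulrA ler_wpM2l.
Qed.

Let sp e := psi e.2 - psi e.1.
Let sn e := - (psi e.2 - psi e.1).
Let spE e : `|sp e| = `|psi e.2 - psi e.1|. Proof. by []. Qed.
Let snE e : `|sn e| = `|psi e.2 - psi e.1|. Proof. by rewrite normrN. Qed.

Let du_wexp u e : du (wexp u) e = (expR (psi e.2))%:C%C * (du u e + A sn u e).
Proof.
rewrite /du /wexp /A /sn opprB expRD expRN; have := expR_gt0 (psi e.2).
case: (u e.1) (u e.2) => a b [a' b'] p0 /=; congr (_ +i* _)%C; field; by rewrite gt_eqF.
Qed.

Let du_unwexp u e : du u e = (expR (psi e.2))^-1%:C%C * (du (wexp u) e + A sp (wexp u) e).
Proof.
rewrite /du /wexp /A /sp expRD expRN; have := expR_gt0 (psi e.2); have := expR_gt0 (psi e.1).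
case: (u e.1) (u e.2) => a b [a' b'] q0 p0 /=; congr (_ +i* _)%C; field; by rewrite !gt_eqF.
Qed.

Lemma wexp_sob u : sob m k u -> sob m k (wexp u).
Proof.
move=> [u1 u2]; split; first exact: wexp_l2.
rewrite (_ : du (wexp u) = fun e => (expR (psi e.2))%:C%C * (du u e + A sn u e)); last first.
  by apply/funext => e; rewrite du_wexp.
apply: (@l2_bmul _ _ _ k_ge0 _ (expR Bd)) => [e _|]; first exact: cmod_exp.
by apply: l2D => //; exact: (A_bound snE u1).1.
Qed.

(** With the test function e^{2 psi} v the factors e^{-psi} and e^{psi} at the far end of the edge
    cancel. What is left is the original form in e^psi u and e^psi v, up to the errors [A], which
    enter with opposite signs of the exponent. *)
Let form_wexp (c : X * X -> R[i]) u v : form k c u (wexp (wexp v)) =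
  ip k (fun e => c e * (du (wexp u) e + A sp (wexp u) e))
    (fun e => du (wexp v) e + A sn (wexp v) e).
Proof.
rewrite /form /ip; congr tsum; apply/funext => e; congr (_ * _).
rewrite du_wexp (du_unwexp u); have := expR_gt0 (psi e.2).
set p := expR (psi e.2); set F := du _ e + A sp _ e; set F' := du _ e + A sn _ e => p0.
case: (c e) (F) (F') => c1 c2 [f1 f2] [g1 g2]; rewrite /rd /=; field; by rewrite gt_eqF.
Qed.

Variables (M delta : R) (c : X * X -> R[i]).
Hypothesis delta0 : 0 < delta.
Hypothesis M0 : 0 <= M.
Hypothesis cell : elliptic m k M delta c.

(** The exponential growth rate allowed in the weighted norm. It is linear in [ga], hence of order
    lambda^2 for a lambda-Lipschitz weight. *)
Definition wrate := (2 * M ^+ 2 / delta + M + delta / 2) * (16 * ga).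
Definition wenergy u := nq k (du (wexp u)) + 16 * ga * nq m (wexp u).

Lemma wrate_ge0 : 0 <= wrate.
Proof.
by rewrite mulr_ge0// ?mulr_ge0// !addr_ge0// ?divr_ge0 ?mulr_ge0 ?sqr_ge0// ltW.
Qed.

Lemma wenergy_ge0 u : 0 <= wenergy u.
Proof. by rewrite addr_ge0 ?mulr_ge0 ?nq_ge0. Qed.

Lemma wform_bound u v : sob m k u -> sob m k v ->
  form k c u (wexp (wexp v)) ^+ 2 <= (2 * M) ^+ 2 * (wenergy u * wenergy v).
Proof.
move=> su sv; rewrite form_wexp.
have [U1 U2] := wexp_sob su; have [V1 V2] := wexp_sob sv.
have [a1 a2] := A_bound spE U1; have [b1 b2] := A_bound snE V1.
set F := (X in ip k (fun e => c e * X e)); set F' := (X in ip k _ X).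
have lF : l2 k F by exact: l2D.
have lF' : l2 k F' by exact: l2D.
have h := ip_cmul_le k_ge0 cell.1 M0 lF lF'.
have sqF (G H : X * X -> R[i]) q w : l2 k G -> l2 k H -> nq k H <= w -> nq k G = q ->
    nq k (fun e => G e + H e) <= 2 * (q + w).
  move=> lG lH hH <-; rewrite nqD//.
  have := nq_ge0 k_ge0 (fun e => G e - H e); rewrite nqB//; lra.
have q1 : nq k F <= 2 * wenergy u by apply: sqF.
have q2 : nq k F' <= 2 * wenergy v by apply: sqF.
rewrite -(real_normK (num_real (ip _ _ _))).
apply: (@le_trans _ _ ((M * (nm k F * nm k F')) ^+ 2)).
  by rewrite lerXn2r ?nnegrE ?mulr_ge0 ?nm_ge0.
rewrite !exprMn !nm2// (_ : _ * (wenergy u * _) = M ^+ 2 * ((2 * wenergy u) * (2 * wenergy v))); last by ring.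
by rewrite ler_wpM2l ?sqr_ge0// ler_pM ?nq_ge0.
Qed.

Lemma wform_coer u : sob m k u ->
  delta / 2 * wenergy u - wrate * nq m (wexp u) <= form k c u (wexp (wexp u)).
Proof.
move=> su; rewrite form_wexp.
have sU := wexp_sob su; have [U1 U2] := sU.
have [a1 a2] := A_bound spE U1; have [b1 b2] := A_bound snE U1.
set G := du (wexp u); set P := A sp _ in a1 a2 *; set Q := A sn _ in b1 b2 *.
have cl F : l2 k F -> l2 k (fun e => c e * F e) by move=> lF; exact: (l2_cmul k_ge0 cell.1).
have E : ip k (fun e => c e * (G e + P e)) (fun e => G e + Q e) =
   form k c (wexp u) (wexp u) + ip k (fun e => c e * G e) Q
   + ip k (fun e => c e * P e) (fun e => G e + Q e).
  rewrite /form -/G -(ipDr k_ge0 U2 b1 (cl _ U2)) -(ipDl k_ge0 (cl _ U2) (cl _ a1) (l2D k_ge0 U2 b1)).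
  by apply: ip_extl => e; rewrite mulrDr.
have E2 : ip k (fun e => c e * P e) (fun e => G e + Q e) =
   ip k (fun e => c e * P e) G + ip k (fun e => c e * P e) Q.
  by rewrite (ipDr k_ge0 U2 b1 (cl _ a1)).
have h1 := ip_cmul_le k_ge0 cell.1 M0 U2 b1.
have h2 := ip_cmul_le k_ge0 cell.1 M0 a1 U2.
have h3 := ip_cmul_le k_ge0 cell.1 M0 a1 b1.
have h4 := cell.2 _ sU; rewrite -/G in h1 h2 h4.
rewrite E E2 /wenergy -/G; set Y := nq m (wexp u) in a2 b2 *.
have Y0 : 0 <= 16 * ga * Y by rewrite mulr_ge0 ?mulr_ge0//; exact: nq_ge0.
have T2 := sqr_sqrtr Y0; have T0 := sqrtr_ge0 (16 * ga * Y).
set T := Num.sqrt _ in T2 T0.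
have p1 : 0 <= nm k P <= T.
  by apply/andP; split; [exact: nm_ge0|rewrite (nm_le_sqr k_ge0 P T0) T2].
have p2 : 0 <= nm k Q <= T.
  by apply/andP; split; [exact: nm_ge0|rewrite (nm_le_sqr k_ge0 Q T0) T2].
rewrite -(nm2 k_ge0 G) in h4 *; rewrite -T2 /wrate -(mulrA _ (16 * ga)) -T2.
exact: (coercivity_arith M0 delta0 (nm_ge0 k G) T0 p1 p2 h4 h1 h2 h3).
Qed.

(** The weight of |u|^2 in the monotone quantity; it must be at least 1 and at least 4 M^2 / delta^2
    for the cross term in [smoothing_arith] to be absorbed. *)
Definition wsmooth := 1 + 4 * M ^+ 2 / delta ^+ 2.

Lemma wsmooth_ge1 : 1 <= wsmooth.
Proof. by rewrite /wsmooth lerDl; apply: divr_ge0; rewrite ?sqr_ge0// mulr_ge0// sqr_ge0. Qed.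

(** A discrete form of the derivative of alpha |u|^2 + s^2 |L u|^2 in time s, in weighted norms. The
    increase of (j t)^2 creates a term in |L u|^2; testing L u1 = w1 with w1 bounds its square by
    the product of the energies of u1 and w1, and both energies are dissipated by the step. For j =
    0 the term with w0 has coefficient 0, so nothing is asked of w0. *)
Let wstep (t : R) (j : nat) u0 u1 w0 w1 : 0 < t -> 0 <= 1 - 2 * t * wrate ->
  opgraph m k c u1 w1 -> u0 = (fun x => u1 x + t%:C%C * w1 x) ->
  (j = 0%N \/ exists2 z1, opgraph m k c w1 z1 & w0 = fun x => w1 x + t%:C%C * z1 x) ->
  (1 - 2 * t * wrate) * (wsmooth * nq m (wexp u1) + (j.+1%:R * t) ^+ 2 * nq m (wexp w1)) <=
  wsmooth * nq m (wexp u0) + (j%:R * t) ^+ 2 * nq m (wexp w0).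
Proof.
move=> t0 r0 G1 E0 hw.
have ex u w z : opgraph m k c u w -> z = (fun x => u x + t%:C%C * w x) ->
    nq m (wexp z) = nq m (wexp u) + 2 * t * form k c u (wexp (wexp u)) + t ^+ 2 * nq m (wexp w).
  move=> [su lw h] ->.
  have lu1 := wexp_l2 su.1; have lw1 := wexp_l2 lw.
  have -> : wexp (fun x => u x + t%:C%C * w x) = fun x => wexp u x + t%:C%C * wexp w x.
    by apply/funext => x; rewrite /wexp; ring.
  rewrite nqD//; last exact: l2Z.
  rewrite (nqZ _ lw1) cmodR real_normK ?num_real// (ipZr m_ge0 t lu1 lw1) h; last by do 2 apply: wexp_sob.
  congr (_ + _ + _); rewrite [in RHS]/wexp [in LHS]/wexp -/(wexp _).
  rewrite -mulrA; congr (_ * (_ * _)); rewrite ipC (ip_mull _ (fun x => (expR (psi x))%:C%C)).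
  by apply: ip_extr => x; rewrite conjc_real.
have [su1 lw1 h1] := G1.
have e0 := ex _ _ _ G1 E0; have c0 := wform_coer su1.
have N0 := wenergy_ge0 u1.
have q1 : 0 <= nq m (wexp w1) by exact: nq_ge0.
have q0 : 0 <= nq m (wexp u1) by exact: nq_ge0.
have a1 := wsmooth_ge1.
set Om := wrate in r0 c0 *; have Om0 : 0 <= Om := wrate_ge0.
set al := wsmooth in a1 *; set p := nq m (wexp u1) in q0 c0 e0 *.
set q := nq m (wexp w1) in q1 e0 *; set a := wenergy u1 in N0 c0 *.
have base : (1 - 2 * t * Om) * p + t * delta * a + t ^+ 2 * q <= nq m (wexp u0).
  by rewrite e0; have := ler_wpM2l (ltW t0) c0; lra.
have tt0 : 0 <= 2 * t by rewrite mulr_ge0// ltW.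
have r1 : 1 - 2 * t * Om <= 1 by rewrite gerBl; exact: mulr_ge0 tt0 Om0.
have tq : 0 <= t ^+ 2 * q := mulr_ge0 (sqr_ge0 t) q1.
have al0 : 0 <= al := le_trans ler01 a1.
case: hw => [->|[z1 Gz Ew]].
  rewrite mul1r mul0r expr0n mul0r addr0.
  have := ler_wpM2l (le_trans ler01 a1) base.
  have : (1 - 2 * t * Om) * (t ^+ 2 * q) <= al * (t ^+ 2 * q) by rewrite ler_wpM2r// (le_trans r1).
  have : 0 <= al * (t * delta * a).
    by apply: mulr_ge0 al0 _; apply: mulr_ge0 N0; rewrite mulr_ge0// ltW.
  lra.
have e1 := ex _ _ _ Gz Ew; have [sw1 lz1 hz] := Gz; have c1 := wform_coer sw1.
have b0 := wenergy_ge0 w1; set b := wenergy w1 in b0 c1 *.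
rewrite -/q -/Om in e1 c1.
have qz : 0 <= nq m (wexp z1) by exact: nq_ge0.
have base1 : (1 - 2 * t * Om) * q + t * delta * b <= nq m (wexp w0).
  by rewrite e1; have := ler_wpM2l (ltW t0) c1; have := mulr_ge0 (sqr_ge0 t) qz; lra.
have qE : q = form k c u1 (wexp (wexp w1)).
  rewrite h1; last by do 2 apply: wexp_sob.
  rewrite /q /nq [in LHS]/wexp (ip_mull _ (fun x => (expR (psi x))%:C%C)).
  by apply: ip_extr => x; rewrite conjc_real.
have qb : q ^+ 2 <= (2 * M) ^+ 2 * (a * b) by rewrite {1}qE; exact: wform_bound.
have alE : 4 * M ^+ 2 <= al * delta ^+ 2.
  have -> : al * delta ^+ 2 = delta ^+ 2 + 4 * M ^+ 2.
    by rewrite /al /wsmooth; field; rewrite gt_eqF.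
  by rewrite lerDr sqr_ge0.
have -> : j.+1%:R = j%:R + 1 :> R by rewrite [RHS]natr1.
exact: (smoothing_arith delta0 t0 (ler0n R j) Om0 r0 a1 alE N0 b0 q1 qb base base1).
Qed.

Lemma weighted_smoothing (t : R) n (u g : nat -> X -> R[i]) : 0 < t ->
  0 <= 1 - 2 * t * wrate -> (0 < n)%N ->
  (forall j, (j < n)%N -> opgraph m k c (u j.+1) (g j.+1) /\
     u j = fun x => u j.+1 x + t%:C%C * g j.+1 x) ->
  (1 - 2 * t * wrate) ^+ n *
    (wsmooth * nq m (wexp (u n)) + (n%:R * t) ^+ 2 * nq m (wexp (g n))) <=
  wsmooth * nq m (wexp (u 0%N)).
Proof.
move=> t0 r0 n0 H.
suff h i : (i <= n)%N -> (1 - 2 * t * wrate) ^+ i *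
    (wsmooth * nq m (wexp (u i)) + (i%:R * t) ^+ 2 * nq m (wexp (g i))) <=
    wsmooth * nq m (wexp (u 0%N)) by exact: h.
elim: i => [_|i IH lt]; first by rewrite expr0 mul1r mul0r expr0n mul0r addr0.
apply: le_trans (IH (ltnW lt)); rewrite exprSr -mulrA ler_wpM2l ?exprn_ge0//.
have [G1 E1] := H i lt; apply: wstep => //.
case: i lt IH G1 E1 => [|i] lt _ G1 E1; [by left|right].
have [G0 E0] := H i (ltnW lt).
have tn : t%:C%C != 0 :> R[i] by rewrite (inj_eq (@complexI _)) gt_eqF.
(* The images under L follow the same scheme: u_{i+1} - u_{i+2} = t g_{i+2}, and applying L gives
   this value for L g_{i+2}. *)
exists (fun x => t%:C%C^-1 * (g i.+1 x - g i.+2 x)); last first.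
  by apply/funext => x; field.
have G00 : opgraph m k c (fun=> 0) (fun=> 0).
  have := opgraph_lin m_gt0 k_ge0 (-1) cell.1 G1 G1.
  by congr opgraph; apply/funext => x; ring.
have Gn := opgraph_lin m_gt0 k_ge0 (- t%:C%C^-1) cell.1 G1 G00.
have := opgraph_lin m_gt0 k_ge0 (t%:C%C^-1) cell.1 G0 Gn.
congr opgraph; apply/funext => x; last by ring.
have -> : u i.+1 x = u i.+2 x + t%:C%C * g i.+2 x by rewrite E1.
by field.
Qed.

(** The scheme with n steps of size t / n. The requirement on n is what [one_sub_pow_ge] needs; the
    squared norms lose e^{4 t wrate}, the norms its square root. *)
Lemma weighted_bound (t : R) n (u g : nat -> X -> R[i]) : 0 < t ->
  (0 < n)%N -> 4 * t * wrate <= n%:R ->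
  (forall j, (j < n)%N -> opgraph m k c (u j.+1) (g j.+1) /\
     u j = fun x => u j.+1 x + (t / n%:R)%:C%C * g j.+1 x) ->
  nm m (wexp (u n)) <= expR (2 * t * wrate) * nm m (wexp (u 0%N)) /\
  nm m (wexp (g n)) <= Num.sqrt wsmooth / t * expR (2 * t * wrate) * nm m (wexp (u 0%N)).
Proof.
move=> t0 n0 tn H; have np : 0 < n%:R :> R by rewrite ltr0n.
have Om0 := wrate_ge0; have tO : 0 <= t * wrate by rewrite mulr_ge0// ltW.
have E : 1 - 2 * (t / n%:R) * wrate = 1 - (2 * t * wrate) / n%:R by field; rewrite gt_eqF.
have r0 : 0 <= 1 - 2 * (t / n%:R) * wrate.
  by rewrite E subr_ge0 ler_pdivrMr// mul1r; lra.
have := weighted_smoothing (divr_gt0 t0 np) r0 n0 H.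
have -> : n%:R * (t / n%:R) = t by field; rewrite gt_eqF.
have := @one_sub_pow_ge R (2 * t * wrate) n _ n0 _; rewrite E => h.
have {}h : expR (- (2 * (2 * t * wrate))) <= (1 - 2 * t * wrate / n%:R) ^+ n by apply: h; lra.
set P := (1 - _) ^+ n in h *.
have a1 := wsmooth_ge1.
set al := wsmooth in a1 *; set p := nq m (wexp (u n)); set q := nq m (wexp (g n)).
set z := nq m (wexp (u 0%N)) => key.
have p0 : 0 <= p by exact: nq_ge0.
have q0 : 0 <= q by exact: nq_ge0.
have z0 : 0 <= z by exact: nq_ge0.
pose x := expR (2 * t * wrate); have x0 : 0 < x by exact: expR_gt0.
have xx : x ^+ 2 * expR (- (2 * (2 * t * wrate))) = 1.
  by rewrite -expRM_natl -expRD subrr expR0.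
have al0 : 0 <= al by exact: le_trans a1.
have key2 : al * p + t ^+ 2 * q <= x ^+ 2 * (al * z).
  have s0 : 0 <= al * p + t ^+ 2 * q := addr_ge0 (mulr_ge0 al0 p0) (mulr_ge0 (sqr_ge0 t) q0).
  rewrite -[leLHS]mul1r -xx -mulrA ler_wpM2l ?sqr_ge0//; apply: le_trans key.
  by rewrite ler_wpM2r.
have tq : 0 <= t ^+ 2 * q := mulr_ge0 (sqr_ge0 t) q0.
have alp : 0 <= al * p := mulr_ge0 al0 p0.
rewrite -/x; split.
  rewrite nm_le_sqr ?mulr_ge0 ?nm_ge0 ?(ltW x0)// exprMn nm2// -/p -/z.
  rewrite -(@ler_pM2l _ al) ?(lt_le_trans ltr01 a1)// mulrCA; apply: le_trans key2; lra.
rewrite nm_le_sqr ?mulr_ge0 ?nm_ge0 ?invr_ge0 ?sqrtr_ge0 ?(ltW x0) ?(ltW t0)//.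
rewrite !exprMn nm2// exprVn sqr_sqrtr// -/q -/z.
rewrite -(@ler_pM2l _ (t ^+ 2)) ?exprn_gt0//.
have -> : t ^+ 2 * (al / t ^+ 2 * x ^+ 2 * z) = x ^+ 2 * (al * z) by field; rewrite gt_eqF.
by apply: le_trans key2; lra.
Qed.

End Weighted.

(** * Energy decay and Morrey estimates *)

Section Cutoff.
Variable R : realType.

Definition clamp (s : R) := Num.max 0 (Num.min 1 s).

Lemma clamp01 s : 0 <= clamp s <= 1.
Proof. by rewrite /clamp le_max lexx /= ge_max ler01 ge_min lexx. Qed.

Lemma clamp_1 s : 1 <= s -> clamp s = 1.
Proof. by move=> s1; rewrite /clamp (min_idPl s1) (max_idPr ler01). Qed.

Lemma clamp_0 s : s <= 0 -> clamp s = 0.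
Proof. by move=> s0; rewrite /clamp; apply/max_idPl; rewrite ge_min s0 orbT. Qed.

Lemma clamp_lip a b : `|clamp a - clamp b| <= `|a - b|.
Proof.
have E s : [\/ s <= 0 /\ clamp s = 0, 0 <= s <= 1 /\ clamp s = s | 1 <= s /\ clamp s = 1].
  have [s0|s0] := lerP s 0; first by constructor 1; rewrite clamp_0.
  have [s1|s1] := lerP s 1; last by constructor 3; rewrite clamp_1 ?ltW.
  by constructor 2; rewrite /clamp (min_idPr s1) (max_idPr (ltW s0)) (ltW s0).
have h1 := ler_norm (a - b); have h2 := ler_norm (b - a); rewrite (distrC b a) in h2.
by case: (E a) => -[? ->]; case: (E b) => -[? ->]; rewrite ler_norml; lra.
Qed.

(** A geometric sum is dominated by its largest term, here at most Hh^2, up to q^2 / (q^2 - 1). The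
    dependence on q is kept because the gain of a factor q - 1 is needed later. *)
Lemma geom_indicator (q Hh : R) (P : nat -> bool) n : 1 < q -> 0 <= Hh ->
  (forall i, P i -> q ^+ i <= Hh) ->
  (q ^+ 2 - 1) * (\sum_(i < n) q ^+ (2 * i) * (P i)%:R) <= q ^+ 2 * Hh ^+ 2.
Proof.
move=> q1 H0 HP; have q0 : 0 < q by exact: lt_trans q1.
have q21 : 0 <= q ^+ 2 - 1 by rewrite subr_ge0 expr_ge1// ltW.
have full k : (q ^+ 2 - 1) * (\sum_(i < k) q ^+ (2 * i) * (P i)%:R) <= q ^+ (2 * k).
  elim: k => [|k IH]; first by rewrite big_ord0 mulr0 expr0.
  rewrite big_ord_recr /= mulrDr mulnS exprD.
  have p0 : 0 <= q ^+ (2 * k) by rewrite exprn_ge0// ltW.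
  have h1 : (q ^+ 2 - 1) * (q ^+ (2 * k) * (P k)%:R) <= (q ^+ 2 - 1) * q ^+ (2 * k).
    by apply: ler_wpM2l => //; apply: ler_piMr => //; case: (P k).
  apply: le_trans (lerD IH h1) _; rewrite mulrBl mul1r; lra.
elim: n => [|n IH]; first by rewrite big_ord0 mulr0 mulr_ge0 ?exprn_ge0// ltW.
have [Pn|nPn] := boolP (P n); last by rewrite big_ord_recr /= (negbTE nPn) mulr0 addr0.
apply: le_trans (full n.+1) _; rewrite mulnS exprD ler_wpM2l ?exprn_ge0 ?(ltW q0)//.
by rewrite mulnC exprM lerXn2r ?nnegrE ?exprn_ge0 ?(ltW q0)// HP.
Qed.

(** S, the form evaluated on Hc du, has no sign term by term and is eliminated between two
    relations: coercivity for [v] (with n the energy of [v]) and the equation tested with [v2] (with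
    F its right-hand side). Here x and y are the norms of Hc du and of the error [Err]. *)
Lemma energy_arith (M delta S x y a1 a2 a3 a4 F n : R) : 0 <= M -> 0 < delta ->
  0 <= x -> 0 <= y -> x ^+ 2 / 2 - y ^+ 2 <= n ->
  delta * n <= S + a1 + a2 + a3 -> F = S + 2 * a2 - a4 + a3 ->
  `|a1| <= M * (y * x) -> `|a2| <= M * (x * y) -> `|a3| <= M * (y * y) -> `|a4| <= M * (y * y) ->
  delta / 4 * x ^+ 2 <= F + (delta + 3 * M + 16 * M ^+ 2 / delta) * y ^+ 2.
Proof.
move=> M0 d0 x0 y0 hn hG hF; rewrite !ler_norml => /andP[_ b1] /andP[c2 b2] /andP[_ b3] /andP[_ b4].
have h := ler_wpM2l (ltW d0) hn.
have key : 4 * M * (x * y) <= delta / 4 * x ^+ 2 + 16 * M ^+ 2 / delta * y ^+ 2.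
  rewrite -subr_ge0.
  have -> : delta / 4 * x ^+ 2 + 16 * M ^+ 2 / delta * y ^+ 2 - 4 * M * (x * y) =
      delta / 4 * (x - 8 * M / delta * y) ^+ 2 by field; rewrite gt_eqF.
  by rewrite mulr_ge0 ?sqr_ge0// divr_ge0// ltW.
have e1 : M * (y * x) = M * (x * y) by ring.
rewrite e1 in b1; have := mulr_ge0 M0 (mulr_ge0 x0 y0); have := mulr_ge0 M0 (mulr_ge0 y0 y0); lra.
Qed.

Lemma absorb_arith (d C e S F E A : R) : 0 <= S -> C * e <= d / 8 ->
  d / 4 * S <= F + C * E -> C * E <= C * (4 * A + e * S) -> d / 8 * S <= F + 4 * C * A.
Proof. by move=> S0 /(ler_wpM2r S0) h h1 h2; lra. Qed.

End Cutoff.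

Section Elliptic.
Variables (R : realType) (X : choiceType) (m : X -> R) (k : X * X -> R).
Variables (d : X -> X -> R) (hs : X -> R) (CW CP cL : R).
Hypothesis m_gt0 : forall x, 0 < m x.
Hypothesis k_ge0 : forall e, 0 <= k e.
Hypothesis k_sym : forall y z, k (y, z) = k (z, y).
Hypothesis d_ge0 : forall x y, 0 <= d x y.
Hypothesis d_refl : forall x, d x x = 0.
Hypothesis d_sym : forall x y, d x y = d y x.
Hypothesis d_tri : forall x y z, d x z <= d x y + d y z.
Hypothesis hs_gt0 : forall x, 0 < hs x.
Hypothesis CW1 : 1 <= CW.
Hypothesis CP0 : 0 < CP.
Hypothesis cL0 : 0 < cL.
Hypothesis d_edge : forall y z, 0 < k (y, z) -> d y z <= hs y.
Hypothesis d_far : forall x y, x != y -> hs x <= CW * d x y.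
Hypothesis k_len : forall y, summR (fun z => k (y, z) * d y z ^+ 2) /\
  tsum (fun z => k (y, z) * d y z ^+ 2) <= m y.

(** Local norms are global norms for a truncated weight; in [kball] an edge counts through its
    origin. *)
Definition mball x r y : R := if d x y < r then m y else 0.
Definition kball x r (e : X * X) : R := if d x e.1 < r then k e else 0.

Hypothesis vol_fin : forall x r, summR (mball x r).
Hypothesis vol_ge : forall x r, 0 < r -> cL * r ^+ 2 <= tsum (mball x r).
Hypothesis poinc : forall x r u, 0 < r -> sob m k u -> exists kap : R[i],
  nq (mball x r) (fun y => u y - kap) <= CP * r ^+ 2 * nq (kball x r) (du u).

Let m_ge0 x : 0 <= m x. Proof. exact: ltW. Qed.
Let mb_ge0 x r y : 0 <= mball x r y. Proof. by rewrite /mball; case: ifP. Qed.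
Let kb_ge0 x r e : 0 <= kball x r e. Proof. by rewrite /kball; case: ifP. Qed.

Lemma l2_mball x r u : l2 m u -> l2 (mball x r) u.
Proof.
apply: summR_le => y; rewrite ger0_norm; last by rewrite mulr_ge0 ?rd_ge0.
by rewrite ler_wpM2l ?rd_ge0// /mball; case: ifP.
Qed.

Lemma nq_mball_le x r u : l2 m u -> nq (mball x r) u <= nq m u.
Proof.
move=> lu; apply: le_tsum => //; first exact: l2_mball.
by move=> y; rewrite ler_wpM2l ?rd_ge0// /mball; case: ifP.
Qed.

Lemma l2_kball x r F : l2 k F -> l2 (kball x r) F.
Proof.
apply: summR_le => y; rewrite ger0_norm; last by rewrite mulr_ge0 ?rd_ge0.
by rewrite ler_wpM2l ?rd_ge0// /kball; case: ifP.
Qed.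

Lemma l2_mball_const x r (a : R[i]) : l2 (mball x r) (fun=> a).
Proof. exact: (summRZ (rd a a) (vol_fin x r)). Qed.

Variables (M delta : R) (c : X * X -> R[i]).
Hypothesis delta0 : 0 < delta.
Hypothesis M0 : 0 < M.
Hypothesis cell : elliptic m k M delta c.

(** A bound for the ratio of the distances to the centre of the two ends of an edge that avoids the
    centre ([edge_cmp]). The ratio [Kr] of successive radii is large enough for cutoffs at different
    scales never to vary on a common edge, and [C4] is the error constant of [energy_arith]. *)
Definition Lam := 1 + CW.
Definition Kr := 4 * Lam ^+ 2.
Definition C4 := delta + 3 * M + 16 * M ^+ 2 / delta.
(** Chosen so that the part of the error proportional to the weighted energy,
    [C4 * (8 * CP * Lam ^+ 2 * eps)], is at most delta / 8 and can be absorbed. *)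
Definition eps := Num.min 1 (delta / (64 * C4 * CP * Lam ^+ 2)).
Definition qq := 1 + eps.

Let Lam2 : 2 <= Lam. Proof. by rewrite /Lam; move: CW1; lra. Qed.
Let Lam0 : 0 < Lam. Proof. by move: Lam2; lra. Qed.
Let C40 : 0 < C4.
Proof.
apply: addr_gt0; first by apply: addr_gt0 => //; rewrite mulr_gt0.
by apply: divr_gt0 => //; apply: mulr_gt0 => //; rewrite exprn_gt0.
Qed.
Let den0 : 0 < 64 * C4 * CP * Lam ^+ 2.
Proof.
apply: mulr_gt0; last by rewrite exprn_gt0.
by apply: mulr_gt0 => //; rewrite mulr_gt0.
Qed.
Let eps0 : 0 < eps.
Proof. by rewrite lt_min ltr01 divr_gt0. Qed.
Let eps1 : eps <= 1. Proof. by rewrite ge_min lexx. Qed.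
Let epsC : C4 * (8 * CP * Lam ^+ 2 * eps) <= delta / 8.
Proof.
have : eps <= delta / (64 * C4 * CP * Lam ^+ 2) by rewrite ge_min lexx orbT.
rewrite ler_pdivlMr// => h; lra.
Qed.
Let q1 : 1 < qq. Proof. by rewrite /qq ltrDl. Qed.
Let q2 : qq <= 2. Proof. by rewrite /qq; move: eps1; lra. Qed.
Let q0 : 0 < qq. Proof. exact: lt_trans q1. Qed.
Let Kr16 : 16 <= Kr.
Proof. by rewrite /Kr; have := Lam2; rewrite -(ler_pXn2r (n := 2))// ?nnegrE ?(ltW Lam0)//; lra. Qed.
Let Kr0 : 0 < Kr. Proof. by move: Kr16; lra. Qed.

(* bb j + al j = qq^j: the weight sum_j al j * eta j is qq^j on the ball where
   eta_0, ..., eta_j are all 1. *)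
Let al (j : nat) : R := if j is i.+1 then eps * qq ^+ i else 1.
Let bb (j : nat) : R := if j is i.+1 then qq ^+ i else 0.
Let al_ge0 j : 0 <= al j.
Proof. by case: j => //= j; rewrite mulr_ge0 ?exprn_ge0// ltW. Qed.
Let bb_ge0 j : 0 <= bb j.
Proof. by case: j => //= j; rewrite exprn_ge0// ltW. Qed.
Let bb_al j : bb j + al j = qq ^+ j.
Proof. by case: j => [|j] /=; rewrite ?add0r// exprS /qq; ring. Qed.
Let bbS j : bb j.+1 = bb j + al j. Proof. by rewrite bb_al. Qed.
Let sum_al j : \sum_(i < j) al i = bb j.
Proof. by elim: j => [|j IH]; rewrite ?big_ord0// big_ord_recr /= IH -bbS. Qed.

Let sum_step (f : nat -> R) N j : (j < N)%N -> (forall i, (i < j)%N -> f i = al i) ->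
  (forall i, (j < i)%N -> f i = 0) -> \sum_(i < N) f i = bb j + f j.
Proof.
move=> jN h1 h2; rewrite -(subnKC jN) -(big_mkord predT f) (@big_cat_nat _ _ _ j.+1)//= ?leq_addr//.
rewrite [X in _ + X]big_nat_cond [X in _ + X]big1 ?addr0; last first.
  by move=> i /andP[/andP[ji _] _]; exact: h2.
rewrite big_mkord big_ord_recr /=; congr (_ + _).
by rewrite -sum_al; apply: eq_bigr => i _; exact: h1.
Qed.

(** * Energy decay around a fixed centre *)

Section Fixed.
Variables (x : X) (r0 : R) (J : nat) (u g : X -> R[i]).
Hypothesis r00 : 0 < r0.
Let rr (j : nat) : R := r0 / Kr ^+ j.
Hypothesis rJ : 2 * hs x < rr J.
Hypothesis Gu : opgraph m k c u g.

Let rr_gt0 j : 0 < rr j. Proof. by rewrite divr_gt0// exprn_gt0. Qed.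
Let rr_lt i j : (i < j)%N -> Kr * rr j <= rr i.
Proof.
move=> ij; have K1 : 1 <= Kr by move: Kr16; lra.
rewrite /rr mulrCA ler_pM2l// ler_pdivrMr ?exprn_gt0// mulrC ler_pdivlMr ?exprn_gt0//.
by rewrite -exprS ler_weXn2l.
Qed.
Let rr_mono i j : (i <= j)%N -> rr j <= rr i.
Proof.
rewrite leq_eqVlt => /predU1P[->//|/rr_lt h]; apply: le_trans h.
by rewrite ler_peMl ?(ltW (rr_gt0 _))//; move: Kr16; lra.
Qed.
Let rr_h j : (j <= J)%N -> 2 * hs x < rr j.
Proof. by move=> jJ; apply: lt_le_trans rJ (rr_mono jJ). Qed.

(** 1 up to distance rr j / 2 and 0 from rr j on. By [rJ] it is still 1 at x and at all neighbours
    of x for every j up to J: no edge at the centre lies in a shell, which is why the scales stop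
    above the mesh size. *)
Let eta j z : R := clamp (2 - 2 * d x z / rr j).
Let eta01 j z : 0 <= eta j z <= 1. Proof. exact: clamp01. Qed.
Let eta_1 j z : 2 * d x z <= rr j -> eta j z = 1.
Proof. by move=> h; apply: clamp_1; have : 2 * d x z / rr j <= 1 by [rewrite ler_pdivrMr ?mul1r]; lra. Qed.
Let eta_0 j z : rr j <= d x z -> eta j z = 0.
Proof. by move=> h; apply: clamp_0; have : 2 <= 2 * d x z / rr j by [rewrite ler_pdivlMr//; lra]; lra. Qed.
Let eta_n0 j z : eta j z != 0 -> d x z < rr j.
Proof. by apply: contraNT; rewrite -leNgt => /eta_0 ->. Qed.
Let eta_nest i j z : (i < j)%N -> eta j z != 0 -> eta i z = 1.
Proof.
move=> ij /eta_n0 h; apply: eta_1; have := rr_lt ij; have := rr_gt0 j.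
by have := ler_wpM2r (ltW (rr_gt0 j)) Kr16; lra.
Qed.
Let deta j (e : X * X) : R := eta j e.2 - eta j e.1.
Let deta_lip j e : deta j e ^+ 2 <= 4 / rr j ^+ 2 * d e.1 e.2 ^+ 2.
Proof.
have h : `|deta j e| <= 2 / rr j * d e.1 e.2.
  apply: le_trans (clamp_lip _ _) _.
  have -> : 2 - 2 * d x e.2 / rr j - (2 - 2 * d x e.1 / rr j) = 2 / rr j * (d x e.1 - d x e.2).
    by field; rewrite gt_eqF.
  have c0 : 0 <= 2 / rr j by rewrite divr_ge0// ltW.
  rewrite normrM (ger0_norm c0); apply: (ler_wpM2l c0).
  have := d_tri x e.1 e.2; have := d_tri x e.2 e.1; rewrite (d_sym e.2 e.1) ler_norml; lra.
rewrite -(real_normK (num_real (deta j e))).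
have -> : 4 / rr j ^+ 2 * d e.1 e.2 ^+ 2 = (2 / rr j * d e.1 e.2) ^+ 2.
  by field; rewrite gt_eqF.
by rewrite lerXn2r ?nnegrE// (le_trans _ h).
Qed.

Let edge_cmp y z : 0 < k (y, z) -> y != x -> d x z <= Lam * d x y.
Proof.
move=> ke yx; apply: le_trans (d_tri x y z) _; rewrite /Lam mulrDl mul1r lerD2l.
by apply: le_trans (d_edge ke) _; rewrite d_sym; exact: d_far.
Qed.

(* An edge on which the j-th cutoff varies lies in the j-th shell; the shells
   are disjoint because rr decreases by the factor Kr = 4 Lam^2. *)
Let shell j y z : (j <= J)%N -> 0 < k (y, z) -> deta j (y, z) != 0 ->
  [/\ rr j < 2 * Lam * d x y, rr j < 2 * Lam * d x z, d x y < Lam * rr j & d x z < Lam * rr j].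
Proof.
move=> jJ ke de; have ke' : 0 < k (z, y) by rewrite k_sym.
have hj := rr_h jJ; have rj := rr_gt0 j; have h0 := hs_gt0 x.
have near a b : 0 < k (a, b) -> a = x -> deta j (a, b) = 0 /\ deta j (b, a) = 0.
  move=> kab ax; have := d_edge kab; rewrite ax => db.
  rewrite /deta /= (@eta_1 j x) ?d_refl ?mulr0 ?(ltW rj)// (@eta_1 j b) ?subrr//; lra.
have yx : y != x.
  by apply: contraNneq de => yx; rewrite (near _ _ ke yx).1.
have zx : z != x.
  by apply: contraNneq de => zx; rewrite (near _ _ ke' zx).2.
have c1 := edge_cmp ke yx; have c2 := edge_cmp ke' zx.
have big : rr j < 2 * d x y \/ rr j < 2 * d x z.
  have [h1|h1] := ltP (rr j) (2 * d x y); first by left.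
  have [h2|h2] := ltP (rr j) (2 * d x z); first by right.
  by move: de; rewrite /deta /= (eta_1 h1) (eta_1 h2) subrr eqxx.
have small : d x y < rr j \/ d x z < rr j.
  have [h1|h1] := ltP (d x y) (rr j); first by left.
  have [h2|h2] := ltP (d x z) (rr j); first by right.
  by move: de; rewrite /deta /= (eta_0 h1) (eta_0 h2) subrr eqxx.
have Ly : d x y <= Lam * d x y by rewrite ler_peMl//; move: Lam2; lra.
have Lz : d x z <= Lam * d x z by rewrite ler_peMl//; move: Lam2; lra.
have up a b : a <= Lam * b -> b < rr j -> a < Lam * rr j.
  by move=> h1 h2; apply: le_lt_trans h1 _; rewrite ltr_pM2l.
have Lr : rr j <= Lam * rr j by rewrite ler_peMl ?(ltW rj)//; move: Lam2; lra.
split.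
- by case: big => h; rewrite -mulrA; lra.
- by case: big => h; rewrite -mulrA; lra.
- by case: small => h; [exact: lt_le_trans Lr|exact: up c2 h].
- by case: small => h; [exact: up c1 h|exact: lt_le_trans Lr].
Qed.

Let shell_lo i j y z : (j <= J)%N -> 0 < k (y, z) -> deta j (y, z) != 0 -> (i < j)%N ->
  eta i y = 1 /\ eta i z = 1.
Proof.
move=> jJ ke de ij; have [_ _ h1 h2] := shell jJ ke de; have h := rr_lt ij.
have : 2 * (Lam * rr j) <= Kr * rr j.
  rewrite mulrA ler_pM2r//; rewrite /Kr; have := Lam2; have := sqr_ge0 (Lam - 1); nra.
by move=> ?; split; apply: eta_1; lra.
Qed.

Let shell_hi i j y z : (j <= J)%N -> 0 < k (y, z) -> deta j (y, z) != 0 -> (j < i)%N ->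
  eta i y = 0 /\ eta i z = 0.
Proof.
move=> jJ ke de ij; have [h1 h2 _ _] := shell jJ ke de; have h := rr_lt ij.
have LL : 2 * Lam <= Kr by rewrite /Kr; have := Lam2; have := sqr_ge0 (Lam - 1); nra.
have far a : rr j < 2 * Lam * a -> rr i <= a.
  move=> ha; rewrite -(ler_pM2l Kr0); apply: le_trans h _; apply: le_trans (ltW ha) _.
  rewrite ler_wpM2r//; rewrite -(pmulr_rge0 _ (_ : 0 < 2 * Lam)); last by rewrite mulr_gt0.
  exact: le_trans (ltW (rr_gt0 j)) (ltW ha).
by split; apply: eta_0; exact: far.
Qed.


Variable kap : nat -> R[i].
Hypothesis kap0 : kap 0%N = 0.
Hypothesis kapP : forall j, nq (mball x (Lam * rr j.+1)) (fun y => u y - kap j.+1) <=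
  CP * (Lam * rr j.+1) ^+ 2 * nq (kball x (Lam * rr j.+1)) (du u).

Let su : sob m k u. Proof. by have [] := Gu. Qed.
Let w j (z : X) : R[i] := u z - kap j.
Let Hc z : R := \sum_(j < J.+1) al j * eta j z.
Let Err (e : X * X) : R[i] := \sum_(j < J.+1) (al j * deta j e)%:C%C * w j e.1.
(* dv = Hc du + Err and, the shells being disjoint, dv2 = Hc^2 du + O(Hc) Err: the
   coercivity inequality for v and the equation tested with v2 both control Hc^2 |du|^2. *)
Let v z : R[i] := \sum_(j < J.+1) (al j * eta j z)%:C%C * w j z.
(** The increment (bb j + al j eta j)^2 - bb j^2: the cutoffs being nested, these increments add up
    to Hc^2, and each scale can keep its own constant kap j in [v2]. *)
Let th j z : R := al j * eta j z * (2 * bb j + al j * eta j z).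
Let v2 z : R[i] := \sum_(j < J.+1) (th j z)%:C%C * w j z.

Let ale0 j z : 0 <= al j * eta j z.
Proof. by rewrite mulr_ge0// ?al_ge0//; case/andP: (eta01 j z). Qed.
Let ale1 j z : al j * eta j z <= al j.
Proof. by apply: ler_piMr; [exact: al_ge0|case/andP: (eta01 j z)]. Qed.
Let Hc_ge0 z : 0 <= Hc z. Proof. by apply: sumr_ge0 => j _. Qed.
Let Hc_le z : Hc z <= qq ^+ J.
Proof.
have -> : qq ^+ J = \sum_(j < J.+1) al j by rewrite sum_al.
by apply: ler_sum => j _; exact: ale1.
Qed.

Let du_v e : du v e = (Hc e.2)%:C%C * du u e + Err e.
Proof.
rewrite /du /v /Err /Hc rmorph_sum mulr_suml -sumrB -big_split /=.
apply: eq_bigr => j _; rewrite /w /deta !rmorphM rmorphB /=; ring.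
Qed.

Let Hc_sq z : \sum_(j < J.+1) th j z = Hc z ^+ 2.
Proof.
rewrite /Hc; elim: J.+1 => [|N IH]; first by rewrite !big_ord0 expr0n.
rewrite !big_ord_recr /= IH /th; have [->|en] := eqVneq (eta N z) 0.
  by rewrite !mulr0 mul0r !addr0.
have -> : \sum_(i < N) al i * eta i z = bb N.
  by rewrite -sum_al; apply: eq_bigr => i _; rewrite (eta_nest _ en)// mulr1.
ring.
Qed.

Let Hc_shell j y z : (j <= J)%N -> 0 < k (y, z) -> deta j (y, z) != 0 ->
  Hc y = bb j + al j * eta j y /\ Hc z = bb j + al j * eta j z.
Proof.
move=> jJ ke de; split.
  apply: (sum_step (f := fun i => al i * eta i y)) => // i ij.
    by rewrite (shell_lo jJ ke de ij).1 mulr1.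
  by rewrite (shell_hi jJ ke de ij).1 mulr0.
apply: (sum_step (f := fun i => al i * eta i z)) => // i ij.
  by rewrite (shell_lo jJ ke de ij).2 mulr1.
by rewrite (shell_hi jJ ke de ij).2 mulr0.
Qed.

(** On an edge of the j-th shell Hc equals bb j + al j eta j at both ends, so th j is Hc^2 minus a
    constant and the difference of squares factors. *)
Let dth j y z : (j <= J)%N -> 0 < k (y, z) ->
  th j z - th j y = al j * deta j (y, z) * (Hc y + Hc z).
Proof.
move=> jJ ke; have [d0|dn] := eqVneq (deta j (y, z)) 0.
  have E : eta j z = eta j y by apply/eqP; rewrite -subr_eq0; apply/eqP.
  by rewrite d0 mulr0 mul0r /th E subrr.
have [-> ->] := Hc_shell jJ ke dn; rewrite /th /deta /=; ring.
Qed.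

Let du_v2 e : 0 < k e -> du v2 e =
  ((Hc e.2) ^+ 2)%:C%C * du u e + (Hc e.1 + Hc e.2)%:C%C * Err e.
Proof.
case: e => y z ke; rewrite -Hc_sq rmorph_sum mulr_suml [X in _ + X]mulr_sumr -big_split /=.
rewrite /du /v2 -sumrB; apply: eq_bigr => j _ /=.
have jJ : (j <= J)%N by rewrite -ltnS.
have -> : (th j z)%:C%C = (th j y)%:C%C + (al j * deta j (y, z))%:C%C * (Hc y + Hc z)%:C%C :> R[i].
  by rewrite -rmorphM -rmorphD /= -(dth jJ ke) addrC subrK.
by rewrite /w /=; ring.
Qed.

Let at_most_one y z : 0 < k (y, z) -> (forall j : 'I_J.+1, deta j (y, z) = 0) \/
  exists j : 'I_J.+1, forall i : 'I_J.+1, i != j -> deta i (y, z) = 0.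
Proof.
move=> ke; have [/existsP[j dj]|] := boolP [exists j : 'I_J.+1, deta j (y, z) != 0]; last first.
  by rewrite negb_exists => /forallP h; left=> j; have := h j; rewrite negbK => /eqP.
right; exists j => i ij; have jJ : (j <= J)%N by rewrite -ltnS.
have : (i < j)%N || (j < i)%N by rewrite -neq_ltn.
case/orP=> h; rewrite /deta.
  by have [/= -> ->] := shell_lo jJ ke dj h; rewrite subrr.
by have [/= -> ->] := shell_hi jJ ke dj h; rewrite subrr.
Qed.

Let A0 := nq (mball x (Lam * r0)) u / r0 ^+ 2.
Let EB j := nq (kball x (Lam * rr j)) (du u).
Let XX := nq k (fun e => (Hc e.2)%:C%C * du u e).

Let l2Hdu (P : X * X -> R) (B : R) : (forall e, `|P e| <= B) -> l2 k (fun e => (P e)%:C%C * du u e).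
Proof. by move=> PB; apply: (l2_bmul k_ge0 (B := B)) su.2 => e _; rewrite cmodR. Qed.

Let swp (e : X * X) := (e.2, e.1).
Let swpK : cancel swp swp. Proof. by case. Qed.
Let k_swp e : k (swp e) = k e. Proof. by case: e => y z; exact: k_sym. Qed.

Let nq_swp F : l2 k F -> l2 k (fun e => F (swp e)) /\ nq k (fun e => F (swp e)) = nq k F.
Proof.
move=> lF; have F0 e : 0 <= rd (F e) (F e) * k e by rewrite mulr_ge0 ?rd_ge0.
have := tsum_swap swpK swpK F0 lF.
rewrite (_ : _ \o swp = fun e => rd (F (swp e)) (F (swp e)) * k e)//.
by apply/funext => e /=; rewrite k_swp.
Qed.

Let XX_swp : l2 k (fun e => (Hc e.1)%:C%C * du u e) /\ nq k (fun e => (Hc e.1)%:C%C * du u e) = XX.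
Proof.
have Hn z : `|Hc z| <= qq ^+ J by rewrite (ger0_norm (Hc_ge0 z)); exact: Hc_le.
have B2 (e : X * X) : `|Hc e.2| <= qq ^+ J by exact: Hn.
have [h1 h2] := nq_swp (l2Hdu B2).
have E : nq k (fun e => (Hc e.1)%:C%C * du u e) = nq k (fun e => (Hc (swp e).2)%:C%C * du u (swp e)).
  rewrite /nq /ip; congr tsum; apply/funext => e.
  by rewrite (_ : du u (swp e) = - du u e) ?mulrN ?rdNl ?(rdC _ (- _)) ?rdNl ?opprK// /du opprB.
by split; [apply: l2Hdu => e; exact: Hn|rewrite E h2].
Qed.

Let lw j : l2 (mball x (Lam * rr j)) (w j).
Proof. by apply: l2B => //; [exact/l2_mball/su.1|exact: l2_mball_const]. Qed.

Let T j (e : X * X) := rd (w j e.1) (w j e.1) * (k e * deta j e ^+ 2).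

(** The cutoff is 2 / rr j Lipschitz, and conductances times squared edge lengths sum to at most m y
    around y ([k_len]); the shell keeps the origin of the edge in the ball of radius Lam * rr j. *)
Let T_bound j : (j <= J)%N -> summR (T j) /\
  tsum (T j) <= 4 / rr j ^+ 2 * nq (mball x (Lam * rr j)) (w j).
Proof.
move=> jJ; set rho := Lam * rr j.
pose b (e : X * X) := kball x rho e * d e.1 e.2 ^+ 2.
have b0 e : 0 <= b e by rewrite mulr_ge0 ?sqr_ge0.
have hb y : summR (fun z => b (y, z)) /\ tsum (fun z => b (y, z)) <= 1 * mball x rho y.
  rewrite /b /kball /mball /= mul1r; case: ifP => _; first exact: k_len.
  by under eq_fun do rewrite mul0r; rewrite tsum0; split => //; exact: summR0.
have [s1 s2] := pair_bound b0 hb (lw j).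
have c0 : 0 <= 4 / rr j ^+ 2 by rewrite divr_ge0 ?sqr_ge0.
have pt e : T j e <= 4 / rr j ^+ 2 * (rd (w j e.1) (w j e.1) * b e).
  have -> : 4 / rr j ^+ 2 * (rd (w j e.1) (w j e.1) * b e) =
    rd (w j e.1) (w j e.1) * (4 / rr j ^+ 2 * b e) by ring.
  apply: ler_wpM2l; first exact: rd_ge0.
  have := k_ge0 e; rewrite le_eqVlt => /predU1P[<-|ke]; first by rewrite mul0r mulr_ge0.
  have [->|dn] := eqVneq (deta j e) 0; first by rewrite expr0n mulr0 mulr_ge0.
  case: e ke dn => y z ke dn; have [_ _ h _] := shell jJ ke dn.
  rewrite /b /kball /rho /= h [leRHS]mulrCA; apply: (ler_wpM2l (k_ge0 (y, z))); exact: deta_lip.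
have T0 e : 0 <= T j e by rewrite mulr_ge0 ?rd_ge0// mulr_ge0 ?sqr_ge0.
have sT : summR (T j).
  by apply: summR_le (summRZ (4 / rr j ^+ 2) s1) => e; rewrite ger0_norm.
split=> //; apply: le_trans (le_tsum sT (summRZ (4 / rr j ^+ 2) s1) pt) _.
by rewrite (tsumZ _ s1); apply: ler_wpM2l => //; rewrite mul1r in s2.
Qed.

Let Err_pt e : rd (Err e) (Err e) * k e <= \sum_(j < J.+1) al j ^+ 2 * T j e.
Proof.
have T0 j : 0 <= al j ^+ 2 * T j e.
  by apply: mulr_ge0; rewrite ?sqr_ge0// /T mulr_ge0 ?rd_ge0// mulr_ge0 ?sqr_ge0.
have := k_ge0 e; rewrite le_eqVlt => /predU1P[<-|ke].
  by rewrite mulr0; apply: sumr_ge0 => j _.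
case: e ke T0 => y z ke T0; case: (at_most_one ke) => [h|[j h]].
  rewrite /Err big1 ?rd0l ?mul0r; first by apply: sumr_ge0 => j _.
  by move=> j _; rewrite h mulr0 mul0r.
rewrite /Err (bigD1 j)//= [X in rd (_ + X)]big1 ?addr0; last first.
  by move=> i ij; rewrite h// mulr0 mul0r.
rewrite [X in rd _ (_ + X)]big1 ?addr0; last first.
  by move=> i ij; rewrite h// mulr0 mul0r.
rewrite (bigD1 j)//= rd_mul2 cmodR real_normK ?num_real//.
have -> : al j ^+ 2 * T j (y, z) = (al j * deta j (y, z)) ^+ 2 * rd (w j y) (w j y) * k (y, z).
  by rewrite /T /=; ring.
by rewrite lerDl; apply: sumr_ge0 => i _.
Qed.

Let sumT : summR (fun e => \sum_(j < J.+1) al j ^+ 2 * T j e).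
Proof.
rewrite (_ : (fun e => _) = fun e => \sum_(j <- enum 'I_J.+1) al j ^+ 2 * T j e); last first.
  by apply/funext => e; rewrite big_enum.
by apply: summR_sum => j; apply: summRZ; apply: (T_bound _).1; rewrite -ltnS.
Qed.

Let lErr : l2 k Err.
Proof.
apply: summR_le sumT => e; rewrite ger0_norm ?Err_pt//.
by rewrite mulr_ge0 ?rd_ge0.
Qed.

(** The source of smallness. After exchanging the sums, an edge collects eps^2 q^{2i} over the balls
    that contain its origin, and each such q^i is at most Hc there. The geometric sum is of order
    eps^2 Hc^2 / (q^2 - 1), and q^2 - 1 >= 2 eps leaves one factor eps. *)
Let sumEB : \sum_(i < J) (eps * qq ^+ i) ^+ 2 * EB i.+1 <= 2 * eps * XX.
Proof.
have [lX EX] := XX_swp; rewrite -EX.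
pose f (e : X * X) := \sum_(i < J) (eps * qq ^+ i) ^+ 2 * (rd (du u e) (du u e) * kball x (Lam * rr i.+1) e).
have sf i : summR (fun e => rd (du u e) (du u e) * kball x (Lam * rr i) e) by exact: l2_kball su.2.
have E : \sum_(i < J) (eps * qq ^+ i) ^+ 2 * EB i.+1 = tsum f.
  transitivity (tsum (fun e => \sum_(i <- enum 'I_J) (eps * qq ^+ i) ^+ 2 * (rd (du u e) (du u e) * kball x (Lam * rr i.+1) e))).
    rewrite tsum_sum; last by move=> i; exact: (summRZ _ (sf i.+1)).
    by rewrite big_enum; apply: eq_bigr => i _; rewrite tsumZ//; exact: sf.
  by congr tsum; apply/funext => e; rewrite big_enum.
have sF : summR f.
  rewrite (_ : f = fun e => \sum_(i <- enum 'I_J) (eps * qq ^+ i) ^+ 2 * (rd (du u e) (du u e) * kball x (Lam * rr i.+1) e)).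
    by apply: summR_sum => i; exact: (summRZ _ (sf i.+1)).
  by apply/funext => e; rewrite big_enum.
have pt e : f e <= 2 * eps * (rd ((Hc e.1)%:C%C * du u e) ((Hc e.1)%:C%C * du u e) * k e).
  pose P i := (i < J)%N && (d x e.1 < Lam * rr i.+1).
  have HP i : P i -> qq ^+ i <= Hc e.1.
    move=> /andP[iJ h]; rewrite -/(bb i.+1) -sum_al /Hc -(subnKC (leqW iJ)) big_split_ord /=.
    apply: (@le_trans _ _ (\sum_(j < i.+1) al j * eta j e.1)).
      rewrite le_eqVlt; apply/orP; left; apply/eqP; apply: eq_bigr => j _.
      rewrite eta_1 ?mulr1//; have := rr_mono (ltnW (ltn_ord j)); have := rr_lt (ltn_ord j).
      have : 2 * (Lam * rr i.+1) <= Kr * rr i.+1.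
        by rewrite mulrA ler_pM2r//; rewrite /Kr; have := Lam2; have := sqr_ge0 (Lam - 1); nra.
      lra.
    by rewrite lerDl; apply: sumr_ge0 => j _; exact: (ale0 (i.+1 + j)%N e.1).
  have gi := geom_indicator J q1 (Hc_ge0 e.1) HP.
  set S := \sum_(i < J) _ in gi.
  have S0 : 0 <= S.
    by apply: sumr_ge0 => i _; rewrite mulr_ge0 ?exprn_ge0 ?(ltW q0)//; case: (P i).
  have fE : f e = eps ^+ 2 * S * (rd (du u e) (du u e) * k e).
    rewrite /f /S mulr_sumr mulr_suml; apply: eq_bigr => i _.
    rewrite /kball /P ltn_ord /=; case: ifP => _; last by rewrite /= !mulr0 mul0r.
    by rewrite /= mulr1 mulnC exprM exprMn; ring.
  rewrite fE rd_mul2 cmodR real_normK ?num_real//.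
  have rk : 0 <= rd (du u e) (du u e) * k e by rewrite mulr_ge0 ?rd_ge0.
  have -> : 2 * eps * (Hc e.1 ^+ 2 * rd (du u e) (du u e) * k e) = 2 * eps * Hc e.1 ^+ 2 * (rd (du u e) (du u e) * k e) by ring.
  apply: (ler_wpM2r rk).
  have h1 : (2 * eps) * S <= (qq ^+ 2 - 1) * S.
    apply: (ler_wpM2r S0); rewrite /qq; have := sqr_ge0 eps; lra.
  have h2 : qq ^+ 2 * Hc e.1 ^+ 2 <= 4 * Hc e.1 ^+ 2.
    apply: (ler_wpM2r (sqr_ge0 _)); have := q2; have := q0; nra.
  have h3 : 2 * eps * S <= 4 * Hc e.1 ^+ 2 by lra.
  have := ler_wpM2l (ltW eps0) h3; lra.
rewrite E; apply: le_trans (le_tsum sF (summRZ (2 * eps) lX) pt) _.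
by rewrite (tsumZ _ lX).
Qed.

(** Poincare's inequality at each scale cancels the 1 / rr^2 of the cutoff, so that only the
    weighted sum of local energies and the term of scale 0 remain. *)
Let Err_bound : nq k Err <= 4 * A0 + 8 * CP * Lam ^+ 2 * eps * XX.
Proof.
have h1 : nq k Err <= \sum_(j < J.+1) al j ^+ 2 * tsum (T j).
  apply: le_trans (le_tsum lErr sumT Err_pt) _.
  rewrite (_ : (fun e => _) = fun e => \sum_(j <- enum 'I_J.+1) al j ^+ 2 * T j e); last first.
    by apply/funext => e; rewrite big_enum.
  have sT (j : 'I_J.+1) : summR (T j) by apply: (T_bound _).1; rewrite -ltnS.
  rewrite tsum_sum => [|j]; last exact: (summRZ _ (sT j)).
  by rewrite big_enum /= le_eqVlt; apply/orP; left; apply/eqP; apply: eq_bigr => j _; rewrite tsumZ.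
apply: le_trans h1 _; rewrite big_ord_recl /=; apply: lerD.
  rewrite expr1n mul1r; apply: le_trans (T_bound (leq0n J)).2 _.
  have -> : w 0%N = u by apply/funext => z; rewrite /w kap0 subr0.
  by rewrite /A0 /rr expr0 divr1 mulrCA mulrC.
have -> : 8 * CP * Lam ^+ 2 * eps * XX = 4 * CP * Lam ^+ 2 * (2 * eps * XX) by ring.
have c0 : 0 <= 4 * CP * Lam ^+ 2 by rewrite mulr_ge0 ?sqr_ge0// mulr_ge0// ltW.
apply: le_trans (ler_wpM2l c0 sumEB).
rewrite mulr_sumr; apply: ler_sum => i _; rewrite mulrCA.
apply: ler_wpM2l; first exact: sqr_ge0.
apply: le_trans (T_bound (ltn_ord i)).2 _.
have r1 := rr_gt0 i.+1; have r2 : 0 <= 4 / rr i.+1 ^+ 2 by rewrite divr_ge0 ?sqr_ge0.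
apply: le_trans (ler_wpM2l r2 (kapP i)) _.
by rewrite le_eqVlt; apply/orP; left; apply/eqP; rewrite /EB; field; rewrite gt_eqF.
Qed.


Let nm_mball_mono r r' f : l2 m f -> r <= r' -> nm (mball x r) f <= nm (mball x r') f.
Proof.
move=> lf rr'; apply: ler_wsqrtr; apply: le_tsum; [exact: l2_mball|exact: l2_mball|].
move=> z; apply: (ler_wpM2l (rd_ge0 _)); rewrite /mball.
by case: ifP => [h|_]; [rewrite (lt_le_trans h rr')|case: ifP].
Qed.

Let lg : l2 m g. Proof. by have [] := Gu. Qed.
Let g1 := nm (mball x (Lam * r0)) g.

Let rr_le0 j : Lam * rr j <= Lam * r0.
Proof. by rewrite ler_pM2l//; have := rr_mono (leq0n j); rewrite /rr expr0 divr1. Qed.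

Let cutw j (P : X -> R) (B : R) : (forall z, `|P z| <= B) -> (forall z, P z != 0 -> d x z < rr j) ->
  l2 m (fun z => (P z)%:C%C * w j z) /\
  ip m g (fun z => (P z)%:C%C * w j z) <= B * (g1 * nm (mball x (Lam * rr j)) (w j)).
Proof.
move=> PB Ps; have Lr : rr j <= Lam * rr j by rewrite ler_peMl ?(ltW (rr_gt0 j))//; move: Lam2; lra.
have B0 : 0 <= B by exact: le_trans (PB x).
have mE z : P z != 0 -> mball x (Lam * rr j) z = m z.
  by move=> /Ps h; rewrite /mball (lt_le_trans h Lr).
have lP : l2 (mball x (Lam * rr j)) (fun z => (P z)%:C%C * w j z).
  by apply: (l2_bmul (mb_ge0 x (Lam * rr j)) (B := B)) (lw j) => z _; rewrite cmodR.
have lPm : l2 m (fun z => (P z)%:C%C * w j z).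
  move: lP; congr summR; apply/funext => z; have [->|Pz] := eqVneq (P z) 0.
    by rewrite mul0r rd0l !mul0r.
  by rewrite mE.
split=> //.
have -> : ip m g (fun z => (P z)%:C%C * w j z) =
    ip (mball x (Lam * rr j)) g (fun z => (P z)%:C%C * w j z).
  rewrite /ip; congr tsum; apply/funext => z; have [->|Pz] := eqVneq (P z) 0.
    by rewrite mul0r rdC rd0l !mul0r.
  by rewrite mE.
apply: le_trans (ip_CS_le (mb_ge0 x (Lam * rr j)) (l2_mball _ _ lg) lP) _.
have h1 : nm (mball x (Lam * rr j)) g <= g1 by apply: nm_mball_mono => //; exact: rr_le0.
have h2 : nm (mball x (Lam * rr j)) (fun z => (P z)%:C%C * w j z) <= B * nm (mball x (Lam * rr j)) (w j).
  by apply: (nm_bmul (mb_ge0 x (Lam * rr j)) B0) (lw j) => z _; rewrite cmodR.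
apply: le_trans (ler_pM (nm_ge0 _ _) (nm_ge0 _ _) h1 h2) _.
by rewrite mulrCA.
Qed.

Let al_cut j z : al j * eta j z != 0 -> d x z < rr j.
Proof. by move=> h; apply: eta_n0; apply: contraNneq h => ->; rewrite mulr0. Qed.

Let th_cut j z : th j z != 0 -> d x z < rr j.
Proof. by move=> h; apply: al_cut; apply: contraNneq h; rewrite /th => ->; rewrite mul0r. Qed.

Let th_bd j z : `|th j z| <= 2 * (al j * qq ^+ j).
Proof.
have h1 := ale0 j z; have h2 := ale1 j z; have h3 := bb_ge0 j; have h4 := al_ge0 j.
have h5 : 0 <= 2 * bb j + al j * eta j z by move: h1 h3; lra.
rewrite /th (ger0_norm (mulr_ge0 h1 h5)) -bb_al.
have : al j * eta j z * (2 * bb j + al j * eta j z) <= al j * (2 * bb j + al j).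
  by apply: ler_pM => //; move: h2; lra.
have := mulr_ge0 h4 h4; lra.
Qed.

Let al_bd j z : `|al j * eta j z| <= al j.
Proof. by rewrite (ger0_norm (ale0 j z)); exact: ale1. Qed.

Let lv : l2 m v.
Proof. by apply: l2_sum => // j; exact: (cutw (al_bd j) (@al_cut j)).1. Qed.

Let lv2 : l2 m v2.
Proof. by apply: l2_sum => // j; exact: (cutw (th_bd j) (@th_cut j)).1. Qed.

Let P (e : X * X) := (Hc e.2)%:C%C * du u e.
(** [Err] read from the other end: reversing the edge changes only the sign, so the two have the
    same norm. It arises because the Leibniz rule for Hc^2 is not symmetric in the ends of the
    edge. *)
Let Qz (e : X * X) : R[i] := \sum_(j < J.+1) (al j * deta j e)%:C%C * w j e.2.

Let Hn z : `|Hc z| <= qq ^+ J.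
Proof. by rewrite (ger0_norm (Hc_ge0 z)); exact: Hc_le. Qed.

Let lP : l2 k P. Proof. by apply: l2Hdu => e; exact: Hn. Qed.

Let Qz_Err : l2 k Qz /\ nq k Qz = nq k Err.
Proof.
have [h1 h2] := nq_swp lErr.
have E : Qz = fun e => - Err (swp e).
  apply/funext => e; rewrite /Qz /Err -sumrN; apply: eq_bigr => j _.
  by rewrite /deta /= -mulNr -rmorphN -mulrN opprB.
rewrite E; split; first exact: l2N.
by rewrite -h2 /nq /ip; congr tsum; apply/funext => e; rewrite rdNl rdC rdNl opprK.
Qed.

Let dv : du v = fun e => P e + Err e.
Proof. by apply/funext => e; rewrite du_v. Qed.

Let sv : sob m k v.
Proof. by split => //; rewrite dv; exact: l2D. Qed.

Let sv2 : sob m k v2.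
Proof.
split => //; pose F e := (Hc e.2 ^+ 2)%:C%C * du u e + (Hc e.1 + Hc e.2)%:C%C * Err e.
apply: (l2_ext k_ge0 (F := F)) => [e ke|]; first by rewrite du_v2.
apply: l2D => //.
  apply: (l2Hdu (B := qq ^+ J ^+ 2)) => e; rewrite normrX lerXn2r ?nnegrE ?exprn_ge0 ?(ltW q0)//; exact: Hn.
apply: (l2_bmul k_ge0 (B := qq ^+ J + qq ^+ J)) lErr => e _; rewrite cmodR.
by apply: le_trans (ler_normD _ _) _; apply: lerD; exact: Hn.
Qed.

Let cb := cell.1.
Let M00 : 0 <= M. Proof. exact: ltW. Qed.

(** H1 + H2 is written as 2 H2 - (H2 - H1), so that every remaining factor is Hc du, [Err] or [Qz],
    all of them square summable with controlled norm. *)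
Let rd_split (C D E : R[i]) (H1 H2 kk : R) :
  rd (C * D) ((H2 ^+ 2)%:C%C * D + (H1 + H2)%:C%C * E) * kk =
  rd (C * (H2%:C%C * D)) (H2%:C%C * D) * kk + 2 * (rd (C * (H2%:C%C * D)) E * kk) -
  rd (C * ((H2 - H1)%:C%C * D + E)) E * kk + rd (C * E) E * kk.
Proof. by case: C => ? ?; case: D => ? ?; case: E => ? ?; rewrite /rd /=; ring. Qed.

Let form_v2 : form k c u v2 = ip k (fun e => c e * P e) P + 2 * ip k (fun e => c e * P e) Err -
  ip k (fun e => c e * Qz e) Err + ip k (fun e => c e * Err e) Err.
Proof.
have lcP := l2_cmul k_ge0 cb lP; have lcQ := l2_cmul k_ge0 cb lErr.
have lcZ := l2_cmul k_ge0 cb Qz_Err.1.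
have s1 := summ_ip k_ge0 lcP lP; have s2 := summ_ip k_ge0 lcP lErr.
have s3 := summ_ip k_ge0 lcZ lErr; have s4 := summ_ip k_ge0 lcQ lErr.
have s2' := summRZ 2 s2.
rewrite /ip -(tsumZ 2 s2) -(tsumD s1 s2') -(tsumB (summRD s1 s2') s3).
rewrite -(tsumD (summRB (summRD s1 s2') s3) s4) /form /ip; congr tsum; apply/funext => e.
have := k_ge0 e; rewrite le_eqVlt => /predU1P[<-|ke]; first by rewrite !mulr0; ring.
rewrite du_v2// rd_split; have -> : (Hc e.2 - Hc e.1)%:C%C * du u e + Err e = Qz e; last by [].
rewrite /Hc -sumrB rmorph_sum mulr_suml -big_split /=; apply: eq_bigr => j _.
by rewrite /w /deta /du -mulrBr rmorphM rmorphB /=; ring.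
Qed.

Let energy0 : delta / 8 * XX <= ip m g v2 + 4 * C4 * A0.
Proof.
have [lZ EZ] := Qz_Err.
have E2 : form k c u v2 = ip m g v2 by have [_ _ h] := Gu; exact: h.
have lcP := l2_cmul k_ge0 cb lP; have lcQ := l2_cmul k_ge0 cb lErr.
have hn : nm k P ^+ 2 / 2 - nm k Err ^+ 2 <= nq k (du v).
  rewrite dv nqD// !(nm2 k_ge0); have := ip_CS k_ge0 lP lErr; rewrite ler_norml => /andP[h _].
  have := sqr_ge0 (nm k P - 2 * nm k Err); rewrite -(nm2 k_ge0 P) -(nm2 k_ge0 Err); lra.
have hG : delta * nq k (du v) <= ip k (fun e => c e * P e) P + ip k (fun e => c e * Err e) P +
    ip k (fun e => c e * P e) Err + ip k (fun e => c e * Err e) Err.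
  apply: le_trans (cell.2 _ sv) _; rewrite /form dv.
  rewrite (ip_extl _ _ (F' := fun e => c e * P e + c e * Err e)); last by move=> e; rewrite mulrDr.
  rewrite (ipDl k_ge0 lcP lcQ (l2D k_ge0 lP lErr)) (ipDr k_ge0 lP lErr lcP) (ipDr k_ge0 lP lErr lcQ); lra.
have nZ : nm k Qz = nm k Err by rewrite /nm EZ.
have b1 := ip_cmul_le k_ge0 cb M00 lErr lP; have b2 := ip_cmul_le k_ge0 cb M00 lP lErr.
have b3 := ip_cmul_le k_ge0 cb M00 lErr lErr; have b4 := ip_cmul_le k_ge0 cb M00 lZ lErr.
rewrite nZ in b4.
have := energy_arith M00 delta0 (nm_ge0 _ _) (nm_ge0 _ _) hn hG (etrans (esym E2) form_v2) b1 b2 b3 b4.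
rewrite -/C4 !(nm2 k_ge0) -/XX => key; have hE := ler_wpM2l (ltW C40) Err_bound.
have XX0 : 0 <= XX by exact: nq_ge0.
exact: absorb_arith epsC key hE.
Qed.

Let EB_decay i : (i < J)%N -> (eps * qq ^+ i) ^+ 2 * EB i.+1 <= 2 * eps * XX.
Proof.
move=> iJ; apply: le_trans sumEB; rewrite (bigD1 (Ordinal iJ))//= lerDl.
by apply: sumr_ge0 => j _; apply: mulr_ge0; [exact: sqr_ge0|exact: nq_ge0].
Qed.

Let geom_half (t : R) n : 0 <= t -> 3 * t <= 1 -> \sum_(i < n) t ^+ i.+1 <= 2^-1.
Proof.
move=> t0 t3; suff h : \sum_(i < n) t ^+ i.+1 <= 2^-1 * (1 - t ^+ n).
  by apply: le_trans h _; have := exprn_ge0 n t0; lra.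
elim: n => [|n IH]; first by rewrite big_ord0 expr0 subrr mulr0.
rewrite big_ord_recr /= exprS; have := exprn_ge0 n t0 => h; have := ler_wpM2r h t3; lra.
Qed.

(** At scale i + 1 the weight of the test function grows like q^{2i}, while Poincare's inequality
    supplies the radius r0 / Kr^{i+1} and [EB_decay] a factor q^-i. The scales thus sum like (q /
    Kr)^i, and XX enters only through its square root, which can be absorbed. *)
Let F_bound : ip m g v2 <= 2 * g1 * nm (mball x (Lam * r0)) u +
  2 * (Num.sqrt CP * Lam * r0) * g1 * Num.sqrt XX.
Proof.
have g10 : 0 <= g1 by exact: nm_ge0.
have X0 := sqrtr_ge0 XX; have C0 := sqrtr_ge0 CP.
rewrite /v2 (ip_sumr m_ge0 _ lg); last by move=> j; exact: (cutw (th_bd j) (@th_cut j)).1.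
have hj j := (cutw (th_bd j) (@th_cut j)).2.
apply: le_trans (ler_sum _ (fun (j : 'I_J.+1) _ => hj j)) _.
rewrite big_ord_recl /=; apply: lerD.
  have -> : w 0%N = u by apply/funext => z; rewrite /w kap0 subr0.
  by rewrite /rr expr0 divr1; lra.
have q3 : 3 * (qq / Kr) <= 1.
  by rewrite mulrA ler_pdivrMr// mul1r; have := q2; have := Kr16; lra.
have qK : 0 <= qq / Kr by rewrite divr_ge0 ?ltW.
have b (i : 'I_J) : 2 * (eps * qq ^+ i * qq ^+ i.+1) * (g1 * nm (mball x (Lam * rr i.+1)) (w i.+1)) <=
    (4 * (Num.sqrt CP * Lam * r0) * g1 * Num.sqrt XX) * (qq / Kr) ^+ i.+1.
  have p1 : 0 <= eps * qq ^+ i by rewrite mulr_ge0 ?exprn_ge0 ?ltW.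
  have p2 : 0 <= Lam * rr i.+1 by rewrite mulr_ge0 ?ltW.
  have n1 : nm (mball x (Lam * rr i.+1)) (w i.+1) <= Num.sqrt CP * (Lam * rr i.+1) * Num.sqrt (EB i.+1).
    have := ler_wsqrtr (kapP i).
    rewrite (sqrtrM _ (mulr_ge0 (ltW CP0) (sqr_ge0 _))) (sqrtrM _ (ltW CP0)) sqrtr_sqr.
    by rewrite (ger0_norm p2).
  have n2 : eps * qq ^+ i * Num.sqrt (EB i.+1) <= 2 * Num.sqrt XX.
    rewrite -(ler_pXn2r (n := 2))// ?nnegrE ?(mulr_ge0 p1 (sqrtr_ge0 _)) ?mulr_ge0//.
    rewrite exprMn sqr_sqrtr ?nq_ge0// [leRHS]exprMn sqr_sqrtr ?nq_ge0//.
    apply: le_trans (EB_decay (ltn_ord i)) _; apply: ler_wpM2r; first exact: nq_ge0.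
    by have := eps1; lra.
  have qi : 0 <= qq ^+ i.+1 by rewrite exprn_ge0 ?ltW.
  have -> : (4 * (Num.sqrt CP * Lam * r0) * g1 * Num.sqrt XX) * (qq / Kr) ^+ i.+1 =
     (2 * qq ^+ i.+1 * g1 * Num.sqrt CP * (Lam * rr i.+1)) * (2 * Num.sqrt XX).
    by rewrite /rr expr_div_n; ring.
  have p3 : 0 <= 2 * qq ^+ i.+1 * g1 * Num.sqrt CP * (Lam * rr i.+1).
    by apply: mulr_ge0 => //; apply: mulr_ge0 => //; apply: mulr_ge0 => //; apply: mulr_ge0.
  apply: le_trans (ler_wpM2l p3 n2).
  have p4 : 0 <= 2 * (eps * qq ^+ i * qq ^+ i.+1) * g1.
    by apply: mulr_ge0 => //; apply: mulr_ge0 => //; exact: mulr_ge0.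
  rewrite [leLHS]mulrA; apply: le_trans (ler_wpM2l p4 n1) _.
  by rewrite le_eqVlt; apply/orP; left; apply/eqP; ring.
apply: le_trans (ler_sum _ (fun i _ => b i)) _; rewrite -mulr_sumr.
have c0 : 0 <= 4 * (Num.sqrt CP * Lam * r0) * g1 * Num.sqrt XX.
  by apply: mulr_ge0 => //; apply: mulr_ge0 => //; rewrite mulr_ge0// mulr_ge0 ?(ltW r00)// mulr_ge0// ltW.
apply: le_trans (ler_wpM2l c0 (geom_half J qK q3)) _; lra.
Qed.

(** The last factor bounds delta / 16 times [XX]; the quotient is (2 / eps) (16 / delta), where 2 /
    eps passes from [XX] to the energy of one ball. *)
Definition CE := 32 / (eps * delta) * (4 * C4 + 2 + 16 * CP * Lam ^+ 2 / delta).

Lemma energy_fixed i : (i < J)%N ->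
  qq ^+ (2 * i) * nq (kball x (Lam * rr i.+1)) (du u) <=
  CE * (nq (mball x (Lam * r0)) u / r0 ^+ 2 + r0 ^+ 2 * nq (mball x (Lam * r0)) g).
Proof.
move=> iJ; set a := nm (mball x (Lam * r0)) u.
have A0E : A0 = (a / r0) ^+ 2 by rewrite /A0 expr_div_n /a nm2.
have gE : r0 ^+ 2 * nq (mball x (Lam * r0)) g = (r0 * g1) ^+ 2 by rewrite exprMn /g1 nm2.
have XX0 : 0 <= XX by exact: nq_ge0.
set y := Num.sqrt XX; have yE : XX = y ^+ 2 by rewrite sqr_sqrtr.
have e1 : delta / 16 * XX <= (4 * C4 + 2 + 16 * CP * Lam ^+ 2 / delta) * (A0 + (r0 * g1) ^+ 2).
  have h := le_trans energy0 (lerD F_bound (lexx _)).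
  have y1 : 2 * g1 * a <= A0 + (r0 * g1) ^+ 2.
    rewrite A0E -subr_ge0 (_ : _ - _ = (a / r0 - r0 * g1) ^+ 2) ?sqr_ge0//.
    by field; rewrite gt_eqF.
  have y2 : 2 * (Num.sqrt CP * Lam * r0) * g1 * y <= delta / 16 * XX + 16 * CP * Lam ^+ 2 / delta * (r0 * g1) ^+ 2.
    have CE : CP = Num.sqrt CP ^+ 2 by rewrite sqr_sqrtr// ltW.
    rewrite yE {2}CE; set sC := Num.sqrt CP.
    rewrite -subr_ge0 (_ : _ - _ = delta / 16 * (y - 16 * (sC * Lam * r0) * g1 / delta) ^+ 2).
      by rewrite mulr_ge0 ?sqr_ge0// divr_ge0// ltW.
    by field; rewrite gt_eqF.
  have t0 : 0 <= A0 by rewrite A0E sqr_ge0.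
  have t1 : 0 <= (r0 * g1) ^+ 2 by exact: sqr_ge0.
  have t2 : 0 <= 16 * CP * Lam ^+ 2 / delta.
    by rewrite divr_ge0 ?(ltW delta0)// mulr_ge0 ?sqr_ge0// mulr_ge0// ltW.
  have t3 := mulr_ge0 (ltW C40) t1; have t4 := mulr_ge0 t2 t0.
  rewrite -/a -/y in h; lra.
have h := EB_decay iJ.
rewrite gE -/A0 mulnC exprM; rewrite exprMn in h.
have h2 : qq ^+ i ^+ 2 * EB i.+1 <= 2 / eps * XX.
  rewrite -(ler_pM2l (exprn_gt0 2 eps0)).
  rewrite (_ : eps ^+ 2 * (2 / eps * XX) = 2 * eps * XX); first by rewrite mulrA.
  by field; rewrite gt_eqF.
apply: le_trans h2 _.
have s0 : 0 <= 32 / (eps * delta) by rewrite divr_ge0// mulr_ge0// ltW.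
have := ler_wpM2l s0 e1; rewrite /CE.
rewrite (_ : 32 / (eps * delta) * (delta / 16 * XX) = 2 / eps * XX); first by rewrite mulrA.
by field; rewrite !gt_eqF.
Qed.

End Fixed.

(** * From energy decay to sup and Hoelder bounds *)

Let level (r a : R) : 0 < a -> a < r -> exists J, r / Kr ^+ J.+1 <= a /\ a < r / Kr ^+ J.
Proof.
move=> a0 ar; have [n hn] : exists n, r / Kr ^+ n <= a.
  have [n hn] : exists n : nat, r / a <= n%:R.
    by exists (Num.truncn (r / a)).+1; apply: ltW; exact: truncnS_gt.
  exists n; rewrite ler_pdivrMr ?exprn_gt0// -ler_pdivrMl// mulrC; apply: le_trans hn _.
  have h : (n <= 2 ^ n)%N by apply: ltnW; exact: ltn_expl.
  apply: (@le_trans _ _ (2 ^+ n)); first by rewrite -natrX ler_nat.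
  by rewrite lerXn2r ?nnegrE ?(ltW Kr0)//; have := Kr16; lra.
have ex : exists n, r / Kr ^+ n <= a by exists n.
case: (ex_minnP ex) => -[|j] hj mj; first by move: hj; rewrite expr0 divr1 leNgt ar.
exists j; split=> //; rewrite ltNge; apply/negP => /mj; by rewrite ltnn.
Qed.

(** Two constants that approximate u on the same ball are close to each other by the triangle
    inequality there; the lower bound on the volume turns this into a bound on their difference. *)
Let const_cmp y rho z rho' u (a b : R[i]) S : l2 m u -> 0 < rho ->
  (forall v, d y v < rho -> d z v < rho') ->
  nq (mball z rho') (fun v => u v - a) <= S -> nq (mball y rho) (fun v => u v - b) <= S ->
  cmod (a - b) ^+ 2 * (cL * rho ^+ 2) <= 4 * S.
Proof.
move=> lu rho0 sub h1 h2.
have la t t' s : l2 (mball t t') (fun v => u v - s).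
  by apply: l2B => //; [exact: l2_mball|exact: l2_mball_const].
have h3 : nq (mball y rho) (fun v => u v - a) <= S.
  apply: le_trans h1; apply: le_tsum; [exact: la|exact: la|] => v.
  apply: (ler_wpM2l (rd_ge0 _)); rewrite /mball; case: ifP => [/sub ->//|_].
  by case: ifP.
have h4 : nq (mball y rho) (fun=> a - b) <= 4 * S.
  have E : (fun=> a - b) = fun v => (u v - b) - (u v - a) by apply/funext => v; ring.
  have n0 := mb_ge0 y rho; rewrite E (nqB n0 (la _ _ _) (la _ _ _)).
  have n1 : nm (mball y rho) (fun v => u v - b) <= Num.sqrt S by exact: ler_wsqrtr.
  have n2 : nm (mball y rho) (fun v => u v - a) <= Num.sqrt S by exact: ler_wsqrtr.
  have S0 : 0 <= S by exact: le_trans (nq_ge0 n0 _) h2.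
  have := ler_pM (nm_ge0 _ _) (nm_ge0 _ _) n1 n2; rewrite -expr2 sqr_sqrtr// => n3.
  have := ip_CS n0 (la y rho b) (la y rho a); rewrite ler_norml => /andP[n4 _]; lra.
apply: le_trans h4; rewrite cmod2 /nq /ip (tsumZ _ (vol_fin y rho)).
by apply: (ler_wpM2l (rd_ge0 _)); exact: vol_ge.
Qed.

Let sqr_le_sqrt (a C A : R) : 0 <= A -> 0 <= C -> a ^+ 2 <= C * A ^+ 2 -> a <= Num.sqrt C * A.
Proof.
move=> A0 C0 h; have := ler_wsqrtr h; rewrite (sqrtrM _ C0) !sqrtr_sqr (ger0_norm A0).
by apply: le_trans; exact: ler_norm.
Qed.

(** The ball of radius hs x / CW contains only its centre. *)
Let m_lo x : cL * (hs x / CW) ^+ 2 <= m x.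
Proof.
have CW0 : 0 < CW by move: CW1; lra.
have h0 : 0 < hs x / CW by exact: divr_gt0.
apply: le_trans (vol_ge x h0) _.
rewrite /tsum -/(tsum _) (@finsupp_tsum _ _ _ [:: x])//; last first.
  move=> y; rewrite inE => yx; rewrite /mball ltNge ler_pdivrMr// mulrC d_far//.
  by rewrite eq_sym.
by rewrite big_seq1 /mball d_refl h0.
Qed.

Let CE0 : 0 <= CE.
Proof.
apply: mulr_ge0; first by rewrite divr_ge0// mulr_ge0// ltW.
apply: addr_ge0; first by rewrite addr_ge0// mulr_ge0// ltW.
by rewrite divr_ge0 ?(ltW delta0)// mulr_ge0 ?sqr_ge0// mulr_ge0// ltW.
Qed.

(** The first term serves the comparison of means at successive scales ([close]), the second the
    last passage from the mean to the value at the centre; [D1] multiplies by the sum q / (q - 1) of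
    the geometric series of ratio 1 / q. *)
Definition D0 := Num.sqrt ((4 * CP * CE * Kr ^+ 2 + 4 * CP * CE * (Lam * Kr * CW) ^+ 2) / cL).
Definition D1 := D0 * qq / (qq - 1).

Let CW0 : 0 < CW. Proof. by move: CW1; lra. Qed.
Let D0a : 0 <= (4 * CP * CE * Kr ^+ 2 + 4 * CP * CE * (Lam * Kr * CW) ^+ 2) / cL.
Proof.
have C0 : 0 <= 4 * CP * CE by rewrite mulr_ge0// mulr_ge0// ltW.
by rewrite divr_ge0 ?(ltW cL0)// addr_ge0// mulr_ge0 ?sqr_ge0.
Qed.
Let D00 : 0 <= D0. Proof. exact: sqrtr_ge0. Qed.
Let q10 : 0 < qq - 1. Proof. by rewrite subr_gt0. Qed.
Let D10 : 0 <= D1. Proof. by rewrite divr_ge0 ?(ltW q10)// mulr_ge0 ?(ltW q0). Qed.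

Let radius r0 j := Lam * (r0 / Kr ^+ j).

Let radius_gt0 r0 j : 0 < r0 -> 0 < radius r0 j.
Proof. by move=> h; rewrite mulr_gt0// divr_gt0// exprn_gt0. Qed.

Let radiusS r0 j : radius r0 j = Kr * radius r0 j.+1.
Proof. by rewrite /radius exprS; field; rewrite expf_neq0 ?gt_eqF. Qed.

Let close y z r0 i u (a b : R[i]) A : l2 m u -> 0 < r0 -> 0 <= A ->
  (forall v, d y v < radius r0 i.+2 -> d z v < radius r0 i.+1) ->
  nq (mball z (radius r0 i.+1)) (fun v => u v - a) <= CP * CE * (radius r0 i.+1 * (A / qq ^+ i)) ^+ 2 ->
  nq (mball y (radius r0 i.+2)) (fun v => u v - b) <= CP * CE * (radius r0 i.+2 * (A / qq ^+ i.+1)) ^+ 2 ->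
  cmod (a - b) <= D0 * (A / qq ^+ i).
Proof.
move=> lu r00 A0 sub h1 h2; have r2 := radius_gt0 i.+2 r00; have r1 := radius_gt0 i.+1 r00.
have Aq0 j : 0 <= A / qq ^+ j by rewrite divr_ge0// exprn_ge0 ?ltW.
have CC : 0 <= CP * CE by rewrite mulr_ge0// ltW.
have h3 : nq (mball y (radius r0 i.+2)) (fun v => u v - b) <= CP * CE * (radius r0 i.+1 * (A / qq ^+ i)) ^+ 2.
  apply: le_trans h2 _; apply: (ler_wpM2l CC).
  rewrite lerXn2r ?nnegrE ?(mulr_ge0 (ltW r2) (Aq0 _)) ?(mulr_ge0 (ltW r1) (Aq0 _))//.
  apply: ler_pM => //; first exact: ltW.
    by rewrite (radiusS r0 i.+1) ler_peMl ?(ltW r2)//; have := Kr16; lra.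
  apply: ler_wpM2l => //; rewrite lef_pV2 ?posrE ?exprn_gt0// exprS.
  by rewrite ler_peMl ?exprn_ge0 ?(ltW q0)// ltW.
have := const_cmp lu r2 sub h1 h3 => h4.
apply: sqr_le_sqrt => //.
have p0 : 0 < cL * radius r0 i.+2 ^+ 2 by rewrite mulr_gt0// exprn_gt0.
rewrite -(ler_pM2r p0); apply: le_trans h4 _.
have -> : (4 * CP * CE * Kr ^+ 2 + 4 * CP * CE * (Lam * Kr * CW) ^+ 2) / cL * (A / qq ^+ i) ^+ 2 * (cL * radius r0 i.+2 ^+ 2) =
  4 * (CP * CE * (radius r0 i.+1 * (A / qq ^+ i)) ^+ 2) + 4 * (CP * CE) * (Lam * Kr * CW * (A / qq ^+ i) * radius r0 i.+2) ^+ 2.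
  by rewrite (radiusS r0 i.+1); set Q := A / _; field; rewrite gt_eqF.
by rewrite lerDl mulr_ge0 ?sqr_ge0// mulr_ge0.
Qed.

(** Poincare's squared error r^2 times energy is divided by a volume of order r^2: the radii cancel,
    and successive means differ by the square root of the energy, of order q^-i. The chain goes down
    to the mesh size of x, where the mass of the single vertex is comparable to the squared
    radius. *)
Lemma morrey_chain x r0 J u g A : 0 < r0 -> opgraph m k c u g ->
  r0 / Kr ^+ J.+2 <= 2 * hs x -> 2 * hs x < r0 / Kr ^+ J.+1 -> 0 <= A ->
  nq (mball x (Lam * r0)) u / r0 ^+ 2 + r0 ^+ 2 * nq (mball x (Lam * r0)) g <= A ^+ 2 ->
  exists kap : nat -> R[i], forall i, (i <= J)%N ->
    nq (mball x (radius r0 i.+1)) (fun v => u v - kap i) <= CP * CE * (radius r0 i.+1 * (A / qq ^+ i)) ^+ 2 /\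
    cmod (u x - kap i) <= D1 * (A / qq ^+ i).
Proof.
move=> r00 Gu J1 J2 A0 hA; have [su lg _] := Gu.
have [kap0 hk] := choice (fun i => poinc x (radius_gt0 i r00) su).
pose kap j := if j is i.+1 then kap0 i.+1 else 0.
have EB i : (i <= J)%N -> nq (kball x (radius r0 i.+1)) (du u) <= CE * (A / qq ^+ i) ^+ 2.
  move=> iJ; have := @energy_fixed x r0 J.+1 u g r00 J2 Gu kap erefl (fun j => hk j.+1) i iJ.
  move=> /le_trans /(_ (ler_wpM2l CE0 hA)).
  have -> : CE * (A / qq ^+ i) ^+ 2 = CE * A ^+ 2 / qq ^+ (2 * i).
    by rewrite expr_div_n [in RHS]mulnC exprM mulrA.
  by move=> h; rewrite ler_pdivlMr ?exprn_gt0// mulrC.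
have key i : (i <= J)%N -> nq (mball x (radius r0 i.+1)) (fun v => u v - kap0 i.+1) <= CP * CE * (radius r0 i.+1 * (A / qq ^+ i)) ^+ 2.
  move=> iJ; apply: le_trans (hk i.+1) _; have r1 := radius_gt0 i.+1 r00.
  have p0 : 0 <= CP * radius r0 i.+1 ^+ 2 by rewrite mulr_ge0 ?sqr_ge0// ltW.
  apply: le_trans (ler_wpM2l p0 (EB i iJ)) _.
  by rewrite le_eqVlt; apply/orP; left; apply/eqP; set Q := A / _; ring.
exists (fun i => kap0 i.+1) => i iJ; split; first exact: key.
have Aq0 j : 0 <= A / qq ^+ j by rewrite divr_ge0// exprn_ge0 ?ltW.
(* At the smallest scale the centre alone is kept in the sum over the ball, and [m_lo] bounds its
   mass from below. *)
have last : cmod (u x - kap0 J.+1) <= D0 * (A / qq ^+ J).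
  apply: sqr_le_sqrt => //; have := key J (leqnn J).
  have r1 := radius_gt0 J.+1 r00.
  have lJ : l2 (mball x (radius r0 J.+1)) (fun v => u v - kap0 J.+1).
    by apply: l2B => //; [exact/l2_mball/su.1|exact: l2_mball_const].
  move=> /(le_trans (nq_pt (mb_ge0 x (radius r0 J.+1)) x lJ)).
  rewrite -cmod2 /mball d_refl r1 => h.
  have h2 := ler_wpM2l (sqr_ge0 (cmod (u x - kap0 J.+1))) (m_lo x).
  have h3 := le_trans h2 h.
  have p0 : 0 < cL * (hs x / CW) ^+ 2 by rewrite mulr_gt0// exprn_gt0// divr_gt0.
  rewrite -(ler_pM2r p0); apply: le_trans h3 _.
  have CC : 0 <= CP * CE by rewrite mulr_ge0// ltW.
  have rh : radius r0 J.+1 <= 2 * Lam * Kr * hs x.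
    have := ler_wpM2l (ltW (mulr_gt0 Lam0 Kr0)) J1.
    rewrite (_ : Lam * Kr * (r0 / Kr ^+ J.+2) = radius r0 J.+1); last first.
      by rewrite /radius [Kr ^+ J.+2]exprS; field; rewrite expf_neq0 gt_eqF.
    by move/le_trans; apply; rewrite le_eqVlt; apply/orP; left; apply/eqP; ring.
  have -> : (4 * CP * CE * Kr ^+ 2 + 4 * CP * CE * (Lam * Kr * CW) ^+ 2) / cL * (A / qq ^+ J) ^+ 2 * (cL * (hs x / CW) ^+ 2) =
    CP * CE * (2 * Lam * Kr * hs x * (A / qq ^+ J)) ^+ 2 + 4 * (CP * CE) * (Kr * (hs x / CW) * (A / qq ^+ J)) ^+ 2.
    by field; rewrite !gt_eqF ?exprn_gt0.
  apply: (@le_trans _ _ (CP * CE * (2 * Lam * Kr * hs x * (A / qq ^+ J)) ^+ 2)).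
    apply: (ler_wpM2l CC); have p1 : 0 <= 2 * Lam * Kr * hs x by exact: le_trans (ltW r1) rh.
    rewrite lerXn2r ?nnegrE ?(mulr_ge0 p1 (Aq0 J)) ?(mulr_ge0 (ltW r1) (Aq0 J))//.
    exact: (ler_wpM2r (Aq0 J)).
  by rewrite lerDl mulr_ge0 ?sqr_ge0// mulr_ge0.
have D01 : D0 <= D1.
  rewrite /D1 ler_pdivlMr// ler_wpM2l//; have := q10; lra.
suff h n : (n <= J)%N -> cmod (u x - kap0 (J - n).+1) <= D1 * (A / qq ^+ (J - n)).
  by have := h (J - i)%N (leq_subr _ _); rewrite subKn.
elim: n => [|n IH] nJ.
  by rewrite subn0; apply: le_trans last _; exact: ler_wpM2r.
have {}IH := IH (ltnW nJ); have E : (J - n)%N = (J - n.+1).+1 by rewrite -subSn.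
rewrite E in IH; set a := (J - n.+1)%N in IH *; have aJ : (a.+1 <= J)%N by rewrite -E leq_subr.
have cl : cmod (kap0 a.+1 - kap0 a.+2) <= D0 * (A / qq ^+ a).
  apply: (@close x x r0 a u) => //; [exact: su.1| |exact: key (ltnW aJ)|exact: key].
  move=> v h; apply: lt_le_trans h _; rewrite (radiusS r0 a.+1) ler_peMl ?(ltW (radius_gt0 _ r00))//.
  by have := Kr16; lra.
have tri : cmod (u x - kap0 a.+1) <= cmod (u x - kap0 a.+2) + cmod (kap0 a.+1 - kap0 a.+2).
  rewrite [X in _ <= _ + X]cmodC; apply: le_trans (cmodD _ _).
  by rewrite (_ : u x - kap0 a.+2 + (kap0 a.+2 - kap0 a.+1) = u x - kap0 a.+1)//; ring.
apply: le_trans tri _; apply: le_trans (lerD IH cl) _.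
rewrite le_eqVlt; apply/orP; left; apply/eqP; rewrite /D1 exprS.
by field; rewrite expf_neq0 ?gt_eqF// (gt_eqF q0) (gt_eqF q10).
Qed.

Definition D2 := D1 + Num.sqrt (4 * (CP * CE + Kr ^+ 2) / cL) + Num.sqrt (4 * Kr ^+ 2 * CW ^+ 2 / cL).

Let D2_ge0 : 0 <= D2.
Proof. by rewrite /D2; apply: addr_ge0; [apply: addr_ge0|]. Qed.

(** If the mesh size at x is small compared with r0, the chain of means is started at scale r0 and
    its first mean compared with 0. Otherwise the mass of x is already of order r0^2 and the l2 norm
    suffices. *)
Lemma sup_bound x r0 u g A : 0 < r0 -> opgraph m k c u g -> 0 <= A ->
  nq (mball x (Lam * r0)) u / r0 ^+ 2 + r0 ^+ 2 * nq (mball x (Lam * r0)) g <= A ^+ 2 ->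
  cmod (u x) <= D2 * A.
Proof.
move=> r00 Gu A0 hA; have [su lg _] := Gu; have hx := hs_gt0 x.
have nu : nq (mball x (Lam * r0)) u <= r0 ^+ 2 * A ^+ 2.
  rewrite [leRHS]mulrC -ler_pdivrMr ?exprn_gt0//; apply: le_trans hA; rewrite lerDl.
  by rewrite mulr_ge0 ?sqr_ge0 ?nq_ge0.
have s1 := sqrtr_ge0 (4 * (CP * CE + Kr ^+ 2) / cL); have s2 := sqrtr_ge0 (4 * Kr ^+ 2 * CW ^+ 2 / cL).
have CC : 0 <= CP * CE by rewrite mulr_ge0// ltW.
have [big|small] := ltP (2 * hs x) (r0 / Kr).
  have [||J [J1 J2]] := @level r0 (2 * hs x).
  - by rewrite mulr_gt0.
  - by apply: lt_le_trans big _; rewrite ler_pdivrMr// ler_peMr ?(ltW r00)//; have := Kr16; lra.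
  case: J J1 J2 => [|J] J1 J2; first by move: J1; rewrite expr1 leNgt big.
  have [kap hk] := morrey_chain r00 Gu J1 J2 A0 hA; have [h1 h2] := hk 0%N (leq0n J).
  rewrite expr0 divr1 in h1 h2; have r1 := radius_gt0 1 r00.
  have rE : r0 = Kr * radius r0 1 / Lam by rewrite /radius expr1; field; rewrite !gt_eqF.
  set S := (CP * CE + Kr ^+ 2) * (radius r0 1 * A) ^+ 2.
  have h3 : nq (mball x (radius r0 1)) (fun v => u v - 0) <= S.
    apply: (@le_trans _ _ (nq (mball x (Lam * r0)) u)).
      apply: le_tsum; [by apply: l2B => //; [exact/l2_mball/su.1|exact: l2_mball_const]|exact/l2_mball/su.1|].
      move=> v; rewrite subr0; apply: (ler_wpM2l (rd_ge0 _)); rewrite /mball.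
      case: ifP => [h|_]; last by case: ifP.
      rewrite (lt_le_trans h)//; rewrite -/(radius r0 0) /radius ler_pM2l// expr1 ler_pdivrMr//.
      by rewrite ler_peMr ?(ltW r00)//; have := Kr16; lra.
    apply: le_trans nu _; rewrite /S mulrDl exprMn.
    rewrite (_ : r0 ^+ 2 = Kr ^+ 2 * radius r0 1 ^+ 2 / Lam ^+ 2); last first.
      by rewrite {1}rE; field; rewrite gt_eqF.
    have p0 : 0 <= CP * CE * (radius r0 1 ^+ 2 * A ^+ 2) by exact: mulr_ge0 CC (mulr_ge0 (sqr_ge0 _) (sqr_ge0 _)).
    have p1 : 0 <= Kr ^+ 2 * radius r0 1 ^+ 2 * A ^+ 2 by exact: mulr_ge0 (mulr_ge0 (sqr_ge0 _) (sqr_ge0 _)) (sqr_ge0 _).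
    have p2 : Kr ^+ 2 * radius r0 1 ^+ 2 / Lam ^+ 2 * A ^+ 2 <= Kr ^+ 2 * radius r0 1 ^+ 2 * A ^+ 2.
      have LL : 1 <= Lam ^+ 2 by rewrite exprn_ege1//; have := Lam2; lra.
      by rewrite mulrAC ler_pdivrMr ?exprn_gt0// ler_peMr.
    lra.
  have h4 : nq (mball x (radius r0 1)) (fun v => u v - kap 0%N) <= S.
    apply: le_trans h1 _; rewrite /S mulrDl lerDl mulr_ge0 ?sqr_ge0//.
  have := const_cmp su.1 r1 (fun v h => h) h4 h3; rewrite subr0 => h5.
  have h6 : cmod (kap 0%N) <= Num.sqrt (4 * (CP * CE + Kr ^+ 2) / cL) * A.
    apply: sqr_le_sqrt => //; first by rewrite divr_ge0 ?(ltW cL0)// mulr_ge0// addr_ge0 ?sqr_ge0.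
    have p0 : 0 < cL * radius r0 1 ^+ 2 by rewrite mulr_gt0// exprn_gt0.
    rewrite -(ler_pM2r p0); apply: le_trans h5 _; rewrite /S.
    by rewrite le_eqVlt; apply/orP; left; apply/eqP; field; rewrite gt_eqF.
  have tri : cmod (u x) <= cmod (u x - kap 0%N) + cmod (kap 0%N).
    by apply: le_trans (cmodD _ _); rewrite subrK.
  rewrite /D2; have := mulr_ge0 s2 A0; lra.
have hx2 : r0 / (2 * Kr * CW) <= hs x / CW.
  rewrite (_ : r0 / (2 * Kr * CW) = r0 / Kr / 2 / CW); last by field; rewrite !gt_eqF.
  by rewrite ler_pM2r ?invr_gt0//; lra.
have lb : l2 (mball x (Lam * r0)) u by exact/l2_mball/su.1.
have := le_trans (nq_pt (mb_ge0 x (Lam * r0)) x lb) nu.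
rewrite -cmod2 /mball d_refl (mulr_gt0 Lam0 r00) => h.
have h2 := ler_wpM2l (sqr_ge0 (cmod (u x))) (m_lo x).
have h3 : cmod (u x) <= Num.sqrt (4 * Kr ^+ 2 * CW ^+ 2 / cL) * A.
  apply: sqr_le_sqrt => //; first by rewrite divr_ge0 ?(ltW cL0)// mulr_ge0 ?sqr_ge0// mulr_ge0 ?sqr_ge0.
  have p0 : 0 < cL * (r0 / (2 * Kr * CW)) ^+ 2 by rewrite mulr_gt0// exprn_gt0// divr_gt0// !mulr_gt0.
  rewrite -(ler_pM2r p0).
  have -> : 4 * Kr ^+ 2 * CW ^+ 2 / cL * A ^+ 2 * (cL * (r0 / (2 * Kr * CW)) ^+ 2) = r0 ^+ 2 * A ^+ 2.
    by field; rewrite !gt_eqF.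
  apply: le_trans (le_trans h2 h); apply: (ler_wpM2l (sqr_ge0 _)); apply: (ler_wpM2l (ltW cL0)).
  rewrite lerXn2r ?nnegrE//; first by rewrite divr_ge0 ?(ltW r00)// !mulr_ge0// ltW.
  by rewrite divr_ge0 ?ltW.
have := mulr_ge0 D10 A0; have := mulr_ge0 s1 A0; rewrite /D2; lra.
Qed.

(** The exponent with Kr^heta = q: one scale divides the radius by Kr and the oscillation by q. *)
Definition heta := ln qq / ln Kr.
Definition D3 := (2 * D2 + (2 * D1 + D0) * qq) * qq ^+ 2 * (2 * CW) `^ heta.

Let Kr1 : 1 < Kr. Proof. by have := Kr16; lra. Qed.
Lemma heta_gt0 : 0 < heta. Proof. by rewrite divr_gt0// ln_gt0. Qed.

Let Kr_pow n : (Kr ^+ n) `^ heta = qq ^+ n.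
Proof.
have E : Kr `^ heta = qq.
  rewrite /powR gt_eqF// /heta -mulrA mulVf ?mulr1 ?lnK ?posrE//.
  by rewrite gt_eqF// ln_gt0.
rewrite -(powR_mulrn n (ltW Kr0)) -powRrM mulrC powRrM E powR_mulrn//; exact: ltW.
Qed.

Let dist_pow n (t : R) : 0 <= t -> 1 <= 2 * CW * Kr ^+ n * t ->
  1 <= (2 * CW) `^ heta * qq ^+ n * t `^ heta.
Proof.
move=> t0 h; have c0 : 0 <= 2 * CW by rewrite mulr_ge0// ltW.
have k0 : 0 <= Kr ^+ n by rewrite exprn_ge0// ltW.
rewrite -Kr_pow -powRM// -powRM ?(mulr_ge0 c0 k0)//.
have E1 : 1 `^ heta = 1 :> R by rewrite powR1.
by rewrite -[X in X <= _]E1 ge0_ler_powR ?nnegrE ?(mulr_ge0 (mulr_ge0 c0 k0) t0)// ltW// heta_gt0.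
Qed.

Let level_ge r a b j J : 0 < r -> a <= b -> r / Kr ^+ J.+1 <= a -> b < r / Kr ^+ j -> (j <= J)%N.
Proof.
move=> r0 ab h1 h2; rewrite leqNgt; apply/negP => Jj.
have hle : r / Kr ^+ j <= r / Kr ^+ J.+1.
  by rewrite ler_pM2l// lef_pV2 ?posrE ?exprn_gt0// ler_weXn2l// ltW.
by have := lt_le_trans (le_lt_trans (le_trans h1 ab) h2) hle; rewrite ltxx.
Qed.

Lemma D3_ge0 : 0 <= D3.
Proof.
have d1 : 0 <= (2 * D1 + D0) * qq by rewrite mulr_ge0 ?(ltW q0)// addr_ge0// mulr_ge0.
have d2 : 0 <= 2 * D2 by rewrite mulr_ge0.
by rewrite /D3 mulr_ge0 ?powR_ge0// mulr_ge0 ?exprn_ge0 ?(ltW q0)// addr_ge0.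
Qed.

(** The chains at x and x' are followed down to the scale of d x x' and compared there, the smaller
    ball around x' lying in the next larger ball around x. When d x x' is of order r0 or more, the
    sup bound is enough. *)
Lemma holder_bound x x' r0 u g : 0 < r0 -> opgraph m k c u g ->
  cmod (u x - u x') <= D3 * (d x x' / r0) `^ heta * (nm m u / r0 + r0 * nm m g).
Proof.
move=> r00 Gu; have [su lg _] := Gu; set B := nm m u / r0 + r0 * nm m g.
have b1 : 0 <= nm m u / r0 by rewrite divr_ge0 ?nm_ge0// ltW.
have b2 : 0 <= r0 * nm m g by rewrite mulr_ge0 ?nm_ge0// ltW.
have B0 : 0 <= B by exact: addr_ge0.
have D30 := D3_ge0.
have [->|xx'] := eqVneq x x'.
  by rewrite subrr cmod0 mulr_ge0// mulr_ge0// powR_ge0.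
have hA y : nq (mball y (Lam * r0)) u / r0 ^+ 2 + r0 ^+ 2 * nq (mball y (Lam * r0)) g <= B ^+ 2.
  have h1 := nq_mball_le y (Lam * r0) su.1; have h2 := nq_mball_le y (Lam * r0) lg.
  have i0 : 0 <= (r0 ^+ 2)^-1 by rewrite invr_ge0 sqr_ge0.
  have h3 := ler_wpM2r i0 h1; have h4 := ler_wpM2l (sqr_ge0 r0) h2.
  have E1 : nq m u / r0 ^+ 2 = (nm m u / r0) ^+ 2 by rewrite expr_div_n nm2.
  have E2 : r0 ^+ 2 * nq m g = (r0 * nm m g) ^+ 2 by rewrite exprMn nm2.
  have := mulr_ge0 b1 b2; rewrite /B; lra.
set t := d x x' / r0; have dx := d_far xx'.
have dx' : hs x' <= CW * d x x' by rewrite d_sym; apply: d_far; rewrite eq_sym.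
have d0 : 0 < d x x' by rewrite -(pmulr_rgt0 _ CW0); exact: lt_le_trans dx.
have t0 : 0 <= t by rewrite divr_ge0 ?ltW.
set W := (2 * CW) `^ heta; have W0 : 0 <= W by exact: powR_ge0.
have d1 : 0 <= (2 * D1 + D0) * qq by rewrite mulr_ge0 ?(ltW q0)// addr_ge0// mulr_ge0.
have T0 : 0 <= W * qq ^+ 2 * t `^ heta by rewrite mulr_ge0 ?powR_ge0// mulr_ge0 ?exprn_ge0 ?(ltW q0).
have D3E : D3 * t `^ heta * B = 2 * D2 * (W * qq ^+ 2 * t `^ heta) * B +
    (2 * D1 + D0) * (W * qq ^+ 3 * t `^ heta) * B.
  by rewrite /D3 -/W; ring.
have T1 : 0 <= W * qq ^+ 3 * t `^ heta by rewrite mulr_ge0 ?powR_ge0// mulr_ge0 ?exprn_ge0 ?(ltW q0).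
rewrite D3E; have [big|small] := lerP (r0 / Kr ^+ 2) (2 * CW * d x x').
  have h1 := sup_bound r00 Gu B0 (hA x); have h2 := sup_bound r00 Gu B0 (hA x').
  have tri := cmodB (u x) (u x').
  have p : 1 <= W * qq ^+ 2 * t `^ heta.
    apply: dist_pow => //; move: big; rewrite ler_pdivrMr ?exprn_gt0// => big.
    by rewrite /t mulrA ler_pdivlMr// mul1r mulrAC.
  have s1 : 0 <= (2 * D1 + D0) * (W * qq ^+ 3 * t `^ heta) * B.
    by rewrite mulr_ge0// mulr_ge0// addr_ge0// mulr_ge0.
  have s2 := ler_wpM2l (mulr_ge0 D2_ge0 B0) p; lra.
have K2 : r0 / Kr ^+ 2 <= r0 by rewrite ler_pdivrMr ?exprn_gt0// ler_peMr ?(ltW r00)// expr_ge1 ?ltW.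
have [||J [J1 J2]] := @level r0 (2 * CW * d x x').
- by rewrite mulr_gt0// mulr_gt0.
- exact: lt_le_trans K2.
have := level_ge r00 (lexx _) J1 small; case: J J1 J2 => [|[|j]]// J1 J2 _.
(* The mesh sizes at x and x' are at most CW d x x', so both chains reach the scale of d x x';
   comparing with 2 CW d x x' matches the stopping rule 2 hs of [morrey_chain]. *)
have chain y : hs y <= CW * d x x' -> exists kap : nat -> R[i], forall i, (i <= j.+1)%N ->
    nq (mball y (radius r0 i.+1)) (fun v => u v - kap i) <= CP * CE * (radius r0 i.+1 * (B / qq ^+ i)) ^+ 2 /\
    cmod (u y - kap i) <= D1 * (B / qq ^+ i).
  move=> hy; have hy2 : 2 * hs y <= 2 * CW * d x x' by rewrite -mulrA ler_pM2l.
  have [||Jy [Jy1 Jy2]] := @level r0 (2 * hs y).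
  - by rewrite mulr_gt0.
  - by apply: le_lt_trans hy2 _; exact: lt_le_trans K2.
  have := level_ge r00 hy2 Jy1 J2; case: Jy Jy1 Jy2 => [|Jy]// Jy1 Jy2 jJ.
  have [kap hk] := morrey_chain r00 Gu Jy1 Jy2 B0 (hA y).
  by exists kap => i ij; apply: hk; exact: leq_trans ij jJ.
have [ka hka] := chain x dx; have [kb hkb] := chain x' dx'.
have [a1 a2] := hka j (leqnSn j); have [c1 c2] := hkb j.+1 (leqnn _).
have cl : cmod (ka j - kb j.+1) <= D0 * (B / qq ^+ j).
  apply: (@close x' x r0 j u) => //; first exact: su.1.
  move=> v hv; apply: le_lt_trans (d_tri x x' v) _.
  have r2 := radius_gt0 j.+2 r00.
  have h1 : d x x' <= 2 * CW * d x x' by rewrite ler_peMl ?(ltW d0)//; move: CW1; lra.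
  have h2 : r0 / Kr ^+ j.+2 <= radius r0 j.+2.
    by rewrite /radius ler_peMl ?divr_ge0 ?exprn_ge0 ?(ltW r00) ?(ltW Kr0)//; move: Lam2; lra.
  have h3 := ler_wpM2r (ltW r2) Kr16; rewrite (radiusS r0 j.+1); lra.
have q1q : B / qq ^+ j.+1 <= B / qq ^+ j.
  apply: (ler_wpM2l B0); rewrite lef_pV2 ?posrE ?exprn_gt0// exprS ler_peMl ?exprn_ge0 ?(ltW q0)//.
  exact: ltW.
have tri : cmod (u x - u x') <= cmod (u x - ka j) + cmod (ka j - kb j.+1) + cmod (u x' - kb j.+1).
  rewrite (cmodC (u x')) (_ : u x - u x' = u x - ka j + (ka j - kb j.+1) + (kb j.+1 - u x')); last by ring.
  by apply: le_trans (cmodD _ _) _; rewrite lerD2r; exact: cmodD.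
have p : 1 <= W * qq ^+ j.+3 * t `^ heta.
  apply: dist_pow => //; move: J1; rewrite ler_pdivrMr ?exprn_gt0// => big.
  by rewrite /t mulrA ler_pdivlMr// mul1r mulrAC.
have qj : 0 < qq ^+ j by rewrite exprn_gt0.
have p2 : B / qq ^+ j <= (W * qq ^+ 3 * t `^ heta) * B.
  rewrite ler_pdivrMr//; have := ler_wpM2r B0 p; rewrite mul1r => h; apply: le_trans h _.
  by rewrite le_eqVlt; apply/orP; left; apply/eqP; rewrite -addn3 exprD; ring.
have s1 : 0 <= 2 * D2 * (W * qq ^+ 2 * t `^ heta) * B.
  by rewrite mulr_ge0// mulr_ge0// mulr_ge0.
have s2 := ler_wpM2l D10 q1q.
have dd : 0 <= 2 * D1 + D0 by rewrite addr_ge0// mulr_ge0.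
have s3 := ler_wpM2l dd p2; lra.
Qed.

End Elliptic.

(** * The heat semigroup *)

Section Heat.
Variables (R : realType) (X : choiceType) (m : X -> R) (k : X * X -> R) (nb : X -> seq X).
Hypothesis m_gt0 : forall x, 0 < m x.
Hypothesis k_ge0 : forall e, 0 <= k e.
Hypothesis k_nb : forall x y, k (x, y) != 0 -> y \in nb x /\ x \in nb y.
Variables (M delta : R).
Hypothesis delta0 : 0 < delta.
Hypothesis M0 : 0 < M.
Let m_ge0 x : 0 <= m x. Proof. exact: ltW. Qed.

Definition angle := delta / (2 * M).
Definition smooth_cst := Num.sqrt (wsmooth M delta).

Lemma angle_gt0 : 0 < angle.
Proof. by rewrite divr_gt0// mulr_gt0. Qed.

Section Coefficients.
Variable c : X * X -> R[i].
Hypothesis cell : elliptic m k M delta c.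

Lemma nm_eq0_fun u : l2 m u -> nm m u = 0 -> u = fun=> 0.
Proof. by move=> lu E; apply/funext => x; exact: (nm_eq0 m_ge0 lu E). Qed.

Lemma nmD_l2 u v : l2 m u -> l2 m v -> nm m (fun x => u x + v x) <= nm m u + nm m v.
Proof. exact: nmD. Qed.

Lemma nm_pos u : 0 <= nm m u.
Proof. exact: nm_ge0. Qed.

Lemma l2_add u v : l2 m u -> l2 m v -> l2 m (fun x => u x + v x).
Proof. exact: l2D. Qed.

Lemma l2_scale (a : R[i]) u : l2 m u -> l2 m (fun x => a * u x).
Proof. exact: l2Z. Qed.

Lemma nm_scale (a : R[i]) u : l2 m u -> nm m (fun x => a * u x) = cmod a * nm m u.
Proof. exact: nmZ. Qed.

Lemma l2_zero : l2 m (fun=> 0).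
Proof. exact: l2_0. Qed.

Lemma l2_cplt (un : nat -> X -> R[i]) : (forall n, l2 m (un n)) ->
  (forall e, 0 < e -> exists N, forall n p, (N <= n)%N -> (N <= p)%N ->
     nm m (fun x => un n x - un p x) <= e) ->
  exists u, l2 m u /\ cv0 (fun n => nm m (fun x => un n x - u x)).
Proof. exact: l2_complete. Qed.

Lemma opgraph_l2 u g : opgraph m k c u g -> l2 m u /\ l2 m g.
Proof. by case=> -[]. Qed.

Lemma opgraph_comb (a : R[i]) u g v h : opgraph m k c u g -> opgraph m k c v h ->
  opgraph m k c (fun x => a * u x + v x) (fun x => a * g x + h x).
Proof. exact: (opgraph_lin _ _ _ cell.1). Qed.

Lemma opgraph_unique u g g' : opgraph m k c u g -> opgraph m k c u g' -> g = g'.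
Proof. exact: (opgraph_fun m_gt0 k_nb). Qed.

Lemma opgraph_res z f : cone angle z -> l2 m f ->
  exists u g, opgraph m k c u g /\ f = fun x => u x + z * g x.
Proof.
move=> cz lf; have z0 : z != 0.
  by case: cz => h _; apply: contraTneq h => ->; rewrite /= ltxx.
have el := elliptic_rot k_ge0 delta0 M0 erefl cell cz.
have d0 : 0 < complex.Re z * delta / 2 by rewrite divr_gt0// mulr_gt0//; case: cz.
have [u [g [Gu E]]] := resolvent_exists m_gt0 k_ge0 d0 el lf.
exists u, (fun x => z^-1 * g x); split; first exact: opgraph_unrot Gu.
by rewrite E; apply/funext => x; rewrite mulrA mulfV ?mul1r.
Qed.

Lemma opgraph_contraction z u g : cone angle z -> opgraph m k c u g ->
  nm m u <= nm m (fun x => u x + z * g x).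
Proof. move=> cz Gu; exact: (opgraph_contr m_gt0 k_ge0 delta0 M0 erefl cell cz Gu). Qed.

Lemma opgraph_dense u e : l2 m u -> 0 < e ->
  exists v g h, [/\ opgraph m k c v g, opgraph m k c g h & nm m (fun x => u x - v x) <= e].
Proof.
move=> lu e0; have [v fv hv] := finsupp_dense m_gt0 lu e0.
have [g fg Gg] := opgraph_finsupp m_gt0 k_nb cell.1 fv.
have [h _ Gh] := opgraph_finsupp m_gt0 k_nb cell.1 fg.
by exists v, g, h.
Qed.

(** The weighted estimate with psi = 0: the growth rate vanishes, so there is no condition relating
    t and n. *)
Lemma opgraph_smooth (t : R) n (u g : nat -> X -> R[i]) : 0 < t -> (2 <= n)%N -> l2 m (u 0%N) ->
  (forall j, (j < n)%N -> opgraph m k c (u j.+1) (g j.+1) /\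
     u j = fun x => u j.+1 x + t%:C%C * g j.+1 x) ->
  nm m (g n) <= smooth_cst / (n%:R * t) * nm m (u 0%N).
Proof.
move=> t0 n2 _ st; have n0 : (0 < n)%N by exact: leq_trans n2.
have nt0 : 0 < n%:R * t by rewrite mulr_gt0// ltr0n.
have w0 : wrate 0 M delta = 0 by rewrite /wrate !mulr0.
have W (v : X -> R[i]) : wexp (fun=> 0) v = v.
  by apply/funext => x; rewrite /wexp expR0 mul1r.
have := @weighted_bound R X m k m_gt0 k_ge0 (fun=> 0) 0 0 (lexx _) _ _ _ M delta c delta0 (ltW M0) cell (n%:R * t) n u g nt0 n0.
rewrite w0 !mulr0 expR0 mulr1 !W mulrAC mulfV ?mul1r ?pnatr_eq0 -?lt0n//.
move=> h; apply: (h _ _ _ _ st).2 => //.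
- by move=> x; rewrite normr0.
- by move=> e _; rewrite subrr normr0.
- move=> y; under eq_fun do rewrite subrr expr0n mulr0.
  by rewrite mul0r tsum0; split=> //; exact: summR0.
Qed.

Definition heat := sg l2_zero l2_add l2_scale nm_pos nm_scale nmD_l2 nm_eq0_fun l2_cplt
  opgraph_l2 opgraph_comb opgraph_unique opgraph_res opgraph_contraction opgraph_dense.

Lemma heat_contr z : cone angle z -> contr (l2 m) (nm m) (heat z).
Proof. by move=> cz; exact: sg_ctr. Qed.

Lemma heat_l2 z f : cone angle z -> l2 m f -> l2 m (heat z f).
Proof. by move=> cz lf; exact: ((heat_contr cz).1 _ lf).1. Qed.

Lemma heat0 f : heat 0 f = f.
Proof. exact: sg0. Qed.

Lemma heatD z w f : cone angle z -> cone angle w -> l2 m f -> heat (z + w) f = heat z (heat w f).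
Proof. exact: sgD. Qed.

Lemma heat_cont0 f e : l2 m f -> 0 < e -> exists2 d, 0 < d &
  forall z, cone angle z -> cmod z < d -> nm m (fun x => heat z f x - f x) <= e.
Proof. exact: sg_cont0. Qed.

Lemma heat_diff z f : cone angle z -> l2 m f -> exists2 v, l2 m v & forall e, 0 < e ->
  exists2 d, 0 < d & forall w, w != 0 -> cmod w < d ->
  nm m (fun x => w^-1 * (heat (z + w) f x - heat z f x) - v x) <= e.
Proof. exact: (sg_diff _ _ _ _ _ _ _ _ angle_gt0 _ _ _ _ _ _ opgraph_smooth). Qed.

Lemma heat_gen u v : l2 m u -> l2 m v ->
  opgraph m k c u v <-> forall e, 0 < e -> exists2 d, 0 < d & forall t : R, 0 < t -> t < d ->
    nm m (fun x => (t^-1)%:C%C * (u x - heat t%:C%C u x) - v x) <= e.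
Proof.
move=> lu lv; split=> [Gu e e0|h]; first exact: (sg_gen1 _ _ _ _ _ _ _ _ angle_gt0).
exact: (sg_gen2 angle_gt0 lu lv h).
Qed.

Lemma cone_real (t : R) : 0 < t -> cone angle t%:C%C.
Proof. by move=> t0; split => //=; rewrite normr0 mulr_gt0// angle_gt0. Qed.

Lemma nm_cv_pt (Fn : nat -> X -> R[i]) F i : (forall n, l2 m (Fn n)) -> l2 m F ->
  cv0 (fun n => nm m (fun x => Fn n x - F x)) -> cv0 (fun n => cmod (Fn n i - F i)).
Proof.
move=> lFn lF h; have s0 : 0 <= (Num.sqrt (m i))^-1 by rewrite invr_ge0.
apply: cv0_le (cv0Z s0 h) => n.
rewrite mulrC ler_pdivlMr ?sqrtr_gt0// -[leLHS]ger0_norm; last by rewrite mulr_ge0 ?cmod_ge0.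
rewrite -sqrtr_sqr; apply: ler_wsqrtr; rewrite exprMn sqr_sqrtr// cmod2.
exact: (nq_pt m_ge0 i (l2B m_ge0 (lFn n) lF)).
Qed.

Let pow2_cone t j : 0 < t -> cone angle (t%:C%C / 2 ^+ j).
Proof.
move=> t0; have -> : t%:C%C / 2 ^+ j = (t / 2 ^+ j)%:C%C :> R[i].
  by rewrite rmorphM fmorphV rmorphXn rmorph_nat.
by apply: cone_real; rewrite divr_gt0// exprn_gt0.
Qed.

(** Fatou's lemma passes the bounds for the Euler products, valid once 2^j exceeds 4 t wrate, to the
    limit. The function g is fixed before psi, so all weights may be used for the same solution. *)
Lemma heat_weighted (t : R) f : 0 < t -> l2 m f -> exists2 g, opgraph m k c (heat t%:C%C f) g &
  forall psi ga Bd, 0 <= ga -> (forall x, `|psi x| <= Bd) ->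
    (forall e, 0 < k e -> `|psi e.2 - psi e.1| <= 1) ->
    (forall y, summR (fun z => k (y, z) * (psi z - psi y) ^+ 2) /\
       tsum (fun z => k (y, z) * (psi z - psi y) ^+ 2) <= ga * m y) ->
  nm m (wexp psi (heat t%:C%C f)) <= expR (2 * t * wrate ga M delta) * nm m (wexp psi f) /\
  nm m (wexp psi g) <= smooth_cst / t * expR (2 * t * wrate ga M delta) * nm m (wexp psi f).
Proof.
move=> t0 lf; have ct := cone_real t0; have lh := heat_l2 ct lf.
have [g [Gg _ cg]] := sg_smooth l2_zero l2_add l2_scale nm_pos nm_scale nmD_l2 nm_eq0_fun l2_cplt
  angle_gt0 opgraph_l2 opgraph_comb opgraph_unique opgraph_res opgraph_contraction opgraph_dense
  opgraph_smooth t0 lf.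
have ce : cv0 (fun j => nm m (fun x => euler opgraph_res t%:C%C j f x - heat t%:C%C f x)).
  exact: sg_cv.
exists g; first exact: Gg.
move=> psi ga Bd ga0 hB hj hg; have [_ lg] := opgraph_l2 Gg.
have lw u : l2 m u -> l2 m (wexp psi u) by exact: (wexp_l2 m_gt0 hB).
have EG j : opgraph m k c (euler opgraph_res t%:C%C j f) (Leuler opgraph_res t%:C%C j f).
  by exact: (euler_G l2_zero l2_add l2_scale nm_pos nm_scale nm_eq0_fun opgraph_l2 opgraph_comb opgraph_res opgraph_contraction).
set r := expR _; have r0 : 0 <= r by exact: expR_ge0.
have [J hJ] : exists J, forall j, (J <= j)%N -> 4 * t * wrate ga M delta <= (2 ^ j)%:R.
  exists (Num.truncn (4 * t * wrate ga M delta)).+1 => j Jj.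
  apply: (@le_trans _ _ (Num.truncn (4 * t * wrate ga M delta)).+1%:R).
    by apply: ltW; exact: truncnS_gt.
  rewrite ler_nat; apply: leq_trans Jj _; apply: ltnW; exact: ltn_expl.
have bd j : (J <= j)%N -> nm m (wexp psi (euler opgraph_res t%:C%C j f)) <= r * nm m (wexp psi f) /\
    nm m (wexp psi (Leuler opgraph_res t%:C%C j f)) <= smooth_cst / t * r * nm m (wexp psi f).
  move=> /hJ hj4; set y := t%:C%C / 2 ^+ j; have cy : cone angle y by exact: pow2_cone.
  have yE : y = (t / (2 ^ j)%:R)%:C%C by rewrite natrX rmorphM fmorphV rmorphXn rmorph_nat.
  have p0 : (0 < 2 ^ j)%N by rewrite expn_gt0.
  have := @weighted_bound R X m k m_gt0 k_ge0 psi ga Bd ga0 hB hj hg M delta c delta0 (ltW M0) cell t (2 ^ j)%N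
    (fun i => iter i (res opgraph_res y) f) (fun i => Lres opgraph_res y (iter i.-1 (res opgraph_res y) f)) t0 p0 hj4.
  apply => i ij; rewrite -yE.
  exact: (euler_seq l2_zero l2_add l2_scale nm_pos nm_scale nm_eq0_fun opgraph_l2 opgraph_comb opgraph_res opgraph_contraction cy lf ij).
have c0 : cv0 (fun=> 0 : R) by exact: cv0_0.
have ptw psi' (Fn : nat -> X -> R[i]) F : (forall i, cv0 (fun n => cmod (Fn n i - F i))) ->
    forall i, 0 < m i -> cv0 (fun n => cmod (wexp psi' (Fn n) i - wexp psi' F i)).
  move=> h i _; apply: cv0_le (cv0Z (expR_ge0 (psi' i)) (h i)) => n.
  by rewrite /wexp -mulrBr cmodM cmodR ger0_norm ?expR_ge0.
have s0 : 0 <= smooth_cst / t * r by rewrite mulr_ge0// divr_ge0 ?sqrtr_ge0// ltW.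
split.
- apply: (l2_fatou m_ge0 (Fn := fun j => wexp psi (euler opgraph_res t%:C%C (j + J)%N f)) _ _ _ c0 _).2.
  + by rewrite mulr_ge0// nm_pos.
  + by move=> j; apply: lw; exact: (opgraph_l2 (EG _)).1.
  + by move=> j; rewrite addr0; apply: (bd _ _).1; exact: leq_addl.
  + apply: (ptw psi (fun j => euler opgraph_res t%:C%C (j + J)%N f)) => i.
    apply: (@nm_cv_pt (fun n => euler opgraph_res t%:C%C (n + J)%N f) (heat t%:C%C f) i) => [n||]; [exact: (opgraph_l2 (EG _)).1|exact: lh|exact: (cv0_shift J ce)].
- apply: (l2_fatou m_ge0 (Fn := fun j => wexp psi (Leuler opgraph_res t%:C%C (j + J).+1 f)) _ _ _ c0 _).2.
  + by rewrite mulr_ge0// nm_pos.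
  + by move=> j; apply: lw; exact: (opgraph_l2 (EG _)).2.
  + by move=> j; rewrite addr0; apply: (bd _ _).2; rewrite leqW// leq_addl.
  + apply: (ptw psi (fun j => Leuler opgraph_res t%:C%C (j + J).+1 f)) => i.
    apply: (@nm_cv_pt (fun n => Leuler opgraph_res t%:C%C (n + J).+1 f) g i) => [n||]; [exact: (opgraph_l2 (EG _)).2|exact: lg|exact: (cv0_shift J cg)].
Qed.

End Coefficients.

(** The adjoint form has conjugate coefficients. The relation holds for resolvents, hence for Euler
    products with the same number of steps, hence in the limit. *)
Lemma heat_adj c (el : elliptic m k M delta c) (el' : elliptic m k M delta (fun e => conjc (c e)))
  (t : R) f g : 0 < t -> l2 m f -> l2 m g ->
  ip m (heat el t%:C%C f) g = ip m f (heat el' t%:C%C g).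
Proof.
move=> t0 lf lg; have ct := cone_real t0.
pose S := opgraph_res el; pose S' := opgraph_res el'.
have res_adj (s : R) u v : 0 < s -> l2 m u -> l2 m v ->
    ip m (res S s%:C%C u) v = ip m u (res S' s%:C%C v).
  move=> s0 lu lv; have cs := cone_real s0.
  have G1 := resG S cs lu; have G2 := resG S' cs lv.
  have E1 := res_eq S cs lu; have E2 := res_eq S' cs lv.
  have [[l1 _] k1 f1] := G1; have [[l2' _] k2 f2] := G2.
  rewrite {1}E2 {2}E1.
  rewrite (ipDr m_ge0 l2' (l2Z m_ge0 _ k2) l1) (ipZr m_ge0 _ l1 k2).
  rewrite (ipDl m_ge0 l1 (l2Z m_ge0 _ k1) l2') (ipZl m_ge0 _ k1 l2').
  by rewrite (ipC _ (res S _ _) (Lres _ _ _)) -f2 ?form_adj -?f1//; [case: G2|case: G1].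
have it_adj (s : R) n u v : 0 < s -> l2 m u -> l2 m v ->
    [/\ l2 m (iter n (res S s%:C%C) u), l2 m (iter n (res S' s%:C%C) v) &
    ip m (iter n (res S s%:C%C) u) v = ip m u (iter n (res S' s%:C%C) v)].
  move=> s0; have cs := cone_real s0; elim: n u v => [|n IH] u v lu lv //.
  have [h1 h2 _] := IH u v lu lv.
  have h3 := (opgraph_l2 (resG S cs h1)).1; have h4 := (opgraph_l2 (resG S' cs h2)).1.
  have h5 := (opgraph_l2 (resG S' cs lv)).1; have [_ _ h6] := IH u _ lu h5.
  split; [exact: h3|exact: h4|].
  by rewrite iterS (res_adj s _ _ s0 h1 lv) h6 -iterSr.
have pE j : t%:C%C / 2 ^+ j = (t / 2 ^+ j)%:C%C :> R[i].
  by rewrite rmorphM fmorphV rmorphXn rmorph_nat.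
have p0 j : 0 < t / 2 ^+ j by rewrite divr_gt0// exprn_gt0.
have eul j : [/\ l2 m (euler S t%:C%C j f), l2 m (euler S' t%:C%C j g) &
    ip m (euler S t%:C%C j f) g = ip m f (euler S' t%:C%C j g)].
  by rewrite /euler pE; exact: it_adj.
have c1 : cv0 (fun j => nm m (fun x => euler S t%:C%C j f x - heat el t%:C%C f x)) by exact: sg_cv.
have c2 : cv0 (fun j => nm m (fun x => euler S' t%:C%C j g x - heat el' t%:C%C g x)) by exact: sg_cv.
have lh := heat_l2 el ct lf; have lh' := heat_l2 el' ct lg.
apply/eqP; rewrite -subr_eq0 -normr_le0; apply: (@cv0_ge _ _ _ (fun j =>
  nm m g * nm m (fun x => euler S t%:C%C j f x - heat el t%:C%C f x) +
  nm m f * nm m (fun x => euler S' t%:C%C j g x - heat el' t%:C%C g x))); last first.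
  by apply: cv0D; apply: cv0Z => //; exact: nm_ge0.
move=> j; rewrite add0r; have [l1 l2' E] := eul j.
have h1 := ip_CS m_ge0 (l2B m_ge0 l1 lh) lg; have h2 := ip_CS m_ge0 lf (l2B m_ge0 l2' lh').
rewrite (ipBl m_ge0 l1 lh lg) in h1; rewrite (ipBr m_ge0 l2' lh' lf) -E in h2.
move: h1 h2; rewrite !ler_norml => /andP[a1 a2] /andP[b1 b2].
by rewrite ![nm m g * _]mulrC; apply/andP; split; lra.
Qed.

End Heat.

(** * Kernel bounds *)

(** Used with s = t^(-1/2): the factor t^(-1/2) + lambda from the choice of the radius is traded for
    t^(-1/2) at the price of one more e^{lambda^2 t}. *)
Lemma le_mul_exp (R : realType) (s t lam : R) : 0 < s -> s ^+ 2 * t = 1 ->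
  lam <= s * expR (lam ^+ 2 * t).
Proof.
move=> s0 E; apply: le_trans (ler_wpM2l (ltW s0) (expR_ge1Dx _)).
rewrite -(ler_pM2r s0) (_ : s * (1 + _) * s = s ^+ 2 + lam ^+ 2 * (s ^+ 2 * t)); last by ring.
by rewrite E mulr1; have := sqr_ge0 (s - lam); have := sqr_ge0 s; have := sqr_ge0 lam; lra.
Qed.

Section Kernel.
Variables (R : realType) (X : choiceType) (m : X -> R) (k : X * X -> R) (nb : X -> seq X).
Variables (d : X -> X -> R) (hs : X -> R) (CW CP cL : R).
Hypothesis m_gt0 : forall x, 0 < m x.
Hypothesis k_ge0 : forall e, 0 <= k e.
Hypothesis k_nb : forall x y, k (x, y) != 0 -> y \in nb x /\ x \in nb y.
Hypothesis k_sym : forall y z, k (y, z) = k (z, y).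
Hypothesis d_ge0 : forall x y, 0 <= d x y.
Hypothesis d_refl : forall x, d x x = 0.
Hypothesis d_sym : forall x y, d x y = d y x.
Hypothesis d_tri : forall x y z, d x z <= d x y + d y z.
Hypothesis hs_gt0 : forall x, 0 < hs x.
Hypothesis CW1 : 1 <= CW.
Hypothesis CP0 : 0 < CP.
Hypothesis cL0 : 0 < cL.
Hypothesis d_edge : forall y z, 0 < k (y, z) -> d y z <= hs y.
Hypothesis d_far : forall x y, x != y -> hs x <= CW * d x y.
Hypothesis k_len : forall y, summR (fun z => k (y, z) * d y z ^+ 2) /\
  tsum (fun z => k (y, z) * d y z ^+ 2) <= m y.
Hypothesis vol_fin : forall x r, summR (mball m d x r).
Hypothesis vol_ge : forall x r, 0 < r -> cL * r ^+ 2 <= tsum (mball m d x r).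
Hypothesis poinc : forall x r u, 0 < r -> sob m k u -> exists kap : R[i],
  nq (mball m d x r) (fun y => u y - kap) <= CP * r ^+ 2 * nq (kball k d x r) (du u).
Variables (M delta : R).
Hypothesis delta0 : 0 < delta.
Hypothesis M0 : 0 < M.
Let m_ge0 x : 0 <= m x. Proof. exact: ltW. Qed.

Definition C5 := `|D2 CW CP cL M delta| * (expR (Lam CW) * (2 + smooth_cst M delta)) + 1.
(** Twice [wrate] per unit of lambda^2, plus 1 for the exponential spent in [le_mul_exp]. *)
Definition C6 := 2 * ((2 * M ^+ 2 / delta + M + delta / 2) * 16) + 1.

Let Cs0 : 0 <= smooth_cst M delta. Proof. exact: sqrtr_ge0. Qed.
Lemma C5_gt0 : 0 < C5.
Proof. by rewrite ltr_wpDl// mulr_ge0// mulr_ge0 ?expR_ge0// addr_ge0. Qed.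
Lemma C6_gt0 : 0 < C6.
Proof.
rewrite ltr_wpDl// mulr_ge0// mulr_ge0//; apply: addr_ge0; last by rewrite divr_ge0// ltW.
by apply: addr_ge0; [rewrite divr_ge0 ?(ltW delta0)// mulr_ge0 ?sqr_ge0|rewrite ltW].
Qed.

Definition lip_weight lam (psi : X -> R) :=
  [/\ forall y z, `|psi y - psi z| <= lam * d y z, exists Bd, forall x, `|psi x| <= Bd &
      forall e, 0 < k e -> `|psi e.2 - psi e.1| <= 1].

Lemma lip_grad lam psi : 0 <= lam -> lip_weight lam psi ->
  forall y, summR (fun z => k (y, z) * (psi z - psi y) ^+ 2) /\
    tsum (fun z => k (y, z) * (psi z - psi y) ^+ 2) <= lam ^+ 2 * m y.
Proof.
move=> l0 [hL _ _] y; have [s1 s2] := k_len y.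
have pt z : k (y, z) * (psi z - psi y) ^+ 2 <= lam ^+ 2 * (k (y, z) * d y z ^+ 2).
  rewrite [leRHS]mulrCA; apply: (ler_wpM2l (k_ge0 _)); rewrite -exprMn -(real_normK (num_real (psi z - psi y))).
  rewrite lerXn2r ?nnegrE ?normr_ge0 ?(mulr_ge0 l0 (d_ge0 y z))//.
  by rewrite distrC; exact: hL.
have s3 := summRZ (lam ^+ 2) s1.
have s4 : summR (fun z => k (y, z) * (psi z - psi y) ^+ 2).
  by apply: summR_le s3 => z; rewrite ger0_norm// mulr_ge0 ?sqr_ge0.
split=> //; apply: le_trans (le_tsum s4 s3 pt) _; rewrite (tsumZ _ s1).
by apply: (ler_wpM2l (sqr_ge0 _)).
Qed.

(** The sup bound is applied on a ball so small that psi, which vanishes at x, stays bounded there;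
    local norms of the solution and of its image under L are then controlled by the weighted global
    ones. *)
Lemma heat_pt c (el : elliptic m k M delta c) (t lam : R) f psi x : 0 < t -> 0 <= lam ->
  l2 m f -> lip_weight lam psi -> psi x = 0 ->
  cmod (heat m_gt0 k_ge0 k_nb delta0 M0 el t%:C%C f x) <=
    C5 / Num.sqrt t * expR (C6 * (lam ^+ 2 * t)) * nm m (wexp psi f).
Proof.
move=> t0 l0 lf hpsi psix; have [hL [Bd hB] hJ] := hpsi.
have [g Gg hw] := heat_weighted m_gt0 k_ge0 k_nb delta0 M0 el t0 lf.
have [w1 w2] := hw psi (lam ^+ 2) Bd (sqr_ge0 lam) hB hJ (lip_grad l0 hpsi).
set u := heat _ _ _ _ _ _ _ _ in Gg w1 *; have [[lu _] lg _] := Gg.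
set r := expR _ in w1 w2; set N := nm m (wexp psi f) in w1 w2 *.
have N0 : 0 <= N by exact: nm_ge0.
have r0 : 0 <= r by exact: expR_ge0.
set s := (Num.sqrt t)^-1; have st0 : 0 < Num.sqrt t by rewrite sqrtr_gt0.
have s0 : 0 < s by rewrite invr_gt0.
have sE : s ^+ 2 = t^-1 by rewrite /s exprVn sqr_sqrtr// ltW.
have sl0 : 0 < s + lam by rewrite ltr_wpDr.
(* At most the square root of t, the natural scale of the semigroup, and at most 1 / lambda, the
   scale on which the weight varies. *)
set rho := (s + lam)^-1; have rho0 : 0 < rho by rewrite invr_gt0.
have L0 : 0 <= Lam CW by rewrite /Lam addr_ge0//; move: CW1; lra.
have loc v : l2 m v -> nm (mball m d x (Lam CW * rho)) v <= expR (Lam CW) * nm m (wexp psi v).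
  move=> lv; have lw : l2 m (wexp psi v) by exact: (wexp_l2 m_gt0 hB).
  have eE : expR (Lam CW) = cmod (expR (Lam CW))%:C%C by rewrite cmodR ger0_norm ?expR_ge0.
  rewrite eE -(nmZ _ lw).
  have lz := l2Z m_ge0 (expR (Lam CW))%:C%C lw.
  apply: ler_wsqrtr; apply: le_tsum => //; first exact: l2_mball.
  move=> z; rewrite /mball; case: ifP => [zx|_]; last by rewrite mulr0 mulr_ge0 ?rd_ge0.
  apply: (ler_wpM2r (m_ge0 z)); rewrite -!cmod2.
  rewrite lerXn2r ?nnegrE ?cmod_ge0// /wexp !cmodM !cmodR !ger0_norm ?expR_ge0//.
  rewrite mulrA -expRD ler_peMl ?cmod_ge0//; apply: le_trans (expR_ge1Dx _); rewrite lerDl.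
  have := hL x z; rewrite psix sub0r normrN ler_norml => /andP[h _].
  have h2 : lam * d x z <= Lam CW.
    apply: le_trans (ler_wpM2l l0 (ltW zx)) _; rewrite mulrCA.
    by apply: ler_piMr => //; rewrite /rho ler_pdivrMr// mul1r lerDr ltW.
  lra.
pose A := (expR (Lam CW) * (2 + smooth_cst M delta)) * (s * expR (lam ^+ 2 * t) * r * N).
have e1 : 1 <= expR (lam ^+ 2 * t).
  by apply: le_trans (expR_ge1Dx _); rewrite lerDl mulr_ge0 ?sqr_ge0// ltW.
have lamS : lam <= s * expR (lam ^+ 2 * t).
  by apply: le_mul_exp => //; rewrite sE mulVf// gt_eqF.
have ss : s <= s * expR (lam ^+ 2 * t) by rewrite ler_peMr// ltW.
have c0 : 0 <= expR (Lam CW) * (2 + smooth_cst M delta) by rewrite mulr_ge0 ?expR_ge0// addr_ge0.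
have E0 : 0 <= expR (lam ^+ 2 * t) by exact: expR_ge0.
have p0 : 0 <= s * expR (lam ^+ 2 * t) * r * N by rewrite mulr_ge0// mulr_ge0// mulr_ge0// ltW.
have A0 : 0 <= A by exact: mulr_ge0.
set B := mball m d x (Lam CW * rho) in loc.
have B0 z : 0 <= B z by rewrite /B /mball; case: ifP.
have rN0 : 0 <= r * N by exact: mulr_ge0.
have eL0 := expR_ge0 (Lam CW).
have a1 : nm B u / rho <= expR (Lam CW) * (2 * (s * expR (lam ^+ 2 * t) * (r * N))).
  rewrite /rho invrK; have h := le_trans (loc u lu) (ler_wpM2l eL0 w1).
  apply: le_trans (ler_wpM2r (ltW sl0) h) _.
  have := ler_wpM2r (mulr_ge0 eL0 rN0) lamS; have := ler_wpM2r (mulr_ge0 eL0 rN0) ss; lra.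
have a2 : rho * nm B g <= expR (Lam CW) * (smooth_cst M delta * (s * expR (lam ^+ 2 * t) * (r * N))).
  have h := le_trans (loc g lg) (ler_wpM2l eL0 w2).
  have rs : rho <= s^-1 by rewrite lef_pV2 ?posrE// lerDl.
  apply: le_trans (ler_pM (ltW rho0) (nm_ge0 _ _) rs h) _.
  have -> : s^-1 * (expR (Lam CW) * (smooth_cst M delta / t * r * N)) =
      expR (Lam CW) * (smooth_cst M delta * (s * (r * N))).
    by rewrite -sE; field; rewrite gt_eqF.
  apply: (ler_wpM2l eL0); apply: (ler_wpM2l Cs0); exact: (ler_wpM2r rN0).
have hA : nq B u / rho ^+ 2 + rho ^+ 2 * nq B g <= A ^+ 2.
  rewrite -!(nm2 B0) -expr_div_n -exprMn.
  have b1 : 0 <= nm B u / rho by rewrite divr_ge0 ?nm_ge0// ltW.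
  have b2 : 0 <= rho * nm B g by rewrite mulr_ge0 ?nm_ge0// ltW.
  apply: (@le_trans _ _ ((nm B u / rho + rho * nm B g) ^+ 2)).
    by have := mulr_ge0 b1 b2; lra.
  rewrite lerXn2r ?nnegrE ?addr_ge0//; apply: le_trans (lerD a1 a2) _.
  by rewrite /A le_eqVlt; apply/orP; left; apply/eqP; ring.
have := sup_bound m_gt0 k_ge0 k_sym d_ge0 d_refl d_sym d_tri hs_gt0 CW1 CP0 cL0 d_edge d_far k_len
  vol_fin vol_ge poinc delta0 M0 el rho0 Gg A0 hA.
move=> h; apply: le_trans h _; apply: le_trans (ler_wpM2r A0 (ler_norm _)) _.
have -> : C5 / Num.sqrt t * expR (C6 * (lam ^+ 2 * t)) * N = C5 * (s * expR (lam ^+ 2 * t) * r * N).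
  have -> : C6 * (lam ^+ 2 * t) = lam ^+ 2 * t + 2 * t * wrate (lam ^+ 2) M delta.
    by rewrite /C6 /wrate; ring.
  by rewrite expRD -/r /s; ring.
rewrite /A mulrA; apply: (ler_wpM2r p0); by rewrite /C5 lerDl.
Qed.

Section Pair.
Variables (c : X * X -> R[i]).
Hypothesis el : elliptic m k M delta c.
Hypothesis el' : elliptic m k M delta (fun e => conjc (c e)).
Let T := heat m_gt0 k_ge0 k_nb delta0 M0 el.
Let T' := heat m_gt0 k_ge0 k_nb delta0 M0 el'.
Definition unit_mass y : X -> R[i] := dirac y (1 / (m y)%:C%C).
(** Taking the adjoint semigroup makes the kernel representation immediate: the value at x is a
    pairing with a point mass, and the semigroup is moved to that side. The form with T and the
    point mass at y is [heat_unit_mass]. *)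
Definition kernel (t : R) x y : R[i] := conjc (T' t%:C%C (unit_mass x) y).

Lemma l2_unit_mass y : l2 m (unit_mass y).
Proof. by apply: finsupp_l2; exact: finsupp_dirac. Qed.

Let lT t f : 0 < t -> l2 m f -> l2 m (T t%:C%C f).
Proof. by move=> t0; apply: heat_l2; exact: cone_real. Qed.
Lemma heat_test (t : R) (a : R[i]) f x : 0 < t -> l2 m f ->
  rd a (T t%:C%C f x) = ip m f (fun y => a * T' t%:C%C (unit_mass x) y).
Proof.
move=> t0 lf; have ct := cone_real delta0 M0 t0.
have ld : l2 m (dirac x (a / (m x)%:C%C)) by apply: finsupp_l2; exact: finsupp_dirac.
rewrite -(ip_dirac m_gt0) ipC (heat_adj m_gt0 k_ge0 k_nb delta0 M0 el el' t0 lf ld) -/T'.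
have [h1 h2] := heat_contr m_gt0 k_ge0 k_nb delta0 M0 el' ct; rewrite -/T' in h1 h2.
have [l0 n0] := h1 _ (l2_0 m).
have T0 : T' t%:C%C (fun=> 0) = fun=> 0.
  apply: (nm_eq0_fun m_gt0 l0); apply/le_anti; rewrite nm_ge0 andbT.
  by apply: le_trans n0 _; rewrite nm0.
apply: ip_extr => y; have := h2 a _ _ (l2_unit_mass x) (l2_0 m); rewrite T0.
have -> : (fun z => a * unit_mass x z + 0) = dirac x (a / (m x)%:C%C).
  by apply/funext => z; rewrite /unit_mass /dirac; case: ifP => _; rewrite ?mulr0 addr0// mul1r.
by move=> ->; rewrite addr0.
Qed.

Lemma rd_inj (z w : R[i]) : (forall a, rd a z = rd a w) -> z = w.
Proof.
move=> h; have := h 1; have := h 'i%C; case: z {h} => a b; case: w => a' b'.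
by rewrite /rd /= !mul0r !mul1r !add0r !addr0 => -> ->.
Qed.

Lemma heat_unit_mass (t : R) x y : 0 < t -> T t%:C%C (unit_mass y) x = kernel t x y.
Proof.
move=> t0; apply: rd_inj => a; rewrite (heat_test _ _ t0 (l2_unit_mass y)) (ip_dirac m_gt0) /kernel.
by case: (T' _ _ _) => p q; case: a => r s; rewrite /rd /=; ring.
Qed.

(** For F = T_t of the point mass at y, the squared weighted norm is the real part of the value at y
    of T'_t (e^{2 psi} F). The pointwise bound for T' with the opposite weight psi y - psi, which
    vanishes at y, estimates it by a multiple of the weighted norm itself; one factor is divided
    out. *)
Lemma heat_dual (t lam : R) psi y : 0 < t -> 0 <= lam -> lip_weight lam psi ->
  nm m (wexp psi (T t%:C%C (unit_mass y))) <=
  C5 / Num.sqrt t * expR (C6 * (lam ^+ 2 * t)) * expR (psi y).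
Proof.
move=> t0 l0 hpsi; have [hL [Bd hB] hJ] := hpsi; set F := T _ _.
have lF : l2 m F by apply: lT => //; exact: l2_unit_mass.
have lW : l2 m (wexp psi F) by exact: (wexp_l2 m_gt0 hB).
have lWW : l2 m (wexp psi (wexp psi F)) by exact: (wexp_l2 m_gt0 hB).
pose phi z := psi y - psi z.
have hphi : lip_weight lam phi.
  split.
  - by move=> a b; rewrite /phi (_ : _ - _ = psi b - psi a); [rewrite d_sym; exact: hL|ring].
  - exists (Bd + Bd) => z; apply: le_trans (ler_normB _ _) _; exact: lerD.
  - move=> e ke; rewrite /phi (_ : _ - _ = psi e.1 - psi e.2); last by ring.
    by rewrite distrC; exact: hJ.
set N := nm m (wexp psi F); set Q := _ * expR (psi y).
have N0 : 0 <= N by exact: nm_ge0.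
have h : N ^+ 2 <= Q * N.
  rewrite (nm2 m_ge0).
  have -> : nq m (wexp psi F) = rd 1 (T' t%:C%C (wexp psi (wexp psi F)) y).
    rewrite -(ip_dirac m_gt0) -(heat_adj m_gt0 k_ge0 k_nb delta0 M0 el el' t0 (l2_unit_mass y) lWW).
    rewrite -/T -/F /nq {1}/wexp ip_mull; apply: ip_extr => z; rewrite /wexp.
    by rewrite conjc_real.
  apply: (@le_trans _ _ (cmod (T' t%:C%C (wexp psi (wexp psi F)) y))).
    by apply: le_trans (Re_le_cmod _); rewrite /rd /= mul1r mul0r addr0 ler_norm.
  apply: le_trans (heat_pt el' t0 l0 lWW hphi _) _; first by rewrite /phi subrr.
  have -> : wexp phi (wexp psi (wexp psi F)) = fun z => (expR (psi y))%:C%C * wexp psi F z.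
    apply/funext => z; rewrite /wexp mulrA -rmorphM /= -expRD.
    by congr ((expR _)%:C%C * _); rewrite /phi; ring.
  rewrite (nmZ _ lW) cmodR ger0_norm ?expR_ge0// -/N /Q.
  by rewrite le_eqVlt; apply/orP; left; apply/eqP; ring.
have [->|Nn] := eqVneq N 0.
  apply: mulr_ge0; last exact: expR_ge0.
  apply: mulr_ge0; last exact: expR_ge0.
  by apply: divr_ge0; [exact: ltW C5_gt0|exact: sqrtr_ge0].
have Np : 0 < N by rewrite lt_def Nn.
by rewrite -(ler_pM2r Np) -expr2.
Qed.

Lemma kernel_weighted (t lam : R) psi x y : 0 < t -> 0 <= lam -> lip_weight lam psi ->
  psi x = 0 ->
  cmod (kernel (2 * t) x y) <= C5 ^+ 2 / t * expR (2 * (C6 * (lam ^+ 2 * t)) + psi y).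
Proof.
move=> t0 l0 hpsi px; have t20 : 0 < 2 * t by rewrite mulr_gt0.
rewrite -(heat_unit_mass x y t20) (_ : 2 * t = t + t); last by ring.
have ct := cone_real delta0 M0 t0.
rewrite rmorphD /T (heatD m_gt0 k_ge0 k_nb delta0 M0 el ct ct (l2_unit_mass y)) -/T.
have lF := lT t0 (l2_unit_mass y).
apply: le_trans (heat_pt el t0 l0 lF hpsi px) _.
have q0 : 0 <= C5 / Num.sqrt t * expR (C6 * (lam ^+ 2 * t)).
  apply: mulr_ge0; last exact: expR_ge0.
  by apply: divr_ge0; [exact: ltW C5_gt0|exact: sqrtr_ge0].
apply: le_trans (ler_wpM2l q0 (heat_dual y t0 l0 hpsi)) _.
rewrite expRD (_ : 2 * (C6 * _) = C6 * (lam ^+ 2 * t) + C6 * (lam ^+ 2 * t)); last by ring.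
rewrite expRD; set E := expR (C6 * _); set s := (Num.sqrt t)^-1.
have -> : t^-1 = s * s by rewrite /s -invfM -expr2 sqr_sqrtr// ltW.
by rewrite le_eqVlt; apply/orP; left; apply/eqP; ring.
Qed.

(** The weight is lambda times a distance function truncated at d x y. The truncation makes it
    bounded and constant off the ball, so only edges meeting the ball limit lambda. The distance may
    be taken from x or from y; in both cases the weight is normalised to vanish at x and equals -
    lambda d x y at y. *)
Lemma kernel_gauss (t lam H : R) x y : 0 < t -> 0 <= lam -> lam * H <= 1 ->
  (forall z w, 0 < k (z, w) -> d x z < d x y \/ d x w < d x y -> d z w <= H) \/
  (forall z w, 0 < k (z, w) -> d y z < d x y \/ d y w < d x y -> d z w <= H) ->
  cmod (kernel (2 * t) x y) <= C5 ^+ 2 / t * expR (2 * (C6 * (lam ^+ 2 * t)) - lam * d x y).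
Proof.
move=> t0 l0 lH hH; set D := d x y; pose trunc o z := Num.min (d o z) D.
have D0 : 0 <= D by exact: d_ge0.
have tl o a b : `|trunc o a - trunc o b| <= d a b.
  rewrite /trunc; have h1 := d_tri o a b; have h2 := d_tri o b a; rewrite (d_sym b a) in h2.
  have h3 := d_ge0 a b; rewrite ler_norml /Num.min.
  by case: ltP => ?; case: ltP => ?; apply/andP; split; lra.
have tb o a : 0 <= trunc o a <= D by rewrite /trunc le_min d_ge0 D0 ge_min lexx orbT.
have tj o : (forall z w, 0 < k (z, w) -> d o z < D \/ d o w < D -> d z w <= H) ->
    forall z w, 0 < k (z, w) -> lam * `|trunc o z - trunc o w| <= 1.
  move=> ho z w kzw; have [h1|h1] := ltP (d o z) D.
    apply: le_trans lH; apply: (ler_wpM2l l0); apply: le_trans (tl o z w) _; apply: ho kzw _; by left.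
  have [h2|h2] := ltP (d o w) D.
    apply: le_trans lH; apply: (ler_wpM2l l0); apply: le_trans (tl o z w) _; apply: ho kzw _; by right.
  by rewrite /trunc (min_idPr h1) (min_idPr h2) subrr normr0 mulr0.
case: hH => hH.
- have hw : lip_weight lam (fun z => - (lam * trunc x z)).
    split.
    + move=> a b; rewrite -opprD normrN -mulrBr normrM (ger0_norm l0).
      by apply: (ler_wpM2l l0); exact: tl.
    + exists (lam * D) => z; rewrite normrN normrM (ger0_norm l0); apply: (ler_wpM2l l0).
      by case/andP: (tb x z) => h1 h2; rewrite ger0_norm.
    + case=> z w kzw /=; rewrite -opprD normrN -mulrBr normrM (ger0_norm l0) distrC; exact: (tj x hH).
  have px : - (lam * trunc x x) = 0 by rewrite /trunc d_refl (min_idPl D0) mulr0 oppr0.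
  have := kernel_weighted y t0 l0 hw px.
  have -> : - (lam * trunc x y) = - (lam * D) by rewrite /trunc minxx.
  by [].
- have hw : lip_weight lam (fun z => lam * (trunc y z - D)).
    split.
    + move=> a b; rewrite -mulrBr (_ : _ - _ = trunc y a - trunc y b); last by ring.
      by rewrite normrM (ger0_norm l0); apply: (ler_wpM2l l0); exact: tl.
    + exists (lam * D) => z; rewrite normrM (ger0_norm l0); apply: (ler_wpM2l l0).
      by case/andP: (tb y z) => h1 h2; rewrite ler_norml; apply/andP; split; lra.
    + case=> z w kzw /=; rewrite -mulrBr (_ : _ - _ = trunc y w - trunc y z); last by ring.
      by rewrite normrM (ger0_norm l0) distrC; exact: (tj y hH).
  have px : lam * (trunc y x - D) = 0 by rewrite /trunc d_sym -/D minxx subrr mulr0.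
  have := kernel_weighted y t0 l0 hw px.
  have -> : lam * (trunc y y - D) = - (lam * D) by rewrite /trunc d_refl (min_idPl D0) sub0r mulrN.
  by [].
Qed.

Definition C7 := 2 * C5 ^+ 2.
(** 1 keeps the oscillation of the weight admissible; 1 / (2 C6) lets half of lambda d absorb the
    term C6 lambda^2 t. *)
Definition rate := Num.min 1 (2 * C6)^-1.

Lemma rate_gt0 : 0 < rate.
Proof. by rewrite lt_min ltr01 invr_gt0 mulr_gt0// C6_gt0. Qed.

(** A slope is admissible if lambda H and lambda t / d are at most [rate]; then half of the decay
    lambda d survives. The first regime takes lambda = rate / H, the second rate d / t. *)
Lemma kernel_decay (t H : R) x y : 0 < t -> 0 < H ->
  (forall z w, 0 < k (z, w) -> d x z < d x y \/ d x w < d x y -> d z w <= H) \/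
  (forall z w, 0 < k (z, w) -> d y z < d x y \/ d y w < d x y -> d z w <= H) ->
  (t <= H * d x y -> cmod (kernel t x y) <= C7 / t * expR (- (rate / 2) * (d x y / H))) /\
  (H * d x y <= t -> cmod (kernel t x y) <= C7 / t * expR (- (rate / 2) * (d x y ^+ 2 / t))).
Proof.
move=> t0 H0 hH; have t20 : 0 < t / 2 by rewrite divr_gt0.
have tE : t = 2 * (t / 2) by field.
have r0 := rate_gt0; have D0 := d_ge0 x y; set D := d x y in hH D0 *.
have r1 : rate <= 1 by rewrite /rate ge_min lexx.
have rC : C6 * rate <= 2^-1.
  have : rate <= (2 * C6)^-1 by rewrite /rate ge_min lexx orbT.
  by move=> /(ler_wpM2l (ltW C6_gt0)); rewrite invfM mulrCA mulfV ?mulr1 ?gt_eqF ?C6_gt0.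
have C0 : 0 <= C7 / t by rewrite divr_ge0 ?(ltW t0)// mulr_ge0 ?sqr_ge0.
have key lam : 0 <= lam -> lam * H <= rate -> lam * t <= rate * D ->
    cmod (kernel t x y) <= C7 / t * expR (- (lam * D / 2)).
  move=> l0 h1 h2; rewrite {1}tE; apply: le_trans (kernel_gauss t20 l0 (le_trans h1 r1) hH) _.
  rewrite (_ : C5 ^+ 2 / (t / 2) = C7 / t); last by rewrite /C7; field; rewrite gt_eqF.
  apply: (ler_wpM2l C0); rewrite ler_expR -/D.
  have h3 := ler_wpM2l (mulr_ge0 (ltW C6_gt0) l0) h2.
  have h4 := ler_wpM2r (mulr_ge0 l0 D0) rC.
  lra.
split=> hD.
- have h := key (rate / H) _ _ _; rewrite (_ : - (rate / 2) * (D / H) = - (rate / H * D / 2)); last by field; rewrite gt_eqF.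
  apply: h.
  + by rewrite divr_ge0 ?ltW.
  + by rewrite -mulrA mulVf ?mulr1// gt_eqF.
  + by rewrite -mulrA ler_pM2l// ler_pdivrMl.
- have h := key (rate * D / t) _ _ _; rewrite (_ : - (rate / 2) * (D ^+ 2 / t) = - (rate * D / t * D / 2)); last by field; rewrite gt_eqF.
  apply: h.
  + by rewrite divr_ge0 ?(ltW t0)// mulr_ge0// ltW.
  + by rewrite -!mulrA ler_piMr ?(ltW r0)// mulrA mulrAC ler_pdivrMr// mul1r mulrC.
  + by rewrite -mulrA mulVf ?mulr1// gt_eqF.
Qed.

Definition C8 := 2 * (D3 CW CP cL M delta * (Num.sqrt 2 `^ heta CW CP M delta) * (1 + smooth_cst M delta) * C5).

(** With s = t / 2, the function T_s T_s of the point mass at y is regular at radius the square root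
    of s, and the l2 norm of the inner factor is bounded by duality with psi = 0. *)
Lemma kernel_holder (t : R) x x' y : 0 < t ->
  cmod (kernel t x y - kernel t x' y) <= C8 / t * (d x x' / Num.sqrt t) `^ heta CW CP M delta.
Proof.
move=> t0; have t20 : 0 < t / 2 by rewrite divr_gt0.
set s := t / 2 in t20 *; have tE : t = s + s by rewrite /s; field.
have ct := cone_real delta0 M0 t20.
rewrite -!heat_unit_mass// {1 2}tE rmorphD /T (heatD m_gt0 k_ge0 k_nb delta0 M0 el ct ct (l2_unit_mass y)) -/T.
set F := T s%:C%C (unit_mass y); have lF : l2 m F by exact: lT (l2_unit_mass y).
have w0 lam : 0 <= lam -> lip_weight lam (fun=> 0).
  move=> l0; split.
  - by move=> a b; rewrite subrr normr0 mulr_ge0.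
  - by exists 0 => z; rewrite normr0.
  - by move=> e _; rewrite subrr normr0.
have W (v : X -> R[i]) : wexp (fun=> 0) v = v.
  by apply/funext => z; rewrite /wexp expR0 mul1r.
have nF : nm m F <= C5 / Num.sqrt s.
  by have := heat_dual y t20 (lexx 0) (w0 0 (lexx 0)); rewrite W expr0n mul0r mulr0 expR0 !mulr1.
have [g Gg hg] := heat_weighted m_gt0 k_ge0 k_nb delta0 M0 el t20 lF; rewrite -/T in Gg hg.
have [n1 n2] : nm m (T s%:C%C F) <= nm m F /\ nm m g <= smooth_cst M delta / s * nm m F.
  have [hL [Bd hB] hJ] := w0 0 (lexx 0).
  have := hg _ (0 ^+ 2) Bd (sqr_ge0 0) hB hJ (lip_grad (lexx 0) (w0 0 (lexx 0))).
  by rewrite !W /wrate expr0n !mulr0 expR0 !mul1r mulr1.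
have q0 : 0 < Num.sqrt s by rewrite sqrtr_gt0.
have h := holder_bound m_gt0 k_ge0 k_sym d_ge0 d_refl d_sym d_tri hs_gt0 CW1 CP0 cL0 d_edge d_far k_len
  vol_fin vol_ge poinc delta0 M0 el x x' q0 Gg.
apply: le_trans h _; set D := D3 _ _ _ _ _; set eta := heta _ _ _ _.
have D30 : 0 <= D by exact: D3_ge0.
have sE : Num.sqrt t = Num.sqrt 2 * Num.sqrt s by rewrite -sqrtrM// /s; congr Num.sqrt; field.
have two0 : 0 < Num.sqrt 2 :> R by rewrite sqrtr_gt0.
have p0 : 0 <= d x x' / Num.sqrt t by rewrite divr_ge0.
have -> : (d x x' / Num.sqrt s) `^ eta = Num.sqrt 2 `^ eta * (d x x' / Num.sqrt t) `^ eta.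
  by rewrite -powRM// ?sqrtr_ge0//; congr (_ `^ _); rewrite sE; field; rewrite !gt_eqF.
set P := (d x x' / Num.sqrt t) `^ eta; set Q := Num.sqrt 2 `^ eta.
have P0 : 0 <= P by exact: powR_ge0.
have Q0 : 0 <= Q by exact: powR_ge0.
have e1 : nm m (T s%:C%C F) / Num.sqrt s + Num.sqrt s * nm m g <= (1 + smooth_cst M delta) * C5 * 2 / t.
  have i0 : 0 <= (Num.sqrt s)^-1 by rewrite invr_ge0 ltW.
  have a1 := ler_wpM2r i0 (le_trans n1 nF).
  have c0 : 0 <= smooth_cst M delta / s by rewrite divr_ge0// ltW.
  have a2 := ler_wpM2l (ltW q0) (le_trans n2 (ler_wpM2l c0 nF)).
  apply: le_trans (lerD a1 a2) _; rewrite le_eqVlt; apply/orP; left; apply/eqP.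
  have ss : s = Num.sqrt s ^+ 2 by rewrite sqr_sqrtr// ltW.
  rewrite (_ : t = 2 * Num.sqrt s ^+ 2); last by rewrite -ss tE; ring.
  move: ss q0; move: (Num.sqrt s) => q ss q0; by rewrite ss; field; rewrite gt_eqF.
have := ler_wpM2l (mulr_ge0 D30 (mulr_ge0 Q0 P0)) e1 => e2.
apply: le_trans e2 _; rewrite /C8 -/D -/eta -/Q le_eqVlt; apply/orP; left; apply/eqP; ring.
Qed.

End Pair.
End Kernel.

(** * Weighted graphs *)

Section Graph.
Variables (R : realType) (Gamma : choiceType) (h mu : Gamma -> Gamma -> R).
Variables (N : nat) (CW Cmu : R).
Hypothesis W : weighted_graph h mu N CW Cmu.
Hypothesis CW1 : 1 <= CW.
Local Notation adj := (adj h).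
Local Notation m := (vmass h mu).
Local Notation d := (gdist h).
Local Notation hs := (hsup h).

Definition star_of (x : Gamma) : seq Gamma := enum_fset (fset_set [set y | adj x y]).
(** The factor h^-2 of |df|^2 is moved into the edge weight; the diagonal, where df vanishes, gets
    weight 0. *)
Definition conduct (e : Gamma * Gamma) : R :=
  if adj e.1 e.2 && (e.1 != e.2) then mu e.1 e.2 / h e.1 e.2 ^+ 2 else 0.

Let CW0 : 0 < CW. Proof. exact: lt_le_trans CW1. Qed.

Lemma adjxx x : adj x x.
Proof. by rewrite /Defs.adj eqxx orbT. Qed.

Lemma adj_sym x y : adj x y = adj y x.
Proof. by rewrite /Defs.adj (weight_sym W) (eq_sym x). Qed.

Lemma adj_pos x y : adj x y -> x != y -> 0 < h x y.
Proof. by rewrite /Defs.adj => /orP[//|/eqP ->]; rewrite eqxx. Qed.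

Let fin_star x : finite_set [set y | adj x y].
Proof. by apply/finite_set_leP; exists N; exact: (graph_degree W). Qed.

Lemma mem_star x y : (y \in star_of x) = adj x y.
Proof. by rewrite /star_of [LHS]in_fset_set//; apply/idP/idP => [/set_mem//|xy]; exact/mem_set. Qed.

Lemma star_uniq x : uniq (star_of x).
Proof. exact: fset_uniq. Qed.

Lemma size_star x : (size (star_of x) <= N)%N.
Proof. exact: geq_card_fset_set (graph_degree W x). Qed.

Lemma sum_starE (F : Gamma -> R) x : \sum_(y \in [set y | adj x y]) F y = \sum_(y <- star_of x) F y.
Proof. by rewrite fsbig_finite. Qed.

Lemma vmassE x : m x = \sum_(y <- star_of x) mu x y.
Proof. exact: sum_starE. Qed.

Lemma mu_le_vmass x y : adj x y -> mu x y <= m x.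
Proof.
move=> xy; rewrite vmassE (big_rem y) ?mem_star//= lerDl big_seq; apply: sumr_ge0 => z.
by move/mem_rem; rewrite mem_star => xz; exact/ltW/(mu_gt0 W).
Qed.

Lemma vmass_gt0 x : 0 < m x.
Proof. exact: lt_le_trans (mu_gt0 W (adjxx x)) (mu_le_vmass (adjxx x)). Qed.

Lemma Cmu_ge1 x y : adj x y -> 1 <= Cmu.
Proof.
move=> xy; have := mu_comparable W xy xy; rewrite mulfV// gt_eqF//; exact: (mu_gt0 W).
Qed.

Lemma vmass_le x y : adj x y -> m x <= N%:R * Cmu * mu x y.
Proof.
move=> xy; have m0 := mu_gt0 W xy.
apply: (@le_trans _ _ (\sum_(z <- star_of x) Cmu * mu x y)).
  rewrite vmassE big_seq [leRHS]big_seq; apply: ler_sum => z; rewrite mem_star => xz.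
  by rewrite -ler_pdivrMr//; exact: (mu_comparable W).
have C0 : 0 <= Cmu * mu x y by rewrite mulr_ge0 ?(ltW m0)//; apply: le_trans (Cmu_ge1 xy).
have -> : \sum_(z <- star_of x) Cmu * mu x y = (size (star_of x))%:R * (Cmu * mu x y).
  by rewrite big_const_seq count_predT iter_addr_0 mulr_natl.
rewrite -[leRHS]mulrA ler_wpM2r// ler_nat.
exact: size_star.
Qed.

Lemma weight_ratio x y z : adj x y -> adj x z -> y != x -> h x z <= CW * h x y.
Proof.
move=> xy xz yx; have hy : 0 < h x y by apply: adj_pos => //; rewrite eq_sym.
have [->|zx] := eqVneq z x; first by rewrite (weight_diag W) mulr_ge0 ?(ltW CW0)// ltW.
by have /andP[_] := weight_comparable W xz xy zx yx; rewrite ler_pdivrMr.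
Qed.

Lemma exists_neighbor x : exists2 y, adj x y & y != x.
Proof.
have [y yx] : exists y, y != x.
  have [[y Hy]|no] := pselect (exists y, y != x); first by exists y.
  exfalso; apply: (graph_infinite W); apply: (sub_finite_set (B := [set x])); last exact: finite_set1.
  by move=> y _ /=; apply/eqP; apply/negPn/negP => yx; apply: no; exists y.
have [s] := graph_connected W x y; elim: s => [_ /= xy|z s IH /= /andP[xz zs] l].
  by rewrite xy eqxx in yx.
have [zx|zx] := eqVneq z x; last by exists z.
by apply: IH; rewrite -zx.
Qed.

Let weights x := [set h x y | y in [set y | adj x y]].

Let weights_ub x B : (forall y, adj x y -> h x y <= B) -> ubound (weights x) B.
Proof. by move=> hB _ [y xy <-]; exact: hB. Qed.

Let weights_sup x : has_sup (weights x).
Proof.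
split; first by exists (h x x), x => //; exact: adjxx.
have [y xy yx] := exists_neighbor x; exists (CW * h x y); apply: weights_ub => z xz.
exact: weight_ratio.
Qed.

Lemma weight_le_hsup x y : adj x y -> h x y <= hs x.
Proof. by move=> xy; apply: ub_le_sup; [exact: (weights_sup x).2|exists y]. Qed.

Lemma hsup_le x y : adj x y -> y != x -> hs x <= CW * h x y.
Proof.
move=> xy yx; apply: ge_sup; first exact: (weights_sup x).1.
by apply: weights_ub => z xz; exact: weight_ratio.
Qed.

Lemma hsup_gt0 x : 0 < hs x.
Proof.
have [y xy yx] := exists_neighbor x; apply: lt_le_trans (weight_le_hsup xy).
by apply: adj_pos => //; rewrite eq_sym.
Qed.

Let lengths x y := [set path_length h x s | s in [set s | path adj x s /\ last x s = y]].

Lemma path_length_cons x z s : path_length h x (z :: s) = h x z + path_length h z s.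
Proof. by rewrite /path_length /= big_cons. Qed.

Lemma path_length_ge0 x s : 0 <= path_length h x s.
Proof.
elim: s x => [|z s IH] x; first by rewrite /path_length big_nil.
by rewrite path_length_cons addr_ge0 ?(weight_ge0 W).
Qed.

Lemma path_length_cat x s s' :
  path_length h x (s ++ s') = path_length h x s + path_length h (last x s) s'.
Proof. by rewrite /path_length pairmap_cat big_cat. Qed.

Let lengths_lb x y : has_lbound (lengths x y).
Proof. by exists 0 => _ [s _ <-]; exact: path_length_ge0. Qed.

Let lengths_n0 x y : lengths x y !=set0.
Proof. by have [s ps ls] := graph_connected W x y; exists (path_length h x s), s. Qed.

Lemma gdist_le x s : path adj x s -> d x (last x s) <= path_length h x s.
Proof. by move=> ps; apply: ge_inf; [exact: lengths_lb|exists s]. Qed.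

Lemma gdist_ge x y B : (forall s, path adj x s -> last x s = y -> B <= path_length h x s) -> B <= d x y.
Proof.
move=> hB; apply: lb_le_inf; first exact: lengths_n0.
by move=> _ [s [ps ls] <-]; exact: hB.
Qed.

Lemma gdist_ge0 x y : 0 <= d x y.
Proof. by apply: gdist_ge => s _ _; exact: path_length_ge0. Qed.

Lemma gdistxx x : d x x = 0.
Proof.
apply/le_anti; rewrite gdist_ge0 andbT.
by have := @gdist_le x [::] isT; rewrite /path_length big_nil.
Qed.

Let path_rev x s : path adj x s -> exists s', [/\ path adj (last x s) s', last (last x s) s' = x &
  path_length h (last x s) s' = path_length h x s].
Proof.
elim: s x => [|z s IH] x /=; first by exists [::].
move=> /andP[xz /IH [s' [p' l' e']]]; exists (s' ++ [:: x]); split.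
- by rewrite cat_path p' l' /= adj_sym xz.
- by rewrite last_cat.
- by rewrite path_length_cat e' l' !path_length_cons /path_length /= big_nil addr0 (weight_sym W) addrC.
Qed.

Lemma gdist_sym x y : d x y = d y x.
Proof.
suff le a b : d a b <= d b a by apply/le_anti; rewrite !le.
apply: gdist_ge => s ps ls; have [s' [p' l' <-]] := path_rev ps.
by rewrite ls in p' l' *; rewrite -l'; exact: gdist_le.
Qed.

Lemma gdist_tri x y z : d x z <= d x y + d y z.
Proof.
rewrite addrC -lerBlDr; apply: gdist_ge => s ps ls; rewrite lerBlDr -lerBlDl.
apply: gdist_ge => s' ps' ls'; rewrite lerBlDl addrC.
have := @gdist_le x (s' ++ s); rewrite cat_path ps' ls' ps /= => /(_ isT).
by rewrite last_cat path_length_cat ls' ls.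
Qed.

Lemma gdist_edge x y : adj x y -> d x y <= h x y.
Proof.
move=> xy; have := @gdist_le x [:: y]; rewrite /= xy => /(_ isT).
by rewrite path_length_cons /path_length big_nil addr0.
Qed.

(** A path that leaves x crosses an edge to a neighbour other than x, and the weights of these edges
    are comparable to hs x; repetitions of x at the start have length 0. *)
Lemma hsup_gdist x y : x != y -> hs x <= CW * d x y.
Proof.
move=> xy; rewrite -ler_pdivrMl// mulrC; apply: gdist_ge => s.
elim: s => [_ /= E|z s IH /= /andP[xz ps] ls]; first by rewrite E eqxx in xy.
rewrite path_length_cons; have [zx|zx] := eqVneq z x.
  by rewrite zx (weight_diag W) add0r; apply: IH; rewrite -zx.
apply: (@le_trans _ _ (h x z)); last by rewrite lerDl path_length_ge0.
by rewrite ler_pdivrMr// mulrC; exact: hsup_le.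
Qed.

Lemma conduct_ge0 e : 0 <= conduct e.
Proof.
case: e => x y; rewrite /conduct /=; case: ifP => // /andP[xy _].
by rewrite divr_ge0 ?sqr_ge0// ltW// (mu_gt0 W).
Qed.

Lemma conduct_adj x y : conduct (x, y) != 0 -> adj x y /\ x != y.
Proof. by rewrite /conduct /=; case: ifP => [/andP[]|]; rewrite ?eqxx. Qed.

Lemma conduct_sym x y : conduct (x, y) = conduct (y, x).
Proof.
rewrite /conduct /= (eq_sym y) (adj_sym y); case: ifP => // /andP[xy _].
by rewrite (mu_sym W)// (weight_sym W).
Qed.

Lemma conduct_star x y : conduct (x, y) != 0 -> y \in star_of x /\ x \in star_of y.
Proof. by case/conduct_adj => xy _; rewrite !mem_star adj_sym (adj_sym y) xy. Qed.

Lemma conduct_off x y : y \notin star_of x -> conduct (x, y) = 0.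
Proof. by rewrite mem_star /conduct /= => /negbTE ->. Qed.

Lemma gdist_conduct y z : 0 < conduct (y, z) -> d y z <= h y z /\ h y z <= hs y.
Proof.
move=> /gt_eqF /negbT /conduct_adj[yz _]; split; [exact: gdist_edge|exact: weight_le_hsup].
Qed.

(** An edge is at least as long as the distance of its ends, which cancels the h^-2 of the
    conductance and leaves at most the sum of the mu y z. *)
Lemma conduct_len y : summR (fun z => conduct (y, z) * d y z ^+ 2) /\
  tsum (fun z => conduct (y, z) * d y z ^+ 2) <= m y.
Proof.
have off z : z \notin star_of y -> conduct (y, z) * d y z ^+ 2 = 0.
  by move/conduct_off ->; rewrite mul0r.
split; first exact: finsupp_summR off.
rewrite (finsupp_tsum (star_uniq y) off) vmassE big_seq [leRHS]big_seq.
apply: ler_sum => z; rewrite mem_star => yz; rewrite /conduct /= yz /=.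
have m0 := ltW (mu_gt0 W yz); case: eqVneq => [_|yz'] /=; first by rewrite mul0r.
have h0 := adj_pos yz yz'; rewrite -mulrA ler_piMr// ler_pdivrMl ?exprn_gt0// mulr1.
by rewrite lerXn2r ?nnegrE ?gdist_ge0 ?(ltW h0)//; exact: gdist_edge.
Qed.

Let grad2E f x : grad h f x ^+ 2 = (hs x)^-1 ^+ 2 * \sum_(y <- star_of x) cmod (f y - f x) ^+ 2.
Proof.
rewrite /grad exprMn sum_starE sqr_sqrtr//; apply: sumr_ge0 => y _; exact: sqr_ge0.
Qed.

Let grad2m f x : grad h f x ^+ 2 * m x = ((hs x)^-1 ^+ 2 * m x) * \sum_(y <- star_of x) cmod (f y - f x) ^+ 2.
Proof. by rewrite grad2E mulrAC. Qed.

Let dist_star (c : R) F x : c * (\sum_(y <- star_of x) F y) = \sum_(y <- star_of x) c * F y.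
Proof. by rewrite mulr_sumr. Qed.

Definition star_energy (f : Gamma -> R[i]) x :=
  \sum_(y <- star_of x) conduct (x, y) * cmod (f y - f x) ^+ 2.

(** Together with [star_energy_le] this identifies the gradient norm with the edge norm: around x
    the h x y are comparable to hs x and the mu x y to m x. *)
Lemma grad_le f x : grad h f x ^+ 2 * m x <= N%:R * Cmu * star_energy f x.
Proof.
rewrite grad2m /star_energy !dist_star big_seq [leRHS]big_seq.
apply: ler_sum => y; rewrite mem_star => xy.
have [->|yx] := eqVneq y x; first by rewrite subrr cmod0 expr0n !mulr0.
have xy' : x != y by rewrite eq_sym.
have h0 := adj_pos xy xy'; have hx := hsup_gt0 x; have m0 := mu_gt0 W xy.
rewrite /conduct /= xy xy' /=; set S := cmod _ ^+ 2; have S0 : 0 <= S by exact: sqr_ge0.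
rewrite (_ : N%:R * Cmu * _ = (h x y)^-1 ^+ 2 * (N%:R * Cmu * mu x y) * S); last by rewrite exprVn; ring.
apply: (ler_wpM2r S0); apply: ler_pM; [exact: sqr_ge0|exact/ltW/vmass_gt0| |exact: vmass_le].
by rewrite lerXn2r ?nnegrE ?invr_ge0 ?(ltW hx) ?(ltW h0)// lef_pV2 ?posrE//; exact: weight_le_hsup.
Qed.

Lemma star_energy_ge0 f x : 0 <= star_energy f x.
Proof. by apply: sumr_ge0 => y _; rewrite mulr_ge0 ?conduct_ge0 ?sqr_ge0. Qed.

Lemma star_energy_le f x : star_energy f x <= CW ^+ 2 * (grad h f x ^+ 2 * m x).
Proof.
rewrite grad2m /star_energy !dist_star big_seq [leRHS]big_seq.
apply: ler_sum => y; rewrite mem_star => xy.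
have [->|yx] := eqVneq y x; first by rewrite subrr cmod0 expr0n !mulr0.
have xy' : x != y by rewrite eq_sym.
have h0 := adj_pos xy xy'; have hx := hsup_gt0 x; have m0 := mu_gt0 W xy.
rewrite /conduct /= xy xy' /=; set S := cmod _ ^+ 2; have S0 : 0 <= S by exact: sqr_ge0.
rewrite (_ : CW ^+ 2 * _ = (CW / hs x) ^+ 2 * m x * S); last by rewrite expr_div_n exprVn; ring.
apply: (ler_wpM2r S0); rewrite mulrC -exprVn; apply: ler_pM => //; rewrite ?sqr_ge0 ?(ltW m0)//.
  rewrite lerXn2r ?nnegrE ?invr_ge0 ?divr_ge0 ?(ltW CW0) ?(ltW hx) ?(ltW h0)//.
  rewrite ler_pdivlMr// ler_pdivrMl// mulrC; exact: hsup_le.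
exact: mu_le_vmass.
Qed.

Lemma conduct_energy f x : summR (fun y => rd (du f (x, y)) (du f (x, y)) * conduct (x, y)) /\
  tsum (fun y => rd (du f (x, y)) (du f (x, y)) * conduct (x, y)) = star_energy f x.
Proof.
have off y : y \notin star_of x -> rd (du f (x, y)) (du f (x, y)) * conduct (x, y) = 0.
  by move/conduct_off ->; rewrite mulr0.
split; first exact: finsupp_summR off.
rewrite (finsupp_tsum (star_uniq x) off); apply: eq_bigr => y _.
by rewrite -cmod2 mulrC.
Qed.

Lemma l2_du f : l2 conduct (du f) <-> summR (star_energy f).
Proof.
have f0 e : 0 <= rd (du f e) (du f e) * conduct e by rewrite mulr_ge0 ?rd_ge0 ?conduct_ge0.
have E : (fun x => tsum (fun y => rd (du f (x, y)) (du f (x, y)) * conduct (x, y))) = star_energy f.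
  by apply/funext => x; exact: (conduct_energy f x).2.
split=> [l|s].
  by have [_] := summR_pair f0 l; rewrite E.
by apply: (tsum_pair f0 _ _).1; [move=> x; exact: (conduct_energy f x).1|rewrite E].
Qed.

Lemma nq_du_ball f x r : l2 conduct (du f) ->
  summR (fun y => if d x y < r then star_energy f y else 0) /\
  nq (kball conduct d x r) (du f) = tsum (fun y => if d x y < r then star_energy f y else 0).
Proof.
move=> lf; have lk := l2_kball d conduct_ge0 x r lf.
have f0 e : 0 <= rd (du f e) (du f e) * kball conduct d x r e.
  by rewrite mulr_ge0 ?rd_ge0// /kball; case: ifP => _ //; exact: conduct_ge0.
have E : (fun y => tsum (fun z => rd (du f (y, z)) (du f (y, z)) * kball conduct d x r (y, z))) =
    fun y => if d x y < r then star_energy f y else 0.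
  apply/funext => y; rewrite /kball /=; case: ifP => _; first exact: (conduct_energy f y).2.
  by under eq_fun do rewrite mulr0; rewrite tsum0.
have [s1 s2] := summR_pair f0 lk; rewrite E in s2; split=> //.
by rewrite /nq /ip (tsum_pair f0 s1 _).2 ?E.
Qed.

End Graph.

Lemma rsum_patch (R : realType) (T : choiceType) (D : set T) (f : T -> R) :
  rsum D f = tsum (fun x => if x \in D then f x else 0).
Proof.
rewrite /tsum /rsum !(esum_mkcond D); congr (fine _ - fine _); apply: eq_esum => x _.
  by rewrite /funrpos; case: ifP => //; rewrite maxxx.
by rewrite /funrneg; case: ifP => //; rewrite oppr0 maxxx.
Qed.

Lemma summable_patch (R : realType) (T : choiceType) (D : set T) (f : T -> R) :
  summable D (EFin \o f) <-> summR (fun x => if x \in D then f x else 0).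
Proof.
rewrite /summR /summable (esum_mkcond D).
have -> : (\esum_(i in [set: T]) (if i \in D then `|(EFin \o f) i| else 0) =
  \esum_(i in [set: T]) `|(EFin \o (fun x => if x \in D then f x else 0%R)) i|)%E by
  apply: eq_esum => x _ /=; case: ifP => //; rewrite normr0.
by [].
Qed.

(** * Translation of the given notions into weighted l2 spaces *)

Section Bridge.
Variables (R : realType) (Gamma : choiceType) (h mu : Gamma -> Gamma -> R).
Variables (N : nat) (CW Cmu : R).
Hypothesis W : weighted_graph h mu N CW Cmu.
Hypothesis CW1 : 1 <= CW.
Local Notation m := (vmass h mu).
Local Notation d := (gdist h).
Local Notation hs := (hsup h).
Local Notation k := (conduct h mu).
Implicit Types u v f : Gamma -> R[i].

Let m_gt0 := vmass_gt0 W.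
Let m_ge0 x : 0 <= m x. Proof. exact/ltW/m_gt0. Qed.
Let k_ge0 := conduct_ge0 W.

Let esum_L2 f : \esum_(x in [set: Gamma]) (cmod (f x) ^+ 2 * m x)%:E =
  \esum_(x in [set: Gamma]) (rd (f x) (f x) * m x)%:E.
Proof. by apply: eq_esum => x _; rewrite cmod2. Qed.

Lemma L2norm_l2 f : l2 m f -> L2norm h mu f = (nm m f)%:E.
Proof.
move=> lf; rewrite /L2norm esum_L2 -(tsum_ge0_EFin (rdw_ge0 m_ge0 f) lf) poweR_EFin.
by rewrite powR12_sqrt//; exact: tsum_ge0 (rdw_ge0 m_ge0 f).
Qed.

Lemma inL2_l2 f : inL2 h mu f <-> l2 m f.
Proof.
split=> [|lf]; last by rewrite /inL2 L2norm_l2// ltry.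
rewrite /inL2 /L2norm esum_L2 => lt; apply/(summR_ge0 (rdw_ge0 m_ge0 f)).
rewrite ltNge leye_eq; apply/negP => /eqP E; move: lt.
by rewrite E poweRyr ?ltxx// invr_eq0 pnatr_eq0.
Qed.

Lemma L2norm_ge0 f : (0 <= L2norm h mu f)%E.
Proof. exact: poweR_ge0. Qed.

Lemma inW12_sob f : inW12 h mu f <-> sob m k f.
Proof.
have G : l2 m (fun x => (grad h f x)%:C%C) <-> l2 k (du f).
  have E : (fun x => rd (grad h f x)%:C%C (grad h f x)%:C%C * m x) = fun x => grad h f x ^+ 2 * m x.
    by apply/funext => x; rewrite /rd /= mulr0 addr0 -expr2.
  have -> : l2 m (fun x => (grad h f x)%:C%C) = summR (fun x => grad h f x ^+ 2 * m x) by rewrite /l2 E.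
  rewrite (l2_du W); split=> [s|s].
    apply: summR_le (summRZ (CW ^+ 2) s) => x; rewrite ger0_norm ?(star_energy_ge0 W)//.
    exact: (star_energy_le W).
  apply: summR_le (summRZ (N%:R * Cmu) s) => x.
  by rewrite (ger0_norm (mulr_ge0 (sqr_ge0 _) (m_ge0 _))); exact: (grad_le W CW1).
rewrite /inW12 /W12norm /sob -G -!inL2_l2 /inL2; split=> [lt|[l1 l2]].
  by split; apply: le_lt_trans lt; [rewrite leeDl|rewrite leeDr]; rewrite ?L2norm_ge0.
exact: lte_add_pinfty.
Qed.

Lemma Re_L2dot u v : complex.Re (L2dot h mu u v) = ip m u v.
Proof.
rewrite /L2dot /csum /=; congr (rsum _ _); apply/funext => x.
by rewrite rdE; case: (u x * _) => a b; rewrite /= mulr0 subr0.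
Qed.

Let ball_in x r y : (y \in gball h x r) = (d x y < r).
Proof. by apply/idP/idP => [/set_mem//|xy]; exact/mem_set. Qed.

Let esum_ball x r (F : Gamma -> R) : (forall y, 0 <= F y) ->
  summR (fun y => if d x y < r then F y else 0) ->
  \esum_(y in gball h x r) (F y)%:E = (tsum (fun y => if d x y < r then F y else 0))%:E.
Proof.
move=> F0 s; rewrite tsum_ge0_EFin//; last by move=> y; case: ifP.
by rewrite esum_mkcond; apply: eq_esum => y _; rewrite ball_in; case: ifP.
Qed.

Lemma vol_esum x r : vol h mu x r = \esum_(y in [set: Gamma]) (mball m d x r y)%:E.
Proof.
by rewrite /vol /mass esum_mkcond; apply: eq_esum => y _; rewrite ball_in /mball; case: ifP.
Qed.

Let mball_ge0 x r y : 0 <= mball m d x r y.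
Proof. by rewrite /mball; case: ifP. Qed.

Lemma vol_summR x r : (vol h mu x r < +oo)%E <-> summR (mball m d x r).
Proof. by rewrite vol_esum summR_ge0. Qed.

(** Balls have finite volume: a small ball is a single point, and doubling propagates finiteness to
    all radii. *)
Lemma summR_mball CD : doubling h mu CD -> forall x r, summR (mball m d x r).
Proof.
move=> D x r; pose r0 := hs x / CW; have CW0 : 0 < CW by exact: lt_le_trans CW1.
have r00 : 0 < r0 by rewrite divr_gt0// (hsup_gt0 W).
have fin n : summR (mball m d x (2 ^+ n * r0)).
  elim: n => [|n /vol_summR IH].
    apply: (@finsupp_summR _ _ _ [:: x]) => y; rewrite inE => yx.
    rewrite /mball expr0 mul1r ltNge ler_pdivrMr// mulrC (hsup_gdist W)// eq_sym.
    by rewrite yx.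
  have p0 : 0 < 2 ^+ n * r0 by rewrite mulr_gt0// exprn_gt0.
  apply/vol_summR; rewrite exprS -mulrA; apply: le_lt_trans (D x _ p0) _.
  have : (0 <= vol h mu x (2 ^+ n * r0))%E by rewrite vol_esum; apply: esum_ge0 => y _; rewrite lee_fin.
  by move: IH; case: (vol _ _ _ _) => // v _ _; rewrite -EFinM ltry.
have [n hn] : exists n, r <= 2 ^+ n * r0.
  exists (Num.truncn (`|r| / r0)).+1; rewrite -ler_pdivrMr//.
  apply: (@le_trans _ _ (`|r| / r0)); first by rewrite ler_pM2r ?invr_gt0// ler_norm.
  apply: le_trans (ltW (truncnS_gt _)) _; rewrite -natrX ler_nat.
  by apply: ltnW; exact: ltn_expl.
apply: summR_le (fin n) => y; rewrite ger0_norm// /mball.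
by case: ifP => [yr|_]; [rewrite (lt_le_trans yr hn)|case: ifP].
Qed.

Lemma tsum_mball_ge CD cL : doubling h mu CD -> volume_lower_bound h mu cL ->
  forall x r, 0 < r -> cL * r ^+ 2 <= tsum (mball m d x r).
Proof.
move=> D V x r r0; have := V x r r0; rewrite vol_esum.
by rewrite -(tsum_ge0_EFin (mball_ge0 x r) (summR_mball D x r)) lee_fin.
Qed.

(** Positive whatever the signs of the given constants, and independent of the graph. *)
Definition poinc_cst (CP : R) := (`|CP| + 1) * (`|N%:R * Cmu| + 1).

Lemma poinc_cst_gt0 CP : 0 < poinc_cst CP.
Proof. by rewrite mulr_gt0// ltr_wpDl. Qed.

Lemma poincare_mball CD CP : doubling h mu CD -> poincare2 h mu CP ->
  forall x r u, 0 < r -> sob m k u -> exists kap : R[i],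
  nq (mball m d x r) (fun y => u y - kap) <= poinc_cst CP * r ^+ 2 * nq (kball k d x r) (du u).
Proof.
move=> D P x r u r0 [lu ldu]; have fin := summR_mball D x r.
have cs : csummable (gball h x r) (fun y => u y * (m y)%:C%C).
  (* On a ball of finite volume u is summable, since |u| <= |u|^2 + 1. *)
  apply/summable_patch; apply: summR_le (summRD lu fin) => y.
  rewrite ball_in /mball; case: ifP => _; last by rewrite normr0 addr0 mulr_ge0 ?rd_ge0.
  rewrite ger0_norm ?cmod_ge0// cmodM cmodR (ger0_norm (m_ge0 y)) -[X in _ <= _ + X]mul1r -mulrDl.
  apply: (ler_wpM2r (m_ge0 y)); rewrite -cmod2; have := sqr_ge0 (cmod (u y) - 1).
  have := sqr_ge0 (cmod (u y)); lra.
have := P x r u r0 cs; set kap := mean _ _ _ _ => le; exists kap.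
have sL : summR (fun y => if d x y < r then cmod (u y - kap) ^+ 2 * m y else 0).
  have := l2B (mball_ge0 x r) (l2_mball d m_gt0 x r lu) (l2_mball_const (summR_mball D) x r kap).
  by congr summR; apply/funext => y; rewrite /mball cmod2; case: ifP => // _; rewrite mulr0.
have sE := (nq_du_ball W x r ldu).1.
have sR : summR (fun y => if d x y < r then grad h u y ^+ 2 * m y else 0).
  apply: summR_le (summRZ (N%:R * Cmu) sE) => y; case: ifP => _; last by rewrite normr0 mulr0.
  by rewrite (ger0_norm (mulr_ge0 (sqr_ge0 _) (m_ge0 _))); exact: (grad_le W CW1).
rewrite !esum_ball// in le; try by move=> y; rewrite mulr_ge0 ?sqr_ge0.
rewrite -EFinM lee_fin in le.
have -> : nq (mball m d x r) (fun y => u y - kap) = tsum (fun y => if d x y < r then cmod (u y - kap) ^+ 2 * m y else 0).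
  by rewrite /nq /ip; congr tsum; apply/funext => y; rewrite /mball cmod2; case: ifP => // _; rewrite mulr0.
apply: le_trans le _; rewrite (nq_du_ball W x r ldu).2.
set SR := tsum _; set SE := tsum _.
have SE0 : 0 <= SE by apply: tsum_ge0 => y; case: ifP => // _; exact: (star_energy_ge0 W).
have SR0 : 0 <= SR by apply: tsum_ge0 => y; case: ifP => // _; rewrite mulr_ge0 ?sqr_ge0.
have h1 : SR <= (`|N%:R * Cmu| + 1) * SE.
  apply: (@le_trans _ _ (N%:R * Cmu * SE)).
    rewrite /SE -(tsumZ _ sE); apply: le_tsum => //; first exact: (summRZ _ sE).
    by move=> y; case: ifP => _; [exact: (grad_le W CW1)|rewrite mulr0].
  by apply: ler_wpM2r => //; apply: le_trans (ler_norm _) _; rewrite lerDl.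
have c1 : CP * r ^+ 2 <= (`|CP| + 1) * r ^+ 2.
  by apply: (ler_wpM2r (sqr_ge0 r)); apply: le_trans (ler_norm _) _; rewrite lerDl.
have c2 : 0 <= (`|CP| + 1) * r ^+ 2 by rewrite mulr_ge0 ?sqr_ge0// addr_ge0.
apply: le_trans (ler_wpM2r SR0 c1) _; apply: le_trans (ler_wpM2l c2 h1) _.
by rewrite /poinc_cst le_eqVlt; apply/orP; left; apply/eqP; ring.
Qed.

Let edge_in (e : Gamma * Gamma) : (e \in edges h) = Defs.adj h e.1 e.2.
Proof. by apply/idP/idP => [/set_mem//|xy]; exact/mem_set. Qed.

Lemma edge_term (a : R[i]) u v (e : Gamma * Gamma) : Defs.adj h e.1 e.2 ->
  rd (a * gdiff h u e.1 e.2) (gdiff h v e.1 e.2) * mu e.1 e.2 =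
  rd (a * du u e) (du v e) * k e.
Proof.
case: e => x y /= xy; rewrite /gdiff /conduct /= xy; case: eqVneq => [_|_] /=.
  by rewrite mulr0 rd0l mul0r mulr0.
rewrite /du /=; have -> : (h x y)%:C%C^-1 = ((h x y)^-1)%:C%C :> R[i] by rewrite fmorphV.
rewrite -exprVn; set i := (h x y)^-1; move: (u y - u x) (v y - v x) => [p1 p2] [q1 q2].
by case: a => a1 a2; rewrite /rd /=; ring.
Qed.

Lemma Re_sesqui_form (c : Gamma -> Gamma -> R[i]) u v :
  complex.Re (sesqui_form h mu c u v) = form k (fun e => c e.1 e.2) u v.
Proof.
rewrite /sesqui_form /csum /= rsum_patch /form /ip; congr tsum; apply/funext => e.
rewrite edge_in; case: ifP => E; last first.
  by case: e E => x y /= E; rewrite /conduct /= E mulr0.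
rewrite -(edge_term _ u v E) rdE; set z := _ * _ * conjc _; case: z => p q /=.
by rewrite mulr0 subr0.
Qed.

Lemma elliptic_conduct Cinf delta c : elliptic_coeffs h mu Cinf delta c ->
  elliptic m k Cinf delta (fun e => c e.1 e.2).
Proof.
case=> cb ce; split=> [[x y] /gt_eqF/negbT/conduct_adj[xy _]|u su]; first exact: cb.
have := ce u ((inW12_sob u).2 su).
have E : \esum_(e in edges h) (cmod (gdiff h u e.1 e.2) ^+ 2 * mu e.1 e.2)%:E = (nq k (du u))%:E.
  rewrite /nq /ip (tsum_ge0_EFin (rdw_ge0 k_ge0 (du u)) su.2) esum_mkcond.
  apply: eq_esum => e _; rewrite edge_in; case: ifP => E.
    by rewrite cmod2; have := edge_term 1 u u E; rewrite !mul1r => ->.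
  by case: e E => x y /= E; rewrite /conduct /= E mulr0.
rewrite E -EFinM lee_fin => /le_trans; apply.
rewrite /csum /= rsum_patch /form /ip le_eqVlt; apply/orP; left; apply/eqP.
congr tsum; apply/funext => e; rewrite edge_in; case: ifP => E'; last first.
  by case: e E' => x y /= E'; rewrite /conduct /= E' mulr0.
rewrite -(edge_term _ u u E') cmod2; case: (c _ _) => a b; case: (gdiff _ _ _ _) => p q.
by rewrite /rd /=; ring.
Qed.

Let op_ex (c : Gamma -> Gamma -> R[i]) : exists A : (Gamma -> R[i]) -> (Gamma -> R[i]), forall u g,
  opgraph m k (fun e => c e.1 e.2) u g -> A u = g.
Proof.
have H u : exists v, (exists g, opgraph m k (fun e => c e.1 e.2) u g) ->
    opgraph m k (fun e => c e.1 e.2) u v.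
  have [[g Gg]|no] := pselect (exists g, opgraph m k (fun e => c e.1 e.2) u g); last by exists u.
  by exists g.
have [A hA] := choice H.
exists A => u g Gg; apply: (opgraph_fun m_gt0 (conduct_star W)) (Gg); apply: hA.
by exists g.
Qed.

(** The weak formulation defines an operator B that extends L and is accretive by ellipticity;
    maximality then gives the missing inclusion of the domains. *)
Lemma operator_opgraph Cinf delta c (L : operator R Gamma) : 0 < delta ->
  elliptic_coeffs h mu Cinf delta c -> operator_of_coeffs h mu c L ->
  forall u v, (dom L u /\ app L u = v) <-> opgraph m k (fun e => c e.1 e.2) u v.
Proof.
move=> d0 ce [maxL dW dF]; have el := elliptic_conduct ce.
have [[linL accL] maxi] := maxL; have [L0 LL2 Llin] := linL.
have dir u : dom L u -> opgraph m k (fun e => c e.1 e.2) u (app L u).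
  move=> Du; split; [exact/inW12_sob/dW|exact/inL2_l2/(LL2 u Du).2|].
  by move=> v sv; rewrite -Re_sesqui_form -dF ?Re_L2dot//; exact/inW12_sob.
move=> u v; split=> [[Du <-]|Gu]; first exact: dir.
have [A hA] := op_ex c.
pose B := @Operator R Gamma [set w | exists g, opgraph m k (fun e => c e.1 e.2) w g] A.
have G0 : opgraph m k (fun e => c e.1 e.2) (fun=> 0) (fun=> 0).
  split; [exact: sob0|exact: l2_0|move=> w sw].
  rewrite (ip0l m) /form (ip_extl _ _ (F' := fun=> 0)) ?ip0l//.
  by move=> e; rewrite /du subrr mulr0.
have accB : accretive h mu B.
  split; first split.
  - by exists (fun=> 0).
  - move=> w [g Gg] /=; rewrite (hA w g Gg); have [[lw _] lg _] := Gg.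
    by split; exact/inL2_l2.
  - move=> a w w' [g Gg] [g' Gg']; have GG := opgraph_lin m_gt0 k_ge0 a el.1 Gg Gg'.
    by split; [exists (fun x => a * g x + g' x)|rewrite /= (hA _ _ GG) (hA _ _ Gg) (hA _ _ Gg')].
  - move=> w [g Gg]; have -> : app B w = g by exact: hA.
    rewrite Re_L2dot; have [sw _ hw] := Gg.
    rewrite -hw//; apply: le_trans (el.2 w sw); rewrite mulr_ge0 ?(ltW d0)//.
    exact: nq_ge0.
have extB : extends B L.
  split=> [w Dw|w Dw] /=; first by exists (app L w); exact: dir.
  exact: hA (dir w Dw).
have Du : dom L u by apply: (maxi B accB extB); exists v.
split=> //; apply: (opgraph_fun m_gt0 (conduct_star W)) Gu; exact: dir.
Qed.

End Bridge.

(** * Proof of the theorem *)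

Section Hstar.
Variables (R : realType) (Gamma : choiceType) (h mu : Gamma -> Gamma -> R).
Variables (N : nat) (CW Cmu : R).
Hypothesis W : weighted_graph h mu N CW Cmu.
Hypothesis CW1 : 1 <= CW.
Local Notation d := (gdist h).

Let gdist_gt0 x y : x != y -> 0 < d x y.
Proof.
move=> xy; have CW0 : 0 < CW by exact: lt_le_trans CW1.
by rewrite -(pmulr_rgt0 _ CW0); exact: lt_le_trans (hsup_gt0 W CW1 x) (hsup_gdist W CW1 xy).
Qed.

(** The supremum is only meaningful because the weights are bounded: a vertex a of the ball other
    than x has hs a <= CW d a x < CW d x y, and for the centre hs x <= CW d x y. *)
Lemma hstar_to_ge x y z w : x != y -> Defs.adj h z w -> d x z < d x y \/ d x w < d x y ->
  h z w <= hstar_to h x y.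
Proof.
move=> xy zw near; rewrite /hstar_to (negbTE xy).
have le a b : Defs.adj h a b -> d x a < d x y -> h a b <= CW * d x y.
  move=> ab xa; apply: le_trans (weight_le_hsup W CW1 ab) _.
  have [->|ax] := eqVneq a x; first exact: (hsup_gdist W CW1).
  apply: le_trans (hsup_gdist W CW1 ax) _; rewrite (gdist_sym W) ler_wpM2l ?ltW//.
  by apply: lt_le_trans CW1.
apply: ub_le_sup; last by exists (z, w).
exists (CW * d x y) => _ [[a b] [/= ab [xa|xb]] <-]; first exact: le.
by rewrite (weight_sym W); apply: le => //; rewrite (adj_sym W).
Qed.

Lemma hstar_to_gt0 x y : x != y -> 0 < hstar_to h x y.
Proof.
move=> xy; have [z xz zx] := exists_neighbor W x.
apply: lt_le_trans (hstar_to_ge xy xz _); first by apply: adj_pos => //; rewrite eq_sym.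
by left; rewrite (gdistxx W) gdist_gt0.
Qed.

Lemma hstar_gt0 x y : x != y -> 0 < hstar h x y.
Proof. by move=> xy; rewrite lt_min !hstar_to_gt0// eq_sym. Qed.

(** Whichever of the two suprema is the smaller decides at which end the weight of Davies' method is
    centred. *)
Lemma hstar_cover x y : x != y ->
  (forall z w, 0 < conduct h mu (z, w) -> d x z < d x y \/ d x w < d x y -> d z w <= hstar h x y) \/
  (forall z w, 0 < conduct h mu (z, w) -> d y z < d x y \/ d y w < d x y -> d z w <= hstar h x y).
Proof.
move=> xy; have yx : y != x by rewrite eq_sym.
have aux a b z w : a != b -> 0 < conduct h mu (z, w) -> d a z < d a b \/ d a w < d a b ->
    d z w <= hstar_to h a b.
  move=> ab kzw near; apply: le_trans (gdist_conduct W CW1 kzw).1 _.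
  by apply: hstar_to_ge => //; move/gt_eqF/negbT/conduct_adj: kzw => -[].
rewrite /hstar /Num.min; case: ifP => _; [left|right] => z w kzw near; first exact: aux.
by rewrite (gdist_sym W x y) in near; exact: aux.
Qed.

End Hstar.

(** * Convergence to 0 in epsilon form *)

Section Filters.
Variables (R : realType).

Lemma cvge0_le (T : Type) (F : set_system T) (FF : Filter F) (f : T -> \bar R) :
  (forall x, (0 <= f x)%E) -> (forall e : R, 0 < e -> \forall x \near F, (f x <= e%:E)%E) ->
  f @ F --> 0%E.
Proof.
move=> f0 H; apply/fine_cvgP; split.
  by apply: filterS (H 1 ltr01) => x /le_lt_trans h; rewrite ge0_fin_numE// h// ltry.
apply/cvgrPdist_le => e e0; apply: filterS (H e e0) => x fx /=.
rewrite sub0r normrN ger0_norm ?fine_ge0//.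
by rewrite -lee_fin fineK// ge0_fin_numE// (le_lt_trans fx)// ltry.
Qed.

Lemma le_cvge0 (T : Type) (F : set_system T) (FF : Filter F) (f : T -> \bar R) :
  (forall x, (0 <= f x)%E) -> f @ F --> 0%E ->
  forall e : R, 0 < e -> \forall x \near F, (f x <= e%:E)%E.
Proof.
move=> f0 /fine_cvgP[fin /cvgrPdist_le H] e e0; apply: filterS2 fin (H e e0) => x fx /=.
by rewrite sub0r normrN ger0_norm ?fine_ge0// -lee_fin fineK.
Qed.

Lemma cmod_ltC (z : R[i]) (e : R) : (`|z| < e%:C%C) = (cmod z < e).
Proof. by case: z => a b; rewrite normc_def ltcR. Qed.

Lemma nbhs0_cmod (P : set R[i]) (e : R) : 0 < e -> (forall z, cmod z < e -> P z) ->
  nbhs (0 : R[i]^o) P.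
Proof.
move=> e0 H; apply/nbhs_ballP; exists e%:C%C; first by rewrite /= ltcR.
by move=> z; rewrite -ball_normE /= sub0r normrN cmod_ltC; exact: H.
Qed.

Lemma dnbhs0_cmod (P : set R[i]) (e : R) : 0 < e -> (forall z, z != 0 -> cmod z < e -> P z) ->
  (0 : R[i]^o)^' P.
Proof. by move=> e0 H; apply: (nbhs0_cmod e0) => z ze z0; exact: H. Qed.

Lemma at_right0_lt (P : set R) (e : R) : 0 < e -> (forall t, 0 < t -> t < e -> P t) ->
  (0 : R)^'+ P.
Proof.
move=> e0 H; apply/nbhs_ballP; exists e => // t; rewrite -ball_normE /= sub0r normrN => te t0.
by apply: H => //; rewrite gtr0_norm in te.
Qed.

Lemma at_right0_ex (P : set R) : (0 : R)^'+ P -> exists2 e, 0 < e & forall t, 0 < t -> t < e -> P t.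
Proof.
move/nbhs_ballP => -[e e0 H]; exists e => // t t0 te; apply: H => //.
by rewrite -ball_normE /= sub0r normrN gtr0_norm.
Qed.

End Filters.

(** * The semigroup and its kernel in the terms of the theorem *)

Section Assembly.
Variables (R : realType) (Gamma : choiceType) (h mu : Gamma -> Gamma -> R).
Variables (N : nat) (CW Cmu : R).
Hypothesis W : weighted_graph h mu N CW Cmu.
Hypothesis CW1 : 1 <= CW.
Local Notation m := (vmass h mu).
Local Notation k := (conduct h mu).
Variables (M delta : R) (c : Gamma * Gamma -> R[i]).
Hypothesis M0 : 0 < M.
Hypothesis delta0 : 0 < delta.
Hypothesis el : elliptic m k M delta c.

Let m_gt0 := vmass_gt0 W.
Let k_ge0 := conduct_ge0 W.
Let T := heat m_gt0 k_ge0 (conduct_star W) delta0 M0 el.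
Let m_ge0 x : 0 <= m x. Proof. exact/ltW/m_gt0. Qed.

Let l2E u := inL2_l2 W u.

Let norm_le u (e : R) : l2 m u -> nm m u <= e -> (L2norm h mu u <= e%:E)%E.
Proof. by move=> lu le; rewrite (L2norm_l2 W lu) lee_fin. Qed.

Lemma heat_holomorphic : holomorphic_semigroup h mu T.
Proof.
(* The sector of this angle is exactly the cone on which the resolvents are contractions. *)
pose theta := atan (angle M delta).
have a0 : 0 < angle M delta by exact: angle_gt0.
exists theta; split.
  have := atan_ltpi2 (angle M delta) => ->; rewrite andbT.
  by rewrite /theta -[ltLHS](atan0 R); exact: lt_atan.
have secE z : sector theta z <-> cone (angle M delta) z by rewrite /sector /theta atanK.
split.
- move=> z; case=> [->|/secE cz].
    split=> [u lu|a u v _ _|]; rewrite ?/T ?heat0//.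
    by exists 1 => u _; rewrite heat0 mul1e.
  have [h1 h2] := heat_contr m_gt0 k_ge0 (conduct_star W) delta0 M0 el cz.
  split=> [u /l2E lu|a u v /l2E lu /l2E lv|].
  + by apply/l2E; exact: (h1 u lu).1.
  + exact: h2.
  + exists 1 => u /l2E lu; have [h3 h4] := h1 u lu.
    by rewrite mul1e (L2norm_l2 W lu); exact: norm_le.
- by move=> u _; exact: heat0.
- by move=> z w u /secE cz /secE cw /l2E lu; exact: heatD.
- move=> z u /secE cz /l2E lu.
  have [v lv hv] := heat_diff m_gt0 k_ge0 (conduct_star W) delta0 M0 el cz lu.
  exists v; first exact/l2E.
  apply: cvge0_le => [w|e e0]; first exact: L2norm_ge0.
  have [r r0 hr] := hv e e0.
  (* Openness of the cone: the difference quotient has to be square summable before its norm can be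
     compared. *)
  have [r' r'0 cr] : exists2 r', 0 < r' & forall w, cmod w < r' -> cone (angle M delta) (z + w).
    case: z cz {hv hr lu} => a b [/= a1 b1].
    have p0 : 0 < angle M delta * a - `|b| by rewrite subr_gt0.
    pose s := 1 + angle M delta; have s0 : 0 < s by rewrite addr_gt0.
    exists (Num.min a ((angle M delta * a - `|b|) / s)).
      by rewrite lt_min a1 divr_gt0.
    case=> p q; rewrite lt_min => /andP[c1]; rewrite ltr_pdivlMr// => c2.
    have := Re_le_cmod (p +i* q)%C; have := Im_le_cmod (p +i* q)%C => /= hq hp.
    have hp' : - cmod (p +i* q)%C <= p by move: hp; rewrite ler_norml => /andP[].
    split=> /=; first by lra.
    have t1 : `|b + q| <= `|b| + cmod (p +i* q)%C by apply: le_trans (ler_normD _ _) _; rewrite lerD2l.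
    apply: le_lt_trans t1 _; have := ler_wpM2l (ltW a0) hp'; rewrite /s in c2; lra.
  apply: (@dnbhs0_cmod _ _ (Num.min r r')); first by rewrite lt_min r0.
  move=> w w0; rewrite lt_min => /andP[wr wr'] /=; apply: norm_le; last exact: hr.
  have l1 := heat_l2 m_gt0 k_ge0 (conduct_star W) delta0 M0 el (cr w wr') lu.
  have l3 := heat_l2 m_gt0 k_ge0 (conduct_star W) delta0 M0 el cz lu.
  by apply: (l2B m_ge0) => //; apply: (l2Z m_ge0); exact: (l2B m_ge0).
- move=> u /l2E lu; apply: cvge0_le => [w|e e0]; first exact: L2norm_ge0.
  have [r r0 hr] := heat_cont0 m_gt0 k_ge0 (conduct_star W) delta0 M0 el lu e0.
  apply: (nbhs0_cmod r0) => z zr /= /secE cz; apply: norm_le; last exact: hr.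
  by apply: (l2B m_ge0) => //; exact: heat_l2.
Qed.

Lemma heat_generated (L : operator R Gamma) :
  (forall u v, (dom L u /\ app L u = v) <-> opgraph m k c u v) -> generated_by h mu L T.
Proof.
move=> LG u v /l2E lu /l2E lv; rewrite LG.
rewrite (heat_gen m_gt0 k_ge0 (conduct_star W) delta0 M0 el lu lv) -/T.
have ld (t : R) : 0 < t -> l2 m (fun x => (t^-1)%:C%C * (u x - T t%:C%C u x) - v x).
  move=> t0; apply: (l2B m_ge0) => //; apply: (l2Z m_ge0); apply: (l2B m_ge0) => //.
  by apply: heat_l2 => //; exact: cone_real.
split=> [H|H e e0].
  apply: cvge0_le => [t|e e0]; first exact: L2norm_ge0.
  have [r r0 hr] := H e e0; apply: (at_right0_lt r0) => t t0 tr /=.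
  by apply: norm_le; [exact: ld|exact: hr].
have [r r0 hr] := at_right0_ex (le_cvge0 _ (fun t => L2norm_ge0 h mu _) H e0).
by exists r => // t t0 tr; have := hr t t0 tr; rewrite /= (L2norm_l2 W (ld t t0)) lee_fin.
Qed.

Lemma heat_has_kernel (el' : elliptic m k M delta (fun e => conjc (c e))) :
  has_kernel h mu T (kernel m_gt0 k_ge0 (conduct_star W) delta0 M0 el').
Proof.
move=> u x t /l2E lu t0 F.
set P := heat m_gt0 k_ge0 (conduct_star W) delta0 M0 el' t%:C%C (unit_mass m x).
have lP : l2 m P by apply: heat_l2; [exact: cone_real|exact: l2_unit_mass].
have FE y : F y = u y * conjc (P y) * (m y)%:C%C by rewrite /F /kernel -/P (mulrC (conjc _)).
have test a := heat_test m_gt0 k_ge0 (conduct_star W) delta0 M0 el el' a x t0 lu.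
split.
  apply: (@summR_le _ _ _ (fun y => 2^-1 * (rd (u y) (u y) * m y + rd (P y) (P y) * m y))); last first.
    by apply: summRZ; exact: summRD.
  move=> y; rewrite ger0_norm ?cmod_ge0// FE !cmodM cmod_conj cmodR (ger0_norm (m_ge0 y)).
  rewrite -mulrDl mulrA; apply: (ler_wpM2r (m_ge0 y)); rewrite -!cmod2.
  have := sqr_ge0 (cmod (u y) - cmod (P y)); lra.
(* Real and imaginary parts are recovered from the real pairings with 1 and i. *)
have zE (z : R[i]) : z = (rd 1 z +i* rd 'i%C z)%C.
  by case: z => a b; rewrite /rd /= !mul0r !mul1r add0r addr0.
rewrite [T _ _ _]zE !test -/P /csum; congr (_ +i* _)%C; rewrite /ip /tsum; congr rsum; apply/funext => y; rewrite FE;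
  by case: (u y) => a b; case: (P y) => p q; rewrite /rd /=; ring.
Qed.

End Assembly.

Theorem theorem5p4 (R : realType) (N : nat)
    (CW Cmu CD cL CP Cinf delta : R) :
  1 <= CW -> 0 < cL -> 0 < Cinf -> 0 < delta ->
  exists C C' beta C'' eta : R,
    [/\ 0 < C, 0 < C', 0 < beta, 0 < C'' & 0 < eta] /\
    forall (Gamma : choiceType) (h mu : Gamma -> Gamma -> R)
      (c : Gamma -> Gamma -> R[i]) (L : operator R Gamma),
      weighted_graph h mu N CW Cmu ->
      doubling h mu CD ->
      volume_lower_bound h mu cL ->
      poincare2 h mu CP ->
      elliptic_coeffs h mu Cinf delta c ->
      operator_of_coeffs h mu c L ->
      exists (T : R[i] -> (Gamma -> R[i]) -> (Gamma -> R[i]))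
             (K : R -> Gamma -> Gamma -> R[i]),
        [/\ holomorphic_semigroup h mu T,
            generated_by h mu L T,
            has_kernel h mu T K,
            forall (x y : Gamma) (t : R), 0 < t ->
              (t <= C' * hstar h x y * gdist h x y ->
                 cmod (K t x y) <=
                   C / t * expR (- beta * (gdist h x y / hstar h x y))) /\
              (C' * hstar h x y * gdist h x y <= t ->
                 cmod (K t x y) <=
                   C / t * expR (- beta * (gdist h x y ^+ 2 / t))) &
            forall (t : R) (x x' y : Gamma), 0 < t ->
              cmod (K t x y - K t x' y) <=
                C'' / t * (gdist h x x' / Num.sqrt t) `^ eta].
Proof.
move=> CW1 cL0 M0 d0; pose CP' := poinc_cst N Cmu CP.
have CP0 : 0 < CP' by exact: poinc_cst_gt0.
pose C := C7 CW CP' cL Cinf delta; pose C'' := `|C8 CW CP' cL Cinf delta| + 1.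
(* The two regimes of [kernel_decay] meet at t = hstar d, hence the value 1 for C'. The absolute
   value and the added 1 in C'' ensure its positivity. *)
exists C, 1, (rate Cinf delta / 2), C'', (heta CW CP' Cinf delta); split.
  split=> //.
  - by rewrite mulr_gt0// exprn_gt0// C5_gt0.
  - by rewrite divr_gt0// rate_gt0.
  - by rewrite ltr_wpDl.
  - exact: heta_gt0.
move=> Gamma h mu c L W D V P ce Lc.
have el := elliptic_conduct W CW1 ce; have el' := elliptic_conj el.
have m_gt0 := vmass_gt0 W; have k_ge0 := conduct_ge0 W.
have d_edge y z : 0 < conduct h mu (y, z) -> gdist h y z <= hsup h y.
  by move/(gdist_conduct W CW1) => -[h1 h2]; exact: le_trans h2.
pose K := kernel (vmass_gt0 W) (conduct_ge0 W) (conduct_star W) d0 M0 el'.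
exists (heat (vmass_gt0 W) (conduct_ge0 W) (conduct_star W) d0 M0 el), K; split.
- exact: heat_holomorphic.
- have OG := operator_opgraph W CW1 d0 ce Lc; by apply: heat_generated => //; exact: OG.
- exact: heat_has_kernel.
- move=> x y t t0; rewrite mul1r.
  have dec H := kernel_decay (vmass_gt0 W) (conduct_ge0 W) (conduct_star W)
    (conduct_sym W) (gdist_ge0 W) (gdistxx W) (gdist_sym W) (gdist_tri W) (hsup_gt0 W CW1) CW1 CP0 cL0
    d_edge (hsup_gdist W CW1) (conduct_len W) (summR_mball W CW1 D) (tsum_mball_ge W CW1 D V)
    (poincare_mball W CW1 D P) d0 M0 el el' (H := H) (x := x) (y := y) t0.
  have [xy|xy] := eqVneq x y; last exact: dec (hstar_gt0 W CW1 xy) (hstar_cover W CW1 xy).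
  (* On the diagonal hstar is 0 and no edge meets the ball of radius 0, so any positive H will do;
     regime (a) is excluded there by 0 < t. *)
  have [|_ dec2] := dec 1 ltr01.
    by left=> z w _; rewrite xy (gdistxx W) => -[]; rewrite ltNge (gdist_ge0 W).
  move: dec2; rewrite -xy (gdistxx W) !mulr0 => /(_ (ltW t0)) dec2; split=> // tn.
  by have := lt_le_trans t0 tn; rewrite ltxx.
- move=> t x x' y t0.
  have hold := kernel_holder (vmass_gt0 W) (conduct_ge0 W) (conduct_star W)
    (conduct_sym W) (gdist_ge0 W) (gdistxx W) (gdist_sym W) (gdist_tri W) (hsup_gt0 W CW1) CW1 CP0 cL0
    d_edge (hsup_gdist W CW1) (conduct_len W) (summR_mball W CW1 D) (tsum_mball_ge W CW1 D V)
    (poincare_mball W CW1 D P) d0 M0 el el' x x' y t0.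
  apply: le_trans hold _; apply: ler_wpM2r; first exact: powR_ge0.
  rewrite ler_pM2r ?invr_gt0//; apply: le_trans (ler_norm _) _.
  by rewrite lerDl.
Qed.
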